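(* As $n\to\infty$, $$p_{1/3}(n)\sim \frac{(25\pi)^{1/4}e^{\frac{225\zeta(3)^3}{\pi^8}-\frac{2\zeta(3)}{\pi^2}+3\zeta'(-1)}}{4(5n)^{13/16}}\exp\left(\frac{4\pi(5n)^{3/4}}{15}+\frac{3\zeta(3)(5n)^{1/2}}{\pi^2}+\frac{\left(\pi^6-135\zeta(3)^2\right)(5n)^{1/4}}{6\pi^5}\right)$$ and $$q_{1/3}(n)\sim \frac{(5/14)^{1/2}e^{\frac{6075\zeta(3)^3}{49\pi^8}-\frac{15\zeta(3)}{28\pi^2}}}{2^{11/4}(5n/14)^{5/8}}\exp\left(\frac{28\pi\left(\frac{5n}{14}\right)^{3/4}}{15}+\frac{9\zeta(3)\left(\frac{5n}{14}\right)^{1/2}}{\pi^2}+\frac{\left(7\pi^6-1215\zeta(3)^2\right)\left(\frac{5n}{14}\right)^{1/4}}{42\pi^5}\right).$$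
   Context: $\zeta$ is the Riemann zeta function. $p_{1/3}(n)$ (resp. $q_{1/3}(n)$) is the number of partitions of $n$ into parts from the sequence $(\lfloor\ell^{1/3}\rfloor)_{\ell\ge1}$, with unlimited repetition (resp. each member of the sequence, indexed by $\ell$, used at most once); equivalently, for $\Re(z)>0$, $\sum_{n\ge0}p_{1/3}(n)e^{-nz}=\prod_{\ell\ge1}(1-e^{-z\lfloor\ell^{1/3}\rfloor})^{-1}$ and $\sum_{n\ge0}q_{1/3}(n)e^{-nz}=\prod_{\ell\ge1}(1+e^{-z\lfloor\ell^{1/3}\rfloor})$. *)

(* Defs.v *)
From HB Require Import structures.
From mathcomp Require Import all_boot all_order all_algebra.
From mathcomp Require Import finmap complex.
From mathcomp Require Import all_classical all_reals all_analysis.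
Set Implicit Arguments.
Unset Strict Implicit.
Unset Printing Implicit Defensive.
Import Order.TTheory GRing.Theory Num.Theory.
Import numFieldNormedType.Exports.
Local Open Scope classical_set_scope.
Local Open Scope ring_scope.
Local Open Scope complex_scope.

(* [R[i]^o] is [R[i]] seen as a normed space over itself: limits are taken for
   the complex modulus. *)

Definition expC {R : realType} (z : R[i]) : R[i] :=
  (expR (complex.Re z))%:C * (cos (complex.Im z) +i* sin (complex.Im z)).

Definition analytic_at {R : realType} (f : R[i] -> R[i]^o) (z : R[i]) : Prop :=
  exists a : nat -> R[i], \forall w \near (z : R[i]^o),
    series (fun k => (a k * (w - z) ^+ k : R[i]^o)) @ \oo --> f w.

(* [zeta] is the analytic continuation to the complex plane minus 1 of
   \sum_(n >= 1) n ^ (- s), Re s > 1, where n ^ (- s) = exp (- s ln n). This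
   determines [zeta] except for the irrelevant value [zeta 1]. *)
Definition is_riemann_zeta {R : realType} (zeta : R[i] -> R[i]^o) : Prop :=
  (forall s : R[i], 1 < complex.Re s ->
     series (fun k => (expC (- s * (ln (k.+1%:R : R))%:C) : R[i]^o)) @ \oo
       --> zeta s) /\
  (forall s : R[i], s != 1 -> analytic_at zeta s).

(* A partition of [n] into parts from the sequence [a] is given by the number
   [m j] of times the [j]-th term is used; equal terms with distinct indices
   count as distinct parts. *)
Definition partitions (a : nat -> nat) (n : nat) : set {fsfun nat -> nat with 0%N} :=
  [set m | (\sum_(j <- finsupp m) m j * a j = n)%N].

Definition distinct_partitions (a : nat -> nat) (n : nat) :
    set {fsfun nat -> nat with 0%N} :=
  partitions a n `&` [set m | forall j, (m j <= 1)%N].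

(* The index j : nat stands for l = j + 1 >= 1. *)
Definition floor_cbrt (R : realType) (j : nat) : nat :=
  Num.truncn ((j.+1%:R : R) `^ (1 / 3)).

(* [fset_set] is the empty set on infinite sets; see the finiteness lemmas
   below. *)
Definition p_third (R : realType) (n : nat) : nat :=
  #|` fset_set (partitions (floor_cbrt R) n)|.

Definition q_third (R : realType) (n : nat) : nat :=
  #|` fset_set (distinct_partitions (floor_cbrt R) n)|.

Lemma finite_partitions (a : nat -> nat) (n N : nat) :
  (forall j, 0 < a j)%N -> (forall j, N <= j -> n < a j)%N ->
  finite_set (partitions a n).
Proof.
move=> a_gt0 a_gtn.
pose g (h : {ffun 'I_N -> 'I_n.+1}) : {fsfun nat -> nat with 0%N} :=
  [fsfun j in [fset k | k in iota 0 N]%fset =>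
     if insub j is Some i then val (h i) else 0%N].
apply: (@sub_finite_set _ _ (g @` [set: {ffun 'I_N -> 'I_n.+1}]));
  last by apply: finite_image.
move=> m /= m_n.
have le_m j : (m j * a j <= n)%N.
  case: (boolP (j \in finsupp m)) => [jm|/fsfun_dflt -> //].
  by rewrite -m_n (big_fsetD1 j jm) /= leq_addr.
exists [ffun i : 'I_N => inord (m i)] => //.
apply/fsfunP => j; rewrite fsfunE /=.
have [jN|Nj] := ltnP j N.
  rewrite ifT; last by rewrite !inE mem_iota add0n jN.
  rewrite insubT /= ffunE inordK //= ltnS.
  by apply: leq_trans (le_m j); rewrite leq_pmulr.
rewrite ifF; last by rewrite !inE mem_iota add0n ltnNge Nj.
apply/esym/eqP; rewrite -leqn0 leqNgt; apply/negP => mj.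
have := leq_trans (leq_pmull (a j) mj) (le_m j).
by rewrite leqNgt a_gtn.
Qed.

Lemma floor_cbrt_ge (R : realType) (n j : nat) :
  (n ^ 3 <= j.+1)%N -> (n <= floor_cbrt R j)%N.
Proof.
move=> nj; rewrite /floor_cbrt truncn_ge_nat ?powR_ge0 //.
have -> : (n%:R : R) = ((n ^ 3)%:R : R) `^ (1 / 3).
  by rewrite natrX -powR_mulrn // -powRrM mulrCA mulfV ?pnatr_eq0 // mulr1 powRr1.
by apply: ge0_ler_powR; rewrite ?nnegrE ?divr_ge0 ?ler_nat.
Qed.

Lemma finite_partitions_floor_cbrt (R : realType) (n : nat) :
  finite_set (partitions (floor_cbrt R) n).
Proof.
apply: (@finite_partitions _ _ (n.+1 ^ 3)) => j; first exact: floor_cbrt_ge.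
by move=> /leqW; apply: floor_cbrt_ge.
Qed.

(* Main.v *)
(* The number of l with floor (l ^ (1/3)) = k is c_k = 3 k ^ 2 + 3 k + 1. Put
   L(t) = sum_k c_k log (1 / (1 - e ^ (- k t))), mu = - L', V = L''. On the
   circle |x| = e ^ (- t) the generating function of p, divided by its value at
   e ^ (- t), is the characteristic function of a sum of independent geometric
   variables with mean mu(t) and variance V(t). Its Fourier inversion on the
   scale of the standard deviation, with the majorant C / (1 + u ^ 2), yields
   p(n) ~ e ^ (L(t) + n t) / sqrt (2 pi V(t)) as soon as
   mu(t) = n + o(sqrt V(t)).

   It remains to expand L = 3 L_2 + 3 L_1 + L_0, where
   L_i(t) = sum_k k ^ i log (1 / (1 - e ^ (- k t))). The combinations
   L_1(t) - 4 L_1(2t) and L_0(t) - 2 L_0(2t) are alternating series, whose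
   limits are Euler sums of k log k and log k; L_2 is found from the partial
   fractions of coth. By convexity of L and mu, the expansion of L determines
   those of mu and V. For q one has L_q(t) = L(t) - L(2t).

   The Euler sum of k log k is a value of the derivative of
   eta(s) = (1 - 2 ^ (1 - s)) zeta(s) at -1: eta is an explicit power series
   at 2 with radius of convergence 4, and it agrees with the given continuation
   of zeta at -1 by the identity theorem along the segment from 2 + i to -1. *)

Require Import Defs.
From mathcomp Require Import all_boot all_order all_algebra.
From mathcomp Require Import finmap complex ring lra zify.
From mathcomp Require Import all_classical all_reals all_analysis measurable_realfun.
Set Implicit Arguments.
Unset Strict Implicit.
Unset Printing Implicit Defensive.
Import Order.TTheory GRing.Theory Num.Theory.
Import numFieldNormedType.Exports.
Local Open Scope ring_scope.
Local Open Scope classical_set_scope.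

(** Since p(n) is wanted up to a factor 1 + o(1), L must be known up to o(1), mu up to o(t ^
    (-5/2)), and V to leading order. A limit of u(t) - 2 ^ j u(2t) determines the limit of u,
    because going from t / 2 ^ N up to t divides the unknown by 2 ^ (j N); this is how an Euler sum
    becomes the constant term of L_1 or L_0. Euler summation is done with third differences, the
    first differences of n log n that are absolutely summable. The constant of L_2 is zeta'(-2) = -
    zeta(3) / (4 pi ^ 2); in the partial fractions it appears as a Riemann sum, one for each pole,
    with integral - 2 pi. The saddle point equation is solved only approximately: t = s + B s ^ 2 /
    (6 A), with 3 A / s ^ 4 = n, misses the mean n by O(t ^ -2), which is below the standard
    deviation t ^ (-5/2). Far from 0 on the circle the decay comes from consecutive parts: k y and
    (k + 1) y are both close to multiples of 2 pi only if y is. There the product is exponentially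
    small in 1 / t, while u ^ 2 is at most of order t ^ -5, so C / (1 + u ^ 2) is a majorant on the
    whole circle. *)

Definition tsum {R : realType} (u : nat -> R) : R := limn (series u).
Definition asum {R : realType} (u : nat -> R) : Prop :=
  cvgn (series (fun k => `|u k|)).

(** * Absolutely convergent series *)

Section Series.
Context {R : realType}.
Implicit Types u v M : nat -> R.

Lemma asum_cvg u : asum u -> cvgn (series u).
Proof. exact: normed_cvg. Qed.

Lemma asum_tsum u : asum u -> series u @ \oo --> tsum u.
Proof. by move/asum_cvg. Qed.

Lemma tsumE u l : series u @ \oo --> l -> tsum u = l.
Proof. by move=> /(cvg_lim (@Rhausdorff R)). Qed.

Lemma asum_nneg u : (forall k, 0 <= u k) -> cvgn (series u) -> asum u.
Proof.
move=> u0; rewrite /asum.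
by have -> : (fun k => `|u k|) = u by apply/funext => k; rewrite ger0_norm.
Qed.

Lemma asum_le u v : (forall k, `|u k| <= v k) -> cvgn (series v) -> asum u.
Proof.
move=> uv; apply: series_le_cvg => // k.
by apply: le_trans (uv k).
Qed.

Lemma asum_norm u : asum u -> asum (fun k => `|u k|).
Proof. by move=> h; apply: asum_nneg. Qed.

Lemma eq_tsum u v : u =1 v -> tsum u = tsum v.
Proof. by move=> /funext->. Qed.

Lemma eq_asum u v : u =1 v -> asum v -> asum u.
Proof. by move=> /funext->. Qed.

Lemma asumD u v : asum u -> asum v -> asum (fun k => u k + v k).
Proof.
move=> su sv; apply: (@asum_le _ (fun k => `|u k| + `|v k|)) => [k|].
  exact: ler_normD.
exact: (is_cvg_seriesD su sv).
Qed.

Lemma asumZ c u : asum u -> asum (fun k => c * u k).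
Proof.
move=> su; apply: (@asum_le _ (fun k => `|c| * `|u k|)) => [k|].
  by rewrite normrM.
by have := @is_cvg_seriesZ R (fun k => `|u k|) `|c| su.
Qed.

Lemma asumN u : asum u -> asum (fun k => - u k).
Proof. by move=> su; apply: (@asum_le _ (fun k => `|u k|)) => // k; rewrite normrN. Qed.

Lemma asumB u v : asum u -> asum v -> asum (fun k => u k - v k).
Proof. by move=> su sv; apply: asumD su (asumN sv). Qed.

Lemma tsumD u v : asum u -> asum v ->
  tsum (fun k => u k + v k) = tsum u + tsum v.
Proof. by move=> /asum_cvg su /asum_cvg sv; exact: (lim_seriesD su sv). Qed.

Lemma tsumZ c u : asum u -> tsum (fun k => c * u k) = c * tsum u.
Proof. by move=> /asum_cvg su; exact: (@lim_seriesZ R _ c su). Qed.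

Lemma tsumN u : asum u -> tsum (fun k => - u k) = - tsum u.
Proof. by move=> /asum_cvg su; exact: (lim_seriesN su). Qed.

Lemma tsumB u v : asum u -> asum v ->
  tsum (fun k => u k - v k) = tsum u - tsum v.
Proof. by move=> /asum_cvg su /asum_cvg sv; exact: (lim_seriesB su sv). Qed.

Lemma le_tsum u v : asum u -> asum v -> (forall k, u k <= v k) ->
  tsum u <= tsum v.
Proof. by move=> /asum_cvg su /asum_cvg sv; exact: lim_series_le. Qed.

Lemma partial_le_tsum u n : asum u -> (forall k, 0 <= u k) ->
  \sum_(0 <= k < n) u k <= tsum u.
Proof.
move=> /asum_cvg su u0.
by apply: (nondecreasing_cvgn_le _ su) => //; apply: nondecreasing_series.
Qed.

Lemma tsum_le_ub u c : asum u -> (forall n, \sum_(0 <= k < n) u k <= c) ->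
  tsum u <= c.
Proof.
by move=> /asum_cvg su h; apply: limr_le => //; near=> n; apply: h.
Unshelve. all: end_near. Qed.

Lemma asum_bounded u c : (forall n, \sum_(0 <= k < n) `|u k| <= c) -> asum u.
Proof.
move=> h; apply: nondecreasing_is_cvgn; first exact: nondecreasing_series.
by exists c => _ [n _ <-]; apply: h.
Qed.

Lemma tsum_ge0 u : asum u -> (forall k, 0 <= u k) -> 0 <= tsum u.
Proof.
move=> su u0; have := partial_le_tsum 0 su u0.
by rewrite big_nil.
Qed.

Lemma ler_norm_tsum u : asum u -> `|tsum u| <= tsum (fun k => `|u k|).
Proof. by move=> su; apply: (@lim_series_norm R R^o). Qed.

Lemma tsumS u : asum u -> asum (fun k => u k.+1).
Proof.
move=> su; apply: (@asum_bounded _ (tsum (fun k => `|u k|))) => n.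
apply: le_trans (partial_le_tsum n.+1 (asum_norm su) _) => //.
rewrite big_nat_recl //= lerDr; exact: normr_ge0.
Qed.

Lemma tsum_recl u : asum u -> tsum u = u 0%N + tsum (fun k => u k.+1).
Proof.
move=> su; apply: tsumE.
rewrite -(cvg_shiftS (series u)).
have -> : [sequence series u n.+1]_n = (fun n => u 0%N + series (fun k => u k.+1) n).
  by apply/funext => n /=; rewrite /series /= big_nat_recl.
by apply: cvgD; [exact: cvg_cst | exact/asum_tsum/tsumS].
Qed.

Lemma tsum_exchange_sum (I : Type) (r : seq I) (f : I -> nat -> R) :
  (forall i, asum (f i)) ->
  asum (fun k => \sum_(i <- r) f i k) /\
  tsum (fun k => \sum_(i <- r) f i k) = \sum_(i <- r) tsum (f i).
Proof.
move=> h; elim: r => [|i r [IH1 IH2]].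
  have -> : (fun k => \sum_(i <- [::]) f i k) = (fun=> 0).
    by apply/funext => k; rewrite big_nil.
  have e : series (fun=> 0 : R) = (fun=> 0).
    by apply/funext => n; rewrite /series /= big1.
  rewrite big_nil; split; last by apply: tsumE; rewrite e; exact: cvg_cst.
  by rewrite /asum normr0 e; exact: is_cvg_cst.
have -> : (fun k => \sum_(j <- i :: r) f j k) =
    (fun k => f i k + \sum_(j <- r) f j k).
  by apply/funext => k; rewrite big_cons.
by split; [exact: asumD | rewrite tsumD // IH2 big_cons].
Qed.

Lemma tsum_tail u n : asum u ->
  tsum u - series u n = tsum (fun k => u (n + k)%N).
Proof.
move=> su; elim: n => [|n IH]; first by rewrite /series /= big_nil subr0.
have sn : asum (fun k => u (n + k)%N).
  by elim: n {IH} => // n /tsumS; under [X in asum X]eq_fun do rewrite addnS.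
rewrite seriesSr opprD addrA IH (tsum_recl sn) addn0 addrAC subrr add0r.
by apply: eq_tsum => k; rewrite addnS.
Qed.

Lemma cvg_tsum_tail u : asum u -> (tsum u - series u n) @[n --> \oo] --> 0.
Proof.
move=> su; rewrite -(subrr (tsum u)).
by apply: cvgB; [exact: cvg_cst | exact: asum_tsum].
Qed.

Lemma asum_shift u n : asum u -> asum (fun k => u (n + k)%N).
Proof.
move=> su; elim: n => // n /tsumS.
by under [X in asum X]eq_fun do rewrite addnS.
Qed.

Lemma cvg_sumr (T I : Type) (F : set_system T) {FF : Filter F} (r : seq I)
    (u : T -> I -> R) (v : I -> R) : (forall i, u t i @[t --> F] --> v i) ->
  \sum_(i <- r) u t i @[t --> F] --> \sum_(i <- r) v i.
Proof.
move=> uv; elim: r => [|i r IH].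
  by rewrite big_nil; under eq_fun do rewrite big_nil; exact: cvg_cst.
by rewrite big_cons; under eq_fun do rewrite big_cons; exact: cvgD.
Qed.

Lemma cvgr_eq (T : Type) (F : set_system T) {FF : Filter F} (f g : T -> R) (a b : R) :
  f x @[x --> F] --> a -> a = b -> (\forall x \near F, f x = g x) ->
  g x @[x --> F] --> b.
Proof. by move=> fa <- fg; apply: cvg_trans fa; exact: near_eq_cvg. Qed.

(** Dominated convergence for series: past an index [N] that depends only on [M], all tails are
    below a quarter of the tolerance, and the remaining finite sum converges term by term. *)
Lemma tannery (T : Type) (F : set_system T) {FF : ProperFilter F}
    (u : T -> nat -> R) v M :
  (\forall t \near F, forall k, `|u t k| <= M k) ->
  (forall k, u t k @[t --> F] --> v k) ->
  cvgn (series M) ->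
  asum v /\ tsum (u t) @[t --> F] --> tsum v.
Proof.
move=> uM uv sM.
have vM k : `|v k| <= M k.
  apply: (cvgr_to_le (f := fun t => `|u t k|) (F := F)).
    exact: cvg_norm (uv k).
  by apply: filterS uM => t; exact.
have sv : asum v by apply: asum_le sM.
split => //; apply/cvgrPdist_le => e e0.
have M0 k : 0 <= M k by apply: le_trans (vM k).
have aM := asum_nneg M0 sM.
have e4 : 0 < e / 4 by lra.
have /cvgrPdist_le/(_ _ e4)[N _ /(_ N (leqnn _))] := cvg_tsum_tail aM.
rewrite sub0r normrN (tsum_tail N aM) => tM.
have tail w : (forall k, `|w k| <= M k) ->
    asum w /\ `|tsum w - series w N| <= e / 4.
  move=> wM; have sw : asum w by apply: asum_le sM.
  split => //; rewrite tsum_tail //.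
  apply: le_trans (ler_norm_tsum (asum_shift sw)) _.
  apply: le_trans (le_trans (ler_norm _) tM).
  apply: le_tsum => [| |k]; [exact/asum_norm/asum_shift|exact: asum_shift|exact: wM].
have fin : series (u t) N @[t --> F] --> series v N.
  by rewrite /series /=; exact: cvg_sumr.
move/cvgrPdist_le : fin => /(_ _ e4) fin.
near=> t.
have [_ h1] := tail _ vM.
have ut : forall k, `|u t k| <= M k by near: t.
have [_ h2] := tail _ ut.
have h3 : `|series v N - series (u t) N| <= e / 4 by near: t.
have -> : tsum v - tsum (u t) = (tsum v - series v N) +
  (series v N - series (u t) N) - (tsum (u t) - series (u t) N) by ring.
apply: le_trans (ler_normB _ _) _.
apply: le_trans (lerD (ler_normD _ _) (lexx _)) _.
lra.
Unshelve. all: end_near. Qed.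

(** Fubini as an instance of [tannery]: the parameter is the number [K] of columns summed, and the
    truncated row sums are dominated by [B]. *)
Lemma tsum_exchange (f : nat -> nat -> R) (B : nat -> R) :
  (forall n, asum (f n)) -> (forall n, tsum (fun k => `|f n k|) <= B n) ->
  cvgn (series B) ->
  [/\ forall k, asum (f ^~ k), asum (fun k => tsum (f ^~ k)),
      asum (fun n => tsum (f n)) &
      tsum (fun n => tsum (f n)) = tsum (fun k => tsum (f ^~ k))].
Proof.
move=> sf fB sB.
have B0 n : 0 <= B n by apply: le_trans (fB n); apply: tsum_ge0 => //; exact: asum_norm.
have aB := asum_nneg B0 sB.
have le1 n k : `|f n k| <= B n.
  apply: le_trans (fB n).
  apply: le_trans (partial_le_tsum k.+1 (asum_norm (sf n)) _) => //.
  by rewrite big_nat_recr //= lerDr sumr_ge0.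
have scol k : asum (f ^~ k) by apply: asum_le sB.
(* Applied to [f] and to its absolute values; the second use yields the absolute convergence of the
   column sums. *)
have part (g : nat -> nat -> R) : (forall n, asum (g n)) ->
    (forall k, asum (g ^~ k)) -> (forall n, tsum (fun k => `|g n k|) <= B n) ->
  [/\ asum (fun n => tsum (g n)) &
   series (fun k => tsum (g ^~ k)) @ \oo --> tsum (fun n => tsum (g n))].
  move=> sg gcol gB.
  have [] := @tannery nat \oo _ (fun K n => series (g n) K) (fun n => tsum (g n)) B.
  - near=> K => n; rewrite /series /=.
    apply: le_trans (ler_norm_sum _ _ _) _.
    by apply: le_trans (gB n); apply: partial_le_tsum => //; exact: asum_norm.
  - by move=> n; exact: asum_tsum.
  - by [].
  move=> h1 h2; split => //.
  have -> // : series (fun k => tsum (g ^~ k)) = (fun K => tsum (fun n => series (g n) K)).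
  apply/funext => K; rewrite /series /=.
  by have [_ ->] := tsum_exchange_sum (index_iota 0 K) gcol.
have [a1 a2] := part f sf scol fB.
have [b1 b2] : [/\ asum (fun n => tsum (fun k => `|f n k|)) &
   series (fun k => tsum (fun n => `|f n k|)) @ \oo --> tsum (fun n => tsum (fun k => `|f n k|))].
  apply: (part (fun n k => `|f n k|)) => [n|k|n]; try exact: asum_norm.
  by apply: le_trans (fB n); apply: le_tsum => [| |k]; rewrite ?normr_id //;
    do ?exact: asum_norm; apply: asum_norm; exact: asum_norm.
split => //; last by rewrite (tsumE a2).
apply: (@asum_le _ (fun k => tsum (fun n => `|f n k|))) => [k|].
  exact: ler_norm_tsum.
by apply/cvg_ex; eexists; exact: b2.
Unshelve. all: end_near. Qed.

End Series.

(** * Derivative rules and mean value inequalities *)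

Section Calculus.
Context {R : realType}.
Implicit Types (f g df dg : R -> R) (x y a b c : R).

Lemma dvE f x d d' : is_derive x 1 f d -> d = d' -> is_derive x 1 f d'.
Proof. by move=> h <-. Qed.

Lemma dv_ext f g x d : f =1 g -> is_derive x 1 f d -> is_derive x 1 g d.
Proof. by move=> /funext ->. Qed.

Lemma dv_cst c x : is_derive x 1 (fun _ : R => c) 0.
Proof. exact: is_derive_cst. Qed.

Lemma dv_id x : is_derive x 1 (fun y : R => y) 1.
Proof. exact: is_derive_id. Qed.

Lemma dvD f g x a b : is_derive x 1 f a -> is_derive x 1 g b ->
  is_derive x 1 (fun y => f y + g y) (a + b).
Proof. by move=> h1 h2; exact: is_deriveD. Qed.

Lemma dvB f g x a b : is_derive x 1 f a -> is_derive x 1 g b ->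
  is_derive x 1 (fun y => f y - g y) (a - b).
Proof. by move=> h1 h2; exact: is_deriveB. Qed.

Lemma dvN f x a : is_derive x 1 f a -> is_derive x 1 (fun y => - f y) (- a).
Proof. by move=> h1; exact: is_deriveN. Qed.

Lemma dvM f g x a b : is_derive x 1 f a -> is_derive x 1 g b ->
  is_derive x 1 (fun y => f y * g y) (a * g x + f x * b).
Proof.
move=> h1 h2; apply: (dvE (is_deriveM h1 h2)).
by rewrite /GRing.scale /= addrC mulrC.
Qed.

Lemma dvZ c f x a : is_derive x 1 f a -> is_derive x 1 (fun y => c * f y) (c * a).
Proof. by move=> h; apply: dvE (dvM (dv_cst c x) h) _; rewrite mul0r add0r. Qed.

Lemma dvMr c f x a : is_derive x 1 f a -> is_derive x 1 (fun y => f y * c) (a * c).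
Proof. by move=> h; apply: dvE (dvM h (dv_cst c x)) _; rewrite mulr0 addr0. Qed.

Lemma dvV f x a : f x != 0 -> is_derive x 1 f a ->
  is_derive x 1 (fun y => (f y)^-1) (- a / f x ^+ 2).
Proof.
move=> f0 h; apply: (dvE (is_deriveV f0 h)).
by rewrite /GRing.scale /= !mulNr [X in - X]mulrC.
Qed.

Lemma dvX n f x a : is_derive x 1 f a ->
  is_derive x 1 (fun y => f y ^+ n) (n%:R * f x ^+ n.-1 * a).
Proof.
move=> h; elim: n => [|n IH].
  by rewrite !mul0r; apply: dv_ext (dv_cst 1 x) => y; rewrite expr0.
apply: dv_ext (dvE (dvM h IH) _) => [y|]; first by rewrite exprS.
by case: n {IH} => [|n] /=; rewrite ?expr0 ?exprS -?natr1; ring.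
Qed.

Lemma dv_comp f g x a b : is_derive (g x) 1 f a -> is_derive x 1 g b ->
  is_derive x 1 (fun y => f (g y)) (a * b).
Proof. by move=> h1 h2; exact: is_derive1_comp. Qed.

Lemma dv_exp f x a : is_derive x 1 f a ->
  is_derive x 1 (fun y => expR (f y)) (expR (f x) * a).
Proof. by move=> h; apply: (dv_comp _ h); exact: is_derive_expR. Qed.

Lemma dv_ln f x a : 0 < f x -> is_derive x 1 f a ->
  is_derive x 1 (fun y => ln (f y)) (a / f x).
Proof. by move=> f0 h; rewrite mulrC; apply: (dv_comp _ h); exact: is_derive1_ln. Qed.

Lemma dv_sum (I : Type) (r : seq I) (f : I -> R -> R) (d : I -> R) x :
  (forall i, is_derive x 1 (f i) (d i)) ->
  is_derive x 1 (fun y => \sum_(i <- r) f i y) (\sum_(i <- r) d i).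
Proof.
move=> h; elim: r => [|i r IH].
  rewrite big_nil; apply: dv_ext (dv_cst 0 x) => y; by rewrite big_nil.
rewrite big_cons; apply: dv_ext (dvD (h i) IH) => y; by rewrite big_cons.
Qed.

Lemma dv_continuous f x d : is_derive x 1 f d -> {for x, continuous f}.
Proof. by move=> h; apply/differentiable_continuous/derivable1_diffP. Qed.

Lemma dv_scale f c x d : is_derive (x * c) 1 f d ->
  is_derive x 1 (fun y => f (y * c)) (d * c).
Proof.
by move=> h; apply: (dv_comp (g := fun y => y * c) h); apply: dvE (dvMr c (dv_id x)) _; rewrite mul1r.
Qed.

Lemma dv_shift f c x d : is_derive (x + c) 1 f d ->
  is_derive x 1 (fun y => f (y + c)) d.
Proof.
move=> h; apply: dvE (dv_comp (g := fun y => y + c) h (dvD (dv_id x) (dv_cst c x))) _.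
by rewrite addr0 mulr1.
Qed.

Lemma mean_value f df a b : a < b ->
  (forall x, a <= x <= b -> is_derive x 1 f (df x)) ->
  exists c, [/\ a < c, c < b & f b - f a = df c * (b - a)].
Proof.
move=> ab h; have [||c] := @MVT R f df a b ab _ _.
- by move=> x; rewrite in_itv /= => /andP[/ltW ? /ltW ?]; apply: h; lra.
- apply: continuous_in_subspaceT => x; rewrite inE /= in_itv /= => xab.
  exact: dv_continuous (h x xab).
by rewrite in_itv /= => /andP[? ?] ?; exists c.
Qed.

Lemma mean_value_le f df M a b : a <= b ->
  (forall x, a <= x <= b -> is_derive x 1 f (df x)) ->
  (forall x, a <= x <= b -> `|df x| <= M) ->
  `|f b - f a| <= M * (b - a).
Proof.
rewrite le_eqVlt => /orP[/eqP <-|ab] h hM; first by rewrite !subrr normr0 mulr0.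
have [c [ac cb ->]] := mean_value ab h.
by rewrite normrM (ger0_norm (x := b - a)) ?ler_wpM2r ?hM ?subr_ge0 //; lra.
Qed.

Lemma mean_value_ub f df M a b : a <= b ->
  (forall x, a <= x <= b -> is_derive x 1 f (df x)) ->
  (forall x, a <= x <= b -> df x <= M) -> f b - f a <= M * (b - a).
Proof.
rewrite le_eqVlt => /orP[/eqP <-|ab] h hM; first by rewrite !subrr mulr0.
have [c [ac cb ->]] := mean_value ab h.
by rewrite ler_wpM2r ?hM ?subr_ge0 //; lra.
Qed.

Lemma mean_value_lb f df M a b : a <= b ->
  (forall x, a <= x <= b -> is_derive x 1 f (df x)) ->
  (forall x, a <= x <= b -> M <= df x) -> M * (b - a) <= f b - f a.
Proof.
rewrite le_eqVlt => /orP[/eqP <-|ab] h hM; first by rewrite !subrr mulr0.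
have [c [ac cb ->]] := mean_value ab h.
by rewrite ler_wpM2r ?hM ?subr_ge0 //; lra.
Qed.

(** Both signs of [b - a] are covered, because the slope of a convex function will be squeezed
    between a step to the left and a step to the right. *)
Lemma tangent_le f df (I : set R) a b : a \in I -> b \in I ->
  (forall x y z, x \in I -> y \in I -> x <= z <= y -> z \in I) ->
  (forall x, x \in I -> is_derive x 1 f (df x)) ->
  (forall x y, x \in I -> y \in I -> x <= y -> df x <= df y) ->
  f a + df a * (b - a) <= f b.
Proof.
move=> aI bI conv h mono; rewrite -lerBrDl.
have [ab|/ltW ba] := leP a b.
  apply: (@mean_value_lb f df) => // x xab; have xI := conv _ _ _ aI bI xab.
    exact: h.
  by case/andP: xab => ? ?; apply: mono.
rewrite -lerN2 -[leRHS]mulrN !opprB.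
apply: (@mean_value_ub f df) => // x xab; have xI := conv _ _ _ bI aI xab.
  exact: h.
by case/andP: xab => ? ?; apply: mono.
Qed.

End Calculus.

(** * Euler summation of alternating series *)

Section Reg.
Context {R : realType}.
Implicit Types (f g : nat -> R) (x y a b c : R).

Lemma dv_powR a x : 0 < x -> is_derive x 1 (fun y => y `^ a) (a * x `^ (a - 1)).
Proof. exact: is_derive1_powR. Qed.

(** Integral comparison: each term is at most a difference of the values of [x ^ (1 - p) / (1 - p)],
    and these differences telescope. *)
Lemma asum_powR (p : R) : 1 < p -> asum (fun k => k.+1%:R `^ (- p) : R).
Proof.
move=> p1; have p10 : 0 < p - 1 by lra.
have step k : k.+2%:R `^ (- p) <=
    (p - 1)^-1 * (k.+1%:R `^ (1 - p) - k.+2%:R `^ (1 - p)) :> R.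
  rewrite mulrC ler_pdivlMr // mulrC.
  have := @mean_value_ub R (fun y => y `^ (1 - p)) (fun y => (1 - p) * y `^ (1 - p - 1))
    ((1 - p) * k.+2%:R `^ (- p)) k.+1%:R k.+2%:R.
  rewrite -natrB // subSnn mulr1 => H.
  rewrite -lerN2 opprB -mulNr opprB; apply: H.
  - by rewrite ler_nat.
  - by move=> x /andP[h _]; apply: dv_powR; apply: lt_le_trans h.
  move=> x /andP[h1 h2]; have x0 : 0 < x by apply: lt_le_trans h1.
  rewrite ler_nM2l; last by lra.
  rewrite [X in _ <= _ `^ X](_ : _ = - p); last by ring.
  rewrite !powRN lef_pV2 ?posrE ?powR_gt0 //.
  by apply: ge0_ler_powR => //; rewrite ?nnegrE; lra.
have bnd n : \sum_(0 <= k < n.+1) `|k.+1%:R `^ (- p)| <=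
    1 + (p - 1)^-1 * (1 - n.+1%:R `^ (1 - p)) :> R.
  elim: n => [|n IH].
    by rewrite big_nat1 !powR1 normr1 subrr mulr0 addr0.
  rewrite big_nat_recr //= (ger0_norm (powR_ge0 _ _)).
  apply: le_trans (lerD IH (step n)) _.
  by rewrite -addrA -mulrDr lerD2l ler_pM2l ?invr_gt0 // addrA subrK.
apply: (@asum_bounded _ _ (1 + (p - 1)^-1)) => n.
apply: (@le_trans _ _ (1 + (p - 1)^-1 * (1 - n.+1%:R `^ (1 - p)))); last first.
  by rewrite lerD2l ler_piMr ?invr_ge0 ?ltW // gerBl powR_ge0.
by apply: le_trans (bnd n); rewrite [leRHS]big_nat_recr //= lerDl.
Qed.

(** Third differences, because they have to be summable for [f n = n ln n]: the second derivative of
    [x ln x] is [1 / x], the third is of order [x ^ -2]. *)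
Definition diff3 f n := f n - 3 * f n.+1 + 3 * f n.+2 - f n.+3.

(* The Euler-summed value of the alternating series
   [f 1 - f 2 + f 3 - ...]. *)
Definition regsum f : R :=
  (7 * f 1%N - 4 * f 2%N + f 3%N) / 8 +
  8^-1 * tsum (fun k => (-1) ^+ k * diff3 f k.+1).

Lemma asum_sign f : asum f -> asum (fun k => (-1) ^+ k * f k).
Proof.
move=> sf; apply: (@asum_le _ _ (fun k => `|f k|)) => // k.
by rewrite normrM normrX normrN1 expr1n mul1r.
Qed.

(** The shift relation [rec], used three times, undoes the three averaging steps. *)
Lemma regsum_asum f : asum (fun k => f k.+1) ->
  regsum f = tsum (fun k => (-1) ^+ k * f k.+1).
Proof.
move=> sf.
have s2 := tsumS sf; have s3 := tsumS s2; have s4 := tsumS s3.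
have a1 := asum_sign sf; have a2 := asum_sign s2.
have a3 := asum_sign s3; have a4 := asum_sign s4.
have rec (g : nat -> R) : asum g -> tsum (fun k => (-1) ^+ k * g k) =
    g 0%N - tsum (fun k => (-1) ^+ k * g k.+1).
  move=> sg; rewrite tsum_recl; last exact: asum_sign.
  rewrite expr0 mul1r -tsumN; last exact/asum_sign/tsumS.
  by congr (_ + _); apply: eq_tsum => k; rewrite exprS mulN1r mulNr.
rewrite /regsum; have -> : tsum (fun k => (-1) ^+ k * diff3 f k.+1) =
    tsum (fun k => (-1) ^+ k * f k.+1) - 3 * tsum (fun k => (-1) ^+ k * f k.+2)
    + 3 * tsum (fun k => (-1) ^+ k * f k.+3) - tsum (fun k => (-1) ^+ k * f k.+4).
  rewrite -!tsumZ // -tsumB //; last exact: asumZ.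
  rewrite -tsumD //; [| by apply: asumB => //; exact: asumZ | exact: asumZ].
  rewrite -tsumB //; last first.
    by apply: asumD; [apply: asumB => //; exact: asumZ | exact: asumZ].
  by apply: eq_tsum => k; rewrite /diff3; ring.
by rewrite (rec _ sf) (rec _ s2) (rec _ s3); field.
Qed.

Definition asum_diff3 f := asum (fun k => diff3 f k.+1).

Lemma regsumD f g : asum_diff3 f -> asum_diff3 g ->
  regsum (fun n => f n + g n) = regsum f + regsum g.
Proof.
move=> sf sg; rewrite /regsum.
have -> : tsum (fun k => (-1) ^+ k * diff3 (fun n => f n + g n) k.+1) =
    tsum (fun k => (-1) ^+ k * diff3 f k.+1) + tsum (fun k => (-1) ^+ k * diff3 g k.+1).
  rewrite -tsumD; [|exact: asum_sign|exact: asum_sign].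
  by apply: eq_tsum => k; rewrite /diff3; ring.
by field.
Qed.

Lemma regsumZ c f : asum_diff3 f -> regsum (fun n => c * f n) = c * regsum f.
Proof.
move=> sf; rewrite /regsum.
have -> : tsum (fun k => (-1) ^+ k * diff3 (fun n => c * f n) k.+1) =
    c * tsum (fun k => (-1) ^+ k * diff3 f k.+1).
  rewrite -tsumZ; last exact: asum_sign.
  by apply: eq_tsum => k; rewrite /diff3; ring.
by field.
Qed.

(** Each of the three differences is traded for one derivative by the mean value theorem, inside the
    interval of length 3 spanned by the four samples. *)
Lemma diff3_le (f f1 f2 f3 : R -> R) (M : R) (n : nat) :
  (forall x, n%:R <= x <= n%:R + 3 ->
    [/\ is_derive x 1 f (f1 x), is_derive x 1 f1 (f2 x),
        is_derive x 1 f2 (f3 x) & `|f3 x| <= M]) ->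
  `|diff3 (fun k => f k%:R) n| <= M.
Proof.
move=> h.
have step (g g' : R -> R) (K a : R) : (forall x, a <= x <= a + 1 ->
    is_derive x 1 g (g' x)) -> (forall x, a <= x <= a + 1 -> `|g' x| <= K) ->
    `|g (a + 1) - g a| <= K.
  move=> gd gK; have := @mean_value_le R g g' K a (a + 1) _ gd gK.
  by rewrite lerDl ler01 => /(_ isT); rewrite addrAC subrr add0r mulr1.
have sh (g g' : R -> R) x c : is_derive (x + c) 1 g (g' (x + c)) ->
  is_derive x 1 (fun y => g (y + c)) (g' (x + c)) by apply: dv_shift.
pose F := fun y => f y - 2 * f (y + 1) + f (y + 2).
pose F1 := fun y => f1 y - 2 * f1 (y + 1) + f1 (y + 2).
have -> : diff3 (fun k => f k%:R) n = - (F (n%:R + 1) - F n%:R).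
  rewrite /diff3 /F.
  have -> : n.+1%:R = n%:R + 1 :> R by rewrite natr1.
  have -> : n.+2%:R = n%:R + 2 :> R by rewrite -natrD addn2.
  have -> : n.+3%:R = n%:R + 3 :> R by rewrite -natrD addn3.
  have -> : n%:R + 1 + 1 = n%:R + 2 :> R by ring.
  have -> : n%:R + 1 + 2 = n%:R + 3 :> R by ring.
  by ring.
rewrite normrN; apply: (step _ F1) => [x xn|x xn].
  apply: dvD; [apply: dvB; [|apply: dvZ]|].
  - by have [|] := h x => //; lra.
  - by apply: sh; have [|] := h (x + 1) => //; lra.
  - by apply: sh; have [|] := h (x + 2) => //; lra.
pose G := fun y => f1 (y + 1) - f1 y.
pose G1 := fun y => f2 (y + 1) - f2 y.
have -> : F1 x = G (x + 1) - G x.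
  rewrite /F1 /G; have -> : x + 1 + 1 = x + 2 by ring.
  by ring.
apply: (step _ G1) => [y yx|y yx].
  apply: dvB; first by apply: sh; have [|] := h (y + 1) => //; lra.
  by have [|] := h y => //; lra.
apply: (step _ f3) => [z zy|z zy].
  by have [|] := h z => //; lra.
by have [|] := h z => //; lra.
Qed.

Lemma asum_diff3_le (f f1 f2 f3 : R -> R) (p C : R) : 1 < p ->
  (forall x, 1 <= x ->
    [/\ is_derive x 1 f (f1 x), is_derive x 1 f1 (f2 x),
        is_derive x 1 f2 (f3 x) & `|f3 x| <= C * x `^ (- p)]) ->
  (forall k, `|diff3 (fun k => f k%:R) k.+1| <= C * k.+1%:R `^ (- p)).
Proof.
move=> p1 h k; apply: (@diff3_le f f1 f2 f3) => x /andP[h1 h2].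
have x1 : 1 <= x by apply: le_trans h1; rewrite ler1n.
have x0 : 0 < x by lra.
have [d1 d2 d3 d4] := h _ x1; split => //; apply: le_trans d4 _.
have C0 : 0 <= C.
  have [_ _ _ ] := h 1 (lexx _); rewrite powR1 mulr1; exact: le_trans.
rewrite ler_wpM2l // !powRN lef_pV2 ?posrE ?powR_gt0 ?ltr0n //.
by apply: ge0_ler_powR; rewrite ?nnegrE ?ler0n //; lra.
Qed.

(** Limits pass through Euler sums under a uniform bound on third derivatives alone: [tannery] is
    applied to the third differences. The terms themselves may grow in [n], as [n ln n] does. *)
Lemma regsum_cvg (T : Type) (F : set_system T) {FF : ProperFilter F}
    (u u1 u2 u3 : T -> R -> R) (v : nat -> R) (p C : R) : 1 < p ->
  (\forall t \near F, forall x, 1 <= x ->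
    [/\ is_derive x 1 (u t) (u1 t x), is_derive x 1 (u1 t) (u2 t x),
        is_derive x 1 (u2 t) (u3 t x) & `|u3 t x| <= C * x `^ (- p)]) ->
  (forall n, (0 < n)%N -> u t n%:R @[t --> F] --> v n) ->
  asum_diff3 v /\ regsum (fun n => u t n%:R) @[t --> F] --> regsum v.
Proof.
move=> p1 uC uv.
have cd k : diff3 (fun n => u t n%:R) k.+1 @[t --> F] --> diff3 v k.+1.
  apply: cvgB; last exact: uv.
  apply: cvgD; last by apply: cvgM; [exact: cvg_cst|exact: uv].
  by apply: cvgB; [exact: uv|apply: cvgM; [exact: cvg_cst|exact: uv]].
have [|||a1 a2] := @tannery R T F _ (fun t k => (-1) ^+ k * diff3 (fun n => u t n%:R) k.+1)
  (fun k => (-1) ^+ k * diff3 v k.+1) (fun k => C * k.+1%:R `^ (- p)).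
- apply: filterS uC => t h k; rewrite normrM normrX normrN1 expr1n mul1r.
  exact: asum_diff3_le h k.
- by move=> k; apply: cvgM; [exact: cvg_cst|exact: cd].
- by apply/asum_cvg/asumZ/asum_powR.
split.
  apply: eq_asum (asum_sign a1) => k /=.
  by rewrite mulrA -exprD addnn -mul2n exprM sqrrN expr1n expr1n mul1r.
apply: cvgD; last by apply: cvgM; [exact: cvg_cst|exact: a2].
apply: cvgM; last exact: cvg_cst.
apply: cvgD; last exact: uv.
by apply: cvgB; (apply: cvgM; [exact: cvg_cst|exact: uv]).
Qed.

End Reg.

(** * Sums over the Bose weights *)

Section Bose.
Context {R : realType}.
Implicit Types (x y t : R).

Lemma eq_leR x y : x = y -> x <= y. Proof. by move=> ->. Qed.

Definition ell x : R := - ln (1 - expR (- x)).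
(** Minus the derivative of [ell], and the mean of a geometric variable of ratio [e ^ (- x)]. Its
    variance is [bose1], which is minus the derivative of [bose]; [bose2] is minus the derivative of
    [bose1]. *)
Definition bose x : R := (expR x - 1)^-1.
Definition bose1 x : R := bose x + bose x ^+ 2.
Definition bose2 x : R := (1 + 2 * bose x) * bose1 x.

Lemma expR_sub1_gt0 x : 0 < x -> 0 < expR x - 1.
Proof. by move=> x0; rewrite subr_gt0 expR_gt1. Qed.

Lemma bose_gt0 x : 0 < x -> 0 < bose x.
Proof. by move=> x0; rewrite invr_gt0 expR_sub1_gt0. Qed.

Lemma one_sub_expN_gt0 x : 0 < x -> 0 < 1 - expR (- x).
Proof. by move=> x0; rewrite subr_gt0 expR_lt1 oppr_lt0. Qed.

Lemma bose1_gt0 x : 0 < x -> 0 < bose1 x.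
Proof. by move=> x0; rewrite addr_gt0 ?exprn_gt0 ?bose_gt0. Qed.

Lemma bose2_gt0 x : 0 < x -> 0 < bose2 x.
Proof.
by move=> x0; have := bose_gt0 x0; have := bose1_gt0 x0; rewrite /bose2 => *; apply: mulr_gt0 => //; lra.
Qed.

Lemma bose_le n x : 0 < x -> bose x <= n.+1`!%:R / x ^+ n.+1.
Proof.
move=> x0; rewrite /bose -[leRHS]invrK lef_pV2 ?posrE ?expR_sub1_gt0 //; last first.
  by rewrite invr_gt0 divr_gt0 ?exprn_gt0 // ltr0n fact_gt0.
by rewrite invf_div lerBrDl; apply: expR_ge1Dxn; exact: ltW.
Qed.

Lemma bose_le1 x : 0 < x -> x * bose x <= 1.
Proof.
by move=> x0; rewrite -ler_pdivlMl // mulr1; have := bose_le 0 x0; rewrite (factS 0) fact0 expr1 mul1r.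
Qed.

Lemma bose_le2 x : 0 < x -> x ^+ 2 * bose x <= 2.
Proof.
move=> x0; rewrite -ler_pdivlMl ?exprn_gt0 // mulrC.
exact: (bose_le 1 x0).
Qed.

Lemma bose_le3 x : 0 < x -> x ^+ 3 * bose x <= 6.
Proof.
move=> x0; rewrite -ler_pdivlMl ?exprn_gt0 // mulrC.
exact: (bose_le 2 x0).
Qed.

Lemma bose_ge x : 0 < x -> 1 - x <= x * bose x.
Proof.
move=> x0; rewrite /bose ler_pdivlMr ?expR_sub1_gt0 //.
have h1 := expR_ge1Dx (- x).
have h2 : (1 - x) * expR x <= 1.
  have : (1 - x) * expR x <= expR (- x) * expR x by rewrite ler_pM2r ?expR_gt0.
  by rewrite -expRD addNr expR0.
have h3 : (1 - x) * (expR x - 1) = (1 - x) * expR x - 1 + x by ring.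
rewrite h3; lra.
Qed.

Lemma bose1_le x : 0 < x -> x ^+ 2 * bose1 x <= 3.
Proof.
move=> x0; have h1 := bose_le1 x0; have h2 := bose_le2 x0.
have h0 : 0 <= x * bose x by rewrite mulr_ge0 // ltW // bose_gt0.
have -> : x ^+ 2 * bose1 x = x ^+ 2 * bose x + (x * bose x) ^+ 2.
  by rewrite /bose1; ring.
have : (x * bose x) ^+ 2 <= 1 by rewrite exprn_ile1.
lra.
Qed.

Lemma bose2_le x : 0 < x -> x ^+ 3 * bose2 x <= 14.
Proof.
move=> x0; have b0 := bose_gt0 x0; have h1 := bose_le1 x0; have h2 := bose_le2 x0.
have h3 := bose_le3 x0; have h4 := bose1_le x0; have h5 := bose1_gt0 x0.
have -> : x ^+ 3 * bose2 x = x ^+ 3 * bose x + (x * bose x) * (x ^+ 2 * bose x)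
   + 2 * (x * bose x) * (x ^+ 2 * bose1 x).
  by rewrite /bose2 {1 2}/bose1; ring.
have x00 := ltW x0; have p1 : 0 <= x * bose x by rewrite mulr_ge0 // ltW.
have p2 : 0 <= x ^+ 2 * bose x by rewrite mulr_ge0 ?exprn_ge0 // ltW.
have p3 : 0 <= x ^+ 2 * bose1 x by rewrite mulr_ge0 ?exprn_ge0 // ltW.
have e1 : (x * bose x) * (x ^+ 2 * bose x) <= 1 * 2.
  by apply: ler_pM.
have e2 : (x * bose x) * (x ^+ 2 * bose1 x) <= 1 * 3.
  by apply: ler_pM.
rewrite -(mulrA 2); lra.
Qed.

Lemma cvg_xbose : x * bose x @[x --> 0^'+] --> (1 : R).
Proof.
apply: (@squeeze_cvgr _ _ _ _ (fun x => 1 - x) (fun=> 1)); last exact: cvg_cst.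
  near=> x; have x0 : 0 < x by near: x; exact: nbhs_right_gt.
  by rewrite bose_ge // bose_le1.
rewrite -[X in _ --> X]subr0; apply: cvgB; first exact: cvg_cst.
exact: cvg_at_right_filter.
Unshelve. all: end_near. Qed.

Lemma cvg_x2bose1 : x ^+ 2 * bose1 x @[x --> 0^'+] --> (1 : R).
Proof.
have -> : (fun x => x ^+ 2 * bose1 x) = (fun x => x * (x * bose x) + (x * bose x) * (x * bose x)).
  by apply/funext => x; rewrite /bose1; ring.
rewrite -[X in _ --> X]add0r -[X in _ --> X + _](mul0r 1) -[X in _ --> _ + X](mul1r 1).
apply: cvgD; last by apply: cvgM; exact: cvg_xbose.
apply: cvgM; last exact: cvg_xbose.
exact: cvg_at_right_filter.
Qed.

Lemma dv_bose x : 0 < x -> is_derive x 1 bose (- bose1 x).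
Proof.
move=> x0; have e0 := expR_sub1_gt0 x0.
have d : is_derive x 1 (fun y => expR y - 1) (expR x - 0).
  exact: dvB (is_derive_expR x) (dv_cst 1 x).
apply: dvE (dvV (f := fun y => expR y - 1) (lt0r_neq0 e0) d) _.
by rewrite /bose1 /bose; field; rewrite gt_eqF.
Qed.

Lemma dv_bose1 x : 0 < x -> is_derive x 1 bose1 (- bose2 x).
Proof.
move=> x0; have h := dv_bose x0.
apply: dvE (dvD h (dvX 2 h)) _.
by rewrite /bose2 expr1; ring.
Qed.

Lemma dv_ell x : 0 < x -> is_derive x 1 ell (- bose x).
Proof.
move=> x0; have e0 := expR_sub1_gt0 x0; have f0 := one_sub_expN_gt0 x0.
have d : is_derive x 1 (fun y => 1 - expR (- y)) (0 - expR (- x) * - 1).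
  exact: dvB (dv_cst 1 x) (dv_exp (dvN (dv_id x))).
have := dvN (dv_ln (f := fun y => 1 - expR (- y)) f0 d).
move=> h; apply: dvE h _; rewrite /bose expRN.
have X0 := expR_gt0 x; field.
rewrite gt_eqF //= gt_eqF //; lra.
Qed.

Lemma ell_ge0 x : 0 < x -> 0 <= ell x.
Proof.
by move=> x0; rewrite oppr_ge0 ln_le0 // gerBl expR_ge0.
Qed.

Lemma ell_le_bose x : 0 < x -> ell x <= bose x.
Proof.
move=> x0; have e0 := expR_sub1_gt0 x0; have f0 := one_sub_expN_gt0 x0.
have b0 := bose_gt0 x0.
rewrite /ell -lnV ?posrE //.
have -> : (1 - expR (- x))^-1 = 1 + bose x.
  rewrite /bose expRN; have X0 := expR_gt0 x; field.
  rewrite gt_eqF //= gt_eqF //; lra.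
by apply: le_ln1Dx; lra.
Qed.

(** The remainder after [N] terms vanishes at 0 and has derivative [y ^ N / (1 - y)], so the mean
    value inequality bounds it geometrically. *)
Lemma ln_sub1_series (x : R) : 0 <= x < 1 ->
  series (fun m => m.+1%:R^-1 * x ^+ m.+1) @ \oo --> - ln (1 - x).
Proof.
move=> /andP[x0 x1].
pose s N y : R := series (fun m => m.+1%:R^-1 * y ^+ m.+1) N.
have sd N y : y < 1 -> is_derive y 1 (s N) ((1 - y ^+ N) / (1 - y)).
  move=> y1; have ny : 1 - y != 0 by rewrite gt_eqF // subr_gt0.
  have := @dv_sum R nat (index_iota 0 N) (fun m y => m.+1%:R^-1 * y ^+ m.+1)
    (fun m => m.+1%:R^-1 * (m.+1%:R * y ^+ m * 1)) y _.
  move=> /(_ (fun m => dvZ _ (dvX m.+1 (dv_id y)))) h; apply: dvE h _.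
  under eq_bigr do rewrite mulr1 mulrA mulVf ?mul1r ?pnatr_eq0 //.
  apply: (canRL (mulfK ny)).
  elim: N => [|N IH]; first by rewrite big_nil mul0r expr0 subrr.
  by rewrite big_nat_recr //= mulrDl IH exprS; ring.
have bd N : `|- ln (1 - x) - s N x| <= x / (1 - x) * x ^+ N.
  have h : `|(- ln (1 - x) - s N x) - (- ln (1 - 0) - s N 0)| <= x ^+ N / (1 - x) * (x - 0).
    apply: (@mean_value_le R (fun y => - ln (1 - y) - s N y)
      (fun y => - ((0 - 1) / (1 - y)) - (1 - y ^+ N) / (1 - y))) => // y /andP[y0 yx].
      apply: dvB; last by apply: sd; lra.
      have d : is_derive y 1 (fun y => 1 - y) (0 - 1) := dvB (dv_cst 1 y) (dv_id y).
      by apply/dvN/(dv_ln (f := fun y => 1 - y)) => //; lra.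
    have y1 : 0 < 1 - y by lra.
    have -> : - ((0 - 1) / (1 - y)) - (1 - y ^+ N) / (1 - y) = y ^+ N / (1 - y).
      by field; rewrite gt_eqF.
    rewrite ger0_norm; last by rewrite divr_ge0 ?exprn_ge0 // ltW.
    apply: ler_pM; rewrite ?exprn_ge0 ?invr_ge0 //; first by lra.
      by rewrite lerXn2r ?nnegrE.
    by rewrite lef_pV2 ?posrE; lra.
  have s0 : s N 0 = 0.
    by rewrite /s /series /= big1 // => m _; rewrite exprS mul0r mulr0.
  move: h; rewrite s0 !subr0 ln1 oppr0 subr0.
  by rewrite (_ : x ^+ N / (1 - x) * x = x / (1 - x) * x ^+ N) //; ring.
apply/cvgrPdist_le => e e0.
have c : x / (1 - x) * x ^+ N @[N --> \oo] --> 0.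
  rewrite -[X in _ --> X](mulr0 (x / (1 - x))); apply: cvgM; first exact: cvg_cst.
  by apply: cvg_expr; rewrite ger0_norm.
move/cvgrPdist_le : c => /(_ _ e0); apply: filterS => N.
rewrite sub0r normrN => h; apply: le_trans (bd N) (le_trans (ler_norm _) h).
Qed.

Lemma expN_le n x : 0 < x -> expR (- x) <= n.+1`!%:R / x ^+ n.+1.
Proof.
move=> x0; apply: le_trans (bose_le n x0); rewrite /bose expRN.
by rewrite lef_pV2 ?posrE ?expR_gt0 ?expR_sub1_gt0 // gerBl.
Qed.

Lemma asum_invX n : asum (fun k => (k.+1%:R ^+ n.+2)^-1 : R).
Proof.
apply: eq_asum (asum_powR (p := n.+2%:R) _) => [k|]; last by rewrite ltr1n.
by rewrite powR_invn.
Qed.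

Lemma asum_decay (f : R -> R) i t c : 0 < t -> (forall x, 0 < x -> 0 <= f x) ->
  (forall x, 0 < x -> f x <= c / x ^+ i.+2) ->
  asum (fun k => k.+1%:R ^+ i * f (k.+1%:R * t)).
Proof.
move=> t0 f0 fc; apply: (@asum_le _ _ (fun k => (c / t ^+ i.+2) * (k.+1%:R ^+ 2)^-1)).
  move=> k; have kt : 0 < k.+1%:R * t by rewrite mulr_gt0.
  rewrite ger0_norm ?mulr_ge0 ?f0 //.
  apply: le_trans (ler_wpM2l _ (fc _ kt)) _ => //.
  have k0 : 0 < k.+1%:R :> R by rewrite ltr0n.
  apply: eq_leR.
  have -> : (k.+1%:R * t) ^+ i.+2 = k.+1%:R ^+ i * k.+1%:R ^+ 2 * t ^+ i.+2.
    by rewrite exprMn -exprD addn2.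
  have Ti : t ^+ i.+2 != 0 by rewrite expf_neq0 // gt_eqF.
  have Ki : k.+1%:R ^+ i != 0 :> R by rewrite expf_neq0 // gt_eqF.
  have K0 : k.+1%:R != 0 :> R by rewrite gt_eqF.
  have e (T K k' : R) : T != 0 -> K != 0 -> k' != 0 ->
      K * (c / (K * k' ^+ 2 * T)) = c / T * (k' ^+ 2)^-1.
    by move=> T0 K0' k0'; field; rewrite T0 K0' k0'.
  exact: e.
exact/asum_cvg/asumZ/asum_invX.
Qed.

Lemma asum_ell i t : 0 < t -> asum (fun k => k.+1%:R ^+ i * ell (k.+1%:R * t)).
Proof.
move=> t0; apply: asum_decay => // x x0; first exact: ell_ge0.
exact: le_trans (ell_le_bose x0) (bose_le _ x0).
Qed.

Lemma asum_bose i t : 0 < t -> asum (fun k => k.+1%:R ^+ i * bose (k.+1%:R * t)).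
Proof.
move=> t0; apply: asum_decay => // x x0; first exact/ltW/bose_gt0.
exact: bose_le.
Qed.

Lemma asum_expN i t : 0 < t -> asum (fun k => k.+1%:R ^+ i * expR (- (k.+1%:R * t))).
Proof.
move=> t0; apply: (@asum_decay (fun x => expR (- x))) => // x x0.
exact: expN_le.
Qed.

(** Splitting off the first term gives a linear equation for the sum. The same shift yields
    [tsum_exp1] and [tsum_exp2], each using the preceding closed forms. *)
Lemma tsum_exp0 t : 0 < t -> tsum (fun k => expR (- (k.+1%:R * t))) = bose t.
Proof.
move=> t0; set S := LHS; have e0 := expR_sub1_gt0 t0; have X0 := expR_gt0 t.
have s0 : asum (fun k => expR (- (k.+1%:R * t))).
  by apply: eq_asum (asum_expN (i := 0) t0) => k; rewrite mul1r.
have : S = expR (- t) + expR (- t) * S.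
  rewrite {1}/S tsum_recl // mul1r; congr (_ + _); rewrite -tsumZ //.
  by apply: eq_tsum => k; rewrite -expRD -natr1; congr expR; ring.
rewrite /bose expRN => h.
have: S * (expR t - 1) = 1.
  by rewrite mulrBr mulr1 {1}h mulrDl mulVf ?gt_eqF // mulrAC mulVf ?gt_eqF // mul1r addrK.
by move=> /(canRL (mulfK (lt0r_neq0 e0))) ->; rewrite mul1r.
Qed.

Lemma tsum_exp1 t : 0 < t -> tsum (fun k => k.+1%:R * expR (- (k.+1%:R * t))) = bose1 t.
Proof.
move=> t0; set S := LHS; have e0 := expR_sub1_gt0 t0; have X0 := expR_gt0 t.
have s0 : asum (fun k => expR (- (k.+1%:R * t))).
  by apply: eq_asum (asum_expN (i := 0) t0) => k; rewrite mul1r.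
have s1 : asum (fun k => k.+1%:R * expR (- (k.+1%:R * t))).
  by apply: eq_asum (asum_expN (i := 1) t0) => k; rewrite expr1.
have h : S = expR (- t) + expR (- t) * (S + bose t).
  rewrite {1}/S tsum_recl // !mul1r; congr (_ + _); rewrite -(tsum_exp0 t0) -tsumD // -tsumZ; last exact: asumD.
  apply: eq_tsum => k.
  have -> : expR (- (k.+2%:R * t)) = expR (- t) * expR (- (k.+1%:R * t)).
    by rewrite -expRD -[k.+2%:R]natr1; congr expR; ring.
  by rewrite -[k.+2%:R]natr1; ring.
apply: (mulIf (lt0r_neq0 e0)).
have -> : S * (expR t - 1) = expR t * S - S by ring.
rewrite {1}h mulrDr mulrA -expRD subrr expR0 mul1r /bose1 /bose; field.
by rewrite gt_eqF.
Qed.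

Lemma tsum_exp2 t : 0 < t -> tsum (fun k => k.+1%:R ^+ 2 * expR (- (k.+1%:R * t))) = bose2 t.
Proof.
move=> t0; set S := LHS; have e0 := expR_sub1_gt0 t0; have X0 := expR_gt0 t.
have s0 : asum (fun k => expR (- (k.+1%:R * t))).
  by apply: eq_asum (asum_expN (i := 0) t0) => k; rewrite mul1r.
have s1 : asum (fun k => k.+1%:R * expR (- (k.+1%:R * t))).
  by apply: eq_asum (asum_expN (i := 1) t0) => k; rewrite expr1.
have s2 := asum_expN (i := 2) t0.
have h : S = expR (- t) + expR (- t) * (S + 2 * bose1 t + bose t).
  rewrite {1}/S tsum_recl // expr1n !mul1r; congr (_ + _).
  rewrite -(tsum_exp0 t0) -(tsum_exp1 t0) -(tsumZ _ s1) -tsumD; [|by []|exact: asumZ].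
  rewrite -tsumD; [|by apply: asumD => //; exact: asumZ|by []].
  rewrite -tsumZ; last by apply: asumD => //; apply: asumD => //; exact: asumZ.
  apply: eq_tsum => k.
  have -> : expR (- (k.+2%:R * t)) = expR (- t) * expR (- (k.+1%:R * t)).
    by rewrite -expRD -[k.+2%:R]natr1; congr expR; ring.
  by rewrite -[k.+2%:R]natr1; ring.
apply: (mulIf (lt0r_neq0 e0)).
have -> : S * (expR t - 1) = expR t * S - S by ring.
rewrite {1}h mulrDr mulrA -expRD subrr expR0 mul1r /bose2 /bose1 /bose; field.
by rewrite gt_eqF.
Qed.

Definition Lsum i t : R := tsum (fun k => k.+1%:R ^+ i * ell (k.+1%:R * t)).

(** The logarithm is expanded and the sum over the parts is taken first: for [i] = 0, 1, 2 the inner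
    sums have the closed forms [bose], [bose1], [bose2] at [(m + 1) t]. *)
Lemma Lsum_double i t : 0 < t ->
  asum (fun m => m.+1%:R^-1 * tsum (fun k => k.+1%:R ^+ i * expR (- (k.+1%:R * (m.+1%:R * t))))) /\
  Lsum i t = tsum (fun m =>
    m.+1%:R^-1 * tsum (fun k => k.+1%:R ^+ i * expR (- (k.+1%:R * (m.+1%:R * t))))).
Proof.
move=> t0.
pose f k m : R := k.+1%:R ^+ i * (m.+1%:R^-1 * expR (- (k.+1%:R * t)) ^+ m.+1).
have f0 k m : 0 <= f k m by rewrite /f !mulr_ge0 ?exprn_ge0 ?expR_ge0 ?invr_ge0.
have row k : asum (f k) /\ tsum (f k) = k.+1%:R ^+ i * ell (k.+1%:R * t).
  have kt : 0 < k.+1%:R * t by rewrite mulr_gt0.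
  have h : 0 <= expR (- (k.+1%:R * t)) < 1 by rewrite expR_ge0 expR_lt1 oppr_lt0.
  have c := ln_sub1_series h.
  have a : asum (fun m => m.+1%:R^-1 * expR (- (k.+1%:R * t)) ^+ m.+1).
    apply: asum_nneg => [m|]; first by rewrite mulr_ge0 ?exprn_ge0 ?expR_ge0 ?invr_ge0.
    by apply/cvg_ex; eexists; exact: c.
  by split; [exact: asumZ|rewrite /f tsumZ // (tsumE c)].
have [|||c1 c2 c3 c4] := @tsum_exchange R f (fun k => k.+1%:R ^+ i * ell (k.+1%:R * t)).
- by move=> k; have [] := row k.
- move=> k; have [_ <-] := row k.
  by under eq_fun do rewrite ger0_norm //.
- exact/asum_cvg/asum_ell.
have fE m : tsum (f ^~ m) = m.+1%:R^-1 * tsum (fun k => k.+1%:R ^+ i * expR (- (k.+1%:R * (m.+1%:R * t)))).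
  rewrite -tsumZ; last by apply: asum_expN; rewrite mulr_gt0.
  apply: eq_tsum => k; rewrite /f -expRM_natl mulrCA; congr (_ * (_ * expR _)); ring.
split; first by apply: eq_asum c2 => m; rewrite fE.
transitivity (tsum (fun k => tsum (f k))).
  by apply: eq_tsum => k; have [_ ->] := row k.
by rewrite c4; apply: eq_tsum => m; exact: fE.
Qed.

Definition zsum n : R := tsum (fun k => (k.+1%:R ^+ n)^-1).

Lemma cvg_mul_at0 (g : R -> R) (c : R) (m : nat) : g x @[x --> 0^'+] --> c ->
  g (m.+1%:R * x) @[x --> 0^'+] --> c.
Proof.
move=> gc; apply: (@cvg_trans _ (g @ (0^'+ : set_system R))) => //.
move=> A [e /= e0 eA]; exists (e / m.+1%:R); first by rewrite /= divr_gt0.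
move=> x /= xe x0; apply: eA => /=; last by rewrite mulr_gt0.
move: xe; rewrite !sub0r !normrN normrM ger0_norm // ltr_pdivlMr // mulrC.
by rewrite mulrC.
Qed.

(** The leading order serves as the growth condition of [iter_half]. The summands are [m ^ -2] times
    [x * bose x] at [x = m t], which is at most 1 and tends to 1. *)
Lemma cvg_tLsum0 : t * Lsum 0 t @[t --> 0^'+] --> zsum 2.
Proof.
have [|||_] := @tannery R R (0^'+) _ (fun t m => (m.+1%:R ^+ 2)^-1 * (m.+1%:R * t * bose (m.+1%:R * t)))
  (fun m => (m.+1%:R ^+ 2)^-1) (fun m => (m.+1%:R ^+ 2)^-1).
- near=> t => m; have t0 : 0 < t by near: t; exact: nbhs_right_gt.
  have mt : 0 < m.+1%:R * t by rewrite mulr_gt0.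
  have b0 := ltW (bose_gt0 mt); have m0 := ltW mt.
  rewrite ger0_norm; last first.
    by apply: mulr_ge0; [rewrite invr_ge0 exprn_ge0|exact: mulr_ge0].
  by rewrite ler_piMr ?invr_ge0 ?exprn_ge0 // bose_le1.
- move=> m; rewrite -[X in _ --> X]mulr1; apply: cvgM; first exact: cvg_cst.
  exact: (cvg_mul_at0 (g := fun x => x * bose x) m cvg_xbose).
- exact: asum_cvg (@asum_invX 0).
apply: cvg_trans; apply: near_eq_cvg; near=> t.
have t0 : 0 < t by near: t; exact: nbhs_right_gt.
have [a ->] := Lsum_double 0 t0; rewrite -tsumZ //.
apply: eq_tsum => m; under eq_fun do rewrite mul1r.
by rewrite tsum_exp0 ?mulr_gt0 //; field; rewrite addrC natr1 pnatr_eq0.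
Unshelve. all: end_near. Qed.

Lemma cvg_tLsum1 : t ^+ 2 * Lsum 1 t @[t --> 0^'+] --> zsum 3.
Proof.
have [|||_] := @tannery R R (0^'+) _ (fun t m => (m.+1%:R ^+ 3)^-1 * ((m.+1%:R * t) ^+ 2 * bose1 (m.+1%:R * t)))
  (fun m => (m.+1%:R ^+ 3)^-1) (fun m => 3 * (m.+1%:R ^+ 3)^-1).
- near=> t => m; have t0 : 0 < t by near: t; exact: nbhs_right_gt.
  have mt : 0 < m.+1%:R * t by rewrite mulr_gt0.
  have b0 := ltW (bose1_gt0 mt); have m0 := ltW mt.
  rewrite ger0_norm; last first.
    by apply: mulr_ge0; [rewrite invr_ge0 exprn_ge0|rewrite mulr_ge0 // exprn_ge0].
  by rewrite mulrC ler_wpM2r ?invr_ge0 ?exprn_ge0 // bose1_le.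
- move=> m; rewrite -[X in _ --> X]mulr1; apply: cvgM; first exact: cvg_cst.
  exact: (cvg_mul_at0 (g := fun x => x ^+ 2 * bose1 x) m cvg_x2bose1).
- exact/asum_cvg/asumZ/(@asum_invX 1).
apply: cvg_trans; apply: near_eq_cvg; near=> t.
have t0 : 0 < t by near: t; exact: nbhs_right_gt.
have [a ->] := Lsum_double 1 t0; rewrite -tsumZ //.
apply: eq_tsum => m; under eq_fun do rewrite expr1.
by rewrite tsum_exp1 ?mulr_gt0 //; field; rewrite addrC natr1 pnatr_eq0.
Unshelve. all: end_near. Qed.

End Bose.

(** * Expansion of L_0 and L_1 through alternating series *)

Section Alternating.
Context {R : realType}.
Implicit Types (x y t : R).

Lemma tsum_alternating (g : nat -> R) : asum (fun k => g k.+1) ->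
  tsum (fun k => g k.+1) - 2 * tsum (fun k => g (2 * k.+1)%N) =
  tsum (fun k => (-1) ^+ k * g k.+1).
Proof.
move=> sg.
have fin n : \sum_(0 <= k < n.*2) (-1) ^+ k * g k.+1 =
    \sum_(0 <= k < n.*2) g k.+1 - 2 * \sum_(0 <= k < n) g (2 * k.+1)%N.
  elim: n => [|n IH]; first by rewrite !big_nil mulr0 subrr.
  rewrite doubleS !(big_nat_recr _ _ _ (leq0n _)) //= IH.
  rewrite exprS -mul2n exprM sqrrN expr1n expr1n !mulrSr; rewrite mulnS.
  by rewrite (_ : (2 + 2 * n = (2 * n).+2)%N) //; ring.
have s2 : asum (fun k => g (2 * k.+1)%N).
  apply: (@asum_bounded _ _ (tsum (fun k => `|g k.+1|))) => n.
  apply: le_trans (partial_le_tsum n.*2 (asum_norm sg) _) => //.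
  elim: n => [|n IH]; first by rewrite !big_nil.
  rewrite doubleS !(big_nat_recr _ _ _ (leq0n _)) //= -addrA lerD //.
  by rewrite mulnS -mul2n lerDr.
have c2 : (fun n => \sum_(0 <= k < n.*2) g k.+1) @ \oo --> tsum (fun k => g k.+1).
  apply: (cvg_comp (fun n => n.*2) (series (fun k => g k.+1))); last exact: asum_tsum.
  apply/cvgnyPge => A; near=> n; apply: (@leq_trans n); last by rewrite -addnn leq_addr.
  by near: n; exact: nbhs_infty_ge.
apply/esym/(cvg_unique _ (F := (fun n => \sum_(0 <= k < n.*2) (-1) ^+ k * g k.+1) @ \oo)) => //.
  apply: (cvg_comp (fun n => n.*2) (series (fun k => (-1) ^+ k * g k.+1))).
    apply/cvgnyPge => A; near=> n; apply: (@leq_trans n); last by rewrite -addnn leq_addr.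
    by near: n; exact: nbhs_infty_ge.
  exact/asum_tsum/asum_sign.
rewrite (funext fin).
apply: cvgB => //; apply: cvgM; first exact: cvg_cst.
exact: asum_tsum.
Unshelve. all: end_near. Qed.

(** Subtracting the even-indexed terms twice makes the series alternate, and the term of index [2 k]
    carries the factor [2 ^ i]; hence the exponent [i + 1]. *)
Lemma Lsum_alternating i t : 0 < t ->
  Lsum i t - 2 ^+ i.+1 * Lsum i (2 * t) =
  regsum (fun n => n%:R ^+ i * ell (n%:R * t)).
Proof.
move=> t0; have s := asum_ell (i := i) t0.
rewrite regsum_asum; last exact: s.
have := tsum_alternating (g := fun n => n%:R ^+ i * ell (n%:R * t)) s.
cbv beta; rewrite -/(Lsum i t) => <-.
suff -> : 2 ^+ i.+1 * Lsum i (2 * t) =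
  2 * tsum (fun k => (2 * k.+1)%:R ^+ i * ell ((2 * k.+1)%:R * t)) by [].
rewrite exprS -mulrA; congr (_ * _); rewrite -tsumZ; last first.
  by apply: asum_ell; rewrite mulr_gt0.
by apply: eq_tsum => k; rewrite natrM exprMn -[RHS]mulrA; congr (_ * (_ * ell _)); ring.
Qed.

Lemma cvg_id0 : t @[t --> (0 : R)^'+] --> (0 : R).
Proof. exact: cvg_at_right_filter. Qed.

Lemma cvg_tln : t * ln t @[t --> 0^'+] --> (0 : R).
Proof.
have sq : - (2 * Num.sqrt t) @[t --> (0 : R)^'+] --> (0 : R).
  rewrite -[X in _ --> X]oppr0 -[X in - X](mulr0 2) -[X in 2 * X](sqrtr0 R).
  apply: cvgN; apply: cvgM; first exact: cvg_cst.
  by apply: cvg_at_right_filter; exact: sqrt_continuous.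
apply: (@squeeze_cvgr _ _ _ _ (fun t => - (2 * Num.sqrt t)) (fun=> 0)) => //; last exact: cvg_cst.
near=> t; have t0 : 0 < t by near: t; exact: nbhs_right_gt.
have t1 : t < 1 by near: t; exact: nbhs_right_lt.
have s0 : 0 < Num.sqrt t by rewrite sqrtr_gt0.
have := ln_sublinear (x := (Num.sqrt t)^-1); rewrite invr_gt0 => /(_ s0).
rewrite lnV ?posrE // => h.
have e : ln t = 2 * ln (Num.sqrt t).
  by rewrite -{1}(sqr_sqrtr (ltW t0)) lnXn // mulr_natl.
apply/andP; split; last by rewrite pmulr_rle0 // ln_le0 // ltW.
have -> : t * ln t = - (2 * (Num.sqrt t ^+ 2 * (- ln (Num.sqrt t)))).
  by rewrite sqr_sqrtr ?ltW // e; ring.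
rewrite lerN2 ler_pM2l // expr2 -mulrA -[leRHS]mulr1 ler_pM2l //.
by rewrite -(mulfV (lt0r_neq0 s0)) ler_pM2l // ltW.
Unshelve. all: end_near. Qed.

(** With [a = 2 ^ j] and [c] the expected limit, the deviation [c - u] at [2 s] is the deviation at
    [s], up to a small error, divided by [a]. Starting from [t / 2 ^ N], the initial deviation is
    divided by [a ^ N], that is, multiplied by [(s N / t) ^ j], which the growth hypothesis sends to
    0. *)
Lemma iter_half (u : R -> R) (j : nat) (kappa : R) : (0 < j)%N ->
  u t - 2 ^+ j * u (2 * t) @[t --> 0^'+] --> kappa ->
  t ^+ j * u t @[t --> 0^'+] --> 0 ->
  u t @[t --> 0^'+] --> kappa / (1 - 2 ^+ j).
Proof.
move=> j0; set a : R := 2 ^+ j => uk tu.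
have a2 : 2 <= a.
  by rewrite /a -[leLHS]expr1; apply: ler_weXn2l => //; lra.
have a0 : 0 < a by lra.
pose c := kappa / (1 - a).
have cE : c - a * c = kappa by rewrite /c; field; rewrite lt_eqF; lra.
apply/cvgrPdist_le => e e0.
have e2 : 0 < e / 2 by lra.
move/cvgrPdist_le : uk => /(_ _ e2) [d /= d0 dP].
exists d => //= t /= td t0.
have td' : t < d by move: td; rewrite sub0r normrN gtr0_norm.
have step s : 0 < s < d -> `|c - u (2 * s)| <= (`|c - u s| + e / 2) / a.
  move=> /andP[s0 sd]; rewrite ler_pdivlMr //.
  have := dP s; rewrite /ball_ /= sub0r normrN gtr0_norm // => /(_ sd s0) h.
  rewrite -[X in _ * X](gtr0_norm a0) -normrM.
  have -> : (c - u (2 * s)) * a = (c - u s) - (kappa - (u s - a * u (2 * s))).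
    by rewrite -cE; ring.
  by apply: le_trans (ler_normB _ _) _; rewrite lerD2l.
pose s N := t / 2 ^+ N.
have s0 N : 0 < s N by rewrite divr_gt0 // exprn_gt0.
have sd N : s N < d.
  apply: le_lt_trans td'; rewrite ler_pdivrMr ?exprn_gt0 //; apply: ler_peMr; first exact: ltW.
  by rewrite exprn_ege1 // ler1n.
(* The term [e / 2 / a ^ N] on the left is a reserve that makes the induction close: a halving
   spends [e / 2 / a ^ N.+1], and as much is left because [a >= 2]. *)
have bd N : `|c - u t| + e / 2 / a ^+ N <= `|c - u (s N)| / a ^+ N + e / 2.
  elim: N => [|N IH]; first by rewrite /s !expr0 !divr1.
  have sE : s N = 2 * s N.+1 by rewrite /s exprS; field; rewrite expf_neq0.
  have := step (s N.+1); rewrite s0 sd -sE => /(_ isT) h.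
  have aN : 0 < a ^+ N by rewrite exprn_gt0.
  have h2 : `|c - u (s N)| / a ^+ N <= (`|c - u (s N.+1)| + e / 2) / a ^+ N.+1.
    by rewrite exprS invfM mulrA ler_pM2r ?invr_gt0.
  have h3 : 2 * (e / 2 / a ^+ N.+1) <= e / 2 / a ^+ N.
    rewrite exprS invfM [leLHS](_ : _ = (e / 2 / a ^+ N) * (2 / a)); last by ring.
    rewrite ler_piMr //; first by rewrite !divr_ge0 // ltW.
    by rewrite ler_pdivrMr // mul1r.
  move: h2; rewrite mulrDl; lra.
have scu : x ^+ j * (c - u x) @[x --> (0 : R)^'+] --> (0 : R).
  have tj : x ^+ j @[x --> (0 : R)^'+] --> (0 : R).
    have h : x ^+ j @[x --> (0 : R)^'+] --> (0 : R) ^+ j.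
      by apply: cvg_at_right_filter; exact: exprn_continuous.
    by rewrite expr0n gtn_eqF in h.
  have H : x ^+ j * c - x ^+ j * u x @[x --> (0 : R)^'+] --> 0 * c - 0.
    exact: cvgB (cvgM tj (cvg_cst c)) tu.
  rewrite mul0r subr0 in H; move: H.
  by rewrite (_ : (fun x => _) = (fun x => x ^+ j * (c - u x))) //; apply/funext => x; rewrite mulrBr.
have e3 : 0 < e / 2 * t ^+ j by rewrite mulr_gt0 // exprn_gt0.
move/cvgrPdist_le : scu => /(_ _ e3) [dl /= dl0 dlP].
have [N hN] : exists N, s N < dl.
  exists (Num.truncn (t / dl)).+1.
  rewrite /s ltr_pdivrMr ?exprn_gt0 // mulrC -ltr_pdivrMr //.
  apply: lt_le_trans (truncnS_gt _) _.
  by rewrite -natrX ler_nat ltnW // ltn_expl.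
have := dlP (s N); rewrite /ball_ /= sub0r normrN gtr0_norm // => /(_ hN (s0 N)).
rewrite sub0r normrN normrM normrX gtr0_norm // => h.
have h4 : `|c - u (s N)| / a ^+ N <= e / 2.
  rewrite -(ler_pM2l (x := t ^+ j)) ?exprn_gt0 // (mulrC _ (e / 2)).
  apply: le_trans h; rewrite /s expr_div_n -exprM mulnC exprM -/a.
  by apply: eq_leR; ring.
have aN : 0 <= e / 2 / a ^+ N by rewrite !divr_ge0 ?exprn_ge0 // ltW.
have := bd N; lra.
Unshelve. all: end_near. Qed.

Lemma regsum_cst (c : R) : regsum (fun=> c) = c / 2.
Proof.
rewrite /regsum (_ : (fun k => _) = (fun=> 0)); last first.
  by apply/funext => k; rewrite /diff3; ring.
rewrite (@tsumE _ _ 0) ?mulr0; first by field.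
by rewrite (_ : series _ = fun=> 0); [exact: cvg_cst | apply/funext => n; rewrite /series /= big1].
Qed.

Lemma asum_diff3_cst (c : R) : asum_diff3 (fun=> c).
Proof.
apply: (@asum_le _ _ (fun k => (k.+1%:R ^+ 2)^-1)) => [k|]; last exact: asum_cvg (@asum_invX R 0).
by rewrite /diff3 (_ : _ - _ = 0) ?normr0 ?invr_ge0 ?exprn_ge0 //; ring.
Qed.

Lemma regsum_id (c : R) : regsum (fun n => n%:R * c) = c / 4.
Proof.
rewrite /regsum (_ : (fun k => _) = (fun=> 0)); last first.
  by apply/funext => k; rewrite /diff3 -!natr1; ring.
rewrite (@tsumE _ _ 0) ?mulr0; first by field.
by rewrite (_ : series _ = fun=> 0); [exact: cvg_cst | apply/funext => n; rewrite /series /= big1].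
Qed.

Lemma asum_diff3_id (c : R) : asum_diff3 (fun n => n%:R * c).
Proof.
apply: (@asum_le _ _ (fun k => (k.+1%:R ^+ 2)^-1)) => [k|]; last exact: asum_cvg (@asum_invX R 0).
by rewrite /diff3 (_ : _ - _ = 0) ?normr0 ?invr_ge0 ?exprn_ge0 //; rewrite -!natr1; ring.
Qed.

Lemma asum_diff3_asum (g : nat -> R) : asum (fun k => g k.+1) -> asum_diff3 g.
Proof.
move=> s1; have s2 := tsumS s1; have s3 := tsumS s2; have s4 := tsumS s3.
rewrite /asum_diff3 /diff3.
by apply: asumB => //; apply: asumD; [apply: asumB => //; exact: asumZ|exact: asumZ].
Qed.

(** The sum equals [ln (x t bose (x t)) - ln x + x t], and [x t bose (x t)] tends to 1. *)
Lemma cvg_ell_ln (x : R) : 0 < x -> ell (x * t) + ln t @[t --> 0^'+] --> - ln x.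
Proof.
move=> x0.
have c1 : x * t * bose (x * t) @[t --> 0^'+] --> (1 : R).
  apply: (@cvg_trans _ ((fun y => y * bose y) @ (0 : R)^'+)); last exact: cvg_xbose.
  move=> A [e /= e0 eA]; exists (e / x); first by rewrite /= divr_gt0.
  move=> y /= ye y0; apply: eA => /=; last by rewrite mulr_gt0.
  by move: ye; rewrite !sub0r !normrN normrM (gtr0_norm x0) ltr_pdivlMr // mulrC.
have c2 : expR (- (x * t)) @[t --> (0 : R)^'+] --> (1 : R).
  have -> : (1 : R) = expR (- (x * 0)) by rewrite mulr0 oppr0 expR0.
  apply: continuous_cvg; first exact: continuous_expR.
  by apply: cvgN; apply: cvgM; [exact: cvg_cst|exact: cvg_id0].
have c3 : ln (x * t * bose (x * t)) + - ln x + x * t @[t --> 0^'+] --> ln 1 + - ln x + x * 0.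
  apply: cvgD; last by apply: cvgM; [exact: cvg_cst|exact: cvg_id0].
  apply: cvgD; last exact: cvg_cst.
  by apply: (continuous_cvg _ _ c1); apply: continuous_ln.
rewrite ln1 add0r mulr0 addr0 in c3.
apply: cvg_trans c3; apply: near_eq_cvg; near=> t.
have t0 : 0 < t by near: t; exact: nbhs_right_gt.
have xt : 0 < x * t by rewrite mulr_gt0.
have b0 := bose_gt0 xt; have e0 := expR_sub1_gt0 xt.
rewrite lnM ?posrE // lnM ?posrE // /ell.
have -> : 1 - expR (- (x * t)) = (bose (x * t) * expR (x * t))^-1.
  rewrite /bose expRN; have X0 := expR_gt0 (x * t).
  field; rewrite !gt_eqF //.
rewrite lnV ?posrE ?mulr_gt0 ?expR_gt0 // lnM ?posrE ?expR_gt0 // expRK; ring.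
Unshelve. all: end_near. Qed.

(** Adding [ln t] to every term makes the terms converge; the Euler sum of a constant is half of it,
    which produces [ln t / 2]. The third derivative in [x] is at most [14 / x ^ 3], uniformly in
    [t], by [bose2_le]. *)
Lemma cvg_reg0 : regsum (fun n => n%:R ^+ 0 * ell (n%:R * t)) + ln t / 2
   @[t --> 0^'+] --> regsum (fun n => - ln n%:R : R).
Proof.
have [||| _] := @regsum_cvg R R (0^'+) _ (fun t x => ell (x * t) + ln t)
  (fun t x => - bose (x * t) * t) (fun t x => bose1 (x * t) * t ^+ 2)
  (fun t x => - bose2 (x * t) * t ^+ 3) (fun n => - ln n%:R) 3%:R 14 _.
- by rewrite ltr1n.
- near=> t => x x1; have t0 : 0 < t by near: t; exact: nbhs_right_gt.
  have x0 : 0 < x by lra.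
  have xt : 0 < x * t by rewrite mulr_gt0.
  split.
  + by rewrite -[X in is_derive _ _ _ X]addr0; apply: dvD (dv_cst _ _); exact/dv_scale/dv_ell.
  + have h := dv_scale (dv_bose xt).
    apply: dvE (dvMr t (dvN h)) _; ring.
  + have h := dv_scale (dv_bose1 xt).
    apply: dvE (dvMr (t ^+ 2) h) _; ring.
  rewrite mulNr normrN powR_invn; last exact: ltW.
  have b := bose2_gt0 xt.
  rewrite ger0_norm; last by rewrite ltW // mulr_gt0 // exprn_gt0.
  rewrite ler_pdivlMr ?exprn_gt0 // -mulrA -exprMn mulrC (mulrC t).
  exact: bose2_le.
- by move=> n n0; apply: cvg_ell_ln; rewrite ltr0n.
apply: cvg_trans; apply: near_eq_cvg; near=> t.
have t0 : 0 < t by near: t; exact: nbhs_right_gt.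
rewrite -(regsum_cst (ln t)) -regsumD; last exact: asum_diff3_cst.
  by congr regsum; apply/funext => n; rewrite mul1r.
by apply: asum_diff3_asum; exact: (asum_ell (i := 0) t0).
Unshelve. all: end_near. Qed.

(** As before with the correction [n ln t], and 1/4 is the Euler sum of [n]. The constant 23 is 3 *
    3 + 14, from [bose1_le] and [bose2_le]. *)
Lemma cvg_reg1 : regsum (fun n => n%:R ^+ 1 * ell (n%:R * t)) + ln t / 4
   @[t --> 0^'+] --> regsum (fun n => - (n%:R * ln n%:R) : R).
Proof.
have [||| _] := @regsum_cvg R R (0^'+) _ (fun t x => x * ell (x * t) + x * ln t)
  (fun t x => (ell (x * t) - x * t * bose (x * t)) + ln t)
  (fun t x => x * t ^+ 2 * bose1 (x * t) - 2 * t * bose (x * t))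
  (fun t x => 3 * t ^+ 2 * bose1 (x * t) - x * t ^+ 3 * bose2 (x * t))
  (fun n => - (n%:R * ln n%:R)) 2%:R 23 _.
- by rewrite ltr1n.
- near=> t => x x1; have t0 : 0 < t by near: t; exact: nbhs_right_gt.
  have x0 : 0 < x by lra.
  have xt : 0 < x * t by rewrite mulr_gt0.
  have d0 := dv_scale (dv_ell xt); have d1 := dv_scale (dv_bose xt).
  have d2 := dv_scale (dv_bose1 xt).
  split.
  + apply: dvE (dvD (dvM (dv_id x) d0) (dvMr (ln t) (dv_id x))) _; ring.
  + apply: dvE (dvD (dvB d0 (dvM (dvMr t (dv_id x)) d1)) (dv_cst (ln t) x)) _; ring.
  + apply: dvE (dvB (dvM (dvMr (t ^+ 2) (dv_id x)) d2) (dvZ (2 * t) d1)) _; ring.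
  have b1 := bose1_gt0 xt; have b2 := bose2_gt0 xt.
  rewrite powR_invn; last exact: ltW.
  rewrite ler_pdivlMr ?exprn_gt0 // -[X in _ * X]gtr0_norm ?exprn_gt0 // -normrM.
  have -> : (3 * t ^+ 2 * bose1 (x * t) - x * t ^+ 3 * bose2 (x * t)) * x ^+ 2 =
    3 * ((x * t) ^+ 2 * bose1 (x * t)) - (x * t) ^+ 3 * bose2 (x * t) by ring.
  have h1 := bose1_le xt; have h2 := bose2_le xt.
  have p1 : 0 < (x * t) ^+ 2 * bose1 (x * t) by rewrite mulr_gt0 // exprn_gt0.
  have p2 : 0 < (x * t) ^+ 3 * bose2 (x * t) by rewrite mulr_gt0 // exprn_gt0.
  rewrite ler_norml; lra.
- move=> n n0; under eq_fun do rewrite -mulrDr.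
  rewrite -mulrN; apply: cvgM; first exact: cvg_cst.
  by apply: cvg_ell_ln; rewrite ltr0n.
apply: cvg_trans; apply: near_eq_cvg; near=> t.
have t0 : 0 < t by near: t; exact: nbhs_right_gt.
rewrite -(regsum_id (ln t)) -regsumD; last exact: asum_diff3_id.
  by congr regsum; apply/funext => n; rewrite expr1.
by apply: asum_diff3_asum; exact: (asum_ell (i := 1) t0).
Unshelve. all: end_near. Qed.

(** [rho0] and [rho1] are the values at 0 and -1 of the derivative of eta(s), the Euler sum of n ^
    (- s). *)
Definition rho0 : R := regsum (fun n => - ln n%:R).
Definition rho1 : R := regsum (fun n => - (n%:R * ln n%:R)).

(** In the combination u(t) - 2 u(2t) the term [zsum 2 / t] cancels, and [ln t / 2] leaves exactly
    the [ln t / 2] of [cvg_reg0] plus [ln 2]. *)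
Lemma Lsum0_asymp : Lsum 0 t - zsum 2 / t - ln t / 2 @[t --> 0^'+] -->
  - (rho0 + ln 2).
Proof.
have -> : - (rho0 + ln 2) = (rho0 + ln 2) / (1 - 2 ^+ 1).
  rewrite (_ : 1 - 2 ^+ 1 = -1 :> R); last by ring.
  by rewrite invrN1 mulrN1.
apply: (@iter_half (fun t => Lsum 0 t - zsum 2 / t - ln t / 2) 1) => //.
  apply: (cvgr_eq (cvgD cvg_reg0 (cvg_cst (ln (2 : R))))) => //; near=> t.
  have t0 : 0 < t by near: t; exact: nbhs_right_gt.
  rewrite /= -Lsum_alternating // lnM ?posrE // expr1.
  move: (Lsum 0 t) (Lsum 0 (2 * t)) (zsum 2) (ln t) (ln 2) => a b c d e.
  by field; rewrite gt_eqF.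
apply: (cvgr_eq (cvgB (cvgB (@cvg_tLsum0 R) (cvg_cst (zsum 2))) (cvgM cvg_tln (cvg_cst (2^-1 : R))))).
  by rewrite subrr mul0r subrr.
near=> t.
have t0 : 0 < t by near: t; exact: nbhs_right_gt.
rewrite !fctE /= expr1; move: (Lsum 0 t) (zsum 2) (ln t) => a b c.
by field; rewrite gt_eqF.
Unshelve. all: end_near. Qed.

(** The coefficient 1/12 solves x - 4 x = -1/4, the divergence left by [cvg_reg1]. By
    [zeta_derive_N1] below, the limit is zeta'(-1). *)
Lemma Lsum1_asymp : Lsum 1 t - zsum 3 / t ^+ 2 - ln t / 12 @[t --> 0^'+] -->
  - (rho1 + ln 2 / 3) / 3.
Proof.
have -> : - (rho1 + ln 2 / 3) / 3 = (rho1 + ln 2 / 3) / (1 - 2 ^+ 2).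
  rewrite (_ : 1 - 2 ^+ 2 = -3 :> R); last by ring.
  by move: rho1 (ln 2) => a b; field.
apply: (@iter_half (fun t => Lsum 1 t - zsum 3 / t ^+ 2 - ln t / 12) 2) => //.
  apply: (cvgr_eq (cvgD cvg_reg1 (cvg_cst (ln (2 : R) / 3)))) => //; near=> t.
  have t0 : 0 < t by near: t; exact: nbhs_right_gt.
  rewrite /= -Lsum_alternating // lnM ?posrE //.
  move: (Lsum 1 t) (Lsum 1 (2 * t)) (zsum 3) (ln t) (ln 2) => a b c d e.
  by field; rewrite gt_eqF.
apply: (cvgr_eq (cvgB (cvgB (@cvg_tLsum1 R) (cvg_cst (zsum 3)))
  (cvgM (cvgM cvg_tln cvg_id0) (cvg_cst (12^-1 : R))))).
  by rewrite subrr !mul0r subrr.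
near=> t.
have t0 : 0 < t by near: t; exact: nbhs_right_gt.
rewrite !fctE /=; move: (Lsum 1 t) (zsum 3) (ln t) => a b c.
by field; rewrite gt_eqF.
Unshelve. all: end_near. Qed.

End Alternating.

(** * Partial fractions of coth *)

Section MittagLeffler.
Context {R : realType}.
Implicit Types (x y z t v : R).

(* The real part of coth ((y + i v) / 2). *)
Definition recoth y v : R := (expR y - expR (- y)) / (expR y + expR (- y) - 2 * cos v).

Lemma expRpN_gt2 y : 0 < y -> 2 < expR y + expR (- y).
Proof.
move=> y0; have a1 : 1 < expR y by rewrite expR_gt1.
have e1 := expRxMexpNx_1 y; move: (expR y) (expR (- y)) a1 e1 => a b a1 e1.
have h : 0 < (a + b - 2) * a.
  have -> : (a + b - 2) * a = (a - 1) ^+ 2 + (a * b - 1) by ring.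
  by rewrite e1 subrr addr0 exprn_gt0 // subr_gt0.
by rewrite -subr_gt0; move: h; rewrite pmulr_lgt0 //; lra.
Qed.

Lemma recoth_den_gt0 y v : 0 < y -> 0 < expR y + expR (- y) - 2 * cos v.
Proof. by move=> /expRpN_gt2; have := cos_le1 v; lra. Qed.

(** The real part of coth(2z) = (coth z + tanh z) / 2, where the tanh is written as a coth at the
    reflected angle, so that all angles stay in [0, pi]. *)
Lemma recoth_dup y v : 0 < y ->
  recoth (2 * y) (2 * v) = (recoth y v + recoth y (pi - v)) / 2.
Proof.
move=> y0; have d1 := recoth_den_gt0 v y0; have d2 := recoth_den_gt0 (pi - v) y0.
have d3 := @recoth_den_gt0 (2 * y) (2 * v) _.
have {}d3 := d3 (mulr_gt0 (ltr0Sn _ _) y0).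
move: d1 d2 d3; rewrite /recoth.
have -> : cos (pi - v) = - cos v by rewrite addrC cosDpi cosN.
have -> : cos (2 * v) = 2 * cos v ^+ 2 - 1 by rewrite mulr_natl cos_mulr2n mulr_natl.
have -> : - (2 * y) = - y + - y by ring.
have -> : 2 * y = y + y by ring.
rewrite !expRD; have e1 := expRxMexpNx_1 y.
have ep := expR_gt0 y; have en := expR_gt0 (- y).
move: (expR y) (expR (- y)) (cos v) e1 ep en => a b c e1 ep en d1 d2 d3.
have E : a * a + b * b - 2 * (2 * c ^+ 2 - 1) = (a + b - 2 * c) * (a + b - 2 * - c).
  have : a * a + b * b - 2 * (2 * c ^+ 2 - 1) = (a + b) ^+ 2 - 4 * c ^+ 2 + 2 * (1 - a * b) by ring.
  by rewrite e1 subrr mulr0 addr0 => ->; ring.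
by rewrite E; field; rewrite !gt_eqF.
Qed.

Lemma recoth0 y : 0 < y -> recoth y 0 = 1 + 2 * bose y.
Proof.
move=> y0; rewrite /recoth /bose cos0 mulr1; have d := expRpN_gt2 y0.
have e0 := expR_sub1_gt0 y0; have ep := expR_gt0 y.
move: d; rewrite expRN; move: (expR y) e0 ep => a e0 ep d.
have -> : a + a^-1 - 2 = (a - 1) ^+ 2 / a by field; rewrite gt_eqF.
by field; rewrite !gt_eqF.
Qed.

Definition trap M (g : nat -> R) : R := \sum_(0 <= k < M) (g k + g k.+1).

Lemma trap_double M g : trap (2 * M) g = trap M g + trap M (fun k => g (2 * M - k)%N).
Proof.
rewrite /trap (big_cat_nat (n := M)) //=; last by rewrite leq_pmull.
congr (_ + _); rewrite big_nat_rev /= (_ : (2 * M)%N = (M + M)%N); last by rewrite mul2n addnn.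
rewrite -{1}[M]add0n big_addn addnK [RHS]big_nat_cond [LHS]big_nat_cond.
apply: eq_bigr => k; rewrite andbT => /andP[_ kM].
rewrite addrC; congr (_ + _); congr g; lia.
Qed.

Lemma trapE M g : trap M g = g 0%N - g M + 2 * \sum_(0 <= k < M) g k.+1.
Proof.
elim: M => [|M IH]; rewrite /trap.
  by rewrite !big_nil mulr0 addr0 subrr.
by rewrite !(big_nat_recr _ _ _ (leq0n _)) //= -/(trap M g) IH; ring.
Qed.

(** After [n] duplications the samples are the [2 ^ n + 1] equidistant angles in [0, pi], the two
    ends with half weight. [trap] is twice the trapezoidal sum, hence the division by [2 ^ n.+1]. *)
Lemma recoth_trap n y : 0 < y -> recoth y 0 =
  trap (2 ^ n) (fun k => recoth (y / 2 ^+ n.+1) (pi * k%:R / 2 ^+ n)) / 2 ^+ n.+1.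
Proof.
move=> y0; elim: n => [|n IH].
  rewrite /trap expn0 big_nat1 expr0 !divr1 mulr0 mulr1 expr1.
  have y2 : 0 < y / 2 by lra.
  have := recoth_dup 0 y2; rewrite mulr0 subr0 => <-.
  by congr recoth; field.
have half (a b : R) : a = b / 2 -> a / 2 ^+ n.+1 = b / 2 ^+ n.+2.
  by move=> ->; rewrite [in RHS]exprS invfM mulrA.
rewrite IH expnS trap_double; apply: half.
rewrite /trap -big_split /= mulr_suml; apply: eq_big_nat => k /andP[_ kn].
have p2 (m : nat) : 2 ^+ m != 0 :> R by rewrite expf_neq0.
have yn : 0 < y / 2 ^+ n.+2 by rewrite divr_gt0 // exprn_gt0.
have e i : recoth (y / 2 ^+ n.+1) (pi * i%:R / 2 ^+ n) =
  (recoth (y / 2 ^+ n.+2) (pi * i%:R / 2 ^+ n.+1)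
   + recoth (y / 2 ^+ n.+2) (pi - pi * i%:R / 2 ^+ n.+1)) / 2.
  rewrite -recoth_dup //; congr recoth; rewrite !exprS; by field; rewrite p2.
have e' : forall i, (i <= 2 ^ n)%N -> recoth (y / 2 ^+ n.+2) (pi * (2 * 2 ^ n - i)%:R / 2 ^+ n.+1) =
    recoth (y / 2 ^+ n.+2) (pi - pi * i%:R / 2 ^+ n.+1).
  move=> i jn; rewrite natrB; last by rewrite (leq_trans jn) // leq_pmull.
  by congr recoth; rewrite natrM natrX !exprS; field; rewrite p2.
rewrite !e !e' //; last exact: ltnW.
by rewrite -mulrDl addrACA.
Qed.

(** From x cos x <= sin x at x = z / 2 one gets sin z >= z cos(z / 2) ^ 2, and 2 cos(z / 2) ^ 2 = 1
    + cos z >= 1. This keeps the sampled denominators away from 0. *)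
Lemma sin_ge_half z : 0 <= z <= pi / 2 -> z / 2 <= sin z.
Proof.
move=> /andP[z0 zp].
have h : 0 * (z / 2 - 0) <= (sin (z / 2) - z / 2 * cos (z / 2)) - (sin 0 - 0 * cos 0).
  apply: (@mean_value_lb R (fun x => sin x - x * cos x) (fun x => x * sin x)).
  - by lra.
  - move=> x _; apply: dvE (dvB (is_derive_sin x) (dvM (dv_id x) (is_derive_cos x))) _; ring.
  move=> x /andP[x0 xz]; rewrite mulr_ge0 // sin_ge0_pi // x0 /=; lra.
have {}h : z / 2 * cos (z / 2) <= sin (z / 2).
  by move: h; rewrite sin0 !mul0r !subr0 subr_ge0.
have c0 : 0 <= cos z by apply: cos_ge0_pihalf; have := @pi_gt0 R; lra.
have c2 : 0 <= cos (z / 2) by apply: cos_ge0_pihalf; have := @pi_gt0 R; lra.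
have s2 : sin z = 2 * (cos (z / 2) * sin (z / 2)).
  by rewrite mulr_natl -sin_mulr2n; congr sin; rewrite -mulr_natl; field.
have cz : cos z = 2 * cos (z / 2) ^+ 2 - 1.
  by rewrite mulr_natl -cos_mulr2n; congr cos; rewrite -mulr_natl; field.
rewrite s2; apply: le_trans (ler_wpM2l _ (ler_wpM2l c2 h)) => //.
have -> : 2 * (cos (z / 2) * (z / 2 * cos (z / 2))) = z / 2 * (2 * cos (z / 2) ^+ 2) by ring.
rewrite -{1}[z / 2]mulr1 ler_wpM2l //; lra.
Qed.

Lemma sinh_le x : 0 <= x -> expR x - expR (- x) <= 2 * x * expR x.
Proof.
move=> x0; have h : (expR x - expR (- x)) - (expR 0 - expR (- 0)) <= (2 * expR x) * (x - 0).
  apply: (@mean_value_ub R (fun x => expR x - expR (- x)) (fun x => expR x + expR (- x))) => //.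
    move=> y _; apply: dvE (dvB (is_derive_expR y) (dv_exp (dvN (dv_id y)))) _; ring.
  move=> y /andP[y0 yx]; have h1 : expR y <= expR x by rewrite ler_expR.
  have h2 : expR (- y) <= expR x by rewrite ler_expR; lra.
  lra.
move: h; rewrite oppr0 subrr !subr0; lra.
Qed.

Lemma cvg_dq (f : R -> R) (d : R) : is_derive (0 : R) (1 : R) f d -> f 0 = 0 ->
  f x / x @[x --> 0^'+] --> d.
Proof.
move=> h f0; have [dr dE] := h.
have : (fun x => x^-1 *: ((f \o shift 0) (x *: 1) - f 0)) @ 0^' --> d.
  by rewrite -dE; exact: dr.
move=> /cvgrPdist_le H; apply/cvgrPdist_le => e e0.
have [r /= r0 rP] := H e e0; exists r => //= x xr x0.
have := rP x xr; rewrite gt_eqF // => /(_ isT).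
by rewrite f0 /= addr0 subr0 /GRing.scale /= mulr1 mulrC.
Qed.

Lemma cvg_sinh : (expR x - expR (- x)) / x @[x --> 0^'+] --> (2 : R).
Proof.
apply: (@cvg_dq (fun x => expR x - expR (- x))); last by rewrite oppr0 subrr.
apply: dvE (dvB (is_derive_expR 0) (dv_exp (dvN (dv_id 0)))) _.
by rewrite oppr0 expR0; ring.
Qed.

Lemma cvg_sin_dq : sin x / x @[x --> 0^'+] --> (1 : R).
Proof.
apply: cvg_dq; last by rewrite sin0.
by apply: dvE (is_derive_sin 0) _; rewrite cos0.
Qed.

Lemma cvg_scale_at0 (g : R -> R) (c a : R) : 0 < a -> g x @[x --> 0^'+] --> c ->
  g (a * x) @[x --> 0^'+] --> c.
Proof.
move=> a0 gc A /gc [e /= e0 eA]; exists (e / a); first by rewrite /= divr_gt0.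
move=> y /= ye y0; apply: eA => /=; last by rewrite mulr_gt0.
by move: ye; rewrite !sub0r !normrN normrM (gtr0_norm a0) ltr_pdivlMr // mulrC.
Qed.

Lemma recoth_denE y v : expR y + expR (- y) - 2 * cos v =
  (expR (y / 2) - expR (- (y / 2))) ^+ 2 + 4 * sin (v / 2) ^+ 2.
Proof.
have -> : cos v = 1 - 2 * sin (v / 2) ^+ 2.
  rewrite sin2cos2 (_ : cos v = cos ((v / 2) *+ 2)); last by rewrite -mulr_natl; congr cos; field.
  by rewrite cos_mulr2n -mulr_natl; ring.
have -> : y = y / 2 + y / 2 by field.
have -> : - (y / 2 + y / 2) = - (y / 2) + - (y / 2) by ring.
rewrite !expRD (_ : (y / 2 + y / 2) / 2 = y / 2); last by field.
have := expRxMexpNx_1 (y / 2); move: (expR (y / 2)) (expR (- (y / 2))) => a b e.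
have -> : (a - b) ^+ 2 = a * a + b * b - 2 * (a * b) by ring.
by rewrite e; ring.
Qed.

Lemma cvgr_sqr (T : Type) (F : set_system T) {FF : Filter F} (f : T -> R) (a : R) :
  f x @[x --> F] --> a -> f x ^+ 2 @[x --> F] --> a ^+ 2.
Proof.
move=> fa; have h := @exprn_continuous R 2 a.
exact: (@cvg_comp _ _ _ f (fun x => x^+2) F (nbhs a) (nbhs (a ^+ 2)) fa h).
Qed.

(** The simple pole of coth at 0: the limit is the real part of 2 / (y + i v). *)
Lemma cvg_recoth y v : 0 < y -> 0 <= v ->
  e * recoth (e * y) (e * v) @[e --> 0^'+] --> 2 * y / (y ^+ 2 + v ^+ 2).
Proof.
move=> y0 v0; have y20 : 0 < y / 2 by lra.
have s1 : (expR (y * e) - expR (- (y * e))) / (y * e) @[e --> 0^'+] --> (2 : R).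
  exact: cvg_scale_at0 cvg_sinh.
have s2 : (expR (y / 2 * e) - expR (- (y / 2 * e))) / (y / 2 * e) @[e --> 0^'+] --> (2 : R).
  exact: (cvg_scale_at0 (g := fun x => (expR x - expR (- x)) / x)) cvg_sinh.
have s3 : sin (v / 2 * e) / e @[e --> 0^'+] --> v / 2.
  have [v1|v1] := ltP 0 v; last first.
    have -> : v = 0 by apply/eqP; rewrite eq_le v0 v1.
    rewrite mul0r; apply: (cvgr_eq (f := fun=> 0)) => //; first exact: cvg_cst.
    by near=> e; rewrite mul0r sin0 mul0r.
  have v20 : 0 < v / 2 by lra.
  have H : v / 2 * (sin (v / 2 * e) / (v / 2 * e)) @[e --> 0^'+] --> v / 2 * 1.
    by apply: cvgM; [exact: cvg_cst|exact: (cvg_scale_at0 v20 cvg_sin_dq)].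
  apply: (cvgr_eq H); first by rewrite mulr1.
  near=> e; have e0 : 0 < e by near: e; exact: nbhs_right_gt.
  by field; rewrite !gt_eqF.
have den0 : y ^+ 2 + v ^+ 2 != 0.
  by rewrite gt_eqF // ltr_pwDl ?exprn_gt0 ?exprn_ge0.
have H2 : ((y / 2) * ((expR (y / 2 * e) - expR (- (y / 2 * e))) / (y / 2 * e))) ^+ 2
    + 4 * (sin (v / 2 * e) / e) ^+ 2 @[e --> 0^'+] --> (y / 2 * 2) ^+ 2 + 4 * (v / 2) ^+ 2.
  apply: cvgD.
    by apply: cvgr_sqr; apply: cvgM s2; exact: cvg_cst.
  apply: cvgM; first exact: cvg_cst.
  exact: cvgr_sqr.
have E2 : (y / 2 * 2) ^+ 2 + 4 * (v / 2) ^+ 2 = y ^+ 2 + v ^+ 2 by field.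
rewrite E2 in H2.
have H3 : y * ((expR (y * e) - expR (- (y * e))) / (y * e)) *
   (((y / 2) * ((expR (y / 2 * e) - expR (- (y / 2 * e))) / (y / 2 * e))) ^+ 2
    + 4 * (sin (v / 2 * e) / e) ^+ 2)^-1 @[e --> 0^'+] --> y * 2 * (y ^+ 2 + v ^+ 2)^-1.
  apply: cvgM; last exact: cvgV.
  by apply: cvgM => //; exact: cvg_cst.
apply: (cvgr_eq H3); first by rewrite (mulrC y).
near=> e; have e0 : 0 < e by near: e; exact: nbhs_right_gt.
have ey : 0 < e * y by rewrite mulr_gt0.
rewrite /recoth.
have D0 := recoth_den_gt0 (e * v) ey; move: D0; rewrite recoth_denE.
have -> : e * y / 2 = y / 2 * e by ring.
have -> : e * v / 2 = v / 2 * e by ring.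
rewrite (mulrC e y).
move: (expR (y / 2 * e) - _) (sin _) (expR (y * e) - _) => a b c D0.
have -> : (y / 2 * (a / (y / 2 * e))) ^+ 2 + 4 * (b / e) ^+ 2 = (a ^+ 2 + 4 * b ^+ 2) / e ^+ 2.
  by field; rewrite !gt_eqF.
move: (a ^+ 2 + 4 * b ^+ 2) D0 => D D0.
by field; rewrite !gt_eqF.
Unshelve. all: end_near. Qed.

Lemma cvg_halfpow : ((2 : R) ^+ n.+1)^-1 @[n --> \oo] --> 0^'+.
Proof.
have h : ((2 : R) ^+ n.+1)^-1 @[n --> \oo] --> (0 : R).
  have := @cvg_geometric R 2^-1 2^-1.
  rewrite gtr0_norm ?invr_gt0 // invf_lt1 // ltr1n => /(_ isT) => H.
  apply: (cvgr_eq H) => //; near=> n; rewrite /geometric /=.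
  by rewrite exprS invfM exprVn.
move=> A [e /= e0 eA]; move/cvgrPdist_lt : h => /(_ e e0) [N _ NP].
exists N => // n Nn; apply: eA => /=; last by rewrite invr_gt0 exprn_gt0.
exact: NP.
Unshelve. all: end_near. Qed.

Definition cothterm y k : R := 2 * y / (y ^+ 2 + (2 * pi * k.+1%:R) ^+ 2).

(* Partial fractions of coth, by halving the argument and passing to the limit
   in the resulting trapezoidal sums. *)
Lemma bose_partial_fractions y : 0 < y ->
  asum (cothterm y) /\ bose y + 1 / 2 = 1 / y + tsum (cothterm y).
Proof.
move=> y0.
pose eps n : R := (2 ^+ n.+1)^-1.
have eps0 n : 0 < eps n by rewrite invr_gt0 exprn_gt0.
have eps1 n : eps n <= 1 by rewrite invf_le1 ?exprn_gt0 // exprn_ege1 // ler1n.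
(* The trapezoidal sum is extended by 0 to a series, ready for [tannery]. The half angles [z] of all
   samples lie in [0, pi / 2], so [sin_ge_half] gives a dominating multiple of [k ^ -2]. *)
pose u n k := if (k < 2 ^ n)%N then eps n * recoth (eps n * y) (eps n * (2 * pi * k.+1%:R)) else 0.
have [|||s1 s2] := @tannery R nat \oo _ u (cothterm y)
    (fun k => 2 * y * expR y / pi ^+ 2 * (k.+1%:R ^+ 2)^-1).
- near=> n => k; rewrite /u; case: ifPn => kn; last first.
    rewrite normr0 mulr_ge0 // ?invr_ge0 ?exprn_ge0 //.
    by rewrite !mulr_ge0 ?invr_ge0 ?exprn_ge0 ?pi_ge0 ?expR_ge0 // ltW.
  have ey : 0 < eps n * y by rewrite mulr_gt0.
  set z := eps n * (2 * pi * k.+1%:R) / 2.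
  have zE : z = eps n * (pi * k.+1%:R) by rewrite /z; field.
  have z0 : 0 < z by rewrite zE !mulr_gt0 ?pi_gt0 // ltr0n.
  have zp : z <= pi / 2.
    rewrite zE /eps mulrC ler_pdivrMr ?exprn_gt0 // exprS.
    have -> : pi / 2 * (2 * 2 ^+ n) = pi * 2 ^+ n :> R by field.
    by rewrite ler_pM2l ?pi_gt0 // -natrX ler_nat.
  have sz : z / 2 <= sin z by apply: sin_ge_half; rewrite (ltW z0) zp.
  have D0 := recoth_den_gt0 (eps n * (2 * pi * k.+1%:R)) ey.
  have num0 : 0 <= expR (eps n * y) - expR (- (eps n * y)).
    by rewrite subr_ge0 ler_expR; lra.
  rewrite ger0_norm; last by rewrite mulr_ge0 ?divr_ge0 // ltW.
  rewrite /recoth mulrA ler_pdivrMr // recoth_denE -/z.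
  have n1 : expR (eps n * y) - expR (- (eps n * y)) <= 2 * (eps n * y) * expR y.
    apply: le_trans (sinh_le (ltW ey)) _.
    have h : expR (eps n * y) <= expR y.
      by rewrite ler_expR -[leRHS]mul1r ler_pM2r.
    by rewrite ler_wpM2l // mulr_ge0 // ltW.
  apply: le_trans (ler_wpM2l (ltW (eps0 n)) n1) _.
  have C0 : 0 <= 2 * y * expR y / pi ^+ 2 / k.+1%:R ^+ 2.
    by rewrite !mulr_ge0 ?invr_ge0 ?exprn_ge0 ?pi_ge0 ?expR_ge0 // ltW.
  apply: (@le_trans _ _ (2 * y * expR y / pi ^+ 2 / k.+1%:R ^+ 2 * (4 * (z / 2) ^+ 2))).
    have gen (p e' X k' : R) : p != 0 -> k' != 0 -> e' * (2 * (e' * y) * X) =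
        2 * y * X / p ^+ 2 / k' ^+ 2 * (4 * (e' * (p * k') / 2) ^+ 2).
      by move=> p0 k0; field; rewrite p0 k0.
    by rewrite zE; apply/eq_leR/gen; rewrite gt_eqF ?pi_gt0.
  rewrite ler_wpM2l // ler_wpDl ?sqr_ge0 // ler_pM2l // lerXn2r // nnegrE; lra.
- move=> k; rewrite /cothterm.
  have w0 : 0 <= 2 * pi * k.+1%:R :> R by rewrite !mulr_ge0 ?pi_ge0.
  have H := cvg_comp _ _ cvg_halfpow (cvg_recoth y0 w0).
  apply: (cvgr_eq H) => //; near=> n.
  rewrite /u ifT //; apply: (@leq_trans n); last exact/ltnW/ltn_expl.
  by near: n; exact: nbhs_infty_gt.
- exact/asum_cvg/asumZ/(@asum_invX R 0).
split => //.
have tE n : recoth y 0 = eps n * recoth (eps n * y) (eps n * 0) -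
    eps n * recoth (eps n * y) pi + 2 * tsum (u n).
  rewrite {1}(recoth_trap n y0) trapE mulrC mulrDr mulrBr -/(eps n).
  have -> : y / 2 ^+ n.+1 = eps n * y by rewrite mulrC.
  rewrite mulr0 mul0r mulr0 natrX mulfK ?expf_neq0 //.
  congr (_ + _); rewrite mulrCA; congr (_ * _).
  have -> : tsum (u n) = \sum_(0 <= k < 2 ^ n) u n k.
    apply: tsumE; apply: cvg_near_cst.
    near=> N; rewrite /series /= (big_cat_nat (n := (2 ^ n)%N)) //=.
      rewrite [X in _ + X]big_nat_cond [X in _ + X]big1 ?addr0 // => k.
      by rewrite andbT => /andP[k1 _]; rewrite /u ltnNge k1.
    by near: N; exact: nbhs_infty_ge.
  rewrite mulr_sumr [RHS]big_nat_cond [LHS]big_nat_cond; apply: eq_bigr => k.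
  rewrite andbT => /andP[_ kn]; rewrite /u kn; congr (_ * recoth _ _).
  by rewrite /eps exprS; field; rewrite expf_neq0.
(* [trapE] counts the last sample in full, so it is subtracted once. It sits at angle pi, where
   [recoth] is at most 1, and vanishes with [eps]; the sample at angle 0 contributes the term 2 /
   y. *)
have L : eps n * recoth (eps n * y) (eps n * 0) -
    eps n * recoth (eps n * y) pi + 2 * tsum (u n) @[n --> \oo] -->
    2 * y / (y ^+ 2 + 0 ^+ 2) - 0 + 2 * tsum (cothterm y).
  apply: cvgD; last by apply: cvgM s2; exact: cvg_cst.
  apply: cvgB.
    exact: (cvg_comp _ _ cvg_halfpow (cvg_recoth y0 (lexx 0))).
  apply: (@squeeze_cvgr _ _ _ _ (fun=> 0) eps); [|exact: cvg_cst|].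
    near=> n; have ey : 0 < eps n * y by rewrite mulr_gt0.
    have D0 := recoth_den_gt0 pi ey.
    have num0 : 0 <= expR (eps n * y) - expR (- (eps n * y)).
      by rewrite subr_ge0 ler_expR; lra.
    rewrite mulr_ge0 ?divr_ge0 //=; [|exact: ltW|exact: ltW].
    rewrite ler_piMr //; first exact: ltW.
    rewrite /recoth ler_pdivrMr // mul1r cospi; have := expR_gt0 (- (eps n * y)); lra.
  move=> A /= A0; apply: cvg_halfpow; move: A0; apply: cvg_within.
have : recoth y 0 = 2 * y / (y ^+ 2 + 0 ^+ 2) - 0 + 2 * tsum (cothterm y).
  apply: (cvg_unique _ _ L) => //.
  by rewrite -(funext tE); exact: cvg_cst.
rewrite recoth0 //; have -> : 2 * y / (y ^+ 2 + 0 ^+ 2) = 2 * (1 / y).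
  by field; rewrite gt_eqF.
move: (tsum _) (bose y) => a b; lra.
Unshelve. all: end_near. Qed.

Lemma taylor2_le (f f1 f2 : R -> R) (x h d M : R) :
  (forall z, `|z - x| <= d -> [/\ is_derive z 1 f (f1 z), is_derive z 1 f1 (f2 z) & `|f2 z| <= M]) ->
  `|h| <= d -> `|f (x + h) - f x - h * f1 x| <= M * h ^+ 2.
Proof.
move=> H hd.
have f1l z : `|z - x| <= d -> `|f1 z - f1 x| <= M * `|z - x|.
  move=> zd; have [xz|/ltW zx] := leP x z.
    rewrite (ger0_norm (x := z - x)) ?subr_ge0 //.
    apply: (@mean_value_le R f1 f2) => // w /andP[w1 w2].
      by have [] := H w _; rewrite // ler_norml; move: zd; rewrite ler_norml; lra.
    by have [] := H w _; rewrite // ler_norml; move: zd; rewrite ler_norml; lra.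
  rewrite distrC (distrC z) (ger0_norm (x := x - z)) ?subr_ge0 //.
  apply: (@mean_value_le R f1 f2) => // w /andP[w1 w2].
    by have [] := H w _; rewrite // ler_norml; move: zd; rewrite ler_norml; lra.
  by have [] := H w _; rewrite // ler_norml; move: zd; rewrite ler_norml; lra.
have M0 : 0 <= M.
  have [|_ _] := H x; first by rewrite subrr normr0 (le_trans _ hd).
  exact: le_trans.
have dg w : `|w - x| <= d -> is_derive w 1 (fun z => f z - z * f1 x) (f1 w - 1 * f1 x).
  by move=> wd; have [h1 _ _] := H w wd; apply: dvB h1 (dvMr _ (dv_id w)).
have -> : f (x + h) - f x - h * f1 x = (f (x + h) - (x + h) * f1 x) - (f x - x * f1 x) by ring.
have -> : M * h ^+ 2 = M * `|h| * `|h| by rewrite -mulrA -expr2 real_normK ?num_real.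
have [h0|/ltW h0] := leP 0 h.
  have hE : `|h| = (x + h) - x by rewrite ger0_norm //; ring.
  rewrite {2}hE; apply: (@mean_value_le R (fun z => f z - z * f1 x) (fun w => f1 w - 1 * f1 x)).
  - by rewrite lerDl.
  - by move=> w /andP[w1 w2]; apply: dg; rewrite ler_norml; move: hd; rewrite ler_norml; lra.
  move=> w /andP[w1 w2]; rewrite mul1r.
  have wd : `|w - x| <= `|h| by rewrite ger0_norm ?subr_ge0 // ger0_norm //; lra.
  by apply: le_trans (f1l _ (le_trans wd hd)) _; rewrite ler_wpM2l.
have hE : `|h| = x - (x + h) by rewrite ler0_norm //; ring.
rewrite distrC {2}hE; apply: (@mean_value_le R (fun z => f z - z * f1 x) (fun w => f1 w - 1 * f1 x)).
- by rewrite gerDl.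
- by move=> w /andP[w1 w2]; apply: dg; rewrite ler_norml; move: hd; rewrite ler_norml; lra.
move=> w /andP[w1 w2]; rewrite mul1r.
have wd : `|w - x| <= `|h| by rewrite ler0_norm ?subr_le0 // ler0_norm //; lra.
by apply: le_trans (f1l _ (le_trans wd hd)) _; rewrite ler_wpM2l.
Qed.

Lemma is_derive_quadratic (f : R -> R) (x l d M : R) : 0 < d ->
  (forall h, `|h| <= d -> `|f (x + h) - f x - h * l| <= M * h ^+ 2) -> is_derive x 1 f l.
Proof.
move=> d0 H.
have M0 : 0 <= M.
  have := H d; rewrite gtr0_norm // => /(_ (lexx _)) => h.
  by have := le_trans (normr_ge0 _) h; rewrite pmulr_lge0 // exprn_gt0.
have C : (fun h => h^-1 *: ((f \o shift x) (h *: 1) - f x)) @ 0^' --> l.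
  apply/cvgrPdist_le => e e0.
  have r0 : 0 < Num.min d (e / (M + 1)) by rewrite lt_min d0 divr_gt0 //; lra.
  exists (Num.min d (e / (M + 1))) => // h; rewrite /ball_ /= sub0r normrN lt_min => /andP[hd he] hn.
  have := H h (ltW hd); rewrite /GRing.scale /= mulr1 (addrC h x) => Hh.
  have h0 : 0 < `|h| by rewrite normr_gt0.
  rewrite -(ler_pM2l h0) -normrM.
  have -> : h * (l - h^-1 * (f (x + h) - f x)) = - (f (x + h) - f x - h * l).
    by field.
  rewrite normrN; apply: le_trans Hh _.
  rewrite -real_normK ?num_real // expr2 mulrCA ler_pM2l //.
  apply: (@le_trans _ _ ((M + 1) * `|h|)); first by rewrite ler_wpM2r //; lra.
  by rewrite mulrC -ler_pdivlMr ?ltW //; lra.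
apply: DeriveDef; first by apply/cvg_ex; exists l.
exact: (cvg_lim (@Rhausdorff R) C).
Qed.

(** Dominated second derivatives make the termwise Taylor remainders add up to O(h ^ 2), and a
    quadratic remainder determines the derivative. *)
Lemma dv_tsum (u u1 u2 : nat -> R -> R) (M : nat -> R) (x d : R) : 0 < d ->
  (forall k z, `|z - x| <= d -> [/\ is_derive z 1 (u k) (u1 k z),
     is_derive z 1 (u1 k) (u2 k z) & `|u2 k z| <= M k]) ->
  cvgn (series M) -> (forall z, `|z - x| <= d -> asum (u ^~ z)) -> asum (u1 ^~ x) ->
  is_derive x 1 (fun z => tsum (u ^~ z)) (tsum (u1 ^~ x)).
Proof.
move=> d0 H sM su su1; apply: (@is_derive_quadratic _ _ _ d (tsum M)) => // h hd.
have M0 k : 0 <= M k.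
  have [|_ _] := H k x; first by rewrite subrr normr0 ltW.
  exact: le_trans.
have aM := asum_nneg M0 sM.
have xh : `|x + h - x| <= d by rewrite addrAC subrr add0r.
have s1 := su _ xh.
have s0 : asum (u ^~ x) by apply: su; rewrite subrr normr0 ltW.
rewrite -tsumB // -tsumZ // -tsumB; [|exact: asumB|exact: asumZ].
rewrite mulrC -tsumZ //.
have sT : asum (fun k => u k (x + h) - u k x - h * u1 k x).
  by apply: asumB; [exact: asumB|exact: asumZ].
apply: le_trans (ler_norm_tsum sT) _; apply: le_tsum => [| |k].
- exact: asum_norm.
- exact: asumZ.
have T := @taylor2_le (u k) (u1 k) (u2 k) x h d (M k) (H k) hd.
by apply: le_trans T _; exact: eq_leR (mulrC _ _).
Qed.

End MittagLeffler.

(** * Expansion of L_2 by summation over the poles of coth *)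

Section SecondSum.
Context {R : realType}.
Implicit Types (x y z t a : R).

Lemma dv_near_unique (f g : R -> R) (x a b : R) : is_derive x 1 f a -> is_derive x 1 g b ->
  (\forall z \near x, f z = g z) -> a = b.
Proof.
move=> [_ <-] [_ <-] fg; apply: near_eq_derive => //; exact: oner_neq0.
Qed.

(** The contribution of the conjugate poles [i a] and [- i a]; [cot1], [cot2], [cot3] are its
    successive derivatives in [y]. *)
Definition cot0 a y : R := 2 * y / (y ^+ 2 + a ^+ 2).
Definition cot1 a y : R := 2 * (a ^+ 2 - y ^+ 2) / (y ^+ 2 + a ^+ 2) ^+ 2.
Definition cot2 a y : R := 4 * y * (y ^+ 2 - 3 * a ^+ 2) / (y ^+ 2 + a ^+ 2) ^+ 3.
Definition cot3 a y : R := (12 * (y ^+ 2 - a ^+ 2) * (y ^+ 2 + a ^+ 2)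
   - 24 * y ^+ 2 * (y ^+ 2 - 3 * a ^+ 2)) / (y ^+ 2 + a ^+ 2) ^+ 4.

Lemma sqr_den_gt0 a y : 0 < a -> 0 < y ^+ 2 + a ^+ 2.
Proof. by move=> a0; rewrite ltr_pwDr ?sqr_ge0 // exprn_gt0. Qed.

Lemma dv_sqr_den a y : is_derive y 1 (fun y => y ^+ 2 + a ^+ 2) (2 * y).
Proof. by apply: dvE (dvD (dvX 2 (dv_id y)) (dv_cst _ y)) _; rewrite expr1; ring. Qed.

Lemma dv_cot0 a y : 0 < a -> is_derive y 1 (cot0 a) (cot1 a y).
Proof.
move=> a0; have D0 := sqr_den_gt0 y a0.
have h := dvV (f := fun y => y ^+ 2 + a ^+ 2) (lt0r_neq0 D0) (dv_sqr_den a y).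
apply: dvE (dvM (dvZ 2 (dv_id y)) h) _.
by rewrite /cot1; field; rewrite gt_eqF.
Qed.

Lemma dv_cot1 a y : 0 < a -> is_derive y 1 (cot1 a) (cot2 a y).
Proof.
move=> a0; have D0 := sqr_den_gt0 y a0.
have h := dvV (f := fun y => (y ^+ 2 + a ^+ 2) ^+ 2) (lt0r_neq0 (exprn_gt0 2 D0))
  (dvX 2 (dv_sqr_den a y)).
apply: dvE (dvM (dvZ 2 (dvB (dv_cst (a ^+ 2) y) (dvX 2 (dv_id y)))) h) _.
by rewrite /cot2 /= !expr1; field; rewrite gt_eqF.
Qed.

Lemma dv_cot2 a y : 0 < a -> is_derive y 1 (cot2 a) (cot3 a y).
Proof.
move=> a0; have D0 := sqr_den_gt0 y a0.
have h := dvV (f := fun y => (y ^+ 2 + a ^+ 2) ^+ 3) (lt0r_neq0 (exprn_gt0 3 D0))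
  (dvX 3 (dv_sqr_den a y)).
apply: dvE (dvM (dvM (dvZ 4 (dv_id y)) (dvB (dvX 2 (dv_id y)) (dv_cst (3 * a ^+ 2) y))) h) _.
by rewrite /cot3 /= !expr1; field; rewrite gt_eqF.
Qed.

Lemma norm_sub3_le a y : `|y ^+ 2 - 3 * a ^+ 2| <= 3 * (y ^+ 2 + a ^+ 2).
Proof. by rewrite ler_norml; have := sqr_ge0 y; have := sqr_ge0 a; lra. Qed.

Lemma cot1_le a y : 0 < a -> `|cot1 a y| <= 2 / a ^+ 2.
Proof.
move=> a0; have D0 := sqr_den_gt0 y a0; have a2 : 0 < a ^+ 2 by rewrite exprn_gt0.
have y2 := sqr_ge0 y; rewrite /cot1; move: (y ^+ 2) (a ^+ 2) a2 y2 D0 => Y A a2 y2 D0.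
rewrite normrM normrV ?unitfE ?gt_eqF ?exprn_gt0 // (gtr0_norm (exprn_gt0 2 D0)).
rewrite ler_pdivrMr ?exprn_gt0 // mulrAC ler_pdivlMr //.
have h : `|2 * (A - Y)| <= 2 * (Y + A) by rewrite ler_norml; lra.
apply: (@le_trans _ _ (2 * (Y + A) * A)); first by rewrite ler_wpM2r // ltW.
by rewrite expr2 mulrA ler_wpM2l //; [rewrite mulr_ge0 // ltW|rewrite lerDr].
Qed.

Lemma cot2_le a y : 0 < a -> `|cot2 a y| <= 12 * `|y| / (y ^+ 2 + a ^+ 2) ^+ 2.
Proof.
move=> a0; have D0 := sqr_den_gt0 y a0.
rewrite /cot2 normrM normrV ?unitfE ?gt_eqF ?exprn_gt0 // (gtr0_norm (exprn_gt0 3 D0)).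
rewrite normrM (normrM 4 y) gtr0_norm //; have h := norm_sub3_le a y.
apply: (@le_trans _ _ (4 * `|y| * (3 * (y ^+ 2 + a ^+ 2)) / (y ^+ 2 + a ^+ 2) ^+ 3)).
  by rewrite ler_wpM2r ?invr_ge0 ?exprn_ge0 ?ler_wpM2l ?mulr_ge0 //; exact: ltW.
by apply: eq_leR; field; rewrite gt_eqF.
Qed.

Lemma den2_ge a y : 0 < a -> a ^+ 2 <= y ^+ 2 + a ^+ 2.
Proof. by move=> _; rewrite lerDr sqr_ge0. Qed.

Lemma cot3_le a y : 0 < a -> `|cot3 a y| <= 84 / a ^+ 4.
Proof.
move=> a0; have D0 := sqr_den_gt0 y a0; have a2 : 0 < a ^+ 2 by rewrite exprn_gt0.
have y2 := sqr_ge0 y; rewrite /cot3 (_ : a ^+ 4 = (a ^+ 2) ^+ 2); last by rewrite -exprM.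
move: (y ^+ 2) (a ^+ 2) a2 y2 D0 => Y A a2 y2 D0.
rewrite normrM normrV ?unitfE ?gt_eqF ?exprn_gt0 // (gtr0_norm (exprn_gt0 4 D0)).
rewrite ler_pdivrMr ?exprn_gt0 // (_ : 84 / A ^+ 2 * (Y + A) ^+ 4 = 84 * (Y + A) ^+ 4 / A ^+ 2); last by ring.
rewrite ler_pdivlMr ?exprn_gt0 //.
have h : `|12 * (Y - A) * (Y + A) - 24 * Y * (Y - 3 * A)| <= 84 * (Y + A) ^+ 2.
  by rewrite ler_norml; apply/andP; split; nra.
apply: (@le_trans _ _ (84 * (Y + A) ^+ 2 * A ^+ 2)).
  by rewrite ler_wpM2r // exprn_ge0 // ltW.
have -> : 84 * (Y + A) ^+ 4 = 84 * (Y + A) ^+ 2 * (Y + A) ^+ 2 by ring.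
rewrite ler_wpM2l //; first by rewrite mulr_ge0 // sqr_ge0.
by rewrite lerXn2r ?nnegrE ?(ltW a2) ?(ltW D0) // lerDr.
Qed.

Definition pole k : R := 2 * pi * k.+1%:R.

Lemma pole_gt0 k : 0 < pole k.
Proof. by rewrite !mulr_gt0 ?pi_gt0 // ltr0n. Qed.

Lemma asum_pole n : asum (fun k => (pole k ^+ n.+2)^-1).
Proof.
apply: (@eq_asum _ _ (fun k => (2 * pi) ^- n.+2 * (k.+1%:R ^+ n.+2)^-1)).
  by move=> k; rewrite /pole exprMn invfM.
exact/asumZ/asum_invX.
Qed.

Lemma tsum_pole n : tsum (fun k => (pole k ^+ n.+2)^-1) = (2 * pi) ^- n.+2 * zsum n.+2.
Proof.
rewrite /zsum -tsumZ; last exact: asum_invX.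
by apply: eq_tsum => k; rewrite /pole exprMn invfM.
Qed.

Lemma asum_cot0 y : asum (fun k => cot0 (pole k) y).
Proof.
apply: (@asum_le _ _ (fun k => (2 * `|y|) * (pole k ^+ 2)^-1)) => [k|]; last first.
  exact/asum_cvg/asumZ/(asum_pole (n := 0)).
have a0 := pole_gt0 k; have D0 := sqr_den_gt0 y a0.
rewrite /cot0 normrM normrV ?unitfE ?gt_eqF // (gtr0_norm D0) normrM gtr0_norm //.
rewrite ler_wpM2l ?mulr_ge0 // lef_pV2 ?posrE ?exprn_gt0 //; exact: den2_ge.
Qed.

Lemma asum_cot1 y : asum (fun k => cot1 (pole k) y).
Proof.
apply: (@asum_le _ _ (fun k => 2 * (pole k ^+ 2)^-1)) => [k|].
  exact: cot1_le (pole_gt0 k).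
exact/asum_cvg/asumZ/(asum_pole (n := 0)).
Qed.

Lemma cot2_le4 a y : 0 < a -> `|cot2 a y| <= 12 * `|y| * (a ^+ 4)^-1.
Proof.
move=> a0; apply: le_trans (cot2_le y a0) _.
have D0 := sqr_den_gt0 y a0.
rewrite ler_wpM2l ?mulr_ge0 // lef_pV2 ?posrE ?exprn_gt0 // (_ : a ^+ 4 = (a ^+ 2) ^+ 2); last by rewrite -exprM.
by rewrite lerXn2r ?nnegrE ?exprn_ge0 ?(ltW a0) ?(ltW D0) //; exact: den2_ge.
Qed.

Lemma asum_cot2 y : asum (fun k => cot2 (pole k) y).
Proof.
apply: (@asum_le _ _ (fun k => (12 * `|y|) * (pole k ^+ 4)^-1)) => [k|].
  exact: cot2_le4 (pole_gt0 k).
exact/asum_cvg/asumZ/(asum_pole (n := 2)).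
Qed.

Lemma dv_tsum_cot0 y : is_derive y 1 (fun z => tsum (fun k => cot0 (pole k) z))
  (tsum (fun k => cot1 (pole k) y)).
Proof.
apply: (@dv_tsum R (fun k => cot0 (pole k)) (fun k => cot1 (pole k)) (fun k => cot2 (pole k))
  (fun k => (12 * (`|y| + 1)) * (pole k ^+ 4)^-1) y 1).
- exact: ltr01.
- move=> k z zd; have a0 := pole_gt0 k; split; [exact: dv_cot0|exact: dv_cot1|].
  apply: le_trans (cot2_le4 z a0) _.
  rewrite ler_wpM2r ?invr_ge0 ?exprn_ge0 ?(ltW a0) // ler_wpM2l //.
  by rewrite -[z](subrK y) (le_trans (ler_normD _ _)) // addrC lerD2l.
- exact/asum_cvg/asumZ/(asum_pole (n := 2)).
- by move=> z _; exact: asum_cot0.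
exact: asum_cot1.
Qed.

Lemma dv_tsum_cot1 y : is_derive y 1 (fun z => tsum (fun k => cot1 (pole k) z))
  (tsum (fun k => cot2 (pole k) y)).
Proof.
apply: (@dv_tsum R (fun k => cot1 (pole k)) (fun k => cot2 (pole k)) (fun k => cot3 (pole k))
  (fun k => 84 * (pole k ^+ 4)^-1) y 1).
- exact: ltr01.
- move=> k z zd; have a0 := pole_gt0 k; split; [exact: dv_cot1|exact: dv_cot2|].
  exact: cot3_le.
- exact/asum_cvg/asumZ/(asum_pole (n := 2)).
- by move=> z _; exact: asum_cot1.
exact: asum_cot2.
Qed.

Lemma bose_cot0 y : 0 < y -> bose y + 1 / 2 - 1 / y = tsum (fun k => cot0 (pole k) y).
Proof.
move=> y0; have [_ ->] := bose_partial_fractions y0.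
by rewrite addrAC subrr add0r.
Qed.

Lemma near_gt0 y : 0 < y -> \forall z \near y, 0 < z.
Proof. exact: lt_nbhsr. Qed.

Lemma bose1_cot1 y : 0 < y -> - bose1 y + 1 / y ^+ 2 = tsum (fun k => cot1 (pole k) y).
Proof.
move=> y0; have d1 : is_derive y 1 (fun z => bose z + 1 / 2 - 1 / z) (- bose1 y + 1 / y ^+ 2).
  apply: dvE (dvB (dvD (dv_bose y0) (dv_cst _ _)) (dvZ 1 (dvV (f := id) (lt0r_neq0 y0) (dv_id y)))) _.
  by rewrite /=; field; rewrite gt_eqF.
apply: (dv_near_unique d1 (dv_tsum_cot0 y)).
by near=> z; apply: bose_cot0; near: z; exact: near_gt0.
Unshelve. all: end_near. Qed.

Lemma bose2_cot2 y : 0 < y -> bose2 y - 2 / y ^+ 3 = tsum (fun k => cot2 (pole k) y).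
Proof.
move=> y0; have d1 : is_derive y 1 (fun z => - bose1 z + 1 / z ^+ 2) (bose2 y - 2 / y ^+ 3).
  have h := dvV (f := fun z => z ^+ 2) (lt0r_neq0 (exprn_gt0 2 y0)) (dvX 2 (dv_id y)).
  apply: dvE (dvD (dvN (dv_bose1 y0)) (dvZ 1 h)) _.
  by rewrite /= expr1; field; rewrite gt_eqF.
apply: (dv_near_unique d1 (dv_tsum_cot1 y)).
by near=> z; apply: bose1_cot1; near: z; exact: near_gt0.
Unshelve. all: end_near. Qed.

(** [cot2 1 y / y], to which every pole reduces by scaling; [rat1] is its derivative and [ratI] the
    primitive vanishing at 0. *)
Definition rat0 y : R := 4 * (y ^+ 2 - 3) / (1 + y ^+ 2) ^+ 3.
Definition rat1 y : R := 8 * y / (1 + y ^+ 2) ^+ 3 - 24 * y * (y ^+ 2 - 3) / (1 + y ^+ 2) ^+ 4.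
Definition ratI y : R := - 4 * y / (1 + y ^+ 2) ^+ 2 - 4 * y / (1 + y ^+ 2) - 4 * atan y.

Lemma den_gt0 y : 0 < 1 + y ^+ 2.
Proof. by rewrite ltr_pwDl // sqr_ge0. Qed.

Lemma dv_den y : is_derive y 1 (fun y => 1 + y ^+ 2) (2 * y).
Proof. by apply: dvE (dvD (dv_cst 1 y) (dvX 2 (dv_id y))) _; rewrite expr1; ring. Qed.

Lemma dv_rat0 y : is_derive y 1 rat0 (rat1 y).
Proof.
have D0 := den_gt0 y.
have h := dvV (f := fun y => (1 + y ^+ 2) ^+ 3) (lt0r_neq0 (exprn_gt0 3 D0)) (dvX 3 (dv_den y)).
apply: dvE (dvM (dvZ 4 (dvB (dvX 2 (dv_id y)) (dv_cst 3 y))) h) _.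
by rewrite /rat1 /= !expr1; field; rewrite gt_eqF.
Qed.

Lemma dv_ratI y : is_derive y 1 ratI (rat0 y).
Proof.
have D0 := den_gt0 y.
have h := dvV (f := fun y => (1 + y ^+ 2) ^+ 2) (lt0r_neq0 (exprn_gt0 2 D0)) (dvX 2 (dv_den y)).
have h1 := dvV (f := fun y => 1 + y ^+ 2) (lt0r_neq0 D0) (dv_den y).
apply: dvE (dvB (dvB (dvM (dvZ (- 4) (dv_id y)) h) (dvM (dvZ 4 (dv_id y)) h1)) (dvZ 4 (is_derive1_atan y))) _.
by rewrite /rat0 /= !expr1; field; rewrite gt_eqF.
Qed.

Lemma rat0_le y : `|rat0 y| <= 12 / (1 + y ^+ 2).
Proof.
have D0 := den_gt0 y; have y2 := sqr_ge0 y; rewrite /rat0.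
move: (y ^+ 2) D0 y2 => Y D0 y2.
rewrite normrM normrV ?unitfE ?gt_eqF ?exprn_gt0 // (gtr0_norm (exprn_gt0 3 D0)).
rewrite ler_pdivrMr ?exprn_gt0 //.
have -> : 12 / (1 + Y) * (1 + Y) ^+ 3 = 12 * (1 + Y) ^+ 2 by field; rewrite gt_eqF.
by rewrite ler_norml; apply/andP; split; nra.
Qed.

Lemma rat1_le y : 0 <= y -> `|rat1 y| <= 80 / (1 + y ^+ 2).
Proof.
move=> y0; have D0 := den_gt0 y; have y2 := sqr_ge0 y; rewrite /rat1.
have yD : y <= 1 + y ^+ 2 by nra.
have -> : 8 * y / (1 + y ^+ 2) ^+ 3 - 24 * y * (y ^+ 2 - 3) / (1 + y ^+ 2) ^+ 4 =
   y * (8 * (1 + y ^+ 2) - 24 * (y ^+ 2 - 3)) / (1 + y ^+ 2) ^+ 4 by field; rewrite gt_eqF.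
move: yD D0 y2; move: (y ^+ 2) => Y yD D0 y2.
rewrite normrM normrV ?unitfE ?gt_eqF ?exprn_gt0 // (gtr0_norm (exprn_gt0 4 D0)).
rewrite ler_pdivrMr ?exprn_gt0 //.
have -> : 80 / (1 + Y) * (1 + Y) ^+ 4 = (1 + Y) * (80 * (1 + Y) ^+ 2) by field; rewrite gt_eqF.
rewrite normrM ger0_norm //; apply: ler_pM => //.
by rewrite ler_norml; apply/andP; split; nra.
Qed.

(** A lower Riemann sum of the decreasing function 1 / (1 + x ^ 2). It is the uniform dominating
    bound here and in the third moment estimate. *)
Lemma atan_partial t n : 0 < t ->
  \sum_(0 <= m < n) t / (1 + (m.+1%:R * t) ^+ 2) <= pi / 2.
Proof.
move=> t0; apply: (@le_trans _ _ (atan (n%:R * t))); last exact/ltW/atan_ltpi2.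
elim: n => [|n IH]; first by rewrite big_nil mul0r atan0.
rewrite big_nat_recr //=; apply: le_trans (lerD IH (lexx _)) _.
rewrite addrC -lerBrDr.
have e : n.+1%:R * t - n%:R * t = t by rewrite -natr1; ring.
rewrite mulrC -[X in _ * X]e.
apply: (@mean_value_lb R atan (fun x => (1 + x ^+ 2)^-1)).
- by rewrite ler_wpM2r ?ler_nat // ltW.
move=> x /andP[x1 x2]; have x0 : 0 <= x by apply: le_trans x1; rewrite mulr_ge0 // ltW.
rewrite lef_pV2 ?posrE ?den_gt0 // lerD2l lerXn2r ?nnegrE //.
by rewrite mulr_ge0 // ltW.
Qed.

Lemma asum_atan t : 0 < t -> asum (fun m => t / (1 + (m.+1%:R * t) ^+ 2)).
Proof.
move=> t0; apply: (@asum_bounded _ _ (pi / 2)) => n.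
under eq_bigr do rewrite ger0_norm ?divr_ge0 ?(ltW (den_gt0 _)) ?(ltW t0) //.
exact: atan_partial.
Qed.

(** A Riemann sum with step [t] of the integral of [rat0] over the half line; the integral is the
    limit of [ratI], namely - 2 pi. *)
Definition Theta t : R := tsum (fun m => t * rat0 (m.+1%:R * t)).

Lemma asum_Theta t : 0 < t -> asum (fun m => t * rat0 (m.+1%:R * t)).
Proof.
move=> t0; apply: (@asum_le _ _ (fun m => 12 * (t / (1 + (m.+1%:R * t) ^+ 2)))) => [m|].
  rewrite normrM gtr0_norm // mulrCA ler_pM2l // ; exact: rat0_le.
exact/asum_cvg/asumZ/asum_atan.
Qed.

Lemma Theta_le t : 0 < t -> `|Theta t| <= 6 * pi.
Proof.
move=> t0; apply: le_trans (ler_norm_tsum (asum_Theta t0)) _.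
apply: tsum_le_ub => [|n]; first exact/asum_norm/asum_Theta.
apply: (@le_trans _ _ (12 * \sum_(0 <= m < n) t / (1 + (m.+1%:R * t) ^+ 2))).
  rewrite mulr_sumr; apply: ler_sum => m _.
  rewrite normrM gtr0_norm // mulrCA ler_pM2l // ; exact: rat0_le.
have := atan_partial n t0; have := @pi_gt0 R; lra.
Qed.

Lemma cvg_ratI : ratI x @[x --> +oo] --> - (2 * pi).
Proof.
have h : (- 4) * x / (1 + x ^+ 2) ^+ 2 - 4 * x / (1 + x ^+ 2) @[x --> +oo] --> (0 : R).
  apply/cvgrPdist_le => e e0; near=> x.
  have x1 : 1 <= x by near: x; apply: nbhs_pinfty_ge; exact: num_real.
  have xe : 8 / e <= x by near: x; apply: nbhs_pinfty_ge; exact: num_real.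
  have x0 : 0 < x by lra.
  have D0 := den_gt0 x; have x2 : 1 <= x ^+ 2 by rewrite exprn_ege1.
  have b1 : x / (1 + x ^+ 2) <= e / 8.
    have h8 : 8 <= x * e by rewrite -ler_pdivrMr.
    rewrite ler_pdivrMr // mulrAC ler_pdivlMr //; nra.
  have p1 : 0 <= x / (1 + x ^+ 2) by rewrite divr_ge0 // ltW.
  have b2 : x / (1 + x ^+ 2) ^+ 2 <= x / (1 + x ^+ 2).
    rewrite ler_pM2l // lef_pV2 ?posrE ?exprn_gt0 // expr2 ler_peMr ?(ltW D0) //; lra.
  have p2 : 0 <= x / (1 + x ^+ 2) ^+ 2 by rewrite divr_ge0 // ?exprn_ge0 // ltW.
  rewrite sub0r normrN -mulrA -(mulrA 4) ler_norml; lra.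
have H : (- 4) * x / (1 + x ^+ 2) ^+ 2 - 4 * x / (1 + x ^+ 2) - 4 * atan x @[x --> +oo] -->
    (0 - 4 * (pi / 2) : R).
  by apply: cvgB => //; apply: cvgM; [exact: cvg_cst|exact: cvgy_atan].
by rewrite (_ : - (2 * pi) = 0 - 4 * (pi / 2) :> R) //; field.
Unshelve. all: end_near. Qed.

Lemma cvg_nat_scale t : 0 < t -> n%:R * t @[n --> \oo] --> +oo.
Proof.
move=> t0; apply/cvgryPge => A; near=> n.
rewrite -ler_pdivrMr //; near: n; exact: nbhs_infty_ger.
Unshelve. all: end_near. Qed.

(** On each cell the error is at most [t ^ 2] times the supremum of [rat1], that is [80 t] times a
    term of the arctangent sum. These terms, starting at index 0, add up to at most [t + pi / 2]. *)
Lemma Theta_sub_le t : 0 < t -> `|Theta t - - (2 * pi)| <= 80 * t ^+ 2 + 40 * pi * t.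
Proof.
move=> t0.
have bd N : `|series (fun m => t * rat0 (m.+1%:R * t)) N - ratI (N%:R * t)| <=
    80 * t ^+ 2 + 40 * pi * t.
  have st m : `|t * rat0 (m.+1%:R * t) - (ratI (m.+1%:R * t) - ratI (m%:R * t))| <=
      80 * t * (t / (1 + (m%:R * t) ^+ 2)).
    have e : m.+1%:R * t - m%:R * t = t by rewrite -natr1; ring.
    have mt : m%:R * t <= m.+1%:R * t by rewrite ler_wpM2r ?ler_nat // ltW.
    have mt0 : 0 <= m%:R * t by rewrite mulr_ge0 // ltW.
    have := @mean_value_le R (fun x => ratI x - rat0 (m.+1%:R * t) * x)
      (fun x => rat0 x - rat0 (m.+1%:R * t)) (80 * t / (1 + (m%:R * t) ^+ 2)) _ _ mt.
    rewrite e => H.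
    have -> : 80 * t * (t / (1 + (m%:R * t) ^+ 2)) = 80 * t / (1 + (m%:R * t) ^+ 2) * t by ring.
    have -> : t * rat0 (m.+1%:R * t) - (ratI (m.+1%:R * t) - ratI (m%:R * t)) =
      - ((ratI (m.+1%:R * t) - rat0 (m.+1%:R * t) * (m.+1%:R * t)) -
       (ratI (m%:R * t) - rat0 (m.+1%:R * t) * (m%:R * t))).
      by rewrite -{1}e; move: (rat0 _) (ratI _) (ratI _) => a b c; ring.
    rewrite normrN; apply: H => x /andP[x1 x2].
      by apply: dvE (dvB (dv_ratI x) (dvZ _ (dv_id x))) _; rewrite mulr1.
    rewrite distrC.
    have := @mean_value_le R rat0 rat1 (80 / (1 + (m%:R * t) ^+ 2)) x (m.+1%:R * t) x2.
    move=> H2; apply: le_trans (H2 _ _) _.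
    - by move=> y _; exact: dv_rat0.
    - move=> y /andP[y1 y2]; have y0 : 0 <= y by lra.
      apply: le_trans (rat1_le y0) _.
      rewrite ler_pM2l // lef_pV2 ?posrE ?den_gt0 // lerD2l lerXn2r ?nnegrE //; lra.
    rewrite [leRHS]mulrAC ler_wpM2l ?divr_ge0 ?(ltW (den_gt0 _)) //; lra.
  have -> : series (fun m => t * rat0 (m.+1%:R * t)) N - ratI (N%:R * t) =
      \sum_(0 <= m < N) (t * rat0 (m.+1%:R * t) - (ratI (m.+1%:R * t) - ratI (m%:R * t))).
    rewrite big_split /= sumrN telescope_sumr //; congr (_ - _).
    by rewrite mul0r [X in _ - X](_ : _ = 0) ?subr0 // /ratI atan0; field.
  apply: le_trans (ler_norm_sum _ _ _) _.
  apply: (@le_trans _ _ (\sum_(0 <= m < N) 80 * t * (t / (1 + (m%:R * t) ^+ 2)))).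
    by apply: ler_sum => m _; exact: st.
  rewrite -mulr_sumr.
  have hN : \sum_(0 <= m < N) t / (1 + (m%:R * t) ^+ 2) <= t + pi / 2.
    case: N => [|N]; first by rewrite big_nil addr_ge0 ?divr_ge0 ?pi_ge0 // ltW.
    rewrite big_nat_recl //= mul0r expr0n addr0 divr1 lerD2l; exact: atan_partial.
  apply: le_trans (ler_wpM2l _ hN) _; first by rewrite mulr_ge0 // ltW.
  by apply: eq_leR; field.
have C : series (fun m => t * rat0 (m.+1%:R * t)) N - ratI (N%:R * t) @[N --> \oo] -->
    Theta t - - (2 * pi).
  apply: cvgB; first exact: asum_tsum (asum_Theta t0).
  exact: (cvg_comp _ _ (cvg_nat_scale t0) cvg_ratI).
apply: (cvgr_to_le (cvg_norm C)); near=> N; exact: bd.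
Unshelve. all: end_near. Qed.

Lemma cvg_Theta : Theta t @[t --> 0^'+] --> - (2 * pi).
Proof.
have C0 : 0 < 80 + 40 * pi :> R by have := @pi_gt0 R; lra.
apply/cvgrPdist_le => e e0; have eC : 0 < e / (80 + 40 * pi) by exact: divr_gt0.
near=> t.
have t0 : 0 < t by near: t; exact: nbhs_right_gt.
have t1 : t < 1 by near: t; exact: nbhs_right_lt.
have te : t < e / (80 + 40 * pi).
  by near: t; exact: nbhs_right_lt.
rewrite distrC; apply: le_trans (Theta_sub_le t0) _.
move: te; rewrite ltr_pdivlMr // => te.
have : 80 * t ^+ 2 <= 80 * t by rewrite ler_pM2l // expr2 ler_piMr // ltW.
move: te; have := @pi_gt0 R; move: pi => p p0 te h; lra.
Unshelve. all: end_near. Qed.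

(** The inner sums of [Lsum_double] are [bose2 (m t)]. Its pole 2 / y ^ 3 at 0 gives the [zsum 4]
    term; the other poles are summed over [m] first, and scaling by the pole turns that sum into
    [Theta]. *)
Lemma Lsum2E t : 0 < t -> Lsum 2 t - 2 * zsum 4 / t ^+ 3 =
  tsum (fun k => (pole k ^+ 3)^-1 * Theta (t / pole k)).
Proof.
move=> t0; have [a ->] := Lsum_double 2 t0.
have rw m : m.+1%:R^-1 * tsum (fun k => k.+1%:R ^+ 2 * expR (- (k.+1%:R * (m.+1%:R * t)))) =
    2 / t ^+ 3 * (m.+1%:R ^+ 4)^-1 + m.+1%:R^-1 * tsum (fun k => cot2 (pole k) (m.+1%:R * t)).
  have mt : 0 < m.+1%:R * t by rewrite mulr_gt0.
  rewrite tsum_exp2 // -bose2_cot2 //; have m0 : m.+1%:R != 0 :> R by rewrite pnatr_eq0.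
  move: (m.+1%:R) m0 (bose2 _) => M M0 b; field; rewrite M0 gt_eqF //.
have le m k : `|m.+1%:R^-1 * cot2 (pole k) (m.+1%:R * t)| <=
    3 / t * (m.+1%:R ^+ 2)^-1 * (pole k ^+ 2)^-1.
  have a0 := pole_gt0 k; have mt : 0 < m.+1%:R * t by rewrite mulr_gt0.
  have D0 := sqr_den_gt0 (m.+1%:R * t) a0.
  have m0 : 0 < m.+1%:R :> R by rewrite ltr0n.
  rewrite normrM gtr0_norm ?invr_gt0 //.
  apply: le_trans (ler_wpM2l _ (cot2_le (m.+1%:R * t) a0)) _; first by rewrite invr_ge0.
  rewrite (gtr0_norm mt); move: (m.+1%:R) (pole k) m0 a0 mt D0 => M A M0 A0 mt D0.
  have -> : M^-1 * (12 * (M * t) / ((M * t) ^+ 2 + A ^+ 2) ^+ 2) =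
     12 * t / ((M * t) ^+ 2 + A ^+ 2) ^+ 2 by field; rewrite !gt_eqF.
  have -> : 3 / t * (M ^+ 2)^-1 * (A ^+ 2)^-1 = 12 * t / (4 * ((M * t) ^+ 2 * A ^+ 2)).
    by field; rewrite !gt_eqF.
  rewrite ler_wpM2l ?mulr_ge0 ?(ltW t0) // lef_pV2 ?posrE ?mulr_gt0 ?exprn_gt0 //.
  (* 4 x y <= (x + y) ^ 2 separates the two summation variables, as the interchange requires. *)
  rewrite -subr_ge0 (_ : _ - _ = ((M * t) ^+ 2 - A ^+ 2) ^+ 2); last by ring.
  exact: sqr_ge0.
pose B m : R := 3 / t * (m.+1%:R ^+ 2)^-1 * tsum (fun k => (pole k ^+ 2)^-1).
have aP := asum_pole (n := 0).
have arow m : asum (fun k => m.+1%:R^-1 * cot2 (pole k) (m.+1%:R * t)).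
  by apply/asumZ/asum_cot2.
have [|||c1 c2 c3 c4] := @tsum_exchange R
   (fun m k => m.+1%:R^-1 * cot2 (pole k) (m.+1%:R * t)) B.
- exact: arow.
- move=> m; rewrite /B -tsumZ //; apply: le_tsum => [| |k].
  + exact: asum_norm (arow m).
  + exact: asumZ.
  + exact: le.
- apply: asum_cvg; apply: (@eq_asum _ _ (fun m => (3 / t * tsum (fun k => (pole k ^+ 2)^-1)) * (m.+1%:R ^+ 2)^-1)).
    by move=> m; rewrite /B mulrAC.
  exact/asumZ/(@asum_invX R 0).
have e1 m : m.+1%:R^-1 * tsum (fun k => cot2 (pole k) (m.+1%:R * t)) =
    tsum (fun k => m.+1%:R^-1 * cot2 (pole k) (m.+1%:R * t)).
  by rewrite tsumZ //; exact: asum_cot2.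
rewrite (eq_tsum rw) tsumD; [|exact/asumZ/(@asum_invX R 2)|by apply: eq_asum c3 => m; rewrite e1].
rewrite tsumZ; last exact: (@asum_invX R 2).
have -> : 2 / t ^+ 3 * tsum (fun k => (k.+1%:R ^+ 4)^-1) = 2 * zsum 4 / t ^+ 3.
  by rewrite /zsum mulrAC.
rewrite addrAC subrr add0r (eq_tsum e1) c4; apply: eq_tsum => k.
rewrite /Theta -tsumZ; last by apply: asum_Theta; rewrite divr_gt0 // pole_gt0.
apply: eq_tsum => m; rewrite /cot2 /rat0; have a0 := pole_gt0 k.
have m0 : m.+1%:R != 0 :> R by rewrite pnatr_eq0.
have D0 := sqr_den_gt0 (m.+1%:R * t) a0.
move: (m.+1%:R) (pole k) m0 a0 D0 => M A M0 A0 D0.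
have -> : 1 + (M * (t / A)) ^+ 2 = ((M * t) ^+ 2 + A ^+ 2) / A ^+ 2 by field; rewrite gt_eqF.
by field; rewrite M0 !gt_eqF.
Qed.

(** Each pole contributes - 2 pi / pole ^ 3 in the limit, with poles at 2 pi k; the limit is the
    value zeta'(-2). *)
Lemma Lsum2_asymp : Lsum 2 t - 2 * zsum 4 / t ^+ 3 @[t --> (0 : R)^'+] -->
  (- zsum 3 / (4 * pi ^+ 2) : R).
Proof.
have [|||_] := @tannery R R (0^'+) _ (fun t k => (pole k ^+ 3)^-1 * Theta (t / pole k))
  (fun k => (pole k ^+ 3)^-1 * - (2 * pi)) (fun k => 6 * pi * (pole k ^+ 3)^-1).
- near=> t => k; have t0 : 0 < t by near: t; exact: nbhs_right_gt.
  have a0 := pole_gt0 k.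
  rewrite normrM gtr0_norm ?invr_gt0 ?exprn_gt0 // mulrC ler_pM2r ?invr_gt0 ?exprn_gt0 //.
  by apply: Theta_le; rewrite divr_gt0.
- move=> k; apply: cvgM; first exact: cvg_cst.
  have a0 := pole_gt0 k.
  have := cvg_scale_at0 (a := (pole k)^-1) _ cvg_Theta; rewrite invr_gt0 => /(_ a0).
  by under eq_fun do rewrite mulrC.
- exact/asum_cvg/asumZ/(asum_pole (n := 1)).
move=> H; apply: (cvgr_eq H).
  under eq_tsum do rewrite mulrC.
  rewrite tsumZ; last exact: (asum_pole (n := 1)).
  rewrite tsum_pole; have := @pi_gt0 R; move: (zsum 3) (pi : R) => z p p0.
  by field; rewrite gt_eqF.
by near=> t; rewrite Lsum2E //; near: t; exact: nbhs_right_gt.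
Unshelve. all: end_near. Qed.

End SecondSum.

(** * The values zeta(2), zeta(4) and the Euler sum of the logarithm *)

Section ZetaValues.
Context {R : realType}.
Implicit Types (x y z t a : R).

Lemma expR_taylor5 y : 0 < y <= 1 -> exists2 r : R, `|r| <= expR 1 &
  expR y = 1 + y + y ^+ 2 / 2 + y ^+ 3 / 6 + y ^+ 4 / 24 + y ^+ 5 / 120 + y ^+ 6 * r.
Proof.
move=> /andP[y0 y1].
have sE x : 0 <= x -> asum (exp_coeff x).
  move=> x0; apply: asum_nneg; last exact: is_cvg_series_exp_coeff.
  by move=> k; exact: exp_coeff_ge0.
have y0' := ltW y0.
have tl := tsum_tail 6 (sE _ y0').
pose w k : R := y ^+ k / (6 + k)`!%:R.
have wle k : `|w k| <= exp_coeff 1 k.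
  rewrite ger0_norm ?divr_ge0 ?exprn_ge0 // /exp_coeff /= expr1n /w.
  apply: ler_pM; rewrite ?exprn_ge0 ?invr_ge0 //; first by rewrite exprn_ile1.
  by rewrite lef_pV2 ?posrE ?ltr0n ?fact_gt0 // ler_nat; apply: leq_fact; rewrite leq_addl.
have s1 := sE 1 ler01.
have sw : asum w by apply: (asum_le wle); exact: asum_cvg.
exists (tsum w).
  apply: le_trans (ler_norm_tsum sw) _; apply: le_tsum => //; exact: asum_norm.
have : expR y - series (exp_coeff y) 6 = y ^+ 6 * tsum w.
  rewrite -tsumZ //; apply: etrans tl _; apply: eq_tsum => k.
  by rewrite /exp_coeff /= /w exprD mulrA.
move=> /(canRL (subrK _)) ->.
rewrite /series /= /index_iota /= !big_cons big_nil /exp_coeff /=.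
rewrite (_ : 0`! = 1)%N // (_ : 1`! = 1)%N // (_ : 2`! = 2)%N // (_ : 3`! = 6)%N //.
rewrite (_ : 4`! = 24)%N // (_ : 5`! = 120)%N // expr0 expr1.
by move: (tsum w) => r; field.
Qed.

Definition cotr a y : R := 2 / (y ^+ 2 + a ^+ 2).

(** The Taylor expansion 1 / (e ^ y - 1) = 1 / y - 1 / 2 + y / 12 - y ^ 3 / 720 + ..., read through
    the partial fractions. *)
Lemma cvg_cotr : (tsum (fun k => cotr (pole k) y) - 1 / 12) / y ^+ 2 @[y --> 0^'+] -->
  (- (1 / 720) : R).
Proof.
pose C : R := expR 1.
have C0 : 0 < 2 * C + 1 by rewrite /C; have := expR_gt0 (1 : R); lra.
apply/cvgrPdist_le => e e0; have eC : 0 < e / (2 * C + 1) by exact: divr_gt0.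
near=> y.
have y0 : 0 < y by near: y; exact: nbhs_right_gt.
have y1 : y < 1 by near: y; exact: nbhs_right_lt.
have ye : y < e / (2 * C + 1) by near: y; exact: nbhs_right_lt.
have tE : tsum (fun k => cotr (pole k) y) = (bose y + 1 / 2 - 1 / y) / y.
  rewrite bose_cot0 // mulrC -tsumZ; last exact: asum_cot0.
  apply: eq_tsum => k; have D0 := sqr_den_gt0 y (pole_gt0 k).
  by rewrite /cotr /cot0; field; rewrite !gt_eqF.
rewrite tE; have [|r rC er] := @expR_taylor5 y; first by rewrite y0 ltW.
have w0 := expR_sub1_gt0 y0; have wy : y <= expR y - 1 by have := expR_ge1Dx y; lra.
(* Defined by y ^ 5 Q = (e ^ y - 1) (1 / y - 1 / 2 + y / 12 - y ^ 3 / 720) - 1. *)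
pose Q := r - 1 / 720 + y * (1 / (720 * 3) - r / 2) + y ^+ 2 * (r / 12 - 1 / (720 * 24))
  - y ^+ 3 / (720 * 120) - y ^+ 4 * r / 720.
have -> : - (1 / 720) - ((bose y + 1 / 2 - 1 / y) / y - 1 / 12) / y ^+ 2 = y ^+ 2 * Q / (expR y - 1).
  apply: (canRL (mulfK (lt0r_neq0 w0))); rewrite /bose.
  have -> : (- (1 / 720) - (((expR y - 1)^-1 + 1 / 2 - 1 / y) / y - 1 / 12) / y ^+ 2) * (expR y - 1)
    = (- (1 / 720) - ((1 / 2 - 1 / y) / y - 1 / 12) / y ^+ 2) * (expR y - 1) - 1 / y ^+ 3.
    by field; rewrite !gt_eqF.
  by rewrite er /Q; field; rewrite gt_eqF.
have Qb : `|Q| <= 2 * C + 1.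
  have y2 : 0 <= y ^+ 2 <= 1 by rewrite exprn_ge0 ?exprn_ile1 ?ltW.
  have y3 : 0 <= y ^+ 3 <= 1 by rewrite exprn_ge0 ?exprn_ile1 ?ltW.
  have y4 : 0 <= y ^+ 4 <= 1 by rewrite exprn_ge0 ?exprn_ile1 ?ltW.
  move: rC; rewrite -/C /Q; move: (y ^+ 2) (y ^+ 3) (y ^+ 4) y2 y3 y4 => Y2 Y3 Y4 y2 y3 y4 rC.
  have pr (p q K : R) : 0 <= p <= 1 -> `|q| <= K -> `|p * q| <= K.
    move=> /andP[p0 p1] qK; rewrite normrM (ger0_norm p0).
    by apply: le_trans qK; rewrite ler_piMl.
  have r1 : `|y * (1 / (720 * 3) - r / 2)| <= C / 2 + 1 / (720 * 3).
    by apply: pr; [lra|move: rC; rewrite !ler_norml; lra].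
  have r2 : `|Y2 * (r / 12 - 1 / (720 * 24))| <= C / 12 + 1 / (720 * 24).
    by apply: pr; [lra|move: rC; rewrite !ler_norml; lra].
  have r4 : `|Y4 * r| <= C by apply: pr.
  move: r1 r2 r4 rC; rewrite !ler_norml; lra.
rewrite normrM normrV ?unitfE ?gt_eqF // (gtr0_norm w0) ler_pdivrMr // normrM gtr0_norm ?exprn_gt0 //.
apply: (@le_trans _ _ (y ^+ 2 * (2 * C + 1))); first by rewrite ler_pM2l ?exprn_gt0.
apply: (@le_trans _ _ (e * y)); last by rewrite ler_pM2l.
move: ye; rewrite ltr_pdivlMr // => ye.
by rewrite expr2 -mulrA mulrC ler_pM2r // ltW.
Unshelve. all: end_near. Qed.

(** Two computations of the same limits are compared: termwise, giving multiples of the sums of pole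
    ^ -2 and pole ^ -4, and by the Taylor coefficients 1/12 and - 1/720. *)
Lemma zsum_values : zsum 2 = pi ^+ 2 / 6 :> R /\ zsum 4 = pi ^+ 4 / 90 :> R.
Proof.
have y2 : y ^+ 2 @[y --> 0^'+] --> (0 : R).
  have h : y ^+ 2 @[y --> 0^'+] --> (0 : R) ^+ 2 by apply: cvgr_sqr; exact: cvg_id0.
  by move: h; rewrite expr0n.
have [|||_ H1] := @tannery R R (0^'+) _ (fun y k => cotr (pole k) y)
  (fun k => 2 * (pole k ^+ 2)^-1) (fun k => 2 * (pole k ^+ 2)^-1).
- near=> y => k; have a0 := @pole_gt0 R k; have D0 := sqr_den_gt0 y a0.
  rewrite ger0_norm ?divr_ge0 ?(ltW D0) // ler_pM2l // lef_pV2 ?posrE ?exprn_gt0 //.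
  exact: den2_ge.
- move=> k; apply: cvgM; first exact: cvg_cst.
  have a0 := @pole_gt0 R k.
  apply: cvgV; first by rewrite gt_eqF // exprn_gt0.
  by rewrite -[X in _ --> X]add0r; apply: cvgD => //; exact: cvg_cst.
- exact/asum_cvg/asumZ/(asum_pole (n := 0)).
have H2 : tsum (fun k => cotr (pole k) y) @[y --> 0^'+] --> (1 / 12 : R).
  have H : (tsum (fun k => cotr (pole k) y) - 1 / 12) / y ^+ 2 * y ^+ 2 + 1 / 12 @[y --> 0^'+] -->
      (- (1 / 720) * 0 + 1 / 12 : R).
    by apply: cvgD; [apply: cvgM => //; exact: cvg_cotr|exact: cvg_cst].
  apply: (cvgr_eq H); first by rewrite mulr0 add0r.
  near=> y; have y0 : 0 < y by near: y; exact: nbhs_right_gt.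
  by rewrite mulfVK ?subrK // gt_eqF // exprn_gt0.
have E1 : tsum (fun k => 2 * (pole k ^+ 2)^-1) = 1 / 12 :> R.
  by apply: (cvg_unique _ H1 H2).
have E1' := E1; rewrite tsumZ in E1; last exact: (asum_pole (n := 0)).
rewrite tsum_pole in E1.
have [|||_ H3] := @tannery R R (0^'+) _ (fun y k => - (cotr (pole k) y * (pole k ^+ 2)^-1))
  (fun k => - (2 * (pole k ^+ 4)^-1)) (fun k => 2 * (pole k ^+ 4)^-1).
- near=> y => k; have a0 := @pole_gt0 R k; have D0 := sqr_den_gt0 y a0.
  have a2 : 0 < pole k ^+ 2 :> R by rewrite exprn_gt0.
  rewrite normrN ger0_norm; last by rewrite mulr_ge0 ?divr_ge0 ?invr_ge0 ?(ltW a2) ?(ltW D0).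
  rewrite /cotr; move: (pole k) a0 D0 a2 => a a0 D0 a2.
  have -> : 2 * (a ^+ 4)^-1 = 2 / a ^+ 2 * (a ^+ 2)^-1 by field; rewrite gt_eqF.
  rewrite ler_pM2r ?invr_gt0 // ler_pM2l // lef_pV2 ?posrE //; exact: den2_ge.
- move=> k; have a0 := @pole_gt0 R k; apply: cvgN.
  have -> : 2 * (pole k ^+ 4)^-1 = 2 / (0 + pole k ^+ 2) * (pole k ^+ 2)^-1 :> R.
    by field; rewrite gt_eqF.
  apply: cvgM; last exact: cvg_cst.
  apply: cvgM; first exact: cvg_cst.
  apply: cvgV; first by rewrite add0r gt_eqF // exprn_gt0.
  by apply: cvgD => //; exact: cvg_cst.
- exact/asum_cvg/asumZ/(asum_pole (n := 2)).
have acotr y : asum (fun k => cotr (pole k) y).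
  apply: (@asum_le _ _ (fun k => 2 * (pole k ^+ 2)^-1)) => [k|].
    have a0 := @pole_gt0 R k; have D0 := sqr_den_gt0 y a0.
    rewrite ger0_norm ?divr_ge0 ?(ltW D0) // ler_pM2l // lef_pV2 ?posrE ?exprn_gt0 //.
    exact: den2_ge.
  exact/asum_cvg/asumZ/(asum_pole (n := 0)).
have H4 : tsum (fun k => - (cotr (pole k) y * (pole k ^+ 2)^-1)) @[y --> 0^'+] --> (- (1 / 720) : R).
  apply: (cvgr_eq cvg_cotr) => //; near=> y.
  have y0 : 0 < y by near: y; exact: nbhs_right_gt.
  have aB : asum (fun k => 2 * (pole k ^+ 2)^-1 : R) by exact/asumZ/(asum_pole (n := 0)).
  have -> : tsum (fun k => cotr (pole k) y) - 1 / 12 =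
      tsum (fun k => cotr (pole k) y - 2 * (pole k ^+ 2)^-1).
    by rewrite (tsumB (acotr y) aB) E1'.
  rewrite mulrC -tsumZ; last exact: asumB.
  apply: eq_tsum => k; have a0 := @pole_gt0 R k; have D0 := sqr_den_gt0 y a0.
  by rewrite /cotr; move: (pole k) a0 D0 => a a0 D0; field; rewrite !gt_eqF.
have E2 : tsum (fun k => - (2 * (pole k ^+ 4)^-1)) = - (1 / 720) :> R.
  by apply: (cvg_unique _ H3 H4).
rewrite tsumN in E2; last exact/asumZ/(asum_pole (n := 2)).
rewrite tsumZ in E2; last exact: (asum_pole (n := 2)).
rewrite tsum_pole in E2.
have p0 := @pi_gt0 R; move: (zsum 2) (zsum 4) (pi : R) p0 E1 E2 => z2 z4 p p0 E1 E2.
split.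
  have -> : z2 = 2 * ((2 * p) ^- 2 * z2) * (2 * p ^+ 2) by field; rewrite gt_eqF.
  by rewrite E1; field.
have -> : z4 = - - (2 * ((2 * p) ^- 4 * z4)) * (8 * p ^+ 4) by field; rewrite gt_eqF.
by rewrite E2; field.
Unshelve. all: end_near. Qed.

Definition lnsq a z : R := ln (z ^+ 2 + a ^+ 2).

Lemma dv_lnsq a z : 0 < a -> is_derive z 1 (lnsq a) (cot0 a z).
Proof. by move=> a0; exact: (dv_ln (f := fun z => z ^+ 2 + a ^+ 2) (sqr_den_gt0 z a0) (dv_sqr_den a z)). Qed.

Lemma lnsqC a z : lnsq a z = lnsq z a.
Proof. by rewrite /lnsq addrC. Qed.

Lemma cot2_le3 a z : 0 < a -> 0 < z -> `|cot2 a z| <= 12 / z ^+ 3.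
Proof.
move=> a0 z0; apply: le_trans (cot2_le z a0) _; have D0 := sqr_den_gt0 z a0.
have -> : 12 / z ^+ 3 = 12 * z / (z ^+ 2) ^+ 2 by field; rewrite gt_eqF.
rewrite gtr0_norm // ler_pM2l ?mulr_gt0 // lef_pV2 ?posrE ?exprn_gt0 //.
by rewrite lerXn2r ?nnegrE ?exprn_ge0 ?(ltW z0) ?(ltW D0) // lerDl sqr_ge0.
Qed.

Lemma lnsq_third a (x : R) : 0 < a -> 1 <= x ->
  [/\ is_derive x 1 (fun x => lnsq a (x * pi)) (cot0 a (x * pi) * pi),
    is_derive x 1 (fun x => cot0 a (x * pi) * pi) (cot1 a (x * pi) * pi * pi),
    is_derive x 1 (fun x => cot1 a (x * pi) * pi * pi) (cot2 a (x * pi) * pi * pi * pi) &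
    `|cot2 a (x * pi) * pi * pi * pi| <= 12 * x `^ (- 3%:R)].
Proof.
move=> a0 x1; have x0 : 0 < x by lra.
have p0 := @pi_gt0 R; have xp : 0 < x * pi by rewrite mulr_gt0.
split.
- exact/dv_scale/dv_lnsq.
- exact/dvMr/dv_scale/dv_cot0.
- exact/dvMr/dvMr/dv_scale/dv_cot1.
rewrite powR_invn; last exact: ltW.
have pp : 0 < pi * (pi * pi) :> R by rewrite !mulr_gt0.
move: (cot2 a (x * pi)) (cot2_le3 a0 xp) => c hc.
rewrite -!mulrA normrM (gtr0_norm pp).
apply: le_trans (ler_wpM2r _ hc) _; first exact: ltW.
by apply: eq_leR; move: (pi : R) p0 => p p0; field; rewrite !gt_eqF.
Qed.

(** The logarithm of a regularised alternating product of the factors y ^ 2 + (n pi) ^ 2; by [GregE]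
    it is ln (y coth (y / 2)). *)
Definition Greg y : R := regsum (fun n => lnsq y (n%:R * pi)).

Lemma asum_diff3_lnsq y : 0 < y -> asum_diff3 (fun n => lnsq y (n%:R * pi)).
Proof.
move=> y0; apply: (@asum_le _ _ (fun k => 12 * k.+1%:R `^ (- 3%:R))).
  apply: (@asum_diff3_le R (fun x => lnsq y (x * pi)) (fun x => cot0 y (x * pi) * pi)
   (fun x => cot1 y (x * pi) * pi * pi) (fun x => cot2 y (x * pi) * pi * pi * pi)).
    by rewrite ltr1n.
  by move=> x; exact: lnsq_third.
by apply/asum_cvg/asumZ/asum_powR; rewrite ltr1n.
Qed.

Lemma dv_diff3 (f : nat -> R -> R) (d : nat -> R) n x :
  (forall n, (0 < n)%N -> is_derive x 1 (f n) (d n)) -> (0 < n)%N ->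
  is_derive x 1 (fun y => diff3 (f ^~ y) n) (diff3 d n).
Proof.
move=> h n0; rewrite /diff3; apply: dvB; last exact: h.
by apply: dvD; [apply: dvB; [exact: h|exact/dvZ/h]|exact/dvZ/h].
Qed.

Lemma diff3_norm_le (d : nat -> R) n K : (forall j, (n <= j)%N -> `|d j| <= K) -> `|diff3 d n| <= 8 * K.
Proof.
move=> h; have h0 := h n (leqnn _); have h1 := h n.+1 (leqnSn _).
have h2 := h n.+2 (leqW (leqnSn _)); have h3 := h n.+3 (leqW (leqW (leqnSn _))).
by move: h0 h1 h2 h3; rewrite /diff3 !ler_norml; lra.
Qed.

Lemma regsum_cot0 y : 0 < y -> regsum (fun n => cot0 (n%:R * pi) y) =
  2 * bose (2 * y) - 2 * bose y + 1 / y.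
Proof.
move=> y0; have y20 : 0 < 2 * y by lra.
have e1 k : cot0 (k.+1%:R * pi) y = 2 * cot0 (pole k) (2 * y).
  have a0 : 0 < k.+1%:R * pi :> R by rewrite mulr_gt0 // ?pi_gt0 // ltr0n.
  have -> : pole k = 2 * (k.+1%:R * pi) :> R by rewrite /pole; ring.
  move: (k.+1%:R * pi) a0 => a a0; have D0 := sqr_den_gt0 y a0.
  rewrite /cot0 (_ : (2 * y) ^+ 2 + (2 * a) ^+ 2 = 4 * (y ^+ 2 + a ^+ 2)); last by ring.
  by field; rewrite gt_eqF.
have sa : asum (fun k => cot0 (k.+1%:R * pi) y).
  by apply: eq_asum e1 _; apply: asumZ; exact: asum_cot0.
rewrite regsum_asum // -(tsum_alternating (g := fun n => cot0 (n%:R * pi) y)) //.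
rewrite (eq_tsum e1) tsumZ; last exact: asum_cot0.
have e2 k : cot0 ((2 * k.+1)%:R * pi) y = cot0 (pole k) y.
  by rewrite /pole natrM; congr cot0; ring.
rewrite (eq_tsum e2) -!bose_cot0 //.
by move: (bose _) (bose _) => b1 b2; field; rewrite gt_eqF.
Qed.

Lemma dv_Greg y : 0 < y -> is_derive y 1 Greg (2 * bose (2 * y) - 2 * bose y + 1 / y).
Proof.
move=> y0; apply: (dvE _ (regsum_cot0 y0)).
have p0 := @pi_gt0 R.
have np n : (0 < n)%N -> 0 < n%:R * pi :> R by move=> n0; rewrite mulr_gt0 // ltr0n.
have d1 n z : (0 < n)%N -> is_derive z 1 (fun z => lnsq z (n%:R * pi)) (cot0 (n%:R * pi) z).
  by move=> n0; apply: dv_ext (dv_lnsq z (np _ n0)) => w; exact: lnsqC.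
have y2 : 0 < y / 2 by lra.
have zpos z : `|z - y| <= y / 2 -> 0 < z by rewrite ler_norml; lra.
rewrite /Greg /regsum; apply: dvD.
  by apply: dvMr; apply: dvD; [apply: dvB; exact/dvZ/d1|exact: d1].
apply: dvZ.
(* 8 from the binomial weights of a third difference, and 2 from [cot1_le]. *)
pose K : R := 16 / pi ^+ 2.
apply: (@dv_tsum R (fun k z => (-1) ^+ k * diff3 (fun n => lnsq z (n%:R * pi)) k.+1)
  (fun k z => (-1) ^+ k * diff3 (fun n => cot0 (n%:R * pi) z) k.+1)
  (fun k z => (-1) ^+ k * diff3 (fun n => cot1 (n%:R * pi) z) k.+1)
  (fun k => K * (k.+1%:R ^+ 2)^-1) y (y / 2)).
- exact: y2.
- move=> k z zd; split.
  + by apply: dvZ; exact: (dv_diff3 (f := fun n z => lnsq z (n%:R * pi)) (fun n n0 => d1 n z n0) (ltn0Sn k)).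
  + by apply: dvZ; exact: (dv_diff3 (f := fun n z => cot0 (n%:R * pi) z) (fun n n0 => dv_cot0 z (np n n0)) (ltn0Sn k)).
  rewrite normrM normrX normrN1 expr1n mul1r.
  have -> : K * (k.+1%:R ^+ 2)^-1 = 8 * (2 / (k.+1%:R * pi) ^+ 2).
    rewrite /K; have k0 : k.+1%:R != 0 :> R by rewrite pnatr_eq0.
    by move: (k.+1%:R) k0 (pi : R) p0 => k' k0 p p0; field; rewrite k0 gt_eqF.
  apply: diff3_norm_le => j kj; have j0 : (0 < j)%N by apply: leq_ltn_trans kj.
  apply: le_trans (cot1_le z (np _ j0)) _.
  rewrite ler_pM2l // lef_pV2 ?posrE ?exprn_gt0 ?np //.
  rewrite lerXn2r ?nnegrE ?(ltW (np _ _)) //.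
  by rewrite ler_pM2r // ler_nat.
- exact/asum_cvg/asumZ/(@asum_invX R 0).
- by move=> z /zpos z0; apply: asum_sign; exact: asum_diff3_lnsq.
apply: asum_sign.
apply: (asum_diff3_asum (g := fun n => cot0 (n%:R * pi) y)).
apply: (@asum_le _ _ (fun k => (2 * y / pi ^+ 2) * (k.+1%:R ^+ 2)^-1)) => [k|]; last first.
  exact/asum_cvg/asumZ/(@asum_invX R 0).
have a0 := np k.+1 isT; have D0 := sqr_den_gt0 y a0.
rewrite /cot0 ger0_norm ?divr_ge0 ?mulr_ge0 ?(ltW D0) ?(ltW y0) //.
have -> : 2 * y / pi ^+ 2 / k.+1%:R ^+ 2 = 2 * y / (k.+1%:R * pi) ^+ 2.
  have k0 : k.+1%:R != 0 :> R by rewrite pnatr_eq0.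
  by move: (k.+1%:R) (pi : R) k0 p0 => k' p k0 p0; field; rewrite k0 gt_eqF.
rewrite ler_pM2l ?mulr_gt0 // lef_pV2 ?posrE ?exprn_gt0 //; exact: den2_ge.
Qed.

Lemma cvg_ell_infty c : 0 < c -> ell (c * y) @[y --> +oo] --> (0 : R).
Proof.
move=> c0; apply/cvgrPdist_le => e e0; near=> y.
have ye : (c * e)^-1 <= y by near: y; apply: nbhs_pinfty_ge; exact: num_real.
have y0 : 0 < y by apply: lt_le_trans ye; rewrite invr_gt0 mulr_gt0.
have cy : 0 < c * y by rewrite mulr_gt0.
rewrite sub0r normrN ger0_norm ?ell_ge0 //; apply: le_trans (ell_le_bose cy) _.
apply: le_trans (bose_le 0 cy) _; rewrite (factS 0) fact0 expr1 mul1r.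
rewrite -[leRHS]invrK lef_pV2 ?posrE ?invr_gt0 //.
have h := ler_wpM2l (ltW c0) ye; move: h.
by rewrite (_ : c * (c * e)^-1 = e^-1) //; field; rewrite !gt_eqF.
Unshelve. all: end_near. Qed.

Lemma cvg_inv_infty : z^-1 @[z --> +oo] --> (0 : R).
Proof.
apply/cvgrPdist_le => e e0; near=> z.
have ze : e^-1 <= z by near: z; apply: nbhs_pinfty_ge; exact: num_real.
have z0 : 0 < z by apply: lt_le_trans ze; rewrite invr_gt0.
rewrite sub0r normrN gtr0_norm ?invr_gt0 //.
by rewrite -[leRHS]invrK lef_pV2 ?posrE ?invr_gt0.
Unshelve. all: end_near. Qed.

Lemma eq_regsum (f g : nat -> R) : (forall n, (0 < n)%N -> f n = g n) -> regsum f = regsum g.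
Proof.
move=> fg; rewrite /regsum !fg //; congr (_ + _ * _); apply: eq_tsum => k.
by rewrite /diff3 !fg.
Qed.

(** Both sides have the same derivative, so their difference [H] is constant. It is evaluated at
    infinity, where the ratio of each factor to y ^ 2 tends to 1 and the Euler sum of the constant 2
    ln y is ln y. *)
Lemma GregE y : 0 < y -> Greg y = ln y - ell (2 * y) + 2 * ell y.
Proof.
move=> y0; have p0 := @pi_gt0 R.
pose H y := Greg y - (ln y - ell (2 * y) + 2 * ell y).
have dH z : 0 < z -> is_derive z 1 H 0.
  move=> z0; have z2 : 0 < 2 * z by lra.
  have d2 : is_derive z 1 (fun y => ell (2 * y)) (- bose (2 * z) * (2 * 1)).
    exact: (dv_comp (f := ell) (g := fun y => 2 * y) (dv_ell z2) (dvZ 2 (dv_id z))).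
  apply: dvE (dvB (dv_Greg z0) (dvD (dvB (dv_ln (f := id) z0 (dv_id z)) d2) (dvZ 2 (dv_ell z0)))) _.
  by rewrite /=; move: (bose _) (bose _) => b1 b2; ring.
have Hc z : y <= z -> H z = H y.
  move=> yz; apply/eqP; rewrite -subr_eq0 -normr_le0.
  have := @mean_value_le R H (fun=> 0) 0 y z yz; rewrite mul0r; apply.
    by move=> x /andP[yx _]; apply: dH; apply: lt_le_trans yx.
  by move=> x _; rewrite normr0.
suff HL : H z @[z --> +oo] --> (0 : R).
  have : H z @[z --> +oo] --> H y.
    apply: cvg_near_cst; near=> z; apply: Hc.
    by near: z; apply: nbhs_pinfty_ge; exact: num_real.
  move=> h; apply/eqP; rewrite -subr_eq0; apply/eqP/esym.
  by apply: (cvg_unique _ HL h).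
have [|||_ c1] := @regsum_cvg R R +oo _ (fun y x => lnsq y (x * pi) - 2 * ln y)
  (fun y x => cot0 y (x * pi) * pi) (fun y x => cot1 y (x * pi) * pi * pi)
  (fun y x => cot2 y (x * pi) * pi * pi * pi) (fun=> 0) 3%:R 12.
- by rewrite ltr1n.
- near=> z => x x1; have z0 : 0 < z by near: z; apply: nbhs_pinfty_gt; exact: num_real.
  have [h1 h2 h3 h4] := lnsq_third z0 x1; split => //.
  by apply: dvE (dvB h1 (dv_cst _ _)) _; rewrite subr0.
- move=> n n0; set b : R := n%:R * pi.
  have b0 : 0 < b by rewrite mulr_gt0 // ltr0n.
  have c2 : 1 + b ^+ 2 * (z^-1) ^+ 2 @[z --> +oo] --> (1 + b ^+ 2 * 0 ^+ 2 : R).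
    apply: cvgD; first exact: cvg_cst.
    apply: cvgM; first exact: cvg_cst.
    by apply: cvgr_sqr; exact: cvg_inv_infty.
  have e1 : 1 + b ^+ 2 * 0 ^+ 2 = 1 :> R by rewrite expr0n mulr0 addr0.
  rewrite e1 in c2.
  have c3 : ln (1 + b ^+ 2 * (z^-1) ^+ 2) @[z --> +oo] --> ln (1 : R).
    by apply: (continuous_cvg _ _ c2); apply: continuous_ln.
  apply: (cvgr_eq c3); first by rewrite ln1.
  near=> z; have z0 : 0 < z by near: z; apply: nbhs_pinfty_gt; exact: num_real.
  have z20 : 0 < z ^+ 2 by rewrite exprn_gt0.
  rewrite /lnsq -/b mulr_natl -lnXn // -ln_div ?posrE //; last by rewrite sqr_den_gt0.
  by congr ln; field; rewrite gt_eqF.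
apply: (cvgr_eq (cvgD (cvgB c1 (cvg_ell_infty (c := 1) ltr01)) (cvgB (cvg_ell_infty (c := 2) (ltr0Sn _ _)) (cvg_ell_infty (c := 1) ltr01)))).
  by rewrite regsum_cst mul0r !subr0 addr0.
near=> z; have z0 : 0 < z by near: z; apply: nbhs_pinfty_gt; exact: num_real.
have e2 : regsum (fun n => lnsq z (n%:R * pi) - 2 * ln z) = Greg z - ln z.
  have -> : - ln z = - (2 * ln z) / 2 by field.
  rewrite -regsum_cst -regsumD //; first exact: asum_diff3_lnsq.
  exact: asum_diff3_cst.
rewrite !fctE /= e2 /H !mul1r; move: (Greg z) (ln z) (ell _) (ell _) => g l e3 e4; ring.
Unshelve. all: end_near. Qed.

(** Letting y tend to 0 in [GregE] gives the Euler sum of ln ((n pi) ^ 2) as the limit ln 2 of ln (y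
    coth (y / 2)). *)
Lemma rho0E : rho0 = (ln pi - ln 2) / 2 :> R.
Proof.
have p0 := @pi_gt0 R.
have [|||sv c1] := @regsum_cvg R R (0^'+) _ (fun y x => lnsq y (x * pi))
  (fun y x => cot0 y (x * pi) * pi) (fun y x => cot1 y (x * pi) * pi * pi)
  (fun y x => cot2 y (x * pi) * pi * pi * pi) (fun n => ln ((n%:R * pi) ^+ 2)) 3%:R 12.
- by rewrite ltr1n.
- near=> z => x x1; have z0 : 0 < z by near: z; exact: nbhs_right_gt.
  exact: lnsq_third.
- move=> n n0; have b0 : 0 < (n%:R * pi) ^+ 2 :> R by rewrite exprn_gt0 // mulr_gt0 // ltr0n.
  have c2 : (n%:R * pi) ^+ 2 + y ^+ 2 @[y --> 0^'+] --> ((n%:R * pi) ^+ 2 + 0 ^+ 2 : R).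
    apply: cvgD; first exact: cvg_cst.
    by apply: cvgr_sqr; exact: cvg_id0.
  rewrite expr0n addr0 in c2.
  by apply: (continuous_cvg _ _ c2); apply: continuous_ln.
have c2 : Greg y @[y --> 0^'+] --> (- - ln 2 + 2 * - ln 1 : R).
  have h1 := @cvg_ell_ln R 1 ltr01; have h2 := @cvg_ell_ln R 2 (ltr0Sn _ _).
  have H : - (ell (2 * y) + ln y) + 2 * (ell (1 * y) + ln y) @[y --> 0^'+] -->
      (- - ln 2 + 2 * - ln 1 : R).
    by apply: cvgD; [exact: cvgN|apply: cvgM => //; exact: cvg_cst].
  apply: (cvgr_eq H) => //.
  near=> y; have y0 : 0 < y by near: y; exact: nbhs_right_gt.
  by rewrite GregE // mul1r; move: (ell _) (ell _) (ln y) => a b c; ring.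
have E : regsum (fun n => ln ((n%:R * pi) ^+ 2)) = ln 2 :> R.
  have U : regsum (fun n => ln ((n%:R * pi) ^+ 2)) = - - ln 2 + 2 * - ln 1 :> R.
    by apply: (cvg_unique _ c1 c2).
  by rewrite U ln1; ring.
have e n : (0 < n)%N -> - ln n%:R = ln pi + (- (1 / 2)) * ln ((n%:R * pi) ^+ 2) :> R.
  move=> n0; have n1 : 0 < n%:R :> R by rewrite ltr0n.
  rewrite lnXn ?mulr_gt0 // lnM ?posrE // -mulr_natl.
  by field.
rewrite /rho0 (eq_regsum e) regsumD; [|exact: asum_diff3_cst|].
  by rewrite regsum_cst regsumZ // E; move: (ln pi) (ln 2) => a b; field.
apply: (@eq_asum _ _ (fun k => - (1 / 2) * diff3 (fun n => ln ((n%:R * pi) ^+ 2)) k.+1)).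
  by move=> k; rewrite /diff3; ring.
exact: asumZ.
Unshelve. all: end_near. Qed.

End ZetaValues.

(** * Expansion of L and convexity *)

Section LogAsymptotics.
Context {R : realType}.
Implicit Types (x y z t h : R) (k : nat).

(* The number of l >= 1 with floor (l ^ (1/3)) = k + 1. *)
Definition mult k : R := 3 * k.+1%:R ^+ 2 + 3 * k.+1%:R + 1.

Lemma mult_gt0 k : 0 < mult k.
Proof.
by rewrite /mult ltr_wpDl // addr_ge0 // mulr_ge0 // exprn_ge0.
Qed.

Definition Ltot t : R := tsum (fun k => mult k * ell (k.+1%:R * t)).
Definition mutot t : R := tsum (fun k => mult k * (k.+1%:R * bose (k.+1%:R * t))).
Definition Vtot t : R := tsum (fun k => mult k * (k.+1%:R ^+ 2 * bose1 (k.+1%:R * t))).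

Lemma asum_mult (f : R -> R) t : (forall i, asum (fun k => k.+1%:R ^+ i * f (k.+1%:R * t))) ->
  forall i, asum (fun k => mult k * (k.+1%:R ^+ i * f (k.+1%:R * t))).
Proof.
move=> h i; apply: (@eq_asum _ _ (fun k => 3 * (k.+1%:R ^+ i.+2 * f (k.+1%:R * t))
   + 3 * (k.+1%:R ^+ i.+1 * f (k.+1%:R * t)) + k.+1%:R ^+ i * f (k.+1%:R * t))).
  by move=> k; rewrite /mult !exprS; move: (f _) => c; ring.
apply: asumD (h i); apply: asumD; [exact: asumZ (h i.+2)|exact: asumZ (h i.+1)].
Qed.

Lemma asum_Ltot t : 0 < t -> asum (fun k => mult k * ell (k.+1%:R * t)).
Proof.
move=> t0; apply: eq_asum (asum_mult (i := 0) (fun i => asum_ell (i := i) t0)) => k.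
by rewrite expr0 mul1r.
Qed.

Lemma asum_mutot t : 0 < t -> asum (fun k => mult k * (k.+1%:R * bose (k.+1%:R * t))).
Proof.
move=> t0; apply: eq_asum (asum_mult (i := 1) (fun i => asum_bose (i := i) t0)) => k.
by rewrite expr1.
Qed.

Lemma asum_bose1 i t : 0 < t -> asum (fun k => k.+1%:R ^+ i * bose1 (k.+1%:R * t)).
Proof.
move=> t0; apply: (@asum_decay R bose1 i t ((i.+2)`!%:R + (i.+1)`!%:R)) => // x x0.
  exact/ltW/bose1_gt0.
have b1 := bose_le i.+1 x0; have b2 := bose_le i x0; have b3 := bose_le1 x0.
have b0 := bose_gt0 x0.
rewrite /bose1 mulrDl lerD // expr2.
have -> : i.+1`!%:R / x ^+ i.+2 = x^-1 * (i.+1`!%:R / x ^+ i.+1).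
  by rewrite exprS invfM mulrCA.
apply: ler_pM => //; try exact: ltW.
by rewrite -ler_pdivlMl ?mulr1 in b3.
Qed.

Lemma asum_Vtot t : 0 < t -> asum (fun k => mult k * (k.+1%:R ^+ 2 * bose1 (k.+1%:R * t))).
Proof. by move=> t0; exact: (asum_mult (i := 2) (fun i => asum_bose1 (i := i) t0)). Qed.

Lemma LtotE t : 0 < t -> Ltot t = 3 * Lsum 2 t + 3 * Lsum 1 t + Lsum 0 t.
Proof.
move=> t0; have a2 := asum_ell (i := 2) t0; have a1 := asum_ell (i := 1) t0.
have a0 := asum_ell (i := 0) t0.
have b2 : asum (fun k => 3 * (k.+1%:R ^+ 2 * ell (k.+1%:R * t))) by exact: asumZ.
have b1 : asum (fun k => 3 * (k.+1%:R ^+ 1 * ell (k.+1%:R * t))) by exact: asumZ.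
rewrite /Lsum -(tsumZ 3 a2) -(tsumZ 3 a1) -(tsumD b2 b1).
rewrite -(tsumD (asumD b2 b1) a0); apply: eq_tsum => k.
by rewrite /mult; move: (ell _) => c; ring.
Qed.

(** The tangent inequality is summed term by term. In this form, with [mutot] as minus a subgradient
    of [Ltot] and [Vtot] as one for [mutot], the derivatives of L enter the argument. *)
Lemma convex_tsum (c : nat -> R) (f df : R -> R) t h :
  (forall x, 0 < x -> is_derive x 1 f (df x)) ->
  (forall x y, 0 < x -> x <= y -> df x <= df y) ->
  (forall k, 0 <= c k) ->
  asum (fun k => c k * f (k.+1%:R * t)) -> asum (fun k => c k * f (k.+1%:R * (t + h))) ->
  asum (fun k => c k * (k.+1%:R * df (k.+1%:R * t))) -> 0 < t -> 0 < t + h ->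
  tsum (fun k => c k * f (k.+1%:R * t)) + h * tsum (fun k => c k * (k.+1%:R * df (k.+1%:R * t)))
   <= tsum (fun k => c k * f (k.+1%:R * (t + h))).
Proof.
move=> fd mono c0 s1 s2 s3 t0 th0.
have s4 : asum (fun k => h * (c k * (k.+1%:R * df (k.+1%:R * t)))) by exact: asumZ.
rewrite -(tsumZ h s3) -(tsumD s1 s4).
apply: (le_tsum (asumD s1 s4) s2) => k.
have -> : c k * f (k.+1%:R * t) + h * (c k * (k.+1%:R * df (k.+1%:R * t))) =
  c k * (f (k.+1%:R * t) + df (k.+1%:R * t) * (k.+1%:R * (t + h) - k.+1%:R * t)) by ring.
apply: ler_wpM2l => //.
have kt : 0 < k.+1%:R * t by rewrite mulr_gt0.
have kth : 0 < k.+1%:R * (t + h) by rewrite mulr_gt0.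
have conv x y z : x \in [set x | 0 < x] -> y \in [set x | 0 < x] -> x <= z <= y ->
    z \in [set x : R | 0 < x].
  by rewrite !inE /= => x0 y0 /andP[xz _]; exact: lt_le_trans xz.
have kI : k.+1%:R * t \in [set x : R | 0 < x] by rewrite inE.
have kJ : k.+1%:R * (t + h) \in [set x : R | 0 < x] by rewrite inE.
have fdI x : x \in [set x : R | 0 < x] -> is_derive x 1 f (df x) by rewrite inE => x0; exact: fd.
have moI x y : x \in [set x : R | 0 < x] -> y \in [set x : R | 0 < x] -> x <= y -> df x <= df y.
  by rewrite !inE => x0 y0; exact: mono.
exact: (tangent_le kI kJ conv fdI moI).
Qed.

Lemma bose_mono x y : 0 < x -> x <= y -> bose y <= bose x.
Proof.
move=> x0 xy; have y0 : 0 < y by exact: lt_le_trans xy.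
by rewrite lef_pV2 ?posrE ?expR_sub1_gt0 // lerD2r ler_expR.
Qed.

Lemma Ltot_convex t h : 0 < t -> 0 < t + h -> Ltot t - h * mutot t <= Ltot (t + h).
Proof.
move=> t0 th0.
have aN : asum (fun k => mult k * (k.+1%:R * - bose (k.+1%:R * t))).
  by apply: eq_asum (asumN (asum_mutot t0)) => k; rewrite !mulrN.
have := @convex_tsum mult ell (fun x => - bose x) t h _ _ _ (asum_Ltot t0) (asum_Ltot th0) aN t0 th0.
have -> : tsum (fun k => mult k * (k.+1%:R * - bose (k.+1%:R * t))) = - mutot t.
  by rewrite /mutot -tsumN; [apply: eq_tsum => k; rewrite !mulrN|exact: asum_mutot].
rewrite mulrN; apply.
- by move=> x; exact: dv_ell.
- by move=> x y x0 xy; rewrite lerN2; exact: bose_mono.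
by move=> k; exact/ltW/mult_gt0.
Qed.

Lemma mutot_convex t h : 0 < t -> 0 < t + h -> mutot t - h * Vtot t <= mutot (t + h).
Proof.
move=> t0 th0.
have e s : (fun k => mult k * k.+1%:R * bose (k.+1%:R * s)) = (fun k => mult k * (k.+1%:R * bose (k.+1%:R * s))).
  by apply/funext => k; rewrite mulrA.
have e' : (fun k => mult k * k.+1%:R * (k.+1%:R * - bose1 (k.+1%:R * t))) =
  (fun k => - (mult k * (k.+1%:R ^+ 2 * bose1 (k.+1%:R * t)))).
  by apply/funext => k; move: (bose1 _) (mult _) => b c; ring.
have a1 : asum (fun k => mult k * k.+1%:R * bose (k.+1%:R * t)) by rewrite e; exact: asum_mutot.
have a2 : asum (fun k => mult k * k.+1%:R * bose (k.+1%:R * (t + h))) by rewrite e; exact: asum_mutot.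
have aN : asum (fun k => mult k * k.+1%:R * (k.+1%:R * - bose1 (k.+1%:R * t))).
  by rewrite e'; apply: asumN; exact: asum_Vtot.
have := @convex_tsum (fun k => mult k * k.+1%:R) bose (fun x => - bose1 x) t h _ _ _ a1 a2 aN t0 th0.
rewrite !e e' (tsumN (asum_Vtot t0)) mulrN; apply.
- by move=> x; exact: dv_bose.
- move=> x y x0 xy; rewrite lerN2; have h1 := bose_mono x0 xy.
  have y0 := bose_gt0 (lt_le_trans x0 xy).
  by rewrite /bose1 lerD // lerXn2r ?nnegrE // ltW // (lt_le_trans y0).
by move=> k; rewrite mulr_ge0 // ltW // mult_gt0.
Qed.

(* [Ltot t = cA / t ^ 3 + cB / t ^ 2 + cC / t + 3 / 4 ln t + cD + o(1)]. *)
Definition cA : R := pi ^+ 4 / 15.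
Definition cB : R := 3 * zsum 3.
Definition cC : R := pi ^+ 2 / 6.
Definition cD : R := - (3 * zsum 3 / (4 * pi ^+ 2)) - (rho1 + ln 2 / 3) - ln (2 * pi) / 2.

Definition phi (a b c e : R) t : R := a / t ^+ 3 + b / t ^+ 2 + c / t + e * ln t.

(** The logarithmic coefficient is 3 / 12 + 1 / 2 = 3 / 4; the constant of L_0 joins with [rho0E] to
    give - ln (2 pi) / 2. *)
Lemma Ltot_asymp : Ltot t - phi cA cB cC (3 / 4) t @[t --> 0^'+] --> (cD : R).
Proof.
have [z2 z4] := @zsum_values R.
have H : 3 * (Lsum 2 t - 2 * zsum 4 / t ^+ 3) + 3 * (Lsum 1 t - zsum 3 / t ^+ 2 - ln t / 12)
   + (Lsum 0 t - zsum 2 / t - ln t / 2) @[t --> 0^'+] -->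
   (3 * (- zsum 3 / (4 * pi ^+ 2)) + 3 * (- (rho1 + ln 2 / 3) / 3) + - (rho0 + ln 2) : R).
  apply: cvgD; last exact: Lsum0_asymp.
  by apply: cvgD; (apply: cvgM; first exact: cvg_cst); [exact: Lsum2_asymp|exact: Lsum1_asymp].
apply: (cvgr_eq H).
  rewrite rho0E /cD lnM ?posrE ?pi_gt0 //.
  have := @pi_gt0 R; move: (ln 2) (ln (pi : R)) (zsum 3) rho1 (pi : R) => a b c d p p0.
  by field; rewrite gt_eqF.
near=> t; have t0 : 0 < t by near: t; exact: nbhs_right_gt.
rewrite LtotE // /phi /cA /cB /cC z2 z4.
by move: (Lsum 0 t) (Lsum 1 t) (Lsum 2 t) (zsum 3) (pi : R) (ln t) => a b c d p l; field; rewrite gt_eqF.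
Unshelve. all: end_near. Qed.

(** The slope lies between two chords of step [h]. Curvature of the approximation costs [M h], and
    its distance [eta] from the convex function costs [2 eta / h]. *)
Lemma convex_slope (F0 Fp Fm f p0 pp pm dp M h eta : R) : 0 < h ->
  F0 - h * f <= Fp -> F0 + h * f <= Fm ->
  `|pp - p0 - h * dp| <= M * h ^+ 2 -> `|pm - p0 - - h * dp| <= M * h ^+ 2 ->
  `|F0 - p0| <= eta -> `|Fp - pp| <= eta -> `|Fm - pm| <= eta ->
  `|f + dp| <= M * h + 2 * eta / h.
Proof.
move=> h0 c1 c2; rewrite !ler_norml => t1 t2 e0 e1 e2.
have -> : M * h + 2 * eta / h = (M * h ^+ 2 + 2 * eta) / h by field; rewrite gt_eqF.
by rewrite -(mulNr _ h^-1) ler_pdivlMr // ler_pdivrMr //; apply/andP; split; lra.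
Qed.

Definition dphi (a b c e : R) t : R := - (3 * a / t ^+ 4) - 2 * b / t ^+ 3 - c / t ^+ 2 + e / t.
Definition ddphi (a b c e : R) t : R := 12 * a / t ^+ 5 + 6 * b / t ^+ 4 + 2 * c / t ^+ 3 - e / t ^+ 2.

Lemma dv_invX n x : 0 < x -> is_derive x 1 (fun t => (t ^+ n)^-1) (- (n%:R / x ^+ n.+1)).
Proof.
move=> x0; have h := dvV (f := fun t => t ^+ n) (lt0r_neq0 (exprn_gt0 n x0)) (dvX n (dv_id x)).
apply: dvE h _; case: n => [|n] /=; first by rewrite !mul0r oppr0 mul0r.
rewrite mulr1 -mulNr [x ^+ n.+2]exprS [x ^+ n.+1]exprS.
have xn : x ^+ n != 0 by rewrite expf_neq0 // gt_eqF.
by move: (x ^+ n) (n.+1%:R) xn => X k xn; field; rewrite xn gt_eqF.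
Qed.

Lemma dv_phi a b c e x : 0 < x -> is_derive x 1 (phi a b c e) (dphi a b c e x).
Proof.
move=> x0; have h1 := dv_invX 1 x0.
apply: dvE (dvD (dvD (dvD (dvZ a (dv_invX 3 x0)) (dvZ b (dv_invX 2 x0)))
  (dvZ c (dvV (f := id) (lt0r_neq0 x0) (dv_id x)))) (dvZ e (dv_ln (f := id) x0 (dv_id x)))) _.
by rewrite /dphi /=; field; rewrite gt_eqF.
Qed.

Lemma dv_dphi a b c e x : 0 < x -> is_derive x 1 (dphi a b c e) (ddphi a b c e x).
Proof.
move=> x0.
apply: dvE (dvD (dvB (dvB (dvN (dvZ (3 * a) (dv_invX 4 x0))) (dvZ (2 * b) (dv_invX 3 x0)))
  (dvZ c (dv_invX 2 x0))) (dvZ e (dvV (f := id) (lt0r_neq0 x0) (dv_id x)))) _.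
by rewrite /ddphi /=; field; rewrite gt_eqF.
Qed.

(** All terms are compared with the most singular one; 32 is 2 ^ 5, from [x >= t / 2]. *)
Lemma ddphi_le a b c e x t : 0 < t -> t <= 1 / 2 -> `|x - t| <= t / 2 ->
  `|ddphi a b c e x| <= (12 * `|a| + 6 * `|b| + 2 * `|c| + `|e|) * 32 / t ^+ 5.
Proof.
move=> t0 t1; rewrite ler_norml => xt.
have x0 : 0 < x by lra.
have x1 : x <= 1 by lra.
have -> : ddphi a b c e x = (12 * a + 6 * b * x + 2 * c * x ^+ 2 - e * x ^+ 3) / x ^+ 5.
  by rewrite /ddphi; field; rewrite gt_eqF.
rewrite normrM normfV (gtr0_norm (exprn_gt0 5 x0)).
apply: (@le_trans _ _ ((12 * `|a| + 6 * `|b| + 2 * `|c| + `|e|) / x ^+ 5)).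
  rewrite ler_pM2r ?invr_gt0 ?exprn_gt0 //.
  have m n u : `|u * x ^+ n| <= `|u|.
    by rewrite normrM ler_piMr // ger0_norm ?exprn_ge0 ?exprn_ile1 // ltW.
  apply: le_trans (ler_normB _ _) _; apply: lerD; last exact: m.
  apply: le_trans (ler_normD _ _) _; apply: lerD; last first.
    by apply: le_trans (m _ _) _; rewrite normrM gtr0_norm.
  apply: le_trans (ler_normD _ _) _; apply: lerD; first by rewrite normrM gtr0_norm.
  by have := m 1%N (6 * b); rewrite expr1 (normrM 6) (gtr0_norm (x := 6)).
rewrite -mulrA ler_wpM2l ?addr_ge0 ?mulr_ge0 //.
rewrite -[leRHS]invrK invf_div lef_pV2 ?posrE ?exprn_gt0 ?divr_gt0 //; last exact: exprn_gt0.
have -> : t ^+ 5 / 32 = (t / 2) ^+ 5 by field.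
apply: lerXn2r; rewrite ?nnegrE; lra.
Qed.

End LogAsymptotics.

(** * First and second moments *)

Section Moments.
Context {R : realType}.
Implicit Types (x y z t h : R) (k : nat).

(** t ^ (5/2), the order of the inverse standard deviation, since V is of order t ^ -5. *)
Definition w52 t : R := t ^+ 2 * Num.sqrt t.

Lemma w52_gt0 t : 0 < t -> 0 < w52 t.
Proof. by move=> t0; rewrite mulr_gt0 ?exprn_gt0 ?sqrtr_gt0. Qed.

Lemma w52_sqr t : 0 <= t -> w52 t ^+ 2 = t ^+ 5.
Proof. by move=> t0; rewrite /w52 exprMn sqr_sqrtr // -exprM -exprSr. Qed.

Lemma sqrt_le1 t : t <= 1 -> Num.sqrt t <= 1.
Proof. by move=> t1; rewrite -(sqrtr1 R) ler_wsqrtr. Qed.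

Lemma w52_le t : 0 < t -> t <= 1 -> w52 t <= t.
Proof.
move=> t0 t1; rewrite /w52 expr2 -mulrA ler_piMr ?(ltW t0) //.
by rewrite mulr_ile1 ?sqrtr_ge0 ?sqrt_le1 // ltW.
Qed.

Lemma cvg_sqrt0 : Num.sqrt t @[t --> 0^'+] --> (0 : R).
Proof.
have h : Num.sqrt t @[t --> 0^'+] --> Num.sqrt (0 : R).
  by apply: cvg_at_right_filter; exact: sqrt_continuous.
by rewrite sqrtr0 in h.
Qed.

(* [- f t] is a subgradient of the convex function [F] at [t]. *)
Definition minorant (F f : R -> R) : Prop :=
  forall t h, 0 < t -> 0 < t + h -> F t - h * f t <= F (t + h).

Lemma near_at_right (P : R -> Prop) : (\forall t \near 0^'+, P t) ->
  exists2 d, 0 < d & forall t, 0 < t -> t < d -> P t.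
Proof.
move=> [d /= d0 dP]; exists d => // t t0 td; apply: dP => //=.
by rewrite sub0r normrN gtr0_norm.
Qed.

Lemma at_right_near (P : R -> Prop) d : 0 < d -> (forall t, 0 < t -> t < d -> P t) ->
  \forall t \near 0^'+, P t.
Proof.
move=> d0 dP; exists d => // t; rewrite /ball_ /= sub0r normrN => td t0.
by apply: dP => //; rewrite -(gtr0_norm t0).
Qed.

(** The step [h = dl * t ^ (5/2)] balances the two errors of [convex_slope]: curvature gives a
    multiple of [dl / t ^ (5/2)], and an error [eta = o(1)] in [F] gives [eta / (dl t ^ (5/2))].
    Thus an expansion up to o(1) fixes the slope up to o(t ^ (-5/2)), the precision that the local
    limit theorem asks for. *)
Lemma slope_asymp (F f : R -> R) (a b c e D : R) : minorant F f ->
  F t - phi a b c e t @[t --> 0^'+] --> D ->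
  (f t + dphi a b c e t) * w52 t @[t --> 0^'+] --> 0.
Proof.
move=> conv /cvgrPdist_le FD.
pose K := (12 * `|a| + 6 * `|b| + 2 * `|c| + `|e|) * 32.
have K0 : 0 <= K by rewrite mulr_ge0 // !addr_ge0 // mulr_ge0.
apply/cvgrPdist_le => ep ep0.
pose dl := Num.min (1 / 2) (ep / (2 * (K + 1))).
have dl0 : 0 < dl by rewrite lt_min divr_gt0 ?divr_gt0 ?mulr_gt0 //; lra.
have dl12 : dl <= 1 / 2 by rewrite ge_min lexx.
have dlK : K * dl <= ep / 2.
  apply: (@le_trans _ _ ((K + 1) * (ep / (2 * (K + 1))))).
    by apply: ler_pM => //; rewrite ?(ltW dl0) ?ge_min ?lexx ?orbT //; lra.
  by apply: eq_leR; field; rewrite gt_eqF //; lra.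
have eta0 : 0 < ep * dl / 4 by rewrite divr_gt0 // mulr_gt0.
have [d0 d00 dP] := near_at_right (FD _ eta0).
apply: (@at_right_near _ (Num.min (1 / 2) (d0 / 2))); first by rewrite lt_min !divr_gt0.
move=> t t0; rewrite lt_min => /andP[t12 td]; rewrite sub0r normrN.
have w0 := w52_gt0 t0; have wt : w52 t <= t by apply: w52_le => //; lra.
pose h := dl * w52 t.
have h0 : 0 < h by rewrite mulr_gt0.
have ht : h <= t / 2.
  rewrite /h (_ : t / 2 = 1 / 2 * t); last by field.
  by apply: ler_pM => //; exact: ltW.
have r s : `|s - t| <= t / 2 -> `|F s - (phi a b c e s + D)| <= ep * dl / 4.
  rewrite ler_norml => st; have s0 : 0 < s by lra.
  have sd : s < d0 by lra.
  by rewrite opprD addrA distrC; exact: dP.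
have tay u : `|u| <= t / 2 ->
    `|(phi a b c e (t + u) + D) - (phi a b c e t + D) - u * dphi a b c e t| <= K / t ^+ 5 * u ^+ 2.
  move=> ut; have -> : phi a b c e (t + u) + D - (phi a b c e t + D) = phi a b c e (t + u) - phi a b c e t by ring.
  have T : forall z, `|z - t| <= t / 2 -> [/\ is_derive z 1 (phi a b c e) (dphi a b c e z),
      is_derive z 1 (dphi a b c e) (ddphi a b c e z) & `|ddphi a b c e z| <= K / t ^+ 5].
    move=> z zt; have z0 : 0 < z by move: zt; rewrite ler_norml; lra.
    split; [exact: dv_phi|exact: dv_dphi|apply: ddphi_le => //; exact: ltW].
  exact: (taylor2_le T ut).
have hn : `|h| <= t / 2 by rewrite gtr0_norm.
have hn' : `|- h| <= t / 2 by rewrite normrN.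
have th : 0 < t + - h by lra.
have thp : 0 < t + h by lra.
have c2 := conv t (- h) t0 th; rewrite mulNr opprK in c2.
have t2 := tay _ hn'; rewrite sqrrN in t2.
have r0 := r t; rewrite subrr normr0 in r0.
have r1 := r (t + h); rewrite addrAC subrr add0r in r1.
have r2 := r (t + - h); rewrite addrAC subrr add0r in r2.
have t20 : 0 <= t / 2 by lra.
have S := convex_slope h0 (conv t h t0 thp) c2 (tay _ hn) t2 (r0 t20) (r1 hn) (r2 hn').
rewrite normrM (gtr0_norm w0); apply: (@le_trans _ _ ((K / t ^+ 5 * h + 2 * (ep * dl / 4) / h) * w52 t)).
  by rewrite ler_pM2r.
have -> : (K / t ^+ 5 * h + 2 * (ep * dl / 4) / h) * w52 t = K * dl * (w52 t ^+ 2 / t ^+ 5) + ep / 2.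
  by rewrite /h; field; rewrite !gt_eqF.
rewrite w52_sqr ?(ltW t0) // divff ?gt_eqF ?exprn_gt0 // mulr1; lra.
Qed.

(** The terms c / t ^ 2 and e / t of [dphi] are themselves o(t ^ (-5/2)). *)
Lemma first_moment_asymp (F f : R -> R) (a b c e D : R) : minorant F f ->
  F t - phi a b c e t @[t --> 0^'+] --> D ->
  (f t - (3 * a / t ^+ 4 + 2 * b / t ^+ 3)) * w52 t @[t --> 0^'+] --> 0.
Proof.
move=> conv FD; have H0 := slope_asymp conv FD.
have H : (f t + dphi a b c e t) * w52 t + (c * Num.sqrt t - e * (t * Num.sqrt t)) @[t --> 0^'+] -->
   (0 + (c * 0 - e * (0 * 0)) : R).
  apply: cvgD => //; apply: cvgB; apply: cvgM; try exact: cvg_cst; first exact: cvg_sqrt0.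
  by apply: cvgM; [exact: cvg_id0|exact: cvg_sqrt0].
apply: (cvgr_eq H); first by rewrite !mulr0 subr0 addr0.
near=> t; have t0 : 0 < t by near: t; exact: nbhs_right_gt.
by rewrite /w52 /dphi; move: (Num.sqrt t) (f t) => s u; field; rewrite gt_eqF.
Unshelve. all: end_near. Qed.

(** Here only the leading term 3 a / t ^ 4 matters, and a step proportional to [t] suffices. *)
Lemma second_moment_asymp (F f : R -> R) (a b : R) : minorant F f ->
  (F t - (3 * a / t ^+ 4 + 2 * b / t ^+ 3)) * w52 t @[t --> 0^'+] --> 0 ->
  t ^+ 5 * f t @[t --> 0^'+] --> 12 * a.
Proof.
move=> conv H0.
have H1 : t ^+ 4 * F t @[t --> 0^'+] --> 3 * a.
  have H : (F t - (3 * a / t ^+ 4 + 2 * b / t ^+ 3)) * w52 t * (t * Num.sqrt t) + (3 * a + 2 * b * t)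
     @[t --> 0^'+] --> (0 * (0 * 0) + (3 * a + 2 * b * 0) : R).
    apply: cvgD.
      by apply: cvgM => //; apply: cvgM; [exact: cvg_id0|exact: cvg_sqrt0].
    by apply: cvgD; [exact: cvg_cst|apply: cvgM; [exact: cvg_cst|exact: cvg_id0]].
  apply: (cvgr_eq H); first by rewrite !mulr0 addr0 add0r.
  near=> t; have t0 : 0 < t by near: t; exact: nbhs_right_gt.
  have -> : (F t - (3 * a / t ^+ 4 + 2 * b / t ^+ 3)) * w52 t * (t * Num.sqrt t) =
    (F t - (3 * a / t ^+ 4 + 2 * b / t ^+ 3)) * t ^+ 3 * Num.sqrt t ^+ 2.
    by rewrite /w52; ring.
  by rewrite sqr_sqrtr ?(ltW t0) //; field; rewrite gt_eqF.
move/cvgrPdist_le : H1 => H1.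
pose K := 60 * `|a| * 64.
have K0 : 0 <= K by rewrite !mulr_ge0.
apply/cvgrPdist_le => ep ep0.
pose dl := Num.min (1 / 2) (ep / (2 * (K + 1))).
have dl0 : 0 < dl by rewrite lt_min divr_gt0 ?divr_gt0 ?mulr_gt0 //; lra.
have dl12 : dl <= 1 / 2 by rewrite ge_min lexx.
have dlK : K * dl <= ep / 2.
  apply: (@le_trans _ _ ((K + 1) * (ep / (2 * (K + 1))))).
    by apply: ler_pM => //; rewrite ?(ltW dl0) ?ge_min ?lexx ?orbT //; lra.
  by apply: eq_leR; field; rewrite gt_eqF //; lra.
have eta0 : 0 < ep * dl / 64 by rewrite divr_gt0 // mulr_gt0.
have [d0 d00 dP] := near_at_right (H1 _ eta0).
apply: (@at_right_near _ (d0 / 2)); first by rewrite divr_gt0.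
move=> t t0 td.
pose h := dl * t.
have h0 : 0 < h by rewrite mulr_gt0.
have ht : h <= t / 2.
  rewrite /h (_ : t / 2 = 1 / 2 * t); last by field.
  by rewrite ler_pM2r.
pose g s := 3 * a * (s ^+ 4)^-1.
have r s : `|s - t| <= t / 2 -> `|F s - g s| <= ep * dl / 4 / t ^+ 4.
  rewrite ler_norml => st; have s0 : 0 < s by lra.
  have := dP s s0; rewrite distrC => hs.
  have {}hs : `|s ^+ 4 * F s - 3 * a| <= ep * dl / 64 by apply: hs; lra.
  have -> : F s - g s = (s ^+ 4 * F s - 3 * a) / s ^+ 4 by rewrite /g; field; rewrite gt_eqF.
  rewrite normrM normfV (gtr0_norm (exprn_gt0 4 s0)).
  have -> : ep * dl / 4 / t ^+ 4 = ep * dl / 64 / (t / 2) ^+ 4 by field; rewrite gt_eqF.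
  have t2 : 0 < t / 2 by lra.
  apply: ler_pM => //; first by rewrite invr_ge0 exprn_ge0 // ltW.
  rewrite lef_pV2 ?posrE ?exprn_gt0 //; apply: lerXn2r; rewrite ?nnegrE; lra.
have tay u : `|u| <= t / 2 ->
    `|g (t + u) - g t - u * - (12 * a / t ^+ 5)| <= K / t ^+ 6 * u ^+ 2.
  move=> ut.
  suff T : forall z, `|z - t| <= t / 2 -> [/\ is_derive z 1 g (- (12 * a / z ^+ 5)),
      is_derive z 1 (fun s => - (12 * a / s ^+ 5)) (60 * a / z ^+ 6) & `|60 * a / z ^+ 6| <= K / t ^+ 6].
    exact: (@taylor2_le R g (fun s => - (12 * a / s ^+ 5)) (fun s => 60 * a / s ^+ 6) t u (t / 2) (K / t ^+ 6) T ut).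
  move=> z zt; have z0 : 0 < z by move: zt; rewrite ler_norml; lra.
  split.
  - by apply: dvE (dvZ (3 * a) (dv_invX 4 z0)) _; ring.
  - by apply: dvE (dvN (dvZ (12 * a) (dv_invX 5 z0))) _; ring.
  rewrite normrM normfV (gtr0_norm (exprn_gt0 6 z0)) normrM gtr0_norm //.
  have -> : K / t ^+ 6 = 60 * `|a| / (t / 2) ^+ 6 by rewrite /K; field; rewrite gt_eqF.
  have t2 : 0 < t / 2 by lra.
  rewrite ler_wpM2l ?mulr_ge0 // lef_pV2 ?posrE ?exprn_gt0 //.
  by apply: lerXn2r; rewrite ?nnegrE; move: zt; rewrite ler_norml; lra.
have hn : `|h| <= t / 2 by rewrite gtr0_norm.
have hn' : `|- h| <= t / 2 by rewrite normrN.
have th : 0 < t + - h by lra.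
have thp : 0 < t + h by lra.
have c2 := conv t (- h) t0 th; rewrite mulNr opprK in c2.
have t2 := tay _ hn'; rewrite sqrrN in t2.
have r0 := r t; rewrite subrr normr0 in r0.
have r1 := r (t + h); rewrite addrAC subrr add0r in r1.
have r2 := r (t + - h); rewrite addrAC subrr add0r in r2.
have t20 : 0 <= t / 2 by lra.
have S := convex_slope h0 (conv t h t0 thp) c2 (tay _ hn) t2 (r0 t20) (r1 hn) (r2 hn').
have t5 : 0 < t ^+ 5 by rewrite exprn_gt0.
have -> : 12 * a - t ^+ 5 * f t = - (t ^+ 5 * (f t + - (12 * a / t ^+ 5))).
  by field; rewrite gt_eqF.
rewrite normrN normrM (gtr0_norm t5); apply: (@le_trans _ _ (t ^+ 5 * (K / t ^+ 6 * h + 2 * (ep * dl / 4 / t ^+ 4) / h))).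
  by rewrite ler_pM2l.
have -> : t ^+ 5 * (K / t ^+ 6 * h + 2 * (ep * dl / 4 / t ^+ 4) / h) = K * dl + ep / 2.
  by rewrite /h; field; rewrite !gt_eqF.
lra.
Unshelve. all: end_near. Qed.

(** [y ^ 5] combines the third moment weight with the multiplicity of order [k ^ 2], and the shape C
    / (1 + y ^ 2) is what [atan_partial] sums. Each power of [bose] beyond the first is absorbed by
    [y * bose y <= 1]. *)
Lemma bose_pow_bound : exists2 C : R, 0 < C & forall y, 0 < y ->
  y ^+ 5 * (bose y + bose y ^+ 2 + bose y ^+ 3 + bose y ^+ 4) <= C / (1 + y ^+ 2).
Proof.
have [f [f0 fb]] : exists f : nat -> R, (forall n, 0 < f n) /\
    (forall n y, 0 < y -> bose y <= f n / y ^+ n.+1).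
  exists (fun n => n.+1`!%:R); split=> [n|n y y0]; last exact: bose_le.
  by rewrite ltr0n fact_gt0.
exists (f 4%N + f 6%N + f 3%N + f 5%N + f 2%N + f 4%N + f 1%N + f 3%N); first by rewrite !addr_gt0 ?f0.
move=> y y0; have D0 := den_gt0 y; rewrite ler_pdivlMr //.
have b0 := bose_gt0 y0; have b1 := bose_le1 y0.
have bn n : 0 < y ^+ n.+1 * bose y <= f n.
  by rewrite mulr_gt0 ?exprn_gt0 //= -ler_pdivlMl ?exprn_gt0 // mulrC fb.
have yb : 0 <= y * bose y <= 1 by rewrite b1 andbT mulr_ge0 // ltW.
have P i n : (y * bose y) ^+ i * (y ^+ n.+1 * bose y) <= f n.
  have /andP[p0 p1] := bn n; apply: le_trans p1; case/andP: yb => q0 q1.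
  by rewrite ler_piMl ?exprn_ile1 // ltW.
have -> : y ^+ 5 * (bose y + bose y ^+ 2 + bose y ^+ 3 + bose y ^+ 4) * (1 + y ^+ 2) =
  (y * bose y) ^+ 0 * (y ^+ 5 * bose y) + (y * bose y) ^+ 0 * (y ^+ 7 * bose y) +
  (y * bose y) ^+ 1 * (y ^+ 4 * bose y) + (y * bose y) ^+ 1 * (y ^+ 6 * bose y) +
  (y * bose y) ^+ 2 * (y ^+ 3 * bose y) + (y * bose y) ^+ 2 * (y ^+ 5 * bose y) +
  (y * bose y) ^+ 3 * (y ^+ 2 * bose y) + (y * bose y) ^+ 3 * (y ^+ 4 * bose y) by ring.
have h1 := P 0%N 4%N; have h2 := P 0%N 6%N; have h3 := P 1%N 3%N; have h4 := P 1%N 5%N.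
have h5 := P 2%N 2%N; have h6 := P 2%N 4%N; have h7 := P 3%N 1%N; have h8 := P 3%N 3%N.
exact: lerD (lerD (lerD (lerD (lerD (lerD (lerD h1 h2) h3) h4) h5) h6) h7) h8.
Qed.

(** The four powers of [bose] are those of the cubic error in [geom_factor_gfac]. Against the cube
    of a standard deviation of order t ^ (-5/2), the bound t ^ -6 leaves t ^ (3/2), which tends to
    0. *)
Lemma third_moment_bound : exists2 C : R, 0 < C & forall t n, 0 < t ->
  \sum_(0 <= k < n) mult k * (k.+1%:R ^+ 3 * (bose (k.+1%:R * t) + bose (k.+1%:R * t) ^+ 2 +
     bose (k.+1%:R * t) ^+ 3 + bose (k.+1%:R * t) ^+ 4)) <= C / t ^+ 6.
Proof.
have [C C0 CP] := bose_pow_bound; have p0 := @pi_gt0 R.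
exists (7 * C * (pi / 2)); first by rewrite !mulr_gt0 // divr_gt0.
move=> t n t0; have t6 : 0 < t ^+ 6 by rewrite exprn_gt0.
apply: (@le_trans _ _ (7 * C / t ^+ 6 * \sum_(0 <= k < n) t / (1 + (k.+1%:R * t) ^+ 2))).
  rewrite mulr_sumr; apply: ler_sum => k _.
  have kt : 0 < k.+1%:R * t by rewrite mulr_gt0.
  have k1 : 1 <= k.+1%:R :> R by rewrite ler1n.
  have h := CP _ kt; have b0 := bose_gt0 kt.
  set S := bose _ + _ + _ + _ in h *.
  have S0 : 0 <= S by rewrite !addr_ge0 ?exprn_ge0 // ltW.
  have D0 := den_gt0 (k.+1%:R * t).
  have m7 : mult k <= 7 * k.+1%:R ^+ 2 :> R.
    rewrite /mult -subr_ge0 (_ : _ - _ = (4 * k.+1%:R + 1) * (k.+1%:R - 1)); last by ring.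
    by rewrite mulr_ge0 ?subr_ge0 //; lra.
  apply: (@le_trans _ _ (7 * k.+1%:R ^+ 2 * (k.+1%:R ^+ 3 * S))).
    by rewrite ler_wpM2r // mulr_ge0 // exprn_ge0.
  have -> : 7 * k.+1%:R ^+ 2 * (k.+1%:R ^+ 3 * S) = 7 / t ^+ 5 * ((k.+1%:R * t) ^+ 5 * S).
    by field; rewrite gt_eqF.
  have -> : 7 * C / t ^+ 6 * (t / (1 + (k.+1%:R * t) ^+ 2)) = 7 / t ^+ 5 * (C / (1 + (k.+1%:R * t) ^+ 2)).
    by move: (1 + _) D0 => d d0; field; rewrite !gt_eqF.
  by rewrite ler_wpM2l // divr_ge0 // exprn_ge0 // ltW.
have -> : 7 * C * (pi / 2) / t ^+ 6 = 7 * C / t ^+ 6 * (pi / 2) by rewrite mulrAC.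
by rewrite ler_wpM2l ?atan_partial // !mulr_ge0 ?invr_ge0 ?(ltW C0) ?(ltW t6).
Qed.

End Moments.

Local Open Scope complex_scope.
Import ComplexField.Normc.
Local Notation Re := complex.Re.
Local Notation Im := complex.Im.
Local Notation cabs u := (asum (fun k => normc (u k))).

(** * Complex power series and the zeta function *)

(** Taken componentwise so that the results on real series transfer. *)
Definition csum {R : realType} (u : nat -> R[i]) : R[i] :=
  tsum (fun k => complex.Re (u k)) +i* tsum (fun k => complex.Im (u k)).

Section ComplexSeries.
Context {R : realType}.
Implicit Types (z w c : R[i]) (u v : nat -> R[i]).

Lemma cReD z w : Re (z + w) = Re z + Re w. Proof. by case: z w => [a b] [c d]. Qed.
Lemma cImD z w : Im (z + w) = Im z + Im w. Proof. by case: z w => [a b] [c d]. Qed.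
Lemma cReN z : Re (- z) = - Re z. Proof. by case: z. Qed.
Lemma cImN z : Im (- z) = - Im z. Proof. by case: z. Qed.
Lemma cReM z w : Re (z * w) = Re z * Re w - Im z * Im w. Proof. by case: z w => [a b] [c d]. Qed.
Lemma cImM z w : Im (z * w) = Re z * Im w + Im z * Re w.
Proof. by case: z w => [a b] [c d]. Qed.
Lemma complexP z w : Re z = Re w -> Im z = Im w -> z = w.
Proof. by case: z w => [a b] [c d] /= -> ->. Qed.

Lemma normc_ge0 z : 0 <= normc z.
Proof. by case: z => a b /=; exact: sqrtr_ge0. Qed.

Lemma Re_le_normc z : `|Re z| <= normc z.
Proof.
case: z => a b /=; rewrite -sqrtr_sqr; apply: ler_wsqrtr.
by rewrite lerDl sqr_ge0.
Qed.

Lemma Im_le_normc z : `|Im z| <= normc z.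
Proof.
case: z => a b /=; rewrite -sqrtr_sqr; apply: ler_wsqrtr.
by rewrite lerDr sqr_ge0.
Qed.

Lemma normc_real (x : R) : normc x%:C = `|x|.
Proof. by rewrite /= expr0n addr0 sqrtr_sqr. Qed.

Lemma normc_le_ReIm z : normc z <= `|Re z| + `|Im z|.
Proof.
rewrite {1}(complexE z); apply: le_trans (le_normcD _ _) _.
rewrite normcM !normc_real (_ : normc 'i%C = 1) ?mul1r //.
by rewrite /= expr0n add0r expr1n sqrtr1.
Qed.

Lemma normcX z n : normc (z ^+ n) = normc z ^+ n.
Proof. by elim: n => [|n IH]; rewrite ?expr0 ?normc1 // !exprS normcM IH. Qed.

Lemma normc_eq0 z : (normc z == 0) = (z == 0).
Proof.
apply/eqP/eqP => [/eq0_normc //|->]; exact: normc0.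
Qed.

Lemma cabs_ReIm u : cabs u -> asum (fun k => Re (u k)) /\ asum (fun k => Im (u k)).
Proof.
by move=> su; split; apply: asum_le (asum_cvg su) => k; [exact: Re_le_normc|exact: Im_le_normc].
Qed.

Lemma cabs_le u (v : nat -> R) : (forall k, normc (u k) <= v k) -> cvgn (series v) -> cabs u.
Proof. by move=> uv; apply: asum_le => k; rewrite ger0_norm ?normc_ge0. Qed.

Lemma eq_csum u v : u =1 v -> csum u = csum v.
Proof. by move=> /funext->. Qed.

Lemma csumD u v : cabs u -> cabs v -> csum (fun k => u k + v k) = csum u + csum v.
Proof.
move=> /cabs_ReIm[u1 u2] /cabs_ReIm[v1 v2]; rewrite /csum.
apply: complexP => /=; rewrite -tsumD //; apply: eq_tsum => k; [exact: cReD|exact: cImD].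
Qed.

Lemma cabsZ c u : cabs u -> cabs (fun k => c * u k).
Proof.
by move=> su; apply: cabs_le (asum_cvg (asumZ (c := normc c) su)) => k; rewrite normcM.
Qed.

Lemma csumZ c u : cabs u -> csum (fun k => c * u k) = c * csum u.
Proof.
move=> /cabs_ReIm[u1 u2]; apply: complexP.
  rewrite cReM /= -!tsumZ // -tsumB; [|exact: asumZ|exact: asumZ].
  by apply: eq_tsum => k; rewrite cReM.
rewrite cImM /= -!tsumZ // -tsumD; [|exact: asumZ|exact: asumZ].
by apply: eq_tsum => k; rewrite cImM.
Qed.

Lemma csum_recl u : cabs u -> csum u = u 0%N + csum (fun k => u k.+1).
Proof.
move=> /cabs_ReIm[u1 u2]; apply: complexP.
  by rewrite cReD /= tsum_recl.
by rewrite cImD /= tsum_recl.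
Qed.

Lemma normc_csum u : cabs u -> normc (csum u) <= 2 * tsum (fun k => normc (u k)).
Proof.
move=> su; have [u1 u2] := cabs_ReIm su.
apply: le_trans (normc_le_ReIm _) _; rewrite mulr_natl mulr2n /=.
apply: lerD.
  apply: le_trans (ler_norm_tsum u1) _.
  by apply: le_tsum => //; [exact: asum_norm|move=> k; exact: Re_le_normc].
apply: le_trans (ler_norm_tsum u2) _.
by apply: le_tsum => //; [exact: asum_norm|move=> k; exact: Im_le_normc].
Qed.

Lemma csum_exchange (f : nat -> nat -> R[i]) (B : nat -> R) :
  (forall n, cabs (f n)) -> (forall n, tsum (fun k => normc (f n k)) <= B n) ->
  cvgn (series B) ->
  [/\ cabs (fun k => csum (f ^~ k)) &
      csum (fun n => csum (f n)) = csum (fun k => csum (f ^~ k))].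
Proof.
move=> sf fB sB.
have ex (T : R[i] -> R) : (forall z, `|T z| <= normc z) ->
    [/\ forall k, asum (fun n => T (f n k)), asum (fun k => tsum (fun n => T (f n k))),
      asum (fun n => tsum (fun k => T (f n k))) &
      tsum (fun n => tsum (fun k => T (f n k))) = tsum (fun k => tsum (fun n => T (f n k)))].
  move=> Tle.
  have sT n : asum (fun k => T (f n k)) by apply: asum_le (asum_cvg (sf n)) => k.
  apply: (@tsum_exchange _ (fun n k => T (f n k)) B) => // n.
  apply: le_trans (fB n); apply: le_tsum => //; exact: asum_norm.
have [r1 r2 r3 r4] := ex _ Re_le_normc; have [i1 i2 i3 i4] := ex _ Im_le_normc.
split.
  apply: cabs_le (asum_cvg (asumD (asum_norm r2) (asum_norm i2))) => k.
  exact: normc_le_ReIm.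
by apply: complexP; [exact: r4|exact: i4].
Qed.

Lemma tsum_fin (u : nat -> R) N : (forall k, (N <= k)%N -> u k = 0) ->
  asum u /\ tsum u = \sum_(0 <= k < N) u k.
Proof.
move=> u0; split.
  apply: (@asum_bounded _ _ (\sum_(0 <= k < N) `|u k|)) => n.
  have [nN|/ltnW Nn] := leqP n N.
    by rewrite [leRHS](big_cat_nat (n := n)) //= lerDl sumr_ge0.
  rewrite (big_cat_nat (n := N)) //= [X in _ + X]big_nat_cond [X in _ + X]big1 ?addr0 // => k.
  by rewrite andbT => /andP[/u0-> _]; rewrite normr0.
apply: tsumE; apply: cvg_near_cst; near=> n.
have Nn : (N <= n)%N by near: n; exact: nbhs_infty_ge.
rewrite /series /= (big_cat_nat (n := N)) //= [X in _ + X]big_nat_cond [X in _ + X]big1 ?addr0 // => k.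
by rewrite andbT => /andP[/u0-> _].
Unshelve. all: end_near. Qed.

Lemma csum_fin u N : (forall k, (N <= k)%N -> u k = 0) ->
  cabs u /\ csum u = \sum_(0 <= k < N) u k.
Proof.
move=> u0; split.
  have h k : (N <= k)%N -> normc (u k) = 0 by move=> /u0->; exact: normc0.
  exact: (tsum_fin h).1.
have hr k : (N <= k)%N -> Re (u k) = 0 by move=> /u0->.
have hi k : (N <= k)%N -> Im (u k) = 0 by move=> /u0->.
have [_ r] := tsum_fin hr; have [_ i] := tsum_fin hi.
rewrite /csum r i; elim: N {u0 hr hi r i} => [|n IH]; first by rewrite !big_nil.
rewrite !big_nat_recr //= -IH; apply: complexP; rewrite ?cReD ?cImD //=.
Qed.

Lemma tsum_delay (u : nat -> R) n : asum u ->
  asum (fun m => if (n <= m)%N then u (m - n)%N else 0) /\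
  tsum (fun m => if (n <= m)%N then u (m - n)%N else 0) = tsum u.
Proof.
move=> su; elim: n => [|n [IH1 IH2]].
  by have -> : (fun m => if (0 <= m)%N then u (m - 0)%N else 0) = u
    by apply/funext => m; rewrite subn0.
have a1 : asum (fun m => if (n.+1 <= m)%N then u (m - n.+1)%N else 0).
  apply: (@asum_bounded _ _ (tsum (fun k => `|if (n <= k)%N then u (k - n)%N else 0|))).
  case=> [|N]; first by rewrite big_nil; apply: tsum_ge0 => //; exact: asum_norm.
  rewrite big_nat_recl //= normr0 add0r.
  by apply: (@partial_le_tsum _ (fun k => `|if (n <= k)%N then u (k - n)%N else 0|));
    first exact: asum_norm.
by split=> //; rewrite tsum_recl // -IH2 /= add0r.
Qed.

(** Row [n] of the array [f] is [v] delayed by [n] places and multiplied by [u n]. The row sums give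
    the product, and the column sums are finite convolutions. *)
Lemma cauchy_product u v : cabs u -> cabs v ->
  cabs (fun m => \sum_(0 <= i < m.+1) u i * v (m - i)%N) /\
  csum (fun m => \sum_(0 <= i < m.+1) u i * v (m - i)%N) = csum u * csum v.
Proof.
move=> su sv.
pose f n m := if (n <= m)%N then u n * v (m - n)%N else 0.
have E n m : normc (f n m) = normc (u n) * (if (n <= m)%N then normc (v (m - n)%N) else 0).
  by rewrite /f; case: ifP => _; rewrite ?normcM ?normc0 ?mulr0.
have [|||c1 c2] := @csum_exchange f (fun n => normc (u n) * tsum (fun k => normc (v k))).
- move=> n; apply: (eq_asum (E n)); apply: asumZ; exact: (tsum_delay n sv).1.
- move=> n; rewrite (eq_tsum (E n)) tsumZ; last exact: (tsum_delay n sv).1.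
  by rewrite (tsum_delay n sv).2.
- have -> : (fun n => normc (u n) * tsum (fun k => normc (v k))) =
     (fun n => tsum (fun k => normc (v k)) * normc (u n)) by apply/funext => n; rewrite mulrC.
  exact/asum_cvg/asumZ.
have F m : csum (f ^~ m) = \sum_(0 <= i < m.+1) u i * v (m - i)%N.
  have h k : (m < k)%N -> f k m = 0 by move=> mk; rewrite /f leqNgt mk.
  have [_ ->] := csum_fin h.
  by rewrite !big_mkord; apply: eq_bigr => i _; rewrite /f -ltnS ltn_ord.
split; first by apply: eq_asum c1 => m; rewrite F.
rewrite -(eq_csum F) -c2 mulrC -csumZ //.
apply: eq_csum => n.
have [v1 v2] := cabs_ReIm sv.
have -> : f n = (fun m => u n * (if (n <= m)%N then v (m - n)%N else 0)).
  by apply/funext => m; rewrite /f; case: ifP; rewrite ?mulr0.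
have e : (fun m => normc (if (n <= m)%N then v (m - n)%N else 0)) =
    (fun m => if (n <= m)%N then normc (v (m - n)%N) else 0).
  by apply/funext => m; case: ifP; rewrite ?normc0.
rewrite csumZ; last by rewrite e; exact: (tsum_delay n sv).1.
rewrite mulrC; congr (_ * _); rewrite /csum -(tsum_delay n v1).2 -(tsum_delay n v2).2.
by congr (_ +i* _); apply: eq_tsum => m; case: ifP.
Qed.

End ComplexSeries.

(** * The complex exponential and local power series *)

Definition cexp_term {R : realType} (z : R[i]) (k : nat) : R[i] :=
  ((k`!%:R)^-1 : R)%:C * z ^+ k.

(** Absolute convergence on a closed disc is built in, since products, recentring and the identity
    theorem all rearrange the series. *)
Definition holo {R : realType} (f : R[i] -> R[i]) (z : R[i]) : Prop :=
  exists (a : nat -> R[i]) (r : R), [/\ 0 < r, asum (fun k => normc (a k) * r ^+ k) &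
    forall w, normc (w - z) <= r -> f w = csum (fun k => a k * (w - z) ^+ k)].

Section Holo.
Context {R : realType}.
Implicit Types (z w c : R[i]) (a b u v : nat -> R[i]) (f g : R[i] -> R[i]).

Lemma normc_cexp_term z k : normc (cexp_term z k) = exp_coeff (normc z) k.
Proof.
rewrite /cexp_term /exp_coeff normcM normcX normc_real ger0_norm ?invr_ge0 //.
by rewrite /= mulrC.
Qed.

Lemma cabs_cexp z : cabs (cexp_term z).
Proof.
apply: eq_asum (normc_cexp_term z) _; apply: asum_nneg; last exact: is_cvg_series_exp_coeff.
by move=> k; apply: exp_coeff_ge0; exact: normc_ge0.
Qed.

Lemma cexp_termD z w m :
  \sum_(0 <= i < m.+1) cexp_term w i * cexp_term z (m - i)%N = cexp_term (z + w) m.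
Proof.
rewrite /cexp_term exprDn mulr_sumr big_mkord; apply: eq_bigr => i _.
have im : (i <= m)%N by rewrite -ltnS.
have e : (i`!%:R^-1 * (m - i)`!%:R^-1 : R) = (m`!%:R)^-1 * 'C(m, i)%:R.
  have f0 n : n`!%:R != 0 :> R by rewrite pnatr_eq0 -lt0n fact_gt0.
  have c0 : 'C(m, i)%:R != 0 :> R by rewrite pnatr_eq0 -lt0n bin_gt0.
  have := congr1 (fun n => n%:R : R) (bin_fact im); rewrite !natrM => <-.
  move: (i`!%:R) (f0 i) ((m - i)`!%:R) (f0 (m - i)%N) ('C(m, i)%:R) c0 => x x0 y y0 q q0.
  by field; rewrite x0 y0 q0.
transitivity ((i`!%:R^-1 * (m - i)`!%:R^-1 : R)%:C * (z ^+ (m - i) * w ^+ i)).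
  by rewrite rmorphM /=; ring.
by rewrite e rmorphM /= -mulrA rmorph_nat mulr_natl.
Qed.

Lemma csum_cexpD z w : csum (cexp_term (z + w)) = csum (cexp_term z) * csum (cexp_term w).
Proof.
have [_ e] := cauchy_product (@cabs_cexp w) (@cabs_cexp z).
by rewrite mulrC -e; apply: eq_csum => m; rewrite cexp_termD.
Qed.

Lemma csum_cexp_real (x : R) : csum (cexp_term x%:C) = (expR x)%:C.
Proof.
have E k : cexp_term x%:C k = (exp_coeff x k)%:C.
  by rewrite /cexp_term /exp_coeff -rmorphXn -rmorphM /= mulrC.
rewrite (eq_csum E) /csum /=; congr (_ +i* _).
by have [_ ->] := @tsum_fin R (fun=> 0) 0%N (fun k h => erefl); rewrite big_nil.
Qed.

Lemma csum_cexp_imag (y : R) : csum (cexp_term (0 +i* y)) = cos y +i* sin y.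
Proof.
have iN k : (0 +i* y) ^+ k = (~~ odd k)%:R * (-1) ^+ k./2 * y ^+ k +i*
    ((odd k)%:R * (-1) ^+ k.-1./2 * y ^+ k).
  have h n : (0 +i* y) ^+ n.*2 = ((-1) ^+ n * y ^+ n.*2)%:C.
    elim: n => [|n IH]; first by rewrite !expr0 mulr1.
    rewrite doubleS !exprS IH; apply: complexP => /=; ring.
  rewrite -(odd_double_half k); set n := k./2.
  case: (odd k); rewrite ?add0n ?add1n.
    have o : odd n.*2.+1 by rewrite /= odd_double.
    rewrite exprS h o (_ : n.*2.+1.-1./2 = n) ?doubleK // [y ^+ n.*2.+1]exprS.
    by apply: complexP => /=; ring.
  by rewrite h; apply: complexP => /=; rewrite odd_double ?doubleK /=; ring.
rewrite /csum; congr (_ +i* _).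
  rewrite unlock; apply: eq_tsum => k; rewrite /cexp_term iN cReM /cos_coeff /=.
  by rewrite mul0r subr0 mulrC.
rewrite unlock; apply: eq_tsum => k; rewrite /cexp_term iN cImM /sin_coeff /=.
by rewrite mul0r addr0 mulrC.
Qed.

Lemma expC_csum z : expC z = csum (cexp_term z).
Proof.
case: z => x y.
have -> : x +i* y = x%:C + (0 +i* y) by apply: complexP => /=; ring.
by rewrite csum_cexpD csum_cexp_real csum_cexp_imag /expC /= addr0 add0r.
Qed.

Lemma expCD z w : expC (z + w) = expC z * expC w :> R[i].
Proof. by rewrite !expC_csum csum_cexpD. Qed.

Lemma expC_real (x : R) : expC x%:C = (expR x)%:C.
Proof. by rewrite expC_csum csum_cexp_real. Qed.

Lemma normc_expC z : normc (expC z) = expR (Re z).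
Proof.
rewrite /expC normcM normc_real ger0_norm ?expR_ge0 //= cos2Dsin2 sqrtr1 mulr1 //.
Qed.

Lemma cvgC (T : Type) (F : set_system T) {FF : Filter F} (u : T -> R[i]^o) (l : R[i]^o) :
  u x @[x --> F] --> l -> normc ((u x : R[i]) - (l : R[i])) @[x --> F] --> 0.
Proof.
move=> /cvgrPdist_lt h; apply/cvgr0Pnorm_lt => e e0.
have e0C : 0 < e%:C :> R[i] by rewrite ltcR.
apply: filterS (h _ e0C) => x /= hx.
rewrite ger0_norm ?normc_ge0 // -ltcR -normcN opprB; exact: hx.
Qed.

Lemma cvgC_Re (T : Type) (F : set_system T) {FF : ProperFilter F} (u : T -> R[i]^o) (l : R[i]^o) :
  u x @[x --> F] --> l -> Re (u x) @[x --> F] --> Re l.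
Proof.
move=> /cvgC h; apply/cvgrPdist_le => e e0.
have /cvgr0Pnorm_le/(_ _ e0) := h; apply: filterS => x.
rewrite ger0_norm ?normc_ge0 // distrC; apply: le_trans.
by apply: le_trans (Re_le_normc _); rewrite cReD cReN.
Qed.

Lemma cvgC_Im (T : Type) (F : set_system T) {FF : ProperFilter F} (u : T -> R[i]^o) (l : R[i]^o) :
  u x @[x --> F] --> l -> Im (u x) @[x --> F] --> Im l.
Proof.
move=> /cvgC h; apply/cvgrPdist_le => e e0.
have /cvgr0Pnorm_le/(_ _ e0) := h; apply: filterS => x.
rewrite ger0_norm ?normc_ge0 // distrC; apply: le_trans.
by apply: le_trans (Im_le_normc _); rewrite cImD cImN.
Qed.

Lemma csumE u (l : R[i]^o) : series (fun k => (u k : R[i]^o)) @ \oo --> l -> csum u = l.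
Proof.
move=> h; apply: complexP; apply: tsumE.
  suff -> : series (fun k => Re (u k)) = (fun n => Re (series (fun k => (u k : R[i]^o)) n)).
    exact: cvgC_Re h.
  apply/funext => n; rewrite /series /=; elim: n => [|n IH]; first by rewrite !big_nil.
  by rewrite !big_nat_recr //= cReD IH.
suff -> : series (fun k => Im (u k)) = (fun n => Im (series (fun k => (u k : R[i]^o)) n)).
  exact: cvgC_Im h.
apply/funext => n; rewrite /series /=; elim: n => [|n IH]; first by rewrite !big_nil.
by rewrite !big_nat_recr //= cImD IH.
Qed.

Lemma nearC (P : R[i] -> Prop) z : (\forall w \near (z : R[i]^o), P w) ->
  exists2 e : R, 0 < e & forall w, normc (w - z) < e -> P w.
Proof.
move=> /nbhs_ballP[e /= e0 h]; exists (Re e).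
  by move: e0; rewrite ltcE /= => /andP[].
have [ei _] : Im e = 0 /\ True by move: e0; rewrite ltcE /= => /andP[/eqP].
move=> w hw; apply: h; rewrite /ball /= /ball_ /= distrC.
have -> : e = (Re e)%:C by apply: complexP.
by rewrite ltcR.
Qed.

Lemma asum_geometric (r : R) : 0 <= r < 1 -> asum (fun k => r ^+ k).
Proof.
move=> /andP[r0 r1]; apply: asum_nneg => [k|]; first exact: exprn_ge0.
have := @is_cvg_geometric_series R 1 r; rewrite ger0_norm // => /(_ r1).
by congr (cvgn (series _)); apply/funext => k; rewrite /= mul1r.
Qed.

(** Convergence at the single point [z + r] bounds the terms there, and at radius [r / 2] they are
    then dominated by a geometric series of ratio 1/2. *)
Lemma analytic_holo (f : R[i] -> R[i]^o) z : analytic_at f z -> holo f z.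
Proof.
move=> [a /nearC[e e0 h]].
pose r := e / 2; have r0 : 0 < r by rewrite divr_gt0.
have rn : normc (r%:C) = r by rewrite normc_real gtr0_norm.
have zr : normc (z + r%:C - z) < e.
  by rewrite addrAC subrr add0r rn /r; lra.
have cv := h _ zr.
have [M M0 HM] : exists2 M : R, 0 < M & forall k, normc (a k) * r ^+ k <= M.
  have t0 : a k * (z + r%:C - z) ^+ k @[k --> \oo] --> (0 : R[i]^o).
    by apply: (cvg_series_cvg_0 (u_ := fun k => (a k * (z + r%:C - z) ^+ k : R[i]^o)));
      apply/cvg_ex; eexists; exact: cv.
  have /(_ _ (cvgP _ (cvgC t0)))/pinfty_ex_gt0[M M0 /= HM] := @cvg_seq_bounded R R^o.
  exists M => // k; have := HM k I.
  by rewrite subr0 addrAC subrr add0r normcM normcX rn ger0_norm // mulr_ge0 ?normc_ge0 // exprn_ge0 // ltW.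
exists a, (r / 2); split.
- by rewrite divr_gt0.
- have := asumZ (c := M) (@asum_geometric 2^-1 _); rewrite invr_ge0 ler0n invf_lt1 // ltr1n.
  move=> /(_ isT) /asum_cvg; apply: asum_le => k.
  rewrite ger0_norm; last by rewrite mulr_ge0 ?normc_ge0 // exprn_ge0 // ltW // divr_gt0.
  by rewrite expr_div_n exprVn mulrA ler_wpM2r // invr_ge0 exprn_ge0.
move=> w hw; apply/esym/csumE; apply: h; apply: le_lt_trans hw _; rewrite /r; lra.
Qed.

End Holo.

(** * Recentring and the identity theorem *)

Section HoloAlgebra.
Context {R : realType}.
Implicit Types (z w c : R[i]) (a b u v : nat -> R[i]) (f g : R[i] -> R[i]).

Lemma asum_pow_le a (r x : R) : asum (fun k => normc (a k) * r ^+ k) -> 0 <= x <= r ->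
  asum (fun k => normc (a k) * x ^+ k).
Proof.
move=> sa /andP[x0 xr]; apply: asum_le (asum_cvg sa) => k.
rewrite ger0_norm; last by rewrite mulr_ge0 ?normc_ge0 ?exprn_ge0.
by rewrite ler_wpM2l ?normc_ge0 // lerXn2r // nnegrE // (le_trans x0).
Qed.

Lemma cabs_pow a (r : R) w : asum (fun k => normc (a k) * r ^+ k) -> normc w <= r ->
  cabs (fun k => a k * w ^+ k).
Proof.
move=> sa wr; apply: (eq_asum (v := fun k => normc (a k) * normc w ^+ k)).
  by move=> k; rewrite normcM normcX.
by apply: asum_pow_le sa _; rewrite normc_ge0.
Qed.

Lemma holoB f g z : holo f z -> holo g z -> holo (fun w => f w - g w) z.
Proof.
move=> [a [r [r0 sa fa]]] [b [s [s0 sb gb]]].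
pose t := Num.min r s; have t0 : 0 < t by rewrite lt_min r0.
have tr : t <= r by rewrite ge_min lexx.
have ts : t <= s by rewrite ge_min lexx orbT.
exists (fun k => a k - b k), t; split => //.
  have s1 : asum (fun k => normc (a k) * t ^+ k) by apply: asum_pow_le sa _; rewrite (ltW t0).
  have s2 : asum (fun k => normc (b k) * t ^+ k) by apply: asum_pow_le sb _; rewrite (ltW t0).
  apply: asum_le (asum_cvg (asumD s1 s2)) => k.
  have tk : 0 <= t ^+ k by rewrite exprn_ge0 // ltW.
  rewrite ger0_norm ?mulr_ge0 ?normc_ge0 // -mulrDl ler_wpM2r //.
  by apply: le_trans (le_normcD _ _) _; rewrite normcN.
move=> w wt; have wr := le_trans wt tr; have ws := le_trans wt ts.
rewrite fa // gb // -[- csum _]mulN1r -csumZ; last exact: cabs_pow sb ws.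
rewrite -csumD; [|exact: cabs_pow sa wr|by apply: cabsZ; exact: cabs_pow sb ws].
by apply: eq_csum => k; ring.
Qed.

Lemma holoM f g z : holo f z -> holo g z -> holo (fun w => f w * g w) z.
Proof.
move=> [a [r [r0 sa fa]]] [b [s [s0 sb gb]]].
pose t := Num.min r s; have t0 : 0 < t by rewrite lt_min r0.
have tr : t <= r by rewrite ge_min lexx.
have ts : t <= s by rewrite ge_min lexx orbT.
have conv x m : \sum_(0 <= i < m.+1) a i * x ^+ i * (b (m - i)%N * x ^+ (m - i)) =
    (\sum_(0 <= i < m.+1) a i * b (m - i)%N) * x ^+ m.
  rewrite mulr_suml !big_mkord; apply: eq_bigr => i _.
  by rewrite mulrACA -exprD subnKC // -ltnS.
exists (fun m => \sum_(0 <= i < m.+1) a i * b (m - i)%N), t; split => //.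
  have tn : normc (t%:C) = t by rewrite normc_real gtr0_norm.
  have [h _] := cauchy_product (cabs_pow (w := t%:C) sa (ltac:(by rewrite tn)))
    (cabs_pow (w := t%:C) sb (ltac:(by rewrite tn))).
  by apply: eq_asum h => m; rewrite conv normcM normcX tn.
move=> w wt; have wr := le_trans wt tr; have ws := le_trans wt ts.
have [_ h] := cauchy_product (cabs_pow sa wr) (cabs_pow sb ws).
by rewrite fa // gb // -h; apply: eq_csum => m; rewrite conv.
Qed.

Lemma holo_cst c z : holo (fun=> c) z.
Proof.
have h k : (1 <= k)%N -> (if k is 0%N then c else 0) = 0 by case: k.
exists (fun k => if k is 0%N then c else 0), 1; split => //.
  have [h1 _] := csum_fin h.
  by apply: eq_asum h1 => k; rewrite expr1n mulr1.
move=> w _; have h' k : (1 <= k)%N -> (if k is 0%N then c else 0) * (w - z) ^+ k = 0.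
  by move=> /h->; rewrite mul0r.
by have [_ ->] := csum_fin h'; rewrite big_nat1 expr0 mulr1.
Qed.

Lemma holo_expC c z : holo (fun w => expC (c * w)) z.
Proof.
exists (fun k => expC (c * z) * cexp_term c k), 1; split => //.
  apply: (eq_asum (v := fun k => normc (expC (c * z) * cexp_term c k))).
    by move=> k; rewrite expr1n mulr1.
  by apply: cabsZ; exact: cabs_cexp.
move=> w _; have -> : c * w = c * z + c * (w - z) by ring.
rewrite expCD (expC_csum (c * (w - z))) -csumZ; last exact: cabs_cexp.
by apply: eq_csum => k; rewrite /cexp_term exprMn !mulrA.
Qed.

(** Binomial expansion of [(d + x) ^ k] and interchange of the sums. The double series is dominated
    because [normc d + r] is still below [rho]; [r] is half the distance to the boundary. *)
Lemma holo_recenter f a z0 (rho : R) z :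
  (forall r : R, 0 <= r < rho -> asum (fun k => normc (a k) * r ^+ k)) ->
  (forall w, normc (w - z0) < rho -> f w = csum (fun k => a k * (w - z0) ^+ k)) ->
  normc (z - z0) < rho -> holo f z.
Proof.
move=> sa fa zr; pose d := z - z0; pose r := (rho - normc d) / 2.
have r0 : 0 < r by rewrite divr_gt0 // subr_gt0.
have d0 := normc_ge0 d.
have rr : 0 <= normc d + r < rho by rewrite /r; lra.
pose F (x : R[i]) k j := a k * ((d ^+ (k - j) * x ^+ j) *+ 'C(k, j)).
pose b j := csum (fun k => a k * (d ^+ (k - j) *+ 'C(k, j))).
have Fbig x k j : (k.+1 <= j)%N -> F x k j = 0.
  by move=> kj; rewrite /F bin_small // mulr0n mulr0.
have Fsum x k : csum (F x k) = a k * (d + x) ^+ k.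
  have [_ ->] := csum_fin (Fbig x k).
  by rewrite -mulr_sumr exprDn big_mkord.
have Fnorm x k j : normc (F x k j) =
    normc (a k) * ((normc d ^+ (k - j) * normc x ^+ j) *+ 'C(k, j)).
  by rewrite /F normcM normcMn normcM !normcX.
have Fnsum x k : tsum (fun j => normc (F x k j)) = normc (a k) * (normc d + normc x) ^+ k.
  have h j : (k.+1 <= j)%N -> normc (F x k j) = 0 by move=> /Fbig->; rewrite normc0.
  have [_ ->] := tsum_fin h; rewrite (eq_bigr _ (fun j _ => Fnorm x k j)).
  by rewrite -mulr_sumr exprDn big_mkord.
have cb j : cabs (fun k => a k * (d ^+ (k - j) *+ 'C(k, j))).
  have rj : 0 < r ^+ j by rewrite exprn_gt0.
  apply: cabs_le (asum_cvg (asumZ (c := (r ^+ j)^-1) (sa _ rr))) => k.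
  rewrite normcM normcMn normcX mulrCA ler_wpM2l ?normc_ge0 // mulrC ler_pdivlMr //.
  have [kj|jk] := ltnP k j.
    rewrite bin_small // mulr0n mul0r exprn_ge0 // addr_ge0 // ltW //.
  rewrite mulrnAl exprDn.
  have jk' : (j < k.+1)%N by rewrite ltnS.
  rewrite (bigD1 (Ordinal jk')) //= lerDl; apply: sumr_ge0 => i _.
  by rewrite mulrn_wge0 // mulr_ge0 // exprn_ge0 // ltW.
have main x : normc x <= r -> cabs (fun j => b j * x ^+ j) /\
    csum (fun j => b j * x ^+ j) = csum (fun k => a k * (d + x) ^+ k).
  move=> xr.
  have E j : csum (fun k => F x k j) = b j * x ^+ j.
    rewrite mulrC -csumZ; last exact: cb.
    apply: eq_csum => k; rewrite /F -mulrnAl mulrA [RHS]mulrC; congr (_ * _ * _).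
  have [|||h1 h2] := @csum_exchange _ (F x) (fun k => normc (a k) * (normc d + r) ^+ k).
  - by move=> k; have [] := csum_fin (Fbig x k).
  - move=> k; rewrite Fnsum ler_wpM2l ?normc_ge0 // lerXn2r ?nnegrE ?addr_ge0 ?normc_ge0 //.
      exact: ltW.
    by rewrite lerD2l.
  - exact: asum_cvg (sa _ rr).
  split; first by apply: eq_asum h1 => j; rewrite E.
  by rewrite -(eq_csum E) -h2; apply: eq_csum => k; exact: Fsum.
exists b, r; split => //.
  have rn : normc (r%:C) = r by rewrite normc_real gtr0_norm.
  have [] := main r%:C; first by rewrite rn.
  by move=> h _; apply: eq_asum h => j; rewrite normcM normcX rn.
move=> w wz; have [_ ->] := main _ wz.
have e : d + (w - z) = w - z0 by rewrite /d; ring.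
rewrite e; apply: fa; rewrite -e.
apply: le_lt_trans (le_normcD _ _) _; case/andP: rr => _; apply: le_lt_trans.
by rewrite lerD2l.
Qed.

(** If the coefficients below [m] vanish, dividing by [x ^ m] at a zero [z + x] bounds [a m] by a
    multiple of the modulus of [x], which can be taken arbitrarily small. *)
Lemma holo_zero f z : holo f z ->
  (forall e : R, 0 < e -> exists w, [/\ w != z, normc (w - z) < e & f w = 0]) ->
  exists2 r : R, 0 < r & forall w, normc (w - z) <= r -> f w = 0.
Proof.
move=> [a [r [r0 sa fa]]] acc; exists r => //.
suff a0 m : a m = 0.
  move=> w /fa->; have h k : (0 <= k)%N -> a k * (w - z) ^+ k = 0 by rewrite a0 mul0r.
  by have [_ ->] := csum_fin h; rewrite big_nil.
elim/ltn_ind: m => m IH.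
pose K := tsum (fun k => normc (a (m.+1 + k)%N) * r ^+ k).
have sK : asum (fun k => normc (a (m.+1 + k)%N) * r ^+ k).
  have := asumZ (c := (r ^+ m.+1)^-1) (asum_shift (n := m.+1) sa); apply: eq_asum => k.
  rewrite exprD; move: (normc _) (r ^+ k) (exprn_gt0 m.+1 r0) => x y p.
  by field; rewrite gt_eqF.
have K0 : 0 <= K.
  by apply: tsum_ge0 => // k; rewrite mulr_ge0 ?normc_ge0 // exprn_ge0 // ltW.
have bnd w : w != z -> normc (w - z) <= r -> f w = 0 -> normc (a m) <= normc (w - z) * (2 * K).
  move=> wz wr; rewrite (fa _ wr); set x := w - z.
  have x0 : x != 0 by rewrite subr_eq0.
  have sx : cabs (fun k => a k * x ^+ k) by exact: cabs_pow sa wr.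
  have sm n : cabs (fun k => a (n + k)%N * x ^+ (n + k)) by exact: (asum_shift (n := n) sx).
  have -> : csum (fun k => a k * x ^+ k) = csum (fun k => a (m + k)%N * x ^+ (m + k)).
    have : (m <= m)%N by []. elim: {1 3 4}m => [//|n IHn] nm.
    rewrite IHn ?(ltnW nm) // csum_recl // addn0 IH // mul0r add0r.
    by apply: eq_csum => k; rewrite addnS addSn.
  rewrite csum_recl // addn0.
  have sx1 : cabs (fun k => a (m.+1 + k)%N * x ^+ k).
    apply: asum_le (asum_cvg sK) => k; rewrite ger0_norm ?normc_ge0 // normcM normcX.
    by rewrite ler_wpM2l ?normc_ge0 // lerXn2r ?nnegrE ?normc_ge0 // ltW.
  have -> : csum (fun k => a (m + k.+1)%N * x ^+ (m + k.+1)) =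
      x ^+ m * (x * csum (fun k => a (m.+1 + k)%N * x ^+ k)).
    rewrite mulrA -exprSr -csumZ //; apply: eq_csum => k.
    by rewrite addnS -addSn exprD; ring.
  rewrite [a m * _]mulrC -mulrDr => /eqP; rewrite mulf_eq0 expf_eq0 (negbTE x0) andbF /=.
  rewrite addr_eq0 => /eqP->; rewrite normcN normcM ler_wpM2l ?normc_ge0 //.
  apply: le_trans (normc_csum sx1) _; rewrite ler_wpM2l //.
  apply: le_tsum => // k; rewrite normcM normcX ler_wpM2l ?normc_ge0 //.
  by rewrite lerXn2r ?nnegrE ?normc_ge0 // ltW.
apply/eqP; rewrite -normc_eq0; apply/negP => /negP am0.
have am : 0 < normc (a m) by rewrite lt_neqAle eq_sym am0 normc_ge0.
pose e := Num.min r (normc (a m) / (2 * K + 1)).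
have K1 : 0 < 2 * K + 1 by lra.
have e0 : 0 < e by rewrite lt_min r0 divr_gt0.
have [w [wz we fw]] := acc _ e0.
have wr : normc (w - z) <= r by apply: le_trans (ltW we) _; rewrite ge_min lexx.
have wa : normc (w - z) < normc (a m) / (2 * K + 1).
  by apply: lt_le_trans we _; rewrite ge_min lexx orbT.
have := bnd w wz wr fw; apply/negP; rewrite -ltNge.
move: wa; rewrite ltr_pdivlMr // mulrDr mulr1.
have := normc_ge0 (w - z); have : w - z != 0 by rewrite subr_eq0.
rewrite -normc_eq0; move: (normc _) (normc (a m)) (2 * K) => x y q xn x0 h.
suff : 0 < x by lra. by rewrite lt_neqAle eq_sym xn.
Qed.

(** [T] is the supremum of the times up to which [f] vanishes along the segment. Zeros accumulate at
    the point of time [T], so [f] vanishes around it, and [T < 1] would contradict the choice of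
    [T]. *)
Lemma holo_segment f (p q : R[i]) (e : R) : q != 0 ->
  (forall t : R, 0 <= t <= 1 -> holo f (p + t%:C * q)) ->
  0 < e -> (forall w, normc (w - p) <= e -> f w = 0) ->
  exists2 r : R, 0 < r & forall w, normc (w - (p + q)) <= r -> f w = 0.
Proof.
move=> q0 hf e0 fe.
have nq : 0 < normc q by rewrite lt_neqAle eq_sym normc_eq0 q0 normc_ge0.
pose g (t : R) := f (p + t%:C * q).
pose S : set R := [set t | 0 <= t <= 1 /\ forall s, 0 <= s <= t -> g s = 0].
have dist (s t : R) : normc (p + s%:C * q - (p + t%:C * q)) = `|s - t| * normc q.
  rewrite -(normc_real (s - t)) -normcM; congr normc.
  by rewrite rmorphB /=; ring.
have near0 (d : R) : 0 < d -> exists2 h : R, 0 < h & forall s t : R, `|s - t| <= h ->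
    normc (p + s%:C * q - (p + t%:C * q)) <= d.
  move=> d0; exists (d / normc q); first by rewrite divr_gt0.
  by move=> s t; rewrite dist -ler_pdivlMr.
have [h0 h00 H0] := near0 _ e0.
pose t0 := Num.min h0 1.
have t00 : 0 < t0 by rewrite lt_min h00 ltr01.
have St0 : S t0.
  split; first by rewrite (ltW t00) ge_min lexx orbT.
  move=> s /andP[s0 st]; apply: fe; have := H0 s 0; rewrite mul0r addr0 subr0; apply.
  by rewrite ger0_norm //; apply: le_trans st _; rewrite ge_min lexx.
have hS : has_sup S.
  by split; [exists t0|exists 1 => t [/andP[]]].
pose T := sup S.
have T0 : 0 < T by apply: lt_le_trans t00 _; exact: (ub_le_sup (proj2 hS) St0).
have T1 : T <= 1 by apply: ge_sup; [exists t0|move=> t [/andP[]]].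
have gT s : 0 <= s < T -> g s = 0.
  move=> /andP[s0 sT].
  have sT' : 0 < T - s by rewrite subr_gt0.
  have [t [_ St]] := sup_adherent sT' hS.
  rewrite -/T opprB addrC subrK => st; apply: St.
  by rewrite s0 ltW.
have hT : holo f (p + T%:C * q) by apply: hf; rewrite (ltW T0).
have [|r r0 fr] := holo_zero hT.
  move=> d d0; have d2 : 0 < d / 2 by rewrite divr_gt0.
  have [h h_0 H] := near0 _ d2.
  pose s := Num.max 0 (T - h).
  have sT : s < T by rewrite gt_max T0 ltrBlDr ltrDl.
  have s0 : 0 <= s by rewrite le_max lexx.
  exists (p + s%:C * q); split.
  - rewrite -subr_eq0 -normc_eq0 dist mulf_neq0 ?(gt_eqF nq) // normr_eq0 subr_eq0.
    by rewrite lt_eqF.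
  - apply: (@le_lt_trans _ _ (d / 2)); last by lra.
    apply: H; rewrite distrC ger0_norm ?subr_ge0 ?(ltW sT) // lerBlDr.
    by rewrite -lerBlDl le_max lexx orbT.
  - by apply: gT; rewrite s0.
have [h h_0 H] := near0 _ r0.
have [T1'|T1'] := eqVneq T 1.
  by exists r => // w; rewrite -[q]mul1r -[1]/(1%:C) -T1'; exact: fr.
have T_1 : T < 1 by rewrite lt_neqAle T1'.
pose t := Num.min 1 (T + h).
have Tt : T < t by rewrite lt_min T_1 ltrDl.
have : S t.
  split; first by rewrite ge_min lexx andbT ltW // (lt_trans T0).
  move=> s /andP[s0 st]; have [sT|Ts] := ltP s T; first by apply: gT; rewrite s0.
  apply: fr; apply: H; rewrite ger0_norm ?subr_ge0 // lerBlDl.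
  by apply: le_trans st _; rewrite ge_min lexx orbT.
by move=> /(ub_le_sup (proj2 hS)); rewrite leNgt Tt.
Qed.

End HoloAlgebra.

(** * Taylor coefficients of eta at 2 *)

Section EtaCoefficients.
Context {R : realType}.
Implicit Types (x y r : R).

(* The derivatives of [x ^- 2 * (- ln x) ^ k / k!] involve the next lower
   powers of [ln x]; the shift by 3 makes these vanish below [k = 0]. *)
Definition lgpow (j : nat) (u : R) : R :=
  if j is i.+3 then u ^+ i / i`!%:R else 0.

(** The [k]-th Taylor coefficient at s = 2 of x ^ (- s). *)
Definition etaf k x : R := x^-1 ^+ 2 * lgpow k.+3 (- ln x).

Definition etac k : R := regsum (fun n => etaf k n%:R).

Lemma lgpow_norm j u v : `|u| <= v -> `|lgpow j u| <= lgpow j v.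
Proof.
case: j => [|[|[|j]]] /= uv; rewrite ?normr0 //.
rewrite normrM normrX [X in _ * X <= _]ger0_norm ?invr_ge0 // ler_wpM2r ?invr_ge0 //.
by rewrite lerXn2r // ?nnegrE // (le_trans _ uv).
Qed.

Lemma dv_lgpow j x : 0 < x ->
  is_derive x 1 (fun t => lgpow j.+1 (- ln t)) (- (x^-1 * lgpow j (- ln x))).
Proof.
move=> x0.
have dl : is_derive x 1 (fun t : R => - ln t) (- (1 / x)).
  by apply: dvN; apply: dv_ln => //; exact: dv_id.
case: j => [|[|[|i]]] /=; try by apply: dvE (dv_cst _ _) _; rewrite mulr0 oppr0.
  apply: (@dv_ext _ (fun=> 1)); first by move=> t; rewrite expr0 fact0 divr1.
  by apply: dvE (dv_cst _ _) _; rewrite mulr0 oppr0.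
apply: dvE (dvMr _ (dvX i.+1 dl)) _.
have f0 : i`!%:R != 0 :> R by rewrite pnatr_eq0 -lt0n fact_gt0.
rewrite factS natrM; move: (i`!%:R) f0 (ln x ) => f f0 l /=.
rewrite invfM div1r -[_ *+ i.+1]mulr_natl.
have i0 : i.+1%:R != 0 :> R by [].
move: ((- l) ^+ i) (i.+1%:R) i0 => p q q0.
by field; rewrite f0 q0 gt_eqF.
Qed.

Lemma dv_invX_mul n (L L' : R -> R) x : 0 < x -> is_derive x 1 L (- (x^-1 * L' x)) ->
  is_derive x 1 (fun t => t^-1 ^+ n.+1 * L t) (- (x^-1 ^+ n.+2 * (n.+1%:R * L x + L' x))).
Proof.
move=> x0 dL.
have xn : (x : R) != 0 by rewrite gt_eqF.
have dV := @dvV R (fun t => t) x 1 xn (dv_id x).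
apply: dvE (dvM (dvX n.+1 dV) dL) _; rewrite /= -exprVn.
by rewrite !exprS expr0; move: (x^-1 ^+ n) (n.+1%:R) => p q; ring.
Qed.

Lemma dv_lin a b (f g : R -> R) x f' g' :
  is_derive x 1 f (- (x^-1 * f')) -> is_derive x 1 g (- (x^-1 * g')) ->
  is_derive x 1 (fun t => a * f t + b * g t) (- (x^-1 * (a * f' + b * g'))).
Proof.
move=> df dg; apply: dvE (dvD (dvZ a df) (dvZ b dg)) _; ring.
Qed.

(** The coefficients 24, 26, 9, 1 are those of (2 + u) (3 + u) (4 + u), where [u] stands for
    lowering the index of [lgpow] by one: each derivative multiplies by the current exponent of 1 /
    x or differentiates the logarithm. *)
Lemma etaf_diff3 k n : `|diff3 (fun m => etaf k m%:R) n.+1| <=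
  n.+1%:R^-1 ^+ 5 * (24 * lgpow k.+3 (ln n.+4%:R) + 26 * lgpow k.+2 (ln n.+4%:R) +
    9 * lgpow k.+1 (ln n.+4%:R) + lgpow k (ln n.+4%:R)).
Proof.
pose l i x := lgpow (i + k) (- ln x).
pose f1 x := - (x^-1 ^+ 3 * (2 * l 3 x + l 2 x)).
pose f2 x := x^-1 ^+ 4 * (6 * l 3 x + 5 * l 2 x + l 1 x).
pose f3 x := - (x^-1 ^+ 5 * (24 * l 3 x + 26 * l 2 x + 9 * l 1 x + l 0 x)).
have dl i x : 0 < x -> is_derive x 1 (l i.+1) (- (x^-1 * l i x)) by exact: dv_lgpow.
apply: (@diff3_le _ (etaf k) f1 f2 f3) => x /andP[xn xn3].
have n1 : 0 < n.+1%:R :> R by [].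
have x0 : 0 < x by exact: lt_le_trans xn.
split.
- by apply: dvE (@dv_invX_mul 1 (l 3) (l 2) x x0 (dl 2 x x0)) _; rewrite /f1.
- have d : is_derive x 1 (fun t => 2 * l 3 t + 1 * l 2 t) (- (x^-1 * (2 * l 2 x + 1 * l 1 x))).
    by apply: dv_lin; exact: dl.
  apply: dv_ext (dvE (dvN (@dv_invX_mul 2 _ (fun x => 2 * l 2 x + 1 * l 1 x) x x0 d)) _).
    by move=> t; rewrite /f1 mul1r.
  by rewrite /f2; ring.
- have d1 : is_derive x 1 (fun t => 5 * l 2 t + 1 * l 1 t) (- (x^-1 * (5 * l 1 x + 1 * l 0 x))).
    by apply: dv_lin; exact: dl.
  have d := dv_lin 6 1 (dl 2%N x x0) d1.
  apply: dv_ext (dvE (@dv_invX_mul 3 _ (fun x => 6 * l 2 x + 1 * (5 * l 1 x + 1 * l 0 x)) x x0 d) _).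
    by move=> t; rewrite /f2; ring.
  by rewrite /f3; ring.
rewrite /f3 normrN normrM ger0_norm; last by rewrite exprn_ge0 // invr_ge0 ltW.
have lnx : `|- ln x| <= ln n.+4%:R.
  rewrite normrN ger0_norm; last by rewrite ln_ge0 // (le_trans _ xn) // ler1n.
  rewrite ler_ln ?posrE //; apply: le_trans xn3 _.
  by rewrite -natrD ler_nat addn3.
apply: ler_pM; rewrite ?exprn_ge0 ?invr_ge0 ?(ltW x0) //.
  by rewrite lerXn2r // ?nnegrE ?invr_ge0 ?(ltW x0) // lef_pV2.
have h i := @lgpow_norm (i + k) _ _ lnx.
have h0 := h 0%N; have h1 := h 1%N; have h2 := h 2; have h3 := h 3; rewrite -!/(l _ _) in h0 h1 h2 h3.
have N c i (c0 : 0 <= c) : `|c * l i x| = c * `|l i x| by rewrite normrM ger0_norm.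
apply: le_trans (ler_normD _ _) _; apply: lerD => //.
apply: le_trans (ler_normD _ _) _; apply: lerD; last by rewrite N // ler_wpM2l.
by apply: le_trans (ler_normD _ _) _; apply: lerD; rewrite N // ler_wpM2l.
Qed.

(** The sum over [k] is an exponential series delayed by at most 3 indices; as [r >= 1], the delay
    costs at most [r ^ 3]. *)
Lemma lgpow_sum (r y : R) i K : 1 <= r -> 0 <= y -> (i <= 3)%N ->
  \sum_(0 <= k < K) r ^+ k * lgpow (i + k) y <= r ^+ 3 * expR (r * y).
Proof.
move=> r1 y0 i3; have r0 : 0 <= r by lra.
pose g j := if j is i.+3 then exp_coeff (r * y) i else 0.
have g0 j : 0 <= g j by case: j => [|[|[|j]]] //=; apply: exp_coeff_ge0; rewrite mulr_ge0.
have -> : expR (r * y) = tsum (exp_coeff (r * y)) by [].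
apply: (@le_trans _ _ (r ^+ 3 * \sum_(0 <= k < K) g (i + k)%N)).
  rewrite mulr_sumr; apply: ler_sum => k _.
  have : (k <= i + k)%N by exact: leq_addl.
  case: (i + k)%N => [|[|[|j]]] kj /=; rewrite ?mulr0 //.
  have -> : r ^+ 3 * exp_coeff (r * y) j = r ^+ (3 + j) * (y ^+ j / j`!%:R).
    by rewrite /exp_coeff /= exprMn exprD !mulrA.
  by rewrite ler_wpM2r ?ler_weXn2l // divr_ge0 // exprn_ge0.
rewrite ler_wpM2l ?exprn_ge0 //.
apply: (@le_trans _ _ (\sum_(0 <= j < K.+3) g j)).
  have iK : (i <= K + 3)%N by apply: leq_trans i3 _; exact: leq_addl.
  rewrite -(addn3 K) (big_cat_nat (leq0n i) iK) /=.
  apply: ler_wpDl; first by apply: sumr_ge0.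
  have -> : \sum_(i <= j < K + 3) g j = \sum_(0 <= k < K + 3 - i) g (i + k)%N.
    by rewrite -{1}(add0n i) big_addn; apply: eq_bigr => k _; rewrite addnC.
  rewrite [leRHS](big_cat_nat (n := K)) //=; last by rewrite -addnBA // leq_addr.
  by rewrite lerDl sumr_ge0.
rewrite !big_nat_recl //= !add0r.
apply: (@partial_le_tsum _ (exp_coeff (r * y))).
  apply: asum_nneg; last exact: is_cvg_series_exp_coeff.
  by move=> k; apply: exp_coeff_ge0; rewrite mulr_ge0.
by move=> k; apply: exp_coeff_ge0; rewrite mulr_ge0.
Qed.

(** The origin of the radius 4: third differences of n ^ -2 decay like n ^ -5, summing the powers of
    the logarithm against r ^ k costs n ^ r, and 5 - r > 1 is required. Moreover 60 = 24 + 26 + 9 +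
    1, and 4 ^ r comes from n + 4 <= 4 (n + 1). *)
Definition etab r n : R := 60 * r ^+ 3 * 4 `^ r * n.+1%:R `^ (- (5 - r)).

Lemma asum_etab r : r < 4 -> cvgn (series (etab r)).
Proof. by move=> r4; apply: asum_cvg; apply: asumZ; apply: asum_powR; lra. Qed.

Lemma etaf_diff3_sum r n K : 1 <= r ->
  \sum_(0 <= k < K) `|diff3 (fun m => etaf k m%:R) n.+1| * r ^+ k <= etab r n.
Proof.
move=> r1; have r0 : 0 <= r by lra.
have y0 : 0 <= ln n.+4%:R :> R by rewrite ln_ge0 // ler1n.
have e1 : expR (r * ln n.+4%:R) <= 4 `^ r * n.+1%:R `^ r.
  rewrite -powRM // mulrC.
  have -> : expR (ln n.+4%:R * r) = n.+4%:R `^ r by rewrite /powR pnatr_eq0 mulrC.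
  apply: ge0_ler_powR; rewrite ?nnegrE // -natrM ler_nat mulnS -addn4 addnC leq_add2l leq_pmull //.
set y := ln n.+4%:R in y0 e1.
pose q : R := n.+1%:R^-1 ^+ 5.
have q0 : 0 <= q by rewrite exprn_ge0 // invr_ge0.
apply: (@le_trans _ _ (\sum_(0 <= k < K) q * (24 * (r ^+ k * lgpow (3 + k) y) +
   26 * (r ^+ k * lgpow (2 + k) y) + 9 * (r ^+ k * lgpow (1 + k) y) + r ^+ k * lgpow (0 + k) y))).
  apply: ler_sum => k _.
  apply: le_trans (ler_wpM2r (exprn_ge0 k r0) (etaf_diff3 k n)) _.
  rewrite -/q -/y !add0n !addSn -subr_ge0 le_eqVlt; apply/orP; left; apply/eqP.
  by move: (lgpow _ _) (lgpow _ _) (lgpow _ _) (lgpow _ _) (r ^+ k) => *; ring.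
rewrite -mulr_sumr !big_split /= -!mulr_sumr.
have h i := @lgpow_sum r y i K r1 y0.
have h0 := h 0%N isT; have h1 := h 1%N isT; have h2 := h 2 isT; have h3 := h 3 isT.
apply: (@le_trans _ _ (q * (60 * (r ^+ 3 * expR (r * y))))).
  rewrite ler_wpM2l //; move: h0 h1 h2 h3.
  move: (\sum_(_ <= _ < _) _) (\sum_(_ <= _ < _) _) (\sum_(_ <= _ < _) _) (\sum_(_ <= _ < _) _) (r ^+ 3 * _) => *; lra.
have -> : etab r n = q * (60 * (r ^+ 3 * (4 `^ r * n.+1%:R `^ r))).
  have -> : q = n.+1%:R `^ (- 5%:R) by rewrite powRN powR_mulrn // /q exprVn.
  rewrite /etab opprB (_ : r - 5 = - 5%:R + r); last by ring.
  rewrite powRD; last by apply/implyP.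
  by move: (_ `^ _) (_ `^ _) (_ `^ _) => *; ring.
by rewrite ler_wpM2l // ler_wpM2l // ler_wpM2l // exprn_ge0.
Qed.

Lemma asum_etaf n (X : nat -> R) r : 0 <= r -> (forall k, `|X k| <= r ^+ k) ->
  asum (fun k => etaf k n.+1%:R * X k).
Proof.
move=> r0 XR.
have y0 : 0 <= ln n.+1%:R :> R by rewrite ln_ge0 // ler1n.
apply: (@asum_le _ _ (fun k => n.+1%:R^-1 ^+ 2 * exp_coeff (r * ln n.+1%:R) k)).
  move=> k; rewrite normrM /etaf normrM ger0_norm ?exprn_ge0 ?invr_ge0 // -mulrA.
  rewrite ler_wpM2l ?exprn_ge0 ?invr_ge0 //.
  have h : `|lgpow k.+3 (- ln n.+1%:R)| <= lgpow k.+3 (ln n.+1%:R).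
    by apply: lgpow_norm; rewrite normrN ger0_norm.
  apply: le_trans (ler_pM _ _ h (XR k)) _ => //.
  by rewrite /exp_coeff /= exprMn mulrC mulrA.
apply: asum_cvg; apply: asumZ; apply: asum_nneg; last exact: is_cvg_series_exp_coeff.
by move=> k; apply: exp_coeff_ge0; rewrite mulr_ge0.
Qed.

(** Taylor summation commutes with Euler summation. [X] will be the real or imaginary part of the
    powers of w - 2, so the bound on it replaces an equality of moduli. *)
Lemma etac_tsum (X : nat -> R) r : 1 <= r < 4 -> (forall k, `|X k| <= r ^+ k) ->
  asum (fun k => etac k * X k) /\
  tsum (fun k => etac k * X k) = regsum (fun n => tsum (fun k => etaf k n%:R * X k)).
Proof.
move=> /andP[r1 r4] XR; have r0 : 0 <= r by lra.
pose S n := tsum (fun k => etaf k n%:R * X k).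
have sE n := asum_etaf (n := n) r0 XR.
pose f n k := (-1) ^+ n * diff3 (fun m => etaf k m%:R) n.+1 * X k.
have fE n k : f n k = (-1) ^+ n * (etaf k n.+1%:R * X k - 3 * (etaf k n.+2%:R * X k) +
    3 * (etaf k n.+3%:R * X k) - etaf k n.+4%:R * X k).
  by rewrite /f /diff3; move: (etaf _ _) (etaf _ _) (etaf _ _) (etaf _ _) => p q s t; ring.
have sf n : asum (f n).
  apply: (eq_asum (fE n)); apply: asumZ; apply: asumB => //; apply: asumD; last exact: asumZ.
  by apply: asumB => //; exact: asumZ.
have tf n : tsum (f n) = (-1) ^+ n * diff3 S n.+1.
  rewrite (eq_tsum (fE n)) tsumZ.
    rewrite /diff3 tsumB //; last first.
      by apply: asumD; [apply: asumB => //|]; exact: asumZ.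
    rewrite tsumD; [|by apply: asumB => //; exact: asumZ|exact: asumZ].
    by rewrite tsumB ?(tsumZ 3) //; exact: asumZ.
  apply: asumB => //; apply: asumD; last exact: asumZ.
  by apply: asumB => //; exact: asumZ.
have fB n : tsum (fun k => `|f n k|) <= etab r n.
  apply: tsum_le_ub => [|K]; first exact: asum_norm.
  apply: le_trans (etaf_diff3_sum n K r1); apply: ler_sum => k _.
  rewrite /f !normrM normrX normrN1 expr1n mul1r.
  by rewrite ler_wpM2l.
have sB := asum_etab r4.
have sd k : asum (fun n => diff3 (fun m => etaf k m%:R) n.+1).
  apply: asum_le sB => n; apply: le_trans (etaf_diff3_sum n k.+1 r1).
  rewrite big_nat_recr //= ler_wpDl //; last by rewrite ler_peMr // exprn_ege1.
  by apply: sumr_ge0 => i _; rewrite mulr_ge0 // exprn_ge0.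
have [h1 h2 h3 h4] := tsum_exchange sf fB sB.
have cE k : etac k * X k = (7 * (etaf k 1%:R * X k) - 4 * (etaf k 2%:R * X k) + etaf k 3%:R * X k) / 8 +
    8^-1 * tsum (f ^~ k).
  rewrite /etac /regsum.
  have -> : tsum (f ^~ k) = tsum (fun n => (-1) ^+ n * diff3 (fun m => etaf k m%:R) n.+1) * X k.
    rewrite mulrC -tsumZ; last exact: asum_sign.
    by apply: eq_tsum => n; rewrite /f mulrC.
  move: (etaf _ _) (etaf _ _) (etaf _ _) (tsum _) => p q s t; ring.
have s7 : asum (fun k => 8^-1 * (7 * (etaf k 1%:R * X k) - 4 * (etaf k 2%:R * X k) + etaf k 3%:R * X k)).
  by apply: asumZ; apply: asumD; [apply: asumB; apply: asumZ|]; exact: sE.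
have cE' k : etac k * X k = 8^-1 * (7 * (etaf k 1%:R * X k) - 4 * (etaf k 2%:R * X k) + etaf k 3%:R * X k) +
    8^-1 * tsum (f ^~ k).
  by rewrite cE [_ / 8]mulrC.
split; first by apply: (eq_asum cE'); apply: asumD => //; exact: asumZ.
rewrite (eq_tsum cE') tsumD //; last exact: asumZ.
rewrite !tsumZ //; last first.
  by apply: asumD; [apply: asumB; apply: asumZ|]; exact: sE.
rewrite -h4 (eq_tsum tf) /regsum -/S [_ / 8]mulrC; congr (_ * _ + _).
rewrite tsumD; [|by apply: asumB; apply: asumZ; exact: sE|exact: (sE 2%N)].
rewrite tsumB; [|by apply: asumZ; exact: (sE 0%N)|by apply: asumZ; exact: (sE 1%N)].
by rewrite (tsumZ 7) ?(tsumZ 4).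
Qed.

End EtaCoefficients.

(* The Taylor series at 2 of [(1 - 2 ^ (1 - s)) zeta s], whose disc of
   convergence contains -1. *)
Definition etaC {R : realType} (w : R[i]) : R[i] :=
  csum (fun k => (etac k)%:C * (w - 2) ^+ k).

Definition dterm {R : realType} (w : R[i]) (n : nat) : R[i] :=
  expC (- w * (ln n%:R)%:C).

(** * Identification of eta with the given zeta *)

Section Zeta.
Context {R : realType}.
Implicit Types (z w c : R[i]) (x y t r : R).

Lemma asum_etac r : 0 <= r < 4 -> asum (fun k => normc ((etac k)%:C : R[i]) * r ^+ k).
Proof.
move=> /andP[r0 r4]; pose s := Num.max 1 r.
have s14 : 1 <= s < 4 by rewrite /s le_max lexx gt_max r4 andbT; lra.
have rs k : `|r ^+ k| <= s ^+ k.
  have s0 : 0 <= s by rewrite le_max ler01.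
  have rs : r <= s by rewrite le_max lexx orbT.
  by rewrite ger0_norm ?exprn_ge0 // lerXn2r ?nnegrE.
have [h _] := etac_tsum s14 rs.
by apply: eq_asum (asum_norm h) => k; rewrite normc_real normrM (ger0_norm (exprn_ge0 k r0)).
Qed.

Lemma holo_etaC z : normc (z - 2) < 4 -> holo etaC z.
Proof.
by apply: holo_recenter => // r; exact: asum_etac.
Qed.

Lemma etaf_expC (n k : nat) w : (etaf k n.+1%:R)%:C * (w - 2) ^+ k =
  (n.+1%:R^-1 ^+ 2)%:C * cexp_term (- (ln n.+1%:R)%:C * (w - 2)) k.
Proof.
rewrite /etaf /cexp_term rmorphM -mulrA; congr (_ * _).
rewrite exprMn -rmorphN -rmorphXn mulrA -rmorphM /=; congr (_%:C * _).
by rewrite mulrC.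
Qed.

Lemma dterm_etaf (n : nat) w : dterm w n.+1 = csum (fun k => (etaf k n.+1%:R)%:C * (w - 2) ^+ k).
Proof.
rewrite (eq_csum (fun k => etaf_expC n k w)) csumZ; last exact: cabs_cexp.
rewrite -expC_csum /dterm.
have -> : (n.+1%:R^-1 ^+ 2)%:C = expC ((- (2 * ln n.+1%:R))%:C) :> R[i].
  rewrite expC_real; congr (_%:C).
  by rewrite expRN expRM_natl // lnK ?posrE // exprVn.
rewrite -expCD; congr expC; rewrite rmorphN rmorphM /=.
by rewrite (_ : (2 : R)%:C = 2) ?rmorph_nat //; ring.
Qed.

Lemma Re_csum_real (a : nat -> R) (u : nat -> R[i]) :
  Re (csum (fun k => (a k)%:C * u k)) = tsum (fun k => a k * Re (u k)).
Proof. by apply: eq_tsum => k; rewrite cReM /= mul0r subr0. Qed.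

Lemma Im_csum_real (a : nat -> R) (u : nat -> R[i]) :
  Im (csum (fun k => (a k)%:C * u k)) = tsum (fun k => a k * Im (u k)).
Proof. by apply: eq_tsum => k; rewrite cImM /= mul0r addr0. Qed.

(** n ^ (- w) is expanded around 2 by [dterm_etaf], and [etac_tsum] moves the Euler sum outside, on
    the whole disc and not only where the series converges. *)
Lemma etaC_regsum w : normc (w - 2) < 4 ->
  Re (etaC w) = regsum (fun n => Re (dterm w n)) /\
  Im (etaC w) = regsum (fun n => Im (dterm w n)).
Proof.
move=> w4; pose s := Num.max 1 (normc (w - 2)).
have s14 : 1 <= s < 4 by rewrite /s le_max lexx gt_max w4 andbT; lra.
have ws k : normc ((w - 2) ^+ k) <= s ^+ k.
  by rewrite normcX lerXn2r // ?nnegrE ?normc_ge0 // le_max ?lexx ?orbT // normc_ge0 orbT.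
split.
  rewrite Re_csum_real (etac_tsum s14 (fun k => le_trans (Re_le_normc _) (ws k))).2.
  by apply: eq_regsum => -[//|n] _; rewrite dterm_etaf Re_csum_real.
rewrite Im_csum_real (etac_tsum s14 (fun k => le_trans (Im_le_normc _) (ws k))).2.
by apply: eq_regsum => -[//|n] _; rewrite dterm_etaf Im_csum_real.
Qed.

Lemma normc_dterm w n : normc (dterm w n.+1) = n.+1%:R `^ (- Re w).
Proof.
rewrite /dterm normc_expC cReM /= mulr0 subr0 cReN /powR pnatr_eq0 /=.
by [].
Qed.

Lemma cabs_dterm w : 1 < Re w -> cabs (fun k => dterm w k.+1).
Proof. by move=> w1; apply: eq_asum (asum_powR w1) => k; exact: normc_dterm. Qed.

Lemma dterm_mul w m n : dterm w (m.+1 * n.+1)%N = dterm w m.+1 * dterm w n.+1.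
Proof.
by rewrite /dterm natrM lnM ?posrE // rmorphD mulrDr expCD.
Qed.

Lemma etaC_dirichlet w : 1 < Re w -> normc (w - 2) < 4 ->
  etaC w = (1 - 2 * dterm w 2) * csum (fun k => dterm w k.+1).
Proof.
move=> w1 w4; have [hr hi] := etaC_regsum w4.
have sd := cabs_dterm w1; have [sr si] := cabs_ReIm sd.
have -> : (1 - 2 * dterm w 2) * csum (fun k => dterm w k.+1) =
    csum (fun k => dterm w k.+1) - 2%:C * csum (fun k => dterm w (2 * k.+1)%N).
  rewrite (eq_csum (fun k => dterm_mul w 1 k)) csumZ // (_ : (2 : R)%:C = 2) ?rmorph_nat //.
  by ring.
apply: complexP.
  rewrite hr regsum_asum // -(tsum_alternating (g := fun n => Re (dterm w n)) sr) cReD cReN cReM /=.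
  by rewrite mul0r subr0.
rewrite hi regsum_asum // -(tsum_alternating (g := fun n => Im (dterm w n)) si) cImD cImN cImM /=.
by rewrite mul0r addr0.
Qed.

Section WithZeta.
Variable zeta : R[i] -> R[i]^o.
Hypothesis hzeta : is_riemann_zeta zeta.

Lemma zeta_csum w : 1 < Re w -> zeta w = csum (fun k => dterm w k.+1).
Proof. by move=> w1; apply/esym/csumE; exact: hzeta.1. Qed.

Lemma Re_zeta3 : Re (zeta 3) = zsum 3.
Proof.
have e : (3 : R[i]) = (3 : R)%:C by rewrite rmorph_nat.
have dk k : dterm (3 : R)%:C k.+1 = ((k.+1%:R ^+ 3)^-1)%:C.
  rewrite /dterm -rmorphN -rmorphM expC_real; congr (_%:C).
  by rewrite mulNr expRN expRM_natl // lnK ?posrE.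
rewrite e zeta_csum; last by rewrite /=; lra.
by apply: eq_tsum => k; rewrite dk.
Qed.

(** The difference [F] of the two sides is holomorphic off 1 in the disc of radius 4 around 2 and
    vanishes where Re w > 1. *)
Lemma zeta_etaC : exists2 r : R, 0 < r & forall w, normc (w + 1) <= r ->
  (1 - 2 * dterm w 2) * zeta w = etaC w.
Proof.
pose F w : R[i] := (1 - 2 * expC (- (ln 2)%:C * w)) * zeta w - etaC w.
have FE w : F w = (1 - 2 * dterm w 2) * zeta w - etaC w.
  by rewrite /F /dterm !mulNr [w * _]mulrC.
have hF z : z != 1 -> normc (z - 2) < 4 -> holo F z.
  move=> z1 z4; apply: holoB; last exact: holo_etaC.
  apply: holoM; last by apply: analytic_holo; exact: hzeta.2.
  apply: holoB; first exact: holo_cst.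
  by apply: holoM; [exact: holo_cst|exact: holo_expC].
(* The segment starts at 2 + i because the real one would cross 1; it meets the real axis only at
   -1. Its points are within distance 3 of 2, and the disc of radius 1/4 around 2 + i lies in Re w >
   1. *)
have [||||r r0 h] := @holo_segment _ F (2 +i* 1) (- 3 +i* - 1) 4^-1.
- by rewrite eq_complex /= oppr_eq0 pnatr_eq0.
- move=> t /andP[t0 t1].
  have -> : 2 +i* 1 + t%:C * (- 3 +i* -1) = (2 - 3 * t) +i* (1 - t) :> R[i].
    by apply: complexP => /=; ring.
  apply: hF.
    rewrite eq_complex /=; apply/negP => /andP[/eqP h1 /eqP h2]; lra.
  have -> : (2 - 3 * t) +i* (1 - t) - 2 = (- 3 * t) +i* (1 - t) :> R[i].
    apply: complexP; rewrite ?cReD ?cImD ?cReN ?cImN (_ : (2 : R[i]) = (2 : R)%:C) ?rmorph_nat //=; ring.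
  apply: le_lt_trans (normc_le_ReIm _) _ => /=.
  rewrite normrM (ger0_norm t0) normrN !ger0_norm //; lra.
- by rewrite invr_gt0.
- move=> w hw; rewrite FE.
  have hr := le_trans (Re_le_normc _) hw; rewrite cReD cReN /= in hr.
  have w1 : 1 < Re w by move: hr; rewrite ler_norml; move=> /andP[]; lra.
  rewrite etaC_dirichlet // -?zeta_csum ?subrr //.
  have -> : w - 2 = (w - (2 +i* 1)) + (0 +i* 1).
    have -> : 2 +i* 1 = 2 + (0 +i* 1) :> R[i].
      have -> : (2 : R[i]) = (2 : R)%:C by rewrite rmorph_nat.
      by apply: complexP => /=; ring.
    ring.
  apply: le_lt_trans (le_normcD _ _) _; apply: le_lt_trans (lerD hw (normc_le_ReIm _)) _ => /=.
  rewrite normr0 normr1; lra.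
exists r => // w hw; apply/eqP; rewrite -subr_eq0 -FE h //.
have -> : w - (2 +i* 1 + (- 3 +i* - 1)) = w + 1.
  by apply: complexP; rewrite !(cReD, cImD, cReN, cImN) /=; ring.
exact: hw.
Qed.

End WithZeta.
End Zeta.

(** * The derivative of zeta at -1 *)

Section ZetaDerivative.
Context {R : realType}.
Implicit Types (z w c : R[i]) (x y t r : R).

Lemma nearC_intro (P : R[i] -> Prop) (e : R) z : 0 < e ->
  (forall w, normc (w - z) < e -> P w) -> \forall w \near (z : R[i]^o), P w.
Proof.
move=> e0 h; apply/nbhs_ballP; exists e%:C => /=; first by rewrite ltcR.
move=> w; rewrite /ball /= /ball_ /= distrC => hw; apply: h.
by rewrite -ltcR; exact: hw.
Qed.

(** A quantitative difference quotient for the complex derivative; it will be used with real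
    increments only. *)
Lemma holo_derive (f : R[i] -> R[i]^o) z : holo f z ->
  exists (r K : R), [/\ 0 < r, 0 <= K & forall w, w != 0 -> normc w <= r ->
    normc (w^-1 * (f (z + w) - f z) - derive1 f z) <= normc w * K].
Proof.
move=> [a [r [r0 sa fa]]].
pose T := tsum (fun k => normc (a k.+2) * r ^+ k).
have sT : asum (fun k => normc (a k.+2) * r ^+ k).
  have := asumZ (c := (r ^+ 2)^-1) (asum_shift (n := 2) sa); apply: eq_asum => k.
  rewrite [r ^+ (2 + k)]exprD add2n; move: (normc _) (r ^+ k) => x y.
  by field; rewrite gt_eqF.
have T0 : 0 <= T by apply: tsum_ge0 => // k; rewrite mulr_ge0 ?normc_ge0 // exprn_ge0 // ltW.
have bnd w : w != 0 -> normc w <= r ->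
    normc (w^-1 * (f (z + w) - f z) - a 1%N) <= normc w * (2 * T).
  move=> w0 wr.
  have e : z + w - z = w by rewrite addrAC subrr add0r.
  have sx : cabs (fun k => a k * w ^+ k) by exact: cabs_pow sa wr.
  have s2 : cabs (fun k => a k.+2 * w ^+ k).
    apply: asum_le (asum_cvg sT) => k; rewrite ger0_norm ?normc_ge0 // normcM normcX.
    by rewrite ler_wpM2l ?normc_ge0 // lerXn2r ?nnegrE ?normc_ge0 // ltW.
  have fz : f z = a 0%N.
    rewrite fa subrr ?normc0 ?(ltW r0) //.
    have h k : (1 <= k)%N -> a k * 0 ^+ k = 0 by case: k => // k _; rewrite expr0n mulr0.
    by have [_ ->] := csum_fin h; rewrite big_nat1 expr0 mulr1.
  have fw : f (z + w) = a 0%N + (a 1%N * w + w ^+ 2 * csum (fun k => a k.+2 * w ^+ k)).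
    rewrite fa e // csum_recl // expr0 mulr1 csum_recl ?expr1; last exact: tsumS sx.
    congr (_ + (_ + _)); rewrite -csumZ //; apply: eq_csum => k.
    by rewrite !exprS; ring.
  have -> : w^-1 * (f (z + w) - f z) - a 1%N = w * csum (fun k => a k.+2 * w ^+ k).
    by rewrite fw fz; move: (csum _) => C; field.
  rewrite normcM ler_wpM2l ?normc_ge0 //; apply: le_trans (normc_csum s2) _.
  rewrite ler_wpM2l //; apply: le_tsum => // k; rewrite normcM normcX ler_wpM2l ?normc_ge0 //.
  by rewrite lerXn2r ?nnegrE ?normc_ge0 // ltW.
suff -> : derive1 f z = a 1%N.
  by exists r, (2 * T); split => //; rewrite mulr_ge0.
apply: cvg_lim; first exact: norm_hausdorff.
apply/cvgrPdist_lt => e; rewrite ltcE /= => /andP[/eqP ie e0].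
have -> : e = (Re e)%:C by apply: complexP.
pose d := Num.min r (Re e / (2 * T + 1)).
have T1 : 0 < 2 * T + 1 by lra.
have d0 : 0 < d by rewrite lt_min r0 divr_gt0.
rewrite near_withinE; apply: (nearC_intro d0) => w; rewrite subr0 => wd w0.
have wr : normc w <= r by apply: le_trans (ltW wd) _; rewrite ge_min lexx.
suff h : normc (w^-1 * (f (z + w) - f z) - a 1%N) < Re e.
  by move: h; rewrite -normcN opprB -ltcR [w + z]addrC; exact.
apply: le_lt_trans (bnd w w0 wr) _.
have we : normc w < Re e / (2 * T + 1) by apply: lt_le_trans wd _; rewrite ge_min lexx orbT.
move: we; rewrite ltr_pdivlMr // mulrDr mulr1.
by move: (normc w) (normc_ge0 w) => x x0; lra.
Qed.

(** The one-sided derivative of eta at -1, taken under the Euler sum: the third derivative in [x] of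
    the quotient [u t x] is at most [x ^ -2] for all 0 < t < 1. The value 1/4 is the Euler sum of
    [n]. *)
Lemma eta_slope : (regsum (fun n => (n%:R : R) `^ (1 - t)) - 1 / 4) / t @[t --> 0^'+] --> (rho1 : R).
Proof.
pose u t x := (x `^ (1 - t) - x) / t.
pose u1 t x := ((1 - t) * x `^ (- t) - 1) / t.
pose u2 t x := - ((1 - t) * x `^ (- t - 1)).
pose u3 t x := (1 - t) * (t + 1) * x `^ (- t - 2).
have du t x : 0 < t < 1 -> 1 <= x -> [/\ is_derive x 1 (u t) (u1 t x), is_derive x 1 (u1 t) (u2 t x),
        is_derive x 1 (u2 t) (u3 t x) & `|u3 t x| <= 1 * x `^ (- 2)].
  move=> /andP[t0 t1] x1; have x0 : 0 < x by lra.
  split.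
  - apply: dvE (dvMr t^-1 (dvB (dv_powR (1 - t) x0) (dv_id x))) _.
    by rewrite /u1 (_ : 1 - t - 1 = - t) //; ring.
  - apply: dvE (dvMr t^-1 (dvB (dvZ (1 - t) (dv_powR (- t) x0)) (dv_cst 1 x))) _.
    by rewrite /u2; move: (_ `^ _) => p; field; rewrite gt_eqF.
  - apply: dvE (dvN (dvZ (1 - t) (dv_powR (- t - 1) x0))) _.
    rewrite /u3 (_ : - t - 1 - 1 = - t - 2); last by ring.
    by move: (_ `^ _) => p; ring.
  rewrite /u3 normrM (ger0_norm (powR_ge0 _ _)) ger0_norm; last by rewrite mulr_ge0; lra.
  apply: ler_pM; rewrite ?powR_ge0 ?mulr_ge0 //; try by nra.
  by rewrite ler_powR //; lra.
have [|||h1 h2] := @regsum_cvg R R (0^'+) _ u u1 u2 u3 (fun n => - (n%:R * ln n%:R)) 2 1 _.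
- by lra.
- near=> t => x; apply: du; apply/andP; split; near: t; [exact: nbhs_right_gt|exact: nbhs_right_lt].
- move=> n n0.
  have n0' : 0 < n%:R :> R by rewrite ltr0n.
  have dd : is_derive (0 : R) (1 : R) (fun t => n%:R * expR (- (t * ln n%:R)) - n%:R) (- (n%:R * ln n%:R)).
    apply: dvE (dvB (dvZ n%:R (dv_exp (dvN (dvMr (ln n%:R) (dv_id 0))))) (dv_cst n%:R 0)) _.
    by rewrite mul0r oppr0 expR0; ring.
  have c : (n%:R * expR (- (t * ln n%:R)) - n%:R) / t @[t --> 0^'+] --> (- (n%:R * ln n%:R) : R).
    by apply: cvg_dq dd _; rewrite mul0r oppr0 expR0 mulr1 subrr.
  apply: (cvgr_eq c erefl); near=> t; rewrite /u /powR gt_eqF //=; congr ((_ - _) / _).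
  by rewrite mulrBl mul1r expRD lnK ?posrE.
apply: (cvgr_eq h2 erefl); near=> t.
have t0 : 0 < t by near: t; exact: nbhs_right_gt.
have t1 : t < 1 by near: t; exact: nbhs_right_lt.
have su : asum_diff3 (fun n => u t n%:R).
  have p2 : 1 < (2 : R) by lra.
  have t01 : 0 < t < 1 by rewrite t0.
  have h := @asum_diff3_le R (u t) (u1 t) (u2 t) (u3 t) 2 1 p2 (fun x => @du t x t01).
  by apply: asum_le h _; apply/asum_cvg/asumZ/asum_powR.
have -> : regsum (fun n => n%:R `^ (1 - t)) = regsum (fun n => n%:R * 1 + t * u t n%:R).
  apply: eq_regsum => n n0; rewrite /u; move: (_ `^ _) => p.
  by field; rewrite gt_eqF.
have st : asum_diff3 (fun n => t * u t n%:R).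
  have := asumZ (c := t) su; apply: eq_asum => k; rewrite /diff3; ring.
rewrite regsumD //; last exact: asum_diff3_id.
rewrite regsum_id regsumZ //; move: (regsum _) => S; field; by rewrite gt_eqF.
Unshelve. all: end_near. Qed.

(** Differentiation of (1 - 2 ^ (1 - s)) zeta(s) = eta(s) at -1, where the first factor is -3 with
    derivative 4 ln 2, and zeta(-1) = - 1 / 12 follows from eta(-1) = 1 / 4. *)
Theorem zeta_derive_N1 (zeta : R[i] -> R[i]^o) : is_riemann_zeta zeta ->
  Re (derive1 zeta (- 1)) = - (rho1 + ln 2 / 3) / 3.
Proof.
move=> hz; have [r r0 hr] := zeta_etaC hz.
have hol : holo zeta (-1).
  apply: analytic_holo; apply: hz.2.
  by rewrite -subr_eq0 -opprD oppr_eq0 -mulr2n pnatr_eq0.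
have [s [K [s0 K0 hs]]] := holo_derive hol.
set D := derive1 zeta _ in hs *.
pose Z t := Re (zeta (- 1 + t%:C)).
pose u t : R := 1 - 4 * expR (- (t * ln 2)).
have eu t : 0 <= t <= r -> t < 4 -> u t * Z t = regsum (fun n => n%:R `^ (1 - t)).
  move=> /andP[t0 tr] t4.
  pose w : R[i] := (- 1 + t)%:C.
  have ew : - 1 + t%:C = w by rewrite /w rmorphD rmorphN rmorph1.
  have h : normc (w + 1) <= r.
    by rewrite -ew addrAC addNr add0r normc_real ger0_norm.
  have w4 : normc (w - 2) < 4.
    have -> : w - 2 = (t - 3)%:C by rewrite -ew rmorphB rmorph_nat; ring.
    by rewrite normc_real ltr_norml; apply/andP; split; lra.
  have dw n : dterm w n = (expR ((1 - t) * ln n%:R))%:C.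
    by rewrite /dterm -rmorphN -rmorphM expC_real opprD opprK.
  have := congr1 (fun z : R[i] => Re z) (hr _ h).
  have -> : 1 - 2 * dterm w 2 = (u t)%:C.
    rewrite dw (_ : (2 : R[i]) = (2 : R)%:C) ?rmorph_nat //.
    have E : expR ((1 - t) * ln 2) = 2 * expR (- (t * ln 2)) :> R.
      by rewrite mulrBl mul1r expRD lnK ?posrE.
    by rewrite E /u; apply: complexP => /=; ring.
  rewrite (etaC_regsum w4).1 cReM [complex.Im _ * _]mul0r subr0 [Re _%:C]/= /Z ew => ->.
  apply: eq_regsum => n n0.
  by rewrite dw /= /powR gt_eqF ?ltr0n.
have eu0 : -3 * Z 0 = 1 / 4.
  have r00 : 0 <= (0 : R) <= r by rewrite lexx ltW.
  have u0 : u 0 = -3 by rewrite /u mul0r oppr0 expR0; ring.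
  rewrite -u0 (eu 0 r00) // -(regsum_id 1); apply: eq_regsum => n _.
  by rewrite subr0 powRr1 // mulr1.
have dZ : (Z t - Z 0) / t @[t --> 0^'+] --> (Re D : R).
  have c : Re D + t * K @[t --> 0^'+] --> (Re D + 0 * K : R).
    by apply: cvgD; [exact: cvg_cst|apply: cvgMl; exact: cvg_id0].
  have c' : Re D - t * K @[t --> 0^'+] --> (Re D - 0 * K : R).
    by apply: cvgB; [exact: cvg_cst|apply: cvgMl; exact: cvg_id0].
  rewrite mul0r ?addr0 in c; rewrite mul0r ?subr0 in c'.
  apply: squeeze_cvgr c' c; near=> t.
  have t0 : 0 < t by near: t; exact: nbhs_right_gt.
  have ts : t <= s by near: t; exact: nbhs_right_le.
  have tC : t%:C != 0 :> R[i] by rewrite -normc_eq0 normc_real normr_eq0 gt_eqF.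
  have := hs t%:C tC; rewrite normc_real gtr0_norm // => /(_ ts).
  move=> /(le_trans (Re_le_normc _)); rewrite cReD cReN -fmorphV cReM /= mul0r subr0.
  have z0 : Z 0 = Re (zeta (-1)) by rewrite /Z (_ : (0 : R)%:C = 0) ?addr0.
  rewrite cReD cReN -/(Z t) -z0.
  by rewrite ler_distl [t^-1 * _]mulrC => /andP[-> ->].
have cZ : Z t @[t --> 0^'+] --> (Z 0 : R).
  have c : Z 0 + t * ((Z t - Z 0) / t) @[t --> 0^'+] --> (Z 0 + 0 * Re D : R).
    by apply: cvgD; [exact: cvg_cst|apply: cvgM => //; exact: cvg_id0].
  apply: (cvgr_eq c); first by rewrite mul0r addr0.
  near=> t; have t0 : 0 < t by near: t; exact: nbhs_right_gt.
  by move: (Z t) (Z 0) => x y; field; rewrite gt_eqF.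
have du : (u t - (- 3)) / t @[t --> 0^'+] --> (4 * ln 2 : R).
  have d : is_derive (0 : R) (1 : R) (fun t => u t - (- 3)) (4 * ln 2).
    apply: dvE (dvB (dvB (dv_cst 1 0) (dvZ 4 (dv_exp (dvN (dvMr (ln 2) (dv_id 0)))))) (dv_cst (-3) 0)) _.
    by rewrite mul0r oppr0 expR0; ring.
  by apply: cvg_dq d _; rewrite /u mul0r oppr0 expR0; ring.
have c : (u t - (- 3)) / t * Z t + -3 * ((Z t - Z 0) / t) @[t --> 0^'+] -->
    (4 * ln 2 * Z 0 + -3 * Re D : R).
  by apply: cvgD; [exact: cvgM|apply: cvgM => //; exact: cvg_cst].
have e : 4 * ln 2 * Z 0 + -3 * Re D = rho1.
  apply: cvg_unique eta_slope; first exact: Rhausdorff.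
  apply: (cvgr_eq c erefl); near=> t.
  have t0 : 0 < t by near: t; exact: nbhs_right_gt.
  have tr : 0 <= t <= r by rewrite ltW //=; near: t; exact: nbhs_right_le.
  have t4 : t < 4 by near: t; exact: nbhs_right_lt.
  rewrite -eu // -eu0.
  by move: (Z t) (Z 0) (u t) => x y v; field; rewrite gt_eqF.
have -> : Re D = - (rho1 - 4 * ln 2 * Z 0) / 3 by rewrite -e; field.
have -> : Z 0 = - 1 / 12 by move: (Z 0) eu0 => x h; lra.
by field.
Unshelve. all: end_near. Qed.

End ZetaDerivative.

(** * Local limit theorem *)

Section CentralLimit.
Local Notation mu := (@lebesgue_measure _).
Context {R : realType}.
Implicit Types (x y a b C : R).

Lemma integrable_cauchy C : (@lebesgue_measure R).-integrable setT (fun x : R => (C / (1 + x ^+ 2))%:E).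
Proof.
have mf : measurable_fun [set: R] (fun x : R => (1 + x ^+ 2)^-1).
  exact: continuous_measurable_fun (@continuous_oneDsqrV R).
have -> : (fun x : R => (C / (1 + x ^+ 2))%:E) = (fun x => C%:E * ((1 + x ^+ 2)^-1)%:E)%E.
  by apply/funext => x; rewrite EFinM.
apply: integrableZl => //; apply/integrableP; split; first exact/measurable_EFinP.
have -> : (\int[mu]_x `|((1 + x ^+ 2)^-1)%:E| = \int[mu]_x (((1 + x ^+ 2)^-1)%:E : \bar R))%E.
  by apply: eq_integral => x _; rewrite abse_EFin ger0_norm // invr_ge0 addr_ge0 // sqr_ge0.
rewrite (@ge0_symfun_integralT _ (fun x => (1 + x ^+ 2)^-1)) //=.
- rewrite (_ : [set x | _] = `[0, +oo[%classic); last first.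
    by apply/seteqP; split => x /=; rewrite in_itv /= andbT.
  by have := @integral0y_oneDsqr R; rewrite /oneDsqr => ->; rewrite -EFinM ltry.
- by move=> x; rewrite invr_ge0 addr_ge0 // sqr_ge0.
- exact: (@continuous_oneDsqrV R).
- by move=> x /=; rewrite sqrrN.
Qed.

(** Dominated convergence with a Cauchy density as majorant, the functions being extended by 0
    outside windows that exhaust the line. [gauss_fun] is exp (- x ^ 2), which is why variances will
    be normalised to 2. *)
Lemma gauss_llt (f : nat -> R -> R) (a : nat -> R) C :
  (forall n, continuous (f n)) ->
  (forall x, f n x @[n --> \oo] --> gauss_fun x) ->
  (\forall n \near \oo, forall x, `|x| <= a n -> `|f n x| <= C / (1 + x ^+ 2)) ->
  a n @[n --> \oo] --> +oo ->
  (\int[mu]_(x in `[- a n, a n]) f n x)%R @[n --> \oo] --> Num.sqrt (pi : R).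
Proof.
move=> cf fg [N _ HN] aoo.
have C0 : 0 <= C.
  near \oo => n; have a0 : 0 <= a n by near: n; apply/cvgryPge: 0.
  have := HN n _ 0; rewrite normr0 expr0n addr0 divr1 => h.
  by apply: le_trans (normr_ge0 (f n 0)) _; apply: h a0; near: n; exact: nbhs_infty_ge.
rewrite -(cvg_shiftn N).
pose g n := f (n + N)%N \_ `[- a (n + N)%N, a (n + N)%N].
have gle n x : `|g n x| <= C / (1 + x ^+ 2).
  rewrite /g patchE; case: ifPn => [|_].
    by rewrite inE /= in_itv /= -ler_norml => xa; apply: HN => //=; exact: leq_addl.
  by rewrite normr0 divr_ge0 // addr_ge0 // sqr_ge0.
have gcv x : g n x @[n --> \oo] --> gauss_fun x.
  have := fg x; rewrite -(cvg_shiftn N); apply: cvg_trans; apply: near_eq_cvg; near=> n.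
  rewrite /g patchE mem_set //= in_itv /= -ler_norml.
  near: n; apply/cvgryPge: `|x|.
  by move: aoo; rewrite -(cvg_shiftn N).
have gcvE x : setT x -> (g n x)%:E @[n --> \oo] --> (gauss_fun x)%:E.
  by move=> _; apply/fine_cvgP; split; [exact: nearW|exact: gcv].
have mg n : measurable_fun setT (g n).
  apply/(measurable_restrictT _ (measurable_itv _)) => //.
  by apply: measurable_funTS; exact: continuous_measurable_fun.
have [|||||_ _] := @dominated_convergence _ _ R (@lebesgue_measure R) setT measurableT
  (fun n x => (g n x)%:E) (fun x => (gauss_fun x)%:E) (fun x => (C / (1 + x ^+ 2))%:E).
- by move=> n; apply/measurable_EFinP; exact: mg.
- by apply/measurable_EFinP; exact: measurable_gauss_fun.
- by apply: aeW => x; exact: gcvE.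
- exact: integrable_cauchy.
- by apply: aeW => x n _; rewrite lee_fin; exact: gle.
rewrite integralT_gauss => h.
have H : fine (\int[@lebesgue_measure R]_x (g n x)%:E)%E @[n --> \oo] --> Num.sqrt (pi : R).
  exact: fine_cvg h.
apply: (cvgr_eq H erefl); near=> n.
by rewrite [RHS]Rintegral_mkcond.
Unshelve. all: end_near. Qed.

Definition ccont (f : R -> R[i]) := continuous (fun x => Re (f x)) /\ continuous (fun x => Im (f x)).

Lemma ccontM f g : ccont f -> ccont g -> ccont (fun x => f x * g x).
Proof.
move=> [f1 f2] [g1 g2]; split => x.
  under eq_fun do rewrite cReM.
  by apply: cvgB; apply: cvgM; [exact: f1|exact: g1|exact: f2|exact: g2].
under eq_fun do rewrite cImM.
by apply: cvgD; apply: cvgM; [exact: f1|exact: g2|exact: f2|exact: g1].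
Qed.

Lemma ccontV f : (forall x, f x != 0) -> ccont f -> ccont (fun x => (f x)^-1).
Proof.
move=> f0 [f1 f2].
have n0 x : Re (f x) ^+ 2 + Im (f x) ^+ 2 != 0.
  rewrite paddr_eq0 ?sqr_ge0 // !sqrf_eq0; apply/negP => /andP[/eqP h1 /eqP h2].
  by move/eqP: (f0 x); apply; apply: complexP.
have cn : continuous (fun x => (Re (f x) ^+ 2 + Im (f x) ^+ 2)^-1).
  move=> x; apply: cvgV => //; rewrite !expr2.
  by apply: cvgD; under eq_fun do rewrite expr2; apply: cvgM; [exact: f1|exact: f1|exact: f2|exact: f2].
split => x.
  have -> : (fun x => Re (f x)^-1) = (fun x => Re (f x) * (Re (f x) ^+ 2 + Im (f x) ^+ 2)^-1).
    by apply/funext => y; case: (f y).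
  by apply: cvgM; [exact: f1|exact: cn].
have -> : (fun x => Im (f x)^-1) = (fun x => - (Im (f x) * (Re (f x) ^+ 2 + Im (f x) ^+ 2)^-1)).
  by apply/funext => y; case: (f y).
by apply: cvgN; apply: cvgM; [exact: f2|exact: cn].
Qed.

Lemma ccontD f g : ccont f -> ccont g -> ccont (fun x => f x + g x).
Proof.
move=> [f1 f2] [g1 g2]; split => x.
  by under eq_fun do rewrite cReD; apply: cvgD; [exact: f1|exact: g1].
by under eq_fun do rewrite cImD; apply: cvgD; [exact: f2|exact: g2].
Qed.

Lemma ccont_cst (z : R[i]) : ccont (fun=> z).
Proof. by split => x; exact: cvg_cst. Qed.

Lemma ccont_cis (c : R) : ccont (fun x => expC (0 +i* (c * x))).
Proof.
have cc : continuous (fun x => c * x) by move=> x; apply: cvgM; [exact: cvg_cst|exact: cvg_id].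
have e x : expC (0 +i* (c * x)) = cos (c * x) +i* sin (c * x).
  by rewrite /expC /= expR0; apply: complexP => /=; ring.
split => x; under eq_fun do rewrite e /=.
  exact: (continuous_comp (cc x) (@continuous_cos _ _)).
exact: (continuous_comp (cc x) (@continuous_sin _ _)).
Qed.

Lemma ccont_prod (I : Type) (r : seq I) (f : I -> R -> R[i]) : (forall i, ccont (f i)) ->
  ccont (fun x => \prod_(i <- r) f i x).
Proof.
move=> h; elim: r => [|i r IH].
  have -> : (fun x => \prod_(i <- [::]) f i x) = (fun=> 1) by apply/funext => x; rewrite big_nil.
  exact: ccont_cst.
have -> : (fun x => \prod_(j <- i :: r) f j x) = (fun x => f i x * \prod_(j <- r) f j x).
  by apply/funext => x; rewrite big_cons.
exact: ccontM.
Qed.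

End CentralLimit.

(** * Partition counts as Fourier coefficients *)

Definition cis {R : realType} (y : R) : R[i] := expC (0 +i* y).

(* The parts are [a 0, ..., a (N - 1)]. *)
Fixpoint pcount (a : nat -> nat) (N n : nat) : nat :=
  if N is N'.+1 then \sum_(0 <= m < n.+1 | (m * a N' <= n)%N) pcount a N' (n - m * a N')
  else (n == 0)%N.

Fixpoint qcount (a : nat -> nat) (N n : nat) : nat :=
  if N is N'.+1 then (qcount a N' n + (if (a N' <= n)%N then qcount a N' (n - a N') else 0))%N
  else (n == 0)%N.

Section Fourier.
Context {R : realType}.
Implicit Types (x y : R) (k : int).

Lemma cisE y : cis y = cos y +i* sin y.
Proof. by rewrite /cis /expC /= expR0; apply: complexP => /=; ring. Qed.

Lemma cisD x y : cis (x + y) = cis x * cis y.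
Proof. by rewrite /cis -expCD; congr expC; apply: complexP => /=; ring. Qed.

Lemma normc_cis y : normc (cis y) = 1.
Proof. by rewrite /cis normc_expC /= expR0. Qed.

Variable tau : R.
Hypothesis tau0 : 0 < tau.

(** The full period of the inversion integral, stretched by [tau]. *)
Definition window (f : R -> R) : R :=
  \int[@lebesgue_measure R]_(x in `[- (pi * tau), pi * tau]) f x.

Let pt0 : 0 < pi * tau. Proof. by rewrite mulr_gt0 // pi_gt0. Qed.

Lemma window_integrable (f : R -> R) : continuous f ->
  (@lebesgue_measure R).-integrable `[- (pi * tau), pi * tau] (EFin \o f).
Proof.
move=> cf; apply: continuous_compact_integrable; first exact: segment_compact.
exact: continuous_subspaceT.
Qed.

Lemma windowB (f g : R -> R) : continuous f -> continuous g ->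
  window (fun x => f x - g x) = window f - window g.
Proof. by move=> cf cg; apply: RintegralB => //; exact: window_integrable. Qed.

Lemma windowD (f g : R -> R) : continuous f -> continuous g ->
  window (fun x => f x + g x) = window f + window g.
Proof. by move=> cf cg; apply: RintegralD => //; exact: window_integrable. Qed.

Lemma windowZ (c : R) (f : R -> R) : continuous f ->
  window (fun x => c * f x) = c * window f.
Proof. by move=> cf; apply: RintegralZl => //; exact: window_integrable. Qed.

Lemma window1 : window (fun=> 1) = 2 * pi * tau.
Proof.
have := @lebesgue_measure_itv R (`[- (pi * tau), pi * tau]%R).
rewrite /= lte_fin gtrN // -EFinD => h.
rewrite /window Rintegral_cst // mul1r.
by rewrite [X in fine X]h /= opprK; ring.
Qed.

Lemma window_le (f : R -> R) : continuous f -> (forall x, `|f x| <= 1) ->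
  `|window f| <= 2 * pi * tau.
Proof.
move=> cf f1; apply: le_trans (le_normr_Rintegral _ (window_integrable cf)) _ => //.
have c1 : continuous (fun _ : R => 1 : R) by move=> x; exact: cvg_cst.
have cn : continuous (fun x => `|f x|) by move=> x; apply: cvg_norm; exact: cf.
apply: (@le_trans _ _ (window (fun=> 1))).
  by apply: le_Rintegral => //; exact: window_integrable.
by rewrite window1.
Qed.

Lemma window_cis k : window (fun x => Re (cis (- (k%:~R * (x / tau))))) =
  if k == 0 then 2 * pi * tau else 0.
Proof.
have e : (fun x => Re (cis (- (k%:~R * (x / tau))))) = (fun x => cos (k%:~R / tau * x)).
  apply/funext => x; rewrite cisE /= cosN; congr cos; ring.
rewrite e; case: eqP => [->|/eqP k0].
  have -> : (fun x : R => cos (0%:~R / tau * x)) = (fun=> 1).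
    by apply/funext => x; rewrite !mul0r cos0.
  exact: window1.
set c := k%:~R / tau.
have c0 : c != 0 by rewrite mulf_neq0 ?intr_eq0 // invr_eq0 gt_eqF.
have cc : continuous (fun x : R => cos (c * x)).
  have cm : continuous (fun x => c * x) by move=> x; apply: cvgM; [exact: cvg_cst|exact: cvg_id].
  by move=> x; exact: (continuous_comp (cm x) (@continuous_cos _ _)).
have dF x : is_derive x 1 (fun x => c^-1 * sin (c * x)) (cos (c * x)).
  have ds := @dv_comp R sin (fun x => c * x) x _ _ (is_derive_sin _) (dvZ c (dv_id x)).
  by apply: dvE (dvZ c^-1 ds) _; move: (cos _) => z; field.
have Fc x : {for x, continuous (fun x => c^-1 * sin (c * x))}.
  exact: dv_continuous (dF x).
rewrite /window /Rintegral (@continuous_FTC2 _ _ (fun x => c^-1 * sin (c * x))) //.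
- have -> : c * (pi * tau) = k%:~R * pi by rewrite /c; field; rewrite gt_eqF.
  have -> : c * - (pi * tau) = - (k%:~R * pi) by rewrite /c; field; rewrite gt_eqF.
  rewrite sinN.
  have -> : sin (k%:~R * pi) = 0 :> R.
    case: k {k0 c c0 cc dF Fc e} => n.
      rewrite -pmulrn; elim: n => [|n IH]; first by rewrite mul0r sin0.
      by rewrite -natr1 mulrDl mul1r sinDpi IH oppr0.
    rewrite NegzE mulrNz mulNr sinN -pmulrn.
    elim: n.+1 => [|m IH]; first by rewrite mul0r sin0 oppr0.
    by rewrite -natr1 mulrDl mul1r sinDpi opprK -[LHS]opprK IH oppr0.
  by rewrite oppr0 mulr0 subee.
- by rewrite gtrN.
- exact: continuous_subspaceT.
- split.
  + by move=> x _; have [] := dF x.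
  + by apply: cvg_at_right_filter; exact: Fc.
  + by apply: cvg_at_left_filter; exact: Fc.
- by move=> x _; rewrite derive1E; have [_ ->] := dF x.
Qed.

Variable r : R.
Hypothesis r01 : 0 < r < 1.
Variable a : nat -> nat.
Hypothesis a0 : forall j, (0 < a j)%N.

(** The characteristic function of [m] times a geometric variable of ratio [r ^ m]; [qfac] is its
    Bernoulli analogue. *)
Definition pfac (m : nat) (y : R) : R[i] := (1 - r ^+ m)%:C / (1 - (r ^+ m)%:C * cis (m%:R * y)).
Definition qfac (m : nat) (y : R) : R[i] := (1 + (r ^+ m)%:C * cis (m%:R * y)) / (1 + r ^+ m)%:C.

Let ra j : 0 < r ^+ a j < 1.
Proof. by case/andP: r01 => h1 h2; rewrite exprn_gt0 //= exprn_ilt1 ?ltW // -lt0n. Qed.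

Lemma pfac_den_le m y : 0 < r ^+ m < 1 -> 1 - r ^+ m <= normc (1 - (r ^+ m)%:C * cis (m%:R * y)).
Proof.
move=> /andP[h0 h1].
have := le_normcD (1 - (r ^+ m)%:C * cis (m%:R * y)) ((r ^+ m)%:C * cis (m%:R * y)).
by rewrite subrK normc1 normcM normc_cis mulr1 normc_real gtr0_norm // -lerBlDr.
Qed.

Lemma pfac_den_neq0 m y : 0 < r ^+ m < 1 -> 1 - (r ^+ m)%:C * cis (m%:R * y) != 0.
Proof.
move=> h; rewrite -normc_eq0 gt_eqF // (lt_le_trans _ (pfac_den_le y h)) // subr_gt0.
by case/andP: h.
Qed.

Lemma normc_pfac m y : 0 < r ^+ m < 1 -> normc (pfac m y) <= 1.
Proof.
move=> h; have d := pfac_den_le y h; have [h0 h1] := andP h.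
have d0 : 0 < normc (1 - (r ^+ m)%:C * cis (m%:R * y)).
  by apply: lt_le_trans d; rewrite subr_gt0.
by rewrite /pfac normcM normcV normc_real gtr0_norm ?subr_gt0 // ler_pdivrMr // mul1r.
Qed.

Lemma ccont_cis_scale (c : R) : ccont (fun x => cis (c * (x / tau))).
Proof.
have -> : (fun x => cis (c * (x / tau))) = (fun x => expC (0 +i* (c / tau * x))).
  by apply/funext => x; rewrite /cis; congr (expC (_ +i* _)); ring.
exact: ccont_cis.
Qed.

Lemma ccont_pfac j : ccont (fun x => pfac (a j) (x / tau)).
Proof.
apply: ccontM; first exact: ccont_cst.
apply: ccontV; first by move=> x; exact: pfac_den_neq0.
have -> : (fun x => 1 - (r ^+ a j)%:C * cis ((a j)%:R * (x / tau))) =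
    (fun x => 1 + - (r ^+ a j)%:C * cis ((a j)%:R * (x / tau))).
  by apply/funext => x; rewrite mulNr.
apply: ccontD; first exact: ccont_cst.
by apply: ccontM; [exact: ccont_cst|exact: ccont_cis_scale].
Qed.

Lemma ccont_qfac j : ccont (fun x => qfac (a j) (x / tau)).
Proof.
apply: ccontM; last exact: ccont_cst.
apply: ccontD; first exact: ccont_cst.
by apply: ccontM; [exact: ccont_cst|exact: ccont_cis_scale].
Qed.

(** Frequencies are integers, because the recursions below step from [k] to [k - a N]. *)
Definition fourier (f : nat -> R -> R[i]) N k :=
  window (fun x => Re (\prod_(j < N) f (a j) (x / tau) * cis (- (k%:~R * (x / tau))))).

Lemma fourier_continuous (f : nat -> R -> R[i]) N k : (forall j, ccont (fun x => f (a j) (x / tau))) ->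
  continuous (fun x => Re (\prod_(j < N) f (a j) (x / tau) * cis (- (k%:~R * (x / tau))))).
Proof.
move=> cf; suff [] : ccont (fun x => \prod_(j < N) f (a j) (x / tau) * cis (- (k%:~R * (x / tau)))) by [].
apply: ccontM; first by apply: ccont_prod => j; exact: cf.
have -> : (fun x => cis (- (k%:~R * (x / tau)))) = (fun x => cis (- k%:~R * (x / tau))).
  by apply/funext => x; rewrite mulNr.
exact: ccont_cis_scale.
Qed.

(** Multiplying the last factor by its denominator: this identity takes the place of expanding the
    geometric series under the integral. *)
Lemma fourier_pfac_rec N k : fourier pfac N.+1 k - r ^+ a N * fourier pfac N.+1 (k - (a N)%:Z) =
  (1 - r ^+ a N) * fourier pfac N k.
Proof.
have cp M l := @fourier_continuous pfac M l ccont_pfac.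
rewrite /fourier -!windowZ // -windowB //; last first.
  by move=> x; apply: cvgM; [exact: cvg_cst|exact: cp].
congr window; apply/funext => x; rewrite big_ord_recr /=.
set y := x / tau; set P := \prod_(_ < _) _; set q := (r ^+ a N).
have Rer (c : R) z : c * Re z = Re (c%:C * z) by rewrite cReM /= mul0r subr0.
rewrite !Rer -cReN -cReD; congr Re.
have -> : - ((k - (a N)%:Z)%:~R * y) = (a N)%:R * y + - (k%:~R * y).
  by rewrite rmorphB /= -pmulrn; ring.
rewrite cisD /pfac -/q; have := pfac_den_neq0 y (ra N); rewrite -/q.
move: (cis _) (cis _) => u v h.
by field.
Qed.

Lemma fourier_qfac_rec N k : (1 + r ^+ a N) * fourier qfac N.+1 k =
  fourier qfac N k + r ^+ a N * fourier qfac N (k - (a N)%:Z).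
Proof.
have cq M l := @fourier_continuous qfac M l ccont_qfac.
rewrite /fourier -!windowZ // -windowD //; last first.
  by move=> x; apply: cvgM; [exact: cvg_cst|exact: cq].
congr window; apply/funext => x; rewrite big_ord_recr /=.
set y := x / tau; set P := \prod_(_ < _) _; set q := (r ^+ a N).
have Rer (c : R) z : c * Re z = Re (c%:C * z) by rewrite cReM /= mul0r subr0.
rewrite !Rer -cReD; congr Re.
have -> : - ((k - (a N)%:Z)%:~R * y) = (a N)%:R * y + - (k%:~R * y).
  by rewrite rmorphB /= -pmulrn; ring.
have [h1 h2] := andP (ra N).
have q0 : (1 + q)%:C != 0 :> R[i] by rewrite -normc_eq0 normc_real normr_eq0 gt_eqF // /q; lra.
rewrite cisD /qfac -/q.
move: (cis _) (cis _) ((1 + q)%:C) q0 => u v w h.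
by field.
Qed.

Lemma fourier_pfac_le N k : `|fourier pfac N k| <= 2 * pi * tau.
Proof.
apply: window_le; first exact: fourier_continuous ccont_pfac.
move=> x; apply: le_trans (Re_le_normc _) _; rewrite normcM normc_cis mulr1.
elim: N => [|N IH]; first by rewrite big_ord0 normc1.
by rewrite big_ord_recr /= normcM mulr_ile1 ?normc_ge0 // normc_pfac.
Qed.

Lemma fourier0 f k : fourier f 0 k = if k == 0 then 2 * pi * tau else 0.
Proof.
rewrite -window_cis; congr window; apply/funext => x.
by rewrite big_ord0 mul1r.
Qed.

End Fourier.

Section FourierCount.
Context {R : realType}.
Variables (tau r : R) (a : nat -> nat).
Hypotheses (tau0 : 0 < tau) (r01 : 0 < r < 1) (a0 : forall j, (0 < a j)%N).

Local Notation P N k := (fourier tau a (pfac r) N k).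
Local Notation Q N k := (fourier tau a (qfac r) N k).

Lemma fourier_pfac_unroll N k B : P N.+1 k =
  (1 - r ^+ a N) * \sum_(0 <= m < B) (r ^+ a N) ^+ m * P N (k - (m * a N)%N%:Z) +
  (r ^+ a N) ^+ B * P N.+1 (k - (B * a N)%N%:Z).
Proof.
elim: B => [|B IH]; first by rewrite big_nil mulr0 add0r expr0 mul1r mul0n subr0.
rewrite IH big_nat_recr //= mulrDr -addrA; congr (_ + _).
have := fourier_pfac_rec tau r01 a0 N (k - (B * a N)%N%:Z).
have -> : k - (B * a N)%N%:Z - (a N)%:Z = k - (B.+1 * a N)%N%:Z.
  by rewrite mulSn addnC PoszD; ring.
move/eqP; rewrite subr_eq => /eqP->.
by rewrite exprS; move: (P _ _) (P _ _) (_ ^+ B) => x y z; ring.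
Qed.

(** The vanishing at negative frequencies is proved together with the count, since it stops the
    recursion after at most [n + 1] steps. *)
Lemma fourier_pfac_count N (n : nat) :
  P N n%:Z = 2 * pi * tau * \prod_(j < N) (1 - r ^+ a j) * (pcount a N n)%:R * r ^+ n /\
  P N (Negz n) = 0.
Proof.
elim: N n => [|N IH] n.
  rewrite !fourier0 // big_ord0 mulr1 /=; split => //.
  by case: n => [|n] /=; rewrite ?mulr1 ?expr0 ?mulr1 // mulr0 mul0r.
have Pneg k : k < 0 -> P N k = 0 by case: k => // m _; have [] := IH m.
have q01 : 0 < r ^+ a N < 1.
  by case/andP: r01 => h1 h2; rewrite exprn_gt0 //= exprn_ilt1 ?ltW // -lt0n.
have Pneg1 k : k < 0 -> P N.+1 k = 0.
  move=> k0.
  (* From a negative frequency, unrolling meets only coefficients that vanish by induction, and the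
     remainder is geometric in [B]. *)
  have le B : `|P N.+1 k| <= (r ^+ a N) ^+ B * (2 * pi * tau).
    rewrite (fourier_pfac_unroll N k B) big1 ?mulr0 ?add0r.
      have qB : 0 <= (r ^+ a N) ^+ B by apply: exprn_ge0; case/andP: q01 => /ltW.
      by rewrite normrM ger0_norm // ler_wpM2l // fourier_pfac_le.
    by move=> m _; rewrite Pneg ?mulr0 // ltrBlDr (lt_le_trans k0).
  apply/eqP; rewrite -normr_le0.
  have c : (r ^+ a N) ^+ B * (2 * pi * tau) @[B --> \oo] --> (0 * (2 * pi * tau) : R).
    apply: cvgM; last exact: cvg_cst.
    by apply: cvg_expr; rewrite gtr0_norm; case/andP: q01.
  rewrite mul0r in c.
  by apply: (cvgr_to_ge c); exact: nearW.
split; last exact: Pneg1.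
rewrite (fourier_pfac_unroll N n n.+1) Pneg1 ?mulr0 ?addr0; last first.
  rewrite subr_lt0 ltz_nat; exact: leq_trans (leq_pmulr _ (a0 N)).
rewrite big_ord_recr /= natr_sum.
set Pi := \prod_(_ < _) _.
have -> : \sum_(0 <= m < n.+1) (r ^+ a N) ^+ m * P N (n%:Z - (m * a N)%N%:Z) =
  2 * pi * tau * Pi * r ^+ n * \sum_(0 <= m < n.+1 | (m * a N <= n)%N) (pcount a N (n - m * a N))%:R.
  rewrite [X in _ = _ * X]big_mkcond mulr_sumr; apply: eq_bigr => m _.
  case: leqP => mn; last by rewrite Pneg ?mulr0 // subr_lt0 ltz_nat.
  rewrite subzn // (IH _).1 -/Pi -exprM [(a N * m)%N]mulnC.
  have -> : r ^+ n = r ^+ (m * a N) * r ^+ (n - m * a N) by rewrite -exprD subnKC.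
  by move: (_ ^+ _) (_ ^+ _) (_%:R) => x y z; ring.
by move: (\sum_(_ <= _ < _ | _) _) (r ^+ n) (r ^+ a N) => x y z; ring.
Qed.

Lemma fourier_qfac_count N (n : nat) :
  \prod_(j < N) (1 + r ^+ a j) * Q N n%:Z = 2 * pi * tau * (qcount a N n)%:R * r ^+ n /\
  Q N (Negz n) = 0.
Proof.
elim: N n => [|N IH] n.
  rewrite !fourier0 // big_ord0 mul1r /=; split => //.
  by case: n => [|n] /=; rewrite ?mulr1 ?expr0 ?mulr1 // mulr0 mul0r.
have Qneg k : k < 0 -> Q N k = 0 by case: k => // m _; have [] := IH m.
have q0 : 0 < r ^+ a N by rewrite exprn_gt0 //; case/andP: r01.
split; last first.
  have := fourier_qfac_rec tau r01 a0 N (Negz n).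
  have ng : Negz n - (a N)%:Z < 0 by rewrite ltrBlDr add0r.
  rewrite (Qneg _ ng) (Qneg (Negz n)) //.
  rewrite mulr0 addr0 => /eqP; rewrite mulf_eq0 => /orP[|/eqP //].
  by rewrite gt_eqF // ltr_pwDr.
rewrite big_ord_recr /= -mulrA (fourier_qfac_rec tau r01 a0 N n) mulrDr (IH n).1 natrD.
rewrite mulrCA; case: leqP => an.
  rewrite subzn // (IH _).1.
  have -> : r ^+ n = r ^+ a N * r ^+ (n - a N) by rewrite -exprD subnKC.
  by move: (_ ^+ _) (_ ^+ _) => x y; ring.
rewrite Qneg ?subr_lt0 ?ltz_nat // !mulr0 !addr0 //.
Qed.

End FourierCount.

(** * Gaussian approximation of one factor *)

Section CharacteristicFactors.
Context {R : realType}.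
Implicit Types (b s v m x y t : R).

Lemma sin_cos_taylor y : [/\ `|sin y| <= `|y|, `|cos y - 1| <= `|y|,
  `|cos y - 1| <= `|y| ^+ 2, `|sin y - y| <= `|y| ^+ 2 &
  `|sin y - y| <= `|y| ^+ 3 /\ `|cos y - 1 + y ^+ 2 / 2| <= `|y| ^+ 3].
Proof.
wlog y0 : y / 0 <= y.
  move=> h; have [|/ltW yn] := leP 0 y; first exact: h.
  have := h (- y); rewrite oppr_ge0 => /(_ yn); rewrite cosN sinN normrN sqrrN normrN.
  by rewrite (_ : - sin y - - y = - (sin y - y)) ?normrN //; ring.
rewrite (ger0_norm y0); have [s0 c0] := (@sin0 R, @cos0 R).
have dcos x : is_derive x 1 (fun z : R => cos z - 1) (- sin x).
  by apply: dvE (dvB (is_derive_cos x) (dv_cst 1 x)) _; rewrite subr0.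
have dsin x : is_derive x 1 (fun z : R => sin z - z) (cos x - 1).
  exact: dvB (is_derive_sin x) (dv_id x).
have h1 (z : R) : 0 <= z -> `|sin z| <= z.
  move=> z0; have := @mean_value_le R sin cos 1 0 z z0 (fun x _ => is_derive_sin x).
  by rewrite s0 !subr0 mul1r; apply=> x _; rewrite ler_norml cos_geN1 cos_le1.
have h2 (z : R) : 0 <= z -> `|cos z - 1| <= z.
  move=> z0; have := @mean_value_le R (fun z => cos z - 1) (fun x => - sin x) 1 0 z z0 (fun x _ => dcos x).
  rewrite c0 subrr !subr0 mul1r; apply=> x _.
  by rewrite normrN ler_norml sin_geN1 sin_le1.
have h3 (z : R) : 0 <= z -> `|cos z - 1| <= z ^+ 2.
  move=> z0; have := @mean_value_le R (fun z => cos z - 1) (fun x => - sin x) z 0 z z0 (fun x _ => dcos x).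
  rewrite c0 subrr !subr0 expr2; apply=> x /andP[x0 xz].
  by rewrite normrN; apply: le_trans (h1 x x0) _.
have h4 (z : R) : 0 <= z -> `|sin z - z| <= z ^+ 2.
  move=> z0; have := @mean_value_le R (fun z => sin z - z) (fun x => cos x - 1) z 0 z z0 (fun x _ => dsin x).
  rewrite s0 !subr0 expr2; apply=> x /andP[x0 xz].
  by apply: le_trans (h2 x x0) _.
split; [exact: h1|exact: h2|exact: h3|exact: h4|split].
  have := @mean_value_le R (fun z => sin z - z) (fun x => cos x - 1) (y ^+ 2) 0 y y0 (fun x _ => dsin x).
  rewrite s0 !subr0 -exprSr; apply=> x /andP[x0 xy].
  by apply: le_trans (h3 x x0) _; rewrite lerXn2r // nnegrE.
have dc2 x : is_derive x 1 (fun z : R => cos z - 1 + z ^+ 2 / 2) (- (sin x - x)).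
  apply: dvE (dvD (dcos x) (dvMr 2^-1 (dvX 2 (dv_id x)))) _ => /=.
  by rewrite expr1 mulr1; field.
have := @mean_value_le R (fun z => cos z - 1 + z ^+ 2 / 2) (fun x => - (sin x - x)) (y ^+ 2) 0 y y0 (fun x _ => dc2 x).
rewrite c0 subrr expr0n mul0r addr0 !subr0 -exprSr; apply=> x /andP[x0 xy].
by rewrite normrN; apply: le_trans (h4 x x0) _; rewrite lerXn2r // nnegrE.
Qed.

Lemma cis_taylor y : [/\ normc (cis y - 1) <= 2 * `|y|,
  normc (cis y - 1 - (0 +i* y)) <= 2 * `|y| ^+ 2 &
  normc (cis y - 1 - (0 +i* y) + (y ^+ 2 / 2)%:C) <= 2 * `|y| ^+ 3].
Proof.
have [h1 h2 h3 h4 [h5 h6]] := sin_cos_taylor y; rewrite cisE.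
split; apply: le_trans (normc_le_ReIm _) _ => /=.
- by rewrite subr0; lra.
- by rewrite !subr0; lra.
- by rewrite !subr0 addr0; lra.
Qed.

(** The characteristic function of the normal law of mean [m] and variance [v]; [quad] is its Taylor
    polynomial of degree 2, written with the second moment [w]. *)
Definition gfac (m v y : R) : R[i] := cis (m * y) * (expR (- (v * y ^+ 2 / 2)))%:C.
Definition quad (m w y : R) : R[i] := 1 + (0 +i* (m * y)) - (w * y ^+ 2 / 2)%:C.

Lemma exp_linear x : 0 <= x -> `|expR (- x) - 1 + x| <= x /\ `|expR (- x) - 1 + x| <= x ^+ 2.
Proof.
move=> x0; have h1 : 0 <= expR (- x) - 1 + x by have := expR_ge1Dx (- x); lra.
rewrite ger0_norm //; split.
  by have : expR (- x) <= 1 by [rewrite -expR0 ler_expR oppr_le0|]; lra.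
have d (z : R) : is_derive z 1 (fun t : R => expR (- t) - 1 + t) (- expR (- z) + 1).
  apply: dvE (dvD (dvB (dv_exp (dvN (dv_id z))) (dv_cst 1 z)) (dv_id z)) _; ring.
have h2 : (expR (- x) - 1 + x) - (expR (- 0) - 1 + 0) <= x * (x - 0).
  apply: (@mean_value_ub R (fun t => expR (- t) - 1 + t) (fun z => - expR (- z) + 1)) => // z /andP[z0 zx].
  by have := expR_ge1Dx (- z); lra.
by move: h2; rewrite oppr0 expR0 expr2 !addr0 subrr subr0.
Qed.

Lemma gfac_quad m v y : 0 <= m -> 0 <= v ->
  normc (gfac m v y - quad m (v + m ^+ 2) y) <= (v + v ^+ 2 + 2 * m ^+ 3 + v * m) * `|y| ^+ 3.
Proof.
move=> m0 v0; pose x := v * y ^+ 2 / 2.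
have x0 : 0 <= x by rewrite divr_ge0 // mulr_ge0 // sqr_ge0.
have [t1 _ t3] := cis_taylor (m * y); have [e1 e2] := exp_linear x0.
have [y0 yy] : 0 <= `|y| /\ y ^+ 2 = `|y| ^+ 2 by rewrite real_normK ?num_real.
have -> : gfac m v y - quad m (v + m ^+ 2) y =
    cis (m * y) * (expR (- x) - 1 + x)%:C +
    (cis (m * y) - 1 - (0 +i* (m * y)) + ((m * y) ^+ 2 / 2)%:C) - x%:C * (cis (m * y) - 1).
  rewrite /gfac /quad -/x; have -> : (v + m ^+ 2) * y ^+ 2 / 2 = x + (m * y) ^+ 2 / 2.
    by rewrite /x; field.
  set E := expR (- x); set q := (m * y) ^+ 2 / 2.
  by case: (cis _) => c d; apply: complexP => /=; ring.
(* The error is made cubic for every [y]: the linear bound of [exp_linear] serves for [|y| > 1], the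
   quadratic one for [|y| <= 1]. *)
have ex : `|expR (- x) - 1 + x| <= (v + v ^+ 2) * `|y| ^+ 3.
  have [y1|/ltW y1] := leP 1 `|y|.
    apply: le_trans e1 _; rewrite /x yy.
    have z23 : `|y| ^+ 2 <= `|y| ^+ 3 by rewrite ler_weXn2l.
    have p1 := ler_wpM2l v0 z23.
    have p2 : 0 <= v ^+ 2 * `|y| ^+ 3 by rewrite mulr_ge0 ?exprn_ge0.
    have p3 : 0 <= v * `|y| ^+ 2 by rewrite mulr_ge0 ?exprn_ge0.
    by rewrite mulrDl; lra.
  apply: le_trans e2 _; rewrite /x yy.
  have z43 : `|y| ^+ 4 <= `|y| ^+ 3 by rewrite ler_wiXn2l.
  have p1 := ler_wpM2l (sqr_ge0 v) z43.
  have p2 : 0 <= v * `|y| ^+ 3 by rewrite mulr_ge0 ?exprn_ge0.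
  have p3 : 0 <= v ^+ 2 * `|y| ^+ 4 by rewrite mulr_ge0 ?exprn_ge0 // sqr_ge0.
  have -> : (v * `|y| ^+ 2 / 2) ^+ 2 = v ^+ 2 * `|y| ^+ 4 / 4 by field.
  by rewrite mulrDl; lra.
rewrite normrM (ger0_norm m0) in t1 t3.
apply: le_trans (le_normcD _ _) _; rewrite normcN normcM normc_real (ger0_norm x0).
apply: le_trans (lerD (le_normcD _ _) (ler_wpM2l x0 t1)) _.
rewrite normcM normc_cis mul1r normc_real.
apply: le_trans (lerD (lerD ex t3) (lexx _)) _.
by rewrite /x yy exprMn le_eqVlt; apply/orP; left; apply/eqP; move: `|y| => z; field.
Qed.

Lemma cis_sqr y : normc ((cis y - 1) ^+ 2 + (y ^+ 2)%:C) <= 6 * `|y| ^+ 3.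
Proof.
have [t1 t2 _] := cis_taylor y.
have -> : (cis y - 1) ^+ 2 + (y ^+ 2)%:C = (cis y - 1 - (0 +i* y)) * ((cis y - 1) + (0 +i* y)).
  have -> : (y ^+ 2)%:C = - (0 +i* y) ^+ 2 :> R[i] by apply: complexP => /=; ring.
  ring.
rewrite normcM; have -> : 6 * `|y| ^+ 3 = 2 * `|y| ^+ 2 * (3 * `|y|) by ring.
apply: ler_pM; rewrite ?normc_ge0 //; apply: le_trans (le_normcD _ _) _.
have -> : normc (0 +i* y) = `|y| by rewrite /= expr0n add0r sqrtr_sqr.
by lra.
Qed.

Lemma normc_sqr (z : R[i]) : normc z ^+ 2 = Re z ^+ 2 + Im z ^+ 2.
Proof. by case: z => p q /=; rewrite sqr_sqrtr // addr_ge0 ?sqr_ge0. Qed.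

(** Geometric and Bernoulli characteristic functions parametrised by their means. Their squared
    moduli obey the same bound in terms of the variance, so one majorant serves for both. *)
Definition geom_factor b y : R[i] := (1 - b%:C * (cis y - 1))^-1.
Definition bern_factor s y : R[i] := 1 + s%:C * (cis y - 1).

Lemma normc_bern b y : normc (bern_factor b y) ^+ 2 = 1 - 2 * (b - b ^+ 2) * (1 - cos y).
Proof.
rewrite normc_sqr /bern_factor cisE /=; have := cos2Dsin2 y.
move: (cos y) (sin y) => c s h.
have -> : (1 + (b * (c - 1) - 0 * (s - 0))) ^+ 2 + (0 + (b * (s - 0) + 0 * (c - 1))) ^+ 2 =
  1 - 2 * (b - b ^+ 2) * (1 - c) + b ^+ 2 * (c ^+ 2 + s ^+ 2 - 1) by ring.
by rewrite h subrr mulr0 addr0.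
Qed.

Lemma normc_geom_den b y : normc (1 - b%:C * (cis y - 1)) ^+ 2 = 1 + 2 * (b + b ^+ 2) * (1 - cos y).
Proof.
have := normc_bern (- b) y; rewrite /bern_factor rmorphN mulNr => ->.
by rewrite sqrrN; ring.
Qed.

Lemma cos_sub_ge0 y : 0 <= 1 - cos y.
Proof. by rewrite subr_ge0 cos_le1. Qed.

Lemma geom_factor_norm b y : 0 <= b ->
  normc (geom_factor b y) ^+ 2 <= (1 + 2 * (b + b ^+ 2) * (1 - cos y))^-1.
Proof. by move=> b0; rewrite /geom_factor normcV exprVn normc_geom_den. Qed.

Lemma bern_factor_norm s y : 0 <= s <= 1 ->
  normc (bern_factor s y) ^+ 2 <= (1 + 2 * (s - s ^+ 2) * (1 - cos y))^-1.
Proof.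
move=> /andP[s0 s1]; rewrite normc_bern.
have x0 : 0 <= 2 * (s - s ^+ 2) * (1 - cos y).
  rewrite mulr_ge0 ?cos_sub_ge0 // mulr_ge0 //.
  by rewrite (_ : s - s ^+ 2 = s * (1 - s)) ?mulr_ge0 ?subr_ge0 //; ring.
move: (2 * _ * _) x0 => x x0; rewrite -[leRHS]mul1r ler_pdivlMr; last by lra.
have := sqr_ge0 x; nra.
Qed.

(** Three errors are added: the cubic tail of 1 / (1 - w), where the modulus of 1 - w is at least 1,
    and the distances of 1 + w + w ^ 2 and of [gfac] from [quad]. The largest coefficient is that of
    b ^ 3, 8 + 5 = 13. *)
Lemma geom_factor_gfac b y : 0 <= b ->
  normc (geom_factor b y - gfac b (b + b ^+ 2) y) <=
  13 * (b + b ^+ 2 + b ^+ 3 + b ^+ 4) * `|y| ^+ 3.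
Proof.
move=> b0; have [t1 t2 t3] := cis_taylor y; have ts := cis_sqr y.
have v0 : 0 <= b + b ^+ 2 by rewrite addr_ge0 // sqr_ge0.
have G := gfac_quad y b0 v0.
set w := b%:C * (cis y - 1).
have dn : 1 <= normc (1 - w).
  rewrite -(@ler_pXn2r _ 2) ?nnegrE ?normc_ge0 // expr1n normc_geom_den.
  by rewrite lerDl mulr_ge0 ?cos_sub_ge0 // mulr_ge0.
have d0 : 1 - w != 0 by rewrite -normc_eq0 gt_eqF // (lt_le_trans _ dn).
have e1 : geom_factor b y - (1 + w + w ^+ 2) = w ^+ 3 / (1 - w).
  by rewrite /geom_factor -/w; field.
have n1 : normc (geom_factor b y - (1 + w + w ^+ 2)) <= 8 * b ^+ 3 * `|y| ^+ 3.
  rewrite e1 normcM normcV ler_pdivrMr; last by apply: lt_le_trans dn.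
  apply: (@le_trans _ _ (8 * b ^+ 3 * `|y| ^+ 3)).
    rewrite normcX /w normcM normc_real (ger0_norm b0).
    have -> : 8 * b ^+ 3 * `|y| ^+ 3 = (b * (2 * `|y|)) ^+ 3 by ring.
    by rewrite lerXn2r ?nnegrE ?mulr_ge0 ?normc_ge0 // ler_wpM2l.
  by rewrite ler_peMr // mulr_ge0 // mulr_ge0 // exprn_ge0.
have n2 : normc (1 + w + w ^+ 2 - quad b (b + b ^+ 2 + b ^+ 2) y) <= (2 * b + 6 * b ^+ 2) * `|y| ^+ 3.
  have -> : 1 + w + w ^+ 2 - quad b (b + b ^+ 2 + b ^+ 2) y =
      b%:C * (cis y - 1 - (0 +i* y) + (y ^+ 2 / 2)%:C) + (b ^+ 2)%:C * ((cis y - 1) ^+ 2 + (y ^+ 2)%:C).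
    rewrite /w /quad.
    by case: (cis y) => c d; rewrite !expr2; apply: complexP => /=; field.
  apply: le_trans (le_normcD _ _) _; rewrite !normcM !normc_real (ger0_norm b0) (ger0_norm (sqr_ge0 b)).
  apply: le_trans (lerD (ler_wpM2l b0 t3) (ler_wpM2l (sqr_ge0 b) ts)) _.
  by move: `|y| => z; rewrite le_eqVlt; apply/orP; left; apply/eqP; ring.
have -> : geom_factor b y - gfac b (b + b ^+ 2) y = (geom_factor b y - (1 + w + w ^+ 2)) +
   (1 + w + w ^+ 2 - quad b (b + b ^+ 2 + b ^+ 2) y) - (gfac b (b + b ^+ 2) y - quad b (b + b ^+ 2 + b ^+ 2) y).
  by ring.
apply: le_trans (le_normcD _ _) _; rewrite normcN.
apply: le_trans (lerD (le_normcD _ _) G) _; apply: le_trans (lerD (lerD n1 n2) (lexx _)) _.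
rewrite -!mulrDl ler_wpM2r ?exprn_ge0 //.
have b2 := exprn_ge0 2 b0; have b3 := exprn_ge0 3 b0; have b4 := exprn_ge0 4 b0.
have -> : (b + b ^+ 2) ^+ 2 = b ^+ 2 + 2 * b ^+ 3 + b ^+ 4 by ring.
have -> : (b + b ^+ 2) * b = b ^+ 2 + b ^+ 3 by ring.
by lra.
Qed.

Lemma bern_factor_gfac s y : 0 <= s <= 1 ->
  normc (bern_factor s y - gfac s (s - s ^+ 2) y) <= 7 * s * `|y| ^+ 3.
Proof.
move=> /andP[s0 s1]; have [t1 t2 t3] := cis_taylor y.
have v0 : 0 <= s - s ^+ 2 by rewrite (_ : s - s ^+ 2 = s * (1 - s)) ?mulr_ge0 ?subr_ge0 //; ring.
have G := gfac_quad y s0 v0; rewrite subrK in G.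
have n2 : normc (bern_factor s y - quad s s y) <= 2 * s * `|y| ^+ 3.
  have -> : bern_factor s y - quad s s y = s%:C * (cis y - 1 - (0 +i* y) + (y ^+ 2 / 2)%:C).
    rewrite /bern_factor /quad.
    by case: (cis y) => c d; apply: complexP => /=; field.
  have -> : 2 * s * `|y| ^+ 3 = s * (2 * `|y| ^+ 3) by ring.
  by rewrite normcM normc_real (ger0_norm s0) ler_wpM2l.
have -> : bern_factor s y - gfac s (s - s ^+ 2) y = (bern_factor s y - quad s s y) -
   (gfac s (s - s ^+ 2) y - quad s s y) by ring.
apply: le_trans (le_normcD _ _) _; rewrite normcN.
apply: le_trans (lerD n2 G) _; rewrite -!mulrDl ler_wpM2r ?exprn_ge0 //.
have s2 : s ^+ 2 <= s by rewrite expr2 ler_piMl.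
have s3 : s ^+ 3 <= s by rewrite exprS ler_piMr // exprn_ile1.
have v2 : (s - s ^+ 2) ^+ 2 <= s.
  have v1 : s - s ^+ 2 <= s by have := sqr_ge0 s; lra.
  by rewrite expr2; apply: le_trans (ler_pM v0 v0 v1 (le_trans v1 s1)) _; rewrite mulr1.
have v3 : (s - s ^+ 2) * s <= s by rewrite ler_piMl //; have := sqr_ge0 s; lra.
have := sqr_ge0 s; lra.
Qed.

Lemma pfac_geom (r : R) (m : nat) y : 0 < r ^+ m < 1 ->
  pfac r m y = geom_factor (r ^+ m / (1 - r ^+ m)) (m%:R * y).
Proof.
move=> /andP[]; rewrite /pfac /geom_factor.
move: (r ^+ m) (cis _) => q c q0 q1.
have q2 : (1 - q)%:C != 0 :> R[i] by rewrite -normc_eq0 normc_real normr_eq0 gt_eqF // subr_gt0.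
rewrite [(q / _)%:C]rmorphM fmorphV /=.
have e : (1 - q)%:C = 1 - q%:C :> R[i] by rewrite rmorphB rmorph1.
rewrite e in q2 *; rewrite -[LHS]invrK invf_div; congr (_^-1).
by field.
Qed.

Lemma qfac_bern (r : R) (m : nat) y : 0 < r ^+ m < 1 ->
  qfac r m y = bern_factor (r ^+ m / (1 + r ^+ m)) (m%:R * y).
Proof.
move=> /andP[]; rewrite /qfac /bern_factor.
move: (r ^+ m) (cis _) => q c q0 q1.
have q2 : (1 + q)%:C != 0 :> R[i].
  by rewrite -normc_eq0 normc_real normr_eq0 gt_eqF // addr_gt0.
rewrite [(q / _)%:C]rmorphM fmorphV /=.
have e : (1 + q)%:C = 1 + q%:C :> R[i] by rewrite rmorphD rmorph1.
rewrite e in q2 *; by field.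
Qed.

End CharacteristicFactors.

(** * Majorant of the characteristic function *)

Definition multn (k : nat) : nat := (3 * k.+1 ^ 2 + 3 * k.+1 + 1)%N.

Section Majorant.
Context {R : realType}.
Implicit Types (x y t c : R).

Lemma multn_mult k : (multn k)%:R = mult k :> R.
Proof. by rewrite /multn /mult !natrD natrM natrX natrM. Qed.

Lemma one_sub_cos_ge y : `|y| <= 4^-1 -> y ^+ 2 / 4 <= 1 - cos y.
Proof.
move=> y4; have [_ _ _ _ [_ h]] := sin_cos_taylor y.
have y2 : y ^+ 2 = `|y| ^+ 2 by rewrite real_normK ?num_real.
have y3 : `|y| ^+ 3 <= `|y| ^+ 2 / 4.
  by rewrite exprSr ler_wpM2l // exprn_ge0.
move: h; rewrite ler_norml => /andP[_]; rewrite y2; lra.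
Qed.

Lemma sum_pow4_ge n : n%:R ^+ 5 / 5 <= \sum_(0 <= k < n) k.+1%:R ^+ 4 :> R.
Proof.
elim: n => [|n IH]; first by rewrite big_nil expr0n mul0r.
rewrite big_nat_recr //=; apply: le_trans (lerD IH (lexx _)).
have n0 : 0 <= n%:R :> R by [].
rewrite -natr1 -subr_ge0; move: (n%:R) n0 => a a0.
have -> : a ^+ 5 / 5 + (a + 1) ^+ 4 - (a + 1) ^+ 5 / 5 =
  2 * a ^+ 3 + 4 * a ^+ 2 + 3 * a + 4 / 5 by field.
by rewrite !addr_ge0 ?mulr_ge0 ?exprn_ge0 // divr_ge0.
Qed.

Lemma sum_sqr_ge n : n%:R ^+ 3 / 3 <= \sum_(0 <= k < n) k.+1%:R ^+ 2 :> R.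
Proof.
elim: n => [|n IH]; first by rewrite big_nil expr0n mul0r.
rewrite big_nat_recr //=; apply: le_trans (lerD IH (lexx _)).
have n0 : 0 <= n%:R :> R by [].
rewrite -natr1 -subr_ge0; move: (n%:R) n0 => a a0.
have -> : a ^+ 3 / 3 + (a + 1) ^+ 2 - (a + 1) ^+ 3 / 3 = a + 2 / 3 by field.
by rewrite addr_ge0 // divr_ge0.
Qed.

(* [y / 2] is the difference of the half angles, so that
   [sin (y / 2) ^ 2 <= 2 (sin a ^ 2 + sin b ^ 2)]: two consecutive parts cannot
   both be close to a resonance. *)
Lemma cos_pair k y : (1 - cos y) / 2 <= (1 - cos (k%:R * y)) + (1 - cos (k.+1%:R * y)).
Proof.
have h (z : R) : 1 - cos z = 2 * sin (z / 2) ^+ 2.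
  have := cosD (z / 2) (z / 2); have -> : z / 2 + z / 2 = z by field.
  by move=> ->; have := cos2Dsin2 (z / 2); rewrite -!expr2; lra.
rewrite !h; set a := k%:R * y / 2.
have -> : k.+1%:R * y / 2 = a + y / 2 by rewrite /a -natr1; field.
have -> : sin (y / 2) = sin (a + y / 2) * cos a - cos (a + y / 2) * sin a.
  by rewrite -sinB; congr sin; ring.
have := cos2Dsin2 a; have := cos2Dsin2 (a + y / 2).
move: (sin _) (cos (a + _)) (sin a) (cos a) => p q s u h1 h2.
have : (p * u - q * s) ^+ 2 <= 2 * (p ^+ 2 * u ^+ 2 + q ^+ 2 * s ^+ 2).
  by have := sqr_ge0 (p * u + q * s); nra.
have : p ^+ 2 * u ^+ 2 <= p ^+ 2 by rewrite ler_piMr ?sqr_ge0 //; have := sqr_ge0 s; lra.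
have : q ^+ 2 * s ^+ 2 <= s ^+ 2 by rewrite ler_piMl ?sqr_ge0 //; have := sqr_ge0 p; lra.
lra.
Qed.

(** For [|y| <= t] every [k y] is at most 1/4, and the quadratic bound on cos gives order y ^ 2 K ^
    5. Otherwise [cos_pair] gives each pair of consecutive parts at least (1 - cos y) / 2, of order
    t ^ 2, in total K ^ 3 t ^ 2, that is 1 / t. *)
Lemma cos_sum_ge t K y : 0 < t -> t <= 32^-1 -> 8^-1 <= K%:R * t -> K%:R * t <= 4^-1 ->
  `|y| <= pi ->
  y ^+ 2 / 40 * (8^-1 / t) ^+ 5 <= \sum_(0 <= k < K) k.+1%:R ^+ 2 * (1 - cos (k.+1%:R * y)) \/
  (16^-1 / t) ^+ 3 * (t ^+ 2 / 48) <= \sum_(0 <= k < K) k.+1%:R ^+ 2 * (1 - cos (k.+1%:R * y)).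
Proof.
move=> t0 t32 K8 K4 ypi.
have [yt|ty] := leP `|y| t.
  left; apply: (@le_trans _ _ (\sum_(0 <= k < K) y ^+ 2 / 4 * k.+1%:R ^+ 4)).
    rewrite -mulr_sumr; apply: le_trans (ler_wpM2l _ (sum_pow4_ge K)); last by rewrite divr_ge0 // sqr_ge0.
    have -> : y ^+ 2 / 40 * (8^-1 / t) ^+ 5 = y ^+ 2 / 4 * ((8^-1 / t) ^+ 5 / 10).
      by move: (_ / t) => q; field.
    rewrite ler_wpM2l //; first by rewrite divr_ge0 // sqr_ge0.
    have h : 8^-1 / t <= K%:R by rewrite ler_pdivrMr.
    have h5 : (8^-1 / t) ^+ 5 <= K%:R ^+ 5 by rewrite lerXn2r ?nnegrE // divr_ge0 // ltW.
    have : 0 <= K%:R ^+ 5 :> R by rewrite exprn_ge0.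
    move: (_ ^+ 5) (K%:R ^+ 5) h5 => p q; lra.
  rewrite !big_mkord; apply: ler_sum => k _.
  have -> : y ^+ 2 / 4 * k.+1%:R ^+ 4 = k.+1%:R ^+ 2 * ((k.+1%:R * y) ^+ 2 / 4) by field.
  rewrite ler_wpM2l ?exprn_ge0 //; apply: one_sub_cos_ge.
  rewrite normrM ger0_norm //; apply: le_trans K4; apply: ler_pM => //.
  by rewrite ler_nat.
right.
set g := fun k : nat => 1 - cos (k%:R * y).
have g0 k : 0 <= g k by exact: cos_sub_ge0.
have g1 : t ^+ 2 / 4 <= 1 - cos y.
  apply: le_trans (one_sub_cos_ge _) _; first by rewrite gtr0_norm //; lra.
  have -> : cos y = cos `|y| by case: (ger0P y) => // _; rewrite cosN.
  rewrite lerD2l lerN2.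
  have tpi : t <= pi by apply: le_trans (ltW ty) ypi.
  by rewrite ltW // ltr_cos // in_itv /= ?normr_ge0 ?ypi ?(ltW t0) ?tpi.
have [L KL] : exists L, K = L.+1.
  by case: K {g0} K8 {K4} => [|L] h; [move: h; rewrite mul0r; lra|exists L].
have two : \sum_(0 <= k < L) k.+1%:R ^+ 2 * ((1 - cos y) / 2) <=
    2 * \sum_(0 <= k < K) k.+1%:R ^+ 2 * g k.+1.
  apply: (@le_trans _ _ (\sum_(0 <= k < L) (k.+1%:R ^+ 2 * g k.+1 + k.+2%:R ^+ 2 * g k.+2))).
    apply: ler_sum => k _.
    apply: (@le_trans _ _ (k.+1%:R ^+ 2 * (g k.+1 + g k.+2))).
      by rewrite ler_wpM2l ?exprn_ge0 // cos_pair.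
    by rewrite mulrDr lerD2l ler_wpM2r // lerXn2r ?nnegrE // ler_nat.
  rewrite big_split /= mulr_natl mulr2n KL; apply: lerD.
    by rewrite [leRHS]big_nat_recr //= lerDl mulr_ge0 ?exprn_ge0.
  by rewrite [leRHS]big_nat_recl //= lerDr mulr_ge0 ?exprn_ge0.
rewrite -mulr_suml in two.
have L16 : 16^-1 / t <= L%:R.
  rewrite ler_pdivrMr //; move: K8; rewrite KL -(natr1 L) mulrDl mul1r; lra.
have L3 : (16^-1 / t) ^+ 3 <= L%:R ^+ 3 by rewrite lerXn2r ?nnegrE // divr_ge0 // ltW.
have sq := sum_sqr_ge L.
have low : (16^-1 / t) ^+ 3 / 3 * (t ^+ 2 / 4 / 2) <= 2 * \sum_(0 <= k < K) k.+1%:R ^+ 2 * g k.+1.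
  apply: le_trans two; apply: ler_pM.
  - by rewrite divr_ge0 // exprn_ge0 // divr_ge0 ?ltW.
  - by rewrite !divr_ge0 // sqr_ge0.
  - by apply: le_trans sq; rewrite ler_pM2r ?invr_gt0.
  - by rewrite ler_pM2r ?invr_gt0.
by move: low; move: (_ ^+ 3) (t ^+ 2) (\sum_(_ <= _ < _) _) => p q z; lra.
Qed.

Lemma inv_le_expR x : 0 <= x <= 1 -> (1 + x)^-1 <= expR (- (x / 2)).
Proof.
move=> /andP[x0 x1]; have := expR_ge1Dx (- (x / 2)); apply: le_trans.
rewrite -[leLHS]mul1r ler_pdivrMr; [nra|lra].
Qed.

(** Parts beyond [K] are dropped, their factors having modulus at most 1. The bound [c <= 1/4] keeps
    [2 c (1 - cos x)] in [0, 1], where [inv_le_expR] applies. *)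
Lemma prod_factor_norm c (M K : nat) (phi : nat -> R -> R[i]) (v : nat -> R) y :
  0 <= c <= 4^-1 -> (K <= M)%N ->
  (forall k x, normc (phi k x) ^+ 2 <= (1 + 2 * v k * (1 - cos x))^-1) ->
  (forall k, 0 <= v k) -> (forall k, (k < K)%N -> c <= v k) ->
  normc (\prod_(k < M) phi k (k.+1%:R * y) ^+ multn k) ^+ 2 <=
  expR (- (c * \sum_(0 <= k < K) k.+1%:R ^+ 2 * (1 - cos (k.+1%:R * y)))).
Proof.
move=> /andP[c0 c4] KM phiv v0 vc.
have phi1 k x : normc (phi k x) ^+ 2 <= 1.
  apply: le_trans (phiv k x) _; rewrite invf_le1 ?ltr_pwDl // ?mulr_ge0 ?cos_sub_ge0 //.
  by rewrite lerDl mulr_ge0 ?cos_sub_ge0 // mulr_ge0.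
have eX k x m : normc (phi k x ^+ m) ^+ 2 = (normc (phi k x) ^+ 2) ^+ m.
  by rewrite normcX -!exprM mulnC.
rewrite -(big_mkord xpredT (fun k => phi k (k.+1%:R * y) ^+ multn k)).
have cut N : (N <= M)%N -> normc (\prod_(0 <= k < M) phi k (k.+1%:R * y) ^+ multn k) ^+ 2 <=
    normc (\prod_(0 <= k < N) phi k (k.+1%:R * y) ^+ multn k) ^+ 2.
  move=> NM; rewrite (big_cat_nat (n := N)) //= normcM exprMn ler_piMr ?sqr_ge0 //.
  rewrite big_seq; elim/big_rec : _ => [|k z _ IH]; first by rewrite normc1 expr1n.
  rewrite normcM exprMn eX; apply: mulr_ile1 => //; try exact: sqr_ge0.
    by rewrite exprn_ge0 // sqr_ge0.
  by apply: exprn_ile1 => //; exact: sqr_ge0.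
apply: le_trans (cut K KM) _.
elim: K KM vc => [|K IH] KM vc; first by rewrite !big_nil normc1 mulr0 oppr0 expR0 expr1n.
rewrite !big_nat_recr //= normcM exprMn mulrDr opprD expRD.
apply: ler_pM; rewrite ?sqr_ge0 //; first by apply: IH => [|k kK]; [exact: ltnW|apply: vc; exact: ltnW].
rewrite eX; set x := K.+1%:R * y.
have s0 := cos_sub_ge0 x; have s2 : 1 - cos x <= 2 by have := cos_geN1 x; lra.
have q1 : normc (phi K x) ^+ 2 <= expR (- (c * (1 - cos x))).
  have cs : 0 <= c * (1 - cos x) <= 2^-1.
    rewrite mulr_ge0 //=; apply: le_trans (ler_pM c0 s0 c4 s2) _; lra.
  apply: le_trans (phiv K x) _.
  have vK := vc K (ltnSn K).
  apply: (@le_trans _ _ (1 + 2 * (c * (1 - cos x)))^-1).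
    have : c * (1 - cos x) <= v K * (1 - cos x) by rewrite ler_wpM2r.
    move: cs => /andP[]; move: (c * _) => p p0 p2; rewrite -mulrA; move: (v K * _) => q pq.
    by rewrite lef_pV2 ?posrE; lra.
  apply: le_trans (inv_le_expR _) _; first by move: cs => /andP[]; move: (c * _) => p *; lra.
  by rewrite (_ : 2 * _ / 2 = c * (1 - cos x)) //; field.
apply: (@le_trans _ _ (expR (- (c * (1 - cos x))) ^+ multn K)).
  by rewrite lerXn2r ?nnegrE ?sqr_ge0 ?expR_ge0.
rewrite -expRM_natl ler_expR mulrN lerN2 mulrCA ler_wpM2r ?mulr_ge0 //.
by rewrite -natrX ler_nat /multn; apply: leq_trans (leq_addr _ _); apply: leq_trans (leq_addr _ _); rewrite leq_pmull.
Qed.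

Lemma expRN_le_inv x : 0 <= x -> expR (- x) <= (1 + x)^-1.
Proof.
move=> x0; rewrite expRN lef_pV2 ?posrE ?expR_gt0 ?expR_ge1Dx //.
by rewrite ltr_pwDl.
Qed.

(** In the first case of [cos_sum_ge] the exponent is a multiple of x ^ 2, since tau ^ 2 t ^ 5 = A.
    In the second the modulus is at most exp (- c2 / t), hence O(t ^ 5), which outweighs x ^ 2 <= pi
    ^ 2 A / t ^ 5. *)
Lemma majorant (A c : R) : 0 < A -> 0 < c <= 4^-1 ->
  exists2 C, 0 < C & forall t tau M (phi : nat -> R -> R[i]) (v : nat -> R),
  0 < t <= 32^-1 -> 0 < tau -> tau ^+ 2 * t ^+ 5 = A -> 4^-1 <= M%:R * t ->
  (forall k x, normc (phi k x) ^+ 2 <= (1 + 2 * v k * (1 - cos x))^-1) ->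
  (forall k, 0 <= v k) -> (forall k, k.+1%:R * t <= 4^-1 -> c <= v k) ->
  forall x, `|x| <= pi * tau ->
  normc (\prod_(k < M) phi k (k.+1%:R * (x / tau)) ^+ multn k) <= C / (1 + x ^+ 2).
Proof.
move=> A0 /andP[c0 c4].
pose e8 : R := 8^-1 ^+ 5; pose e16 : R := 16^-1 ^+ 3.
have e80 : 0 < e8 by rewrite exprn_gt0.
have e160 : 0 < e16 by rewrite exprn_gt0.
pose c1 := c * e8 / 80 / A; pose c2 := c * e16 / 96.
have c10 : 0 < c1 by rewrite !divr_gt0 // mulr_gt0.
have c20 : 0 < c2 by rewrite divr_gt0 // mulr_gt0.
have [F F0 FP] : exists2 F : R, 0 < F & forall x : R, 0 < x -> expR (- x) <= F / x ^+ 5.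
  by exists 5`!%:R => [|z z0]; [rewrite ltr0n fact_gt0|exact: (expN_le 4 z0)].
pose C1 := 1 + c1^-1; pose C2 := F / c2 ^+ 5 * (1 + pi ^+ 2 * A).
have p2 : 0 <= pi ^+ 2 :> R := sqr_ge0 pi.
have C10 : 0 < C1 by rewrite addr_gt0 // invr_gt0.
have C20 : 0 < C2.
  by rewrite mulr_gt0 ?divr_gt0 ?exprn_gt0 // ltr_pwDl // mulr_ge0 // ltW.
exists (C1 + C2) => [|t tau M phi v /andP[t0 t32] tau0 tA Mt phiv v0 vc x xpt]; first exact: addr_gt0.
have [K [K8 K4]] : exists K : nat, 8^-1 <= K%:R * t /\ K%:R * t <= 4^-1.
  exists (Num.truncn (4^-1 / t)).
  have h0 : 0 <= 4^-1 / t by rewrite divr_ge0 // ltW.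
  have /andP[h1 h2] := truncn_itv h0.
  rewrite ler_pdivlMr // in h1; rewrite ltr_pdivrMr // -(natr1 (Num.truncn _)) mulrDl mul1r in h2.
  split => //; lra.
have KM : (K <= M)%N.
  by rewrite -(ler_nat R) -(ler_pM2r t0); apply: le_trans K4 Mt.
pose y := x / tau.
have ypi : `|y| <= pi by rewrite normrM normfV (gtr0_norm tau0) ler_pdivrMr.
pose S := \sum_(0 <= k < K) k.+1%:R ^+ 2 * (1 - cos (k.+1%:R * y)).
have PS : normc (\prod_(k < M) phi k (k.+1%:R * y) ^+ multn k) <= expR (- (c * S / 2)).
  rewrite -(@ler_pXn2r _ 2) ?nnegrE ?normc_ge0 ?expR_ge0 // -expRM_natl.
  rewrite (_ : 2%:R * - (c * S / 2) = - (c * S)); last by field.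
  apply: (@prod_factor_norm c M K phi v) => //; first by rewrite (ltW c0).
  move=> k kK; apply: vc; apply: le_trans K4; rewrite ler_pM2r // ler_nat //.
have x2 : 0 <= x ^+ 2 := sqr_ge0 x.
have D0 : 0 < 1 + x ^+ 2 by rewrite ltr_pwDl.
rewrite -/y ler_pdivlMr //.
apply: le_trans (ler_wpM2r (ltW D0) PS) _.
have [h|h] := cos_sum_ge t0 t32 K8 K4 ypi.
  have cS : c1 * x ^+ 2 <= c * S / 2.
    have -> : c1 * x ^+ 2 = c * (y ^+ 2 / 40 * (8^-1 / t) ^+ 5) / 2.
      rewrite /c1 /y -tA !expr_div_n -/e8.
      by move: (e8) => e; field; rewrite !gt_eqF.
    by rewrite ler_pM2r ?invr_gt0 // ler_pM2l.
  have e1 : expR (- (c * S / 2)) <= (1 + c1 * x ^+ 2)^-1.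
    apply: le_trans (expRN_le_inv _); last by rewrite mulr_ge0 // ltW.
    by rewrite ler_expR lerN2.
  apply: le_trans (ler_wpM2r (ltW D0) e1) _.
  have E0 : 0 < 1 + c1 * x ^+ 2 by rewrite ltr_pwDl // mulr_ge0 // ltW.
  apply: (@le_trans _ _ C1); last by rewrite lerDl ltW.
  rewrite mulrC ler_pdivrMr //.
  have -> : C1 * (1 + c1 * x ^+ 2) = 1 + c1 * x ^+ 2 + c1^-1 + x ^+ 2.
    by rewrite /C1; move: (c1) c10 (x ^+ 2) => p p0 q; field; rewrite gt_eqF.
  have := ltW c10; have : 0 <= c1^-1 by rewrite invr_ge0 ltW.
  have : 0 <= c1 * x ^+ 2 by rewrite mulr_ge0 // ltW.
  by lra.
have cS : c2 / t <= c * S / 2.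
  have -> : c2 / t = c * ((16^-1 / t) ^+ 3 * (t ^+ 2 / 48)) / 2.
    by rewrite /c2 expr_div_n -[16^-1 ^+ 3]/e16; move: (e16) => e; field; rewrite gt_eqF.
  by rewrite ler_pM2r ?invr_gt0 // ler_pM2l.
have xA : x ^+ 2 <= pi ^+ 2 * A / t ^+ 5.
  have : x ^+ 2 <= (pi * tau) ^+ 2.
    rewrite -(real_normK (num_real x)) lerXn2r ?nnegrE // ?normr_ge0 // mulr_ge0 ?pi_ge0 // ltW //.
  have t50 : t ^+ 5 != 0 by rewrite expf_neq0 // gt_eqF.
  suff -> : pi ^+ 2 * A / t ^+ 5 = (pi * tau) ^+ 2 by [].
  by rewrite -tA; move: (t ^+ 5) t50 (pi) => p p0 q; field.
have et : expR (- (c * S / 2)) <= F / c2 ^+ 5 * t ^+ 5.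
  apply: (@le_trans _ _ (expR (- (c2 / t)))); first by rewrite ler_expR lerN2.
  have q0 : 0 < c2 / t by rewrite divr_gt0.
  apply: le_trans (FP _ q0) _.
  by rewrite expr_div_n invf_div mulrA mulrAC.
apply: (@le_trans _ _ C2); last by rewrite lerDr ltW.
apply: le_trans (ler_wpM2r (ltW D0) et) _.
have t5 : 0 < t ^+ 5 by rewrite exprn_gt0.
have t51 : t ^+ 5 <= 1 by rewrite exprn_ile1 ?(ltW t0) //; lra.
have hh : t ^+ 5 * (1 + x ^+ 2) <= 1 + pi ^+ 2 * A.
  by rewrite mulrDr mulr1 lerD // mulrC -ler_pdivlMr.
have f0 : 0 <= F / c2 ^+ 5 by rewrite divr_ge0 ?exprn_ge0 ?(ltW F0) ?(ltW c20).
apply: le_trans (ler_wpM2l f0 hh).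
by move: (F / _) (t ^+ 5) (1 + _) => p q w; rewrite -mulrA.
Qed.

End Majorant.

(** * The local limit theorem for triangular arrays *)

Section LocalLimit.
Context {R : realType}.
Implicit Types (x y c : R).

Lemma normc_pow_sub (a b : R[i]) n : normc a <= 1 -> normc b <= 1 ->
  normc (a ^+ n - b ^+ n) <= n%:R * normc (a - b).
Proof.
move=> a1 b1; elim: n => [|n IH]; first by rewrite !expr0 subrr normc0 mul0r.
have -> : a ^+ n.+1 - b ^+ n.+1 = a ^+ n * (a - b) + (a ^+ n - b ^+ n) * b.
  by rewrite !exprSr; ring.
apply: le_trans (le_normcD _ _) _; rewrite !normcM -natr1 mulrDl mul1r addrC.
apply: lerD.
  by apply: le_trans IH; rewrite ler_piMr ?normc_ge0.
by rewrite ler_piMl ?normc_ge0 // normcX exprn_ile1 ?normc_ge0.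
Qed.

(** The factors are replaced one at a time; all others stay in the unit disc. *)
Lemma normc_prod_sub (M : nat) (a b : nat -> R[i]) (w : nat -> nat) :
  (forall k, normc (a k) <= 1) -> (forall k, normc (b k) <= 1) ->
  normc (\prod_(k < M) a k ^+ w k - \prod_(k < M) b k ^+ w k) <=
  \sum_(0 <= k < M) (w k)%:R * normc (a k - b k).
Proof.
move=> a1 b1.
have p1 (u : nat -> R[i]) N : (forall k, normc (u k) <= 1) ->
    normc (\prod_(k < N) u k ^+ w k) <= 1.
  move=> u1; elim: N => [|N IH]; first by rewrite big_ord0 normc1.
  by rewrite big_ord_recr /= normcM mulr_ile1 ?normc_ge0 // normcX exprn_ile1 ?normc_ge0.
elim: M => [|M IH]; first by rewrite !big_ord0 subrr normc0 big_nil.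
rewrite !big_ord_recr big_nat_recr //=.
set P := \prod_(_ < _) _; set Q := \prod_(_ < _) _.
have -> : P * a M ^+ w M - Q * b M ^+ w M = (P - Q) * a M ^+ w M + Q * (a M ^+ w M - b M ^+ w M).
  by ring.
apply: le_trans (le_normcD _ _) _; rewrite !normcM; apply: lerD.
  apply: le_trans IH; rewrite ler_piMr ?normc_ge0 // normcX exprn_ile1 ?normc_ge0 //.
apply: le_trans (normc_pow_sub _ (a1 M) (b1 M)).
by rewrite ler_piMl ?normc_ge0 // p1.
Qed.

Lemma normc_gfac (m v y : R) : 0 <= v -> normc (gfac m v y) <= 1.
Proof.
move=> v0; rewrite /gfac normcM normc_cis mul1r normc_real ger0_norm ?expR_ge0 //.
by rewrite -expR0 ler_expR oppr_le0 divr_ge0 // mulr_ge0 // sqr_ge0.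
Qed.

Lemma gfac_prod (M : nat) (m v : nat -> R) y :
  \prod_(k < M) gfac (m k) (v k) (k.+1%:R * y) ^+ multn k =
  gfac (\sum_(0 <= k < M) mult k * (k.+1%:R * m k))
       (\sum_(0 <= k < M) mult k * (k.+1%:R ^+ 2 * v k)) y.
Proof.
have cisX (z : R) n : cis z ^+ n = cis (n%:R * z).
  elim: n => [|n IH]; first by rewrite expr0 mul0r cisE cos0 sin0.
  by rewrite exprS IH -cisD -natr1; congr cis; ring.
elim: M => [|M IH].
  rewrite big_ord0 !big_nil /gfac !mul0r oppr0 expR0 cisE cos0 sin0.
  by rewrite mulr1.
rewrite big_ord_recr /= IH !big_nat_recr //= /gfac exprMn cisX -rmorphXn /= -expRM_natl multn_mult.
set a := \sum_(_ <= _ < _) _; set b := \sum_(_ <= _ < _) _.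
have -> : cis ((a + mult M * (M.+1%:R * m M)) * y) = cis (a * y) * cis (mult M * (m M * (M.+1%:R * y))).
  by rewrite -cisD; congr cis; ring.
have -> : expR (- ((b + mult M * (M.+1%:R ^+ 2 * v M)) * y ^+ 2 / 2)) =
    expR (- (b * y ^+ 2 / 2)) * expR (mult M * - (v M * (M.+1%:R * y) ^+ 2 / 2)).
  by rewrite -expRD; congr expR; field.
by rewrite rmorphM /=; ring.
Qed.

(** The factors are abstract so that the geometric and the Bernoulli case share the proof. Replacing
    them by Gaussian factors costs |x| ^ 3 C3 / (t ^ 6 tau ^ 3), which is |x| ^ 3 (C3 / A) / (tau t)
    and tends to 0; the product of Gaussian factors is explicit. *)
Lemma local_limit (A c C3 : R) (t tau : nat -> R) (M : nat -> nat)
    (phi : nat -> nat -> R -> R[i]) (m v kap : nat -> nat -> R) :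
  0 < A -> 0 < c <= 4^-1 ->
  t n @[n --> \oo] --> 0 -> (forall n, 0 < t n) -> (forall n, 0 < tau n) ->
  (forall n, tau n ^+ 2 * t n ^+ 5 = A) -> (forall n, 4^-1 <= (M n)%:R * t n) ->
  (forall n k x, normc (phi n k x) ^+ 2 <= (1 + 2 * v n k * (1 - cos x))^-1) ->
  (forall n k, 0 <= v n k) -> (forall n k, k.+1%:R * t n <= 4^-1 -> c <= v n k) ->
  (forall n k x, normc (phi n k x - gfac (m n k) (v n k) x) <= kap n k * `|x| ^+ 3) ->
  (forall n, \sum_(0 <= k < M n) mult k * (k.+1%:R ^+ 3 * kap n k) <= C3 / t n ^+ 6) ->
  (\sum_(0 <= k < M n) mult k * (k.+1%:R * m n k) - n%:R) / tau n @[n --> \oo] --> 0 ->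
  (\sum_(0 <= k < M n) mult k * (k.+1%:R ^+ 2 * v n k)) / tau n ^+ 2 @[n --> \oo] --> (2 : R) ->
  (forall n k, ccont (fun x => phi n k (k.+1%:R * (x / tau n)))) ->
  window (tau n) (fun x => Re (\prod_(k < M n) phi n k (k.+1%:R * (x / tau n)) ^+ multn k *
    cis (- (n%:R * (x / tau n))))) @[n --> \oo] --> Num.sqrt (pi : R).
Proof.
move=> A0 c0 tc t0 tau0 tA Mt phiv v0 vc phig kapC mc Vc cphi.
have [C C0 HC] := majorant A0 c0.
have p0 := @pi_gt0 R.
have w0 : (tau n * t n)^-1 @[n --> \oo] --> (0 : R).
  have c1 : Num.sqrt (t n ^+ 3 / A) @[n --> \oo] --> Num.sqrt ((0 : R) ^+ 3 / A).
    apply: (continuous_cvg _ (@sqrt_continuous R _)); apply: cvgM; last exact: cvg_cst.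
    exact: (continuous_cvg _ (@exprn_continuous R 3 _) tc).
  rewrite expr0n mul0r sqrtr0 in c1; apply: (cvgr_eq c1 erefl); near=> n.
  have tn := t0 n; have un := tau0 n.
  have -> : t n ^+ 3 / A = (tau n * t n)^-1 ^+ 2 by rewrite -(tA n); field; rewrite !gt_eqF.
  by rewrite sqrtr_sqr ger0_norm // invr_ge0 mulr_ge0 // ltW.
have tauoo : pi * tau n @[n --> \oo] --> +oo.
  apply/cvgryPge => B; pose B1 := `|B| + 1.
  have B10 : 0 < B1 by rewrite ltr_wpDl.
  have iB : 0 < B1^-1 by rewrite invr_gt0.
  near=> n; have tn := t0 n; have un := tau0 n.
  have t1 : t n <= 1 by near: n; apply: (cvgr_le _ tc).
  have h : (tau n * t n)^-1 <= B1^-1 by near: n; exact: (cvgr_le _ w0).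
  rewrite lef_pV2 ?posrE ?mulr_gt0 // in h.
  have hB : B <= B1 by apply: le_trans (ler_norm _) _; rewrite lerDl.
  apply: le_trans hB _; apply: le_trans h _; rewrite mulrC.
  have p2 := @pi_ge2 R.
  by rewrite ler_pM2r //; apply: le_trans t1 _; lra.
apply: (@gauss_llt R (fun n x => Re (\prod_(k < M n) phi n k (k.+1%:R * (x / tau n)) ^+ multn k *
    cis (- (n%:R * (x / tau n))))) (fun n => pi * tau n) C _ _ _ tauoo).
- move=> n; suff [] : ccont (fun x => \prod_(k < M n) phi n k (k.+1%:R * (x / tau n)) ^+ multn k *
    cis (- (n%:R * (x / tau n)))) by [].
  apply: ccontM.
    apply: (@ccont_prod R _ _ (fun (k : 'I_(M n)) x => phi n k (k.+1%:R * (x / tau n)) ^+ multn k)) => k.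
    elim: (multn k) => [|j IH].
      by under [X in ccont X]eq_fun do rewrite expr0; exact: ccont_cst.
    by under [X in ccont X]eq_fun do rewrite exprS; exact: ccontM.
  have -> : (fun x => cis (- (n%:R * (x / tau n)))) = (fun x => cis (- n%:R * (x / tau n))).
    by apply/funext => x; rewrite mulNr.
  exact: ccont_cis_scale.
- move=> x; pose y n := x / tau n.
  pose mu n := \sum_(0 <= k < M n) mult k * (k.+1%:R * m n k).
  pose V n := \sum_(0 <= k < M n) mult k * (k.+1%:R ^+ 2 * v n k).
  have main : cos (x * ((mu n - n%:R) / tau n)) * expR (- (x ^+ 2 * (V n / tau n ^+ 2) / 2))
      @[n --> \oo] --> (gauss_fun x : R).
    have c1 : cos (x * ((mu n - n%:R) / tau n)) @[n --> \oo] --> (cos (x * 0) : R).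
      by apply: (continuous_cvg _ (@continuous_cos R _)); apply: cvgM; [exact: cvg_cst|exact: mc].
    have c2 : expR (- (x ^+ 2 * (V n / tau n ^+ 2) / 2)) @[n --> \oo] --> (expR (- (x ^+ 2 * 2 / 2)) : R).
      apply: (continuous_cvg _ (@continuous_expR R _)); apply: cvgN; apply: cvgM; last exact: cvg_cst.
      by apply: cvgM; [exact: cvg_cst|exact: Vc].
    apply: (cvgr_eq (cvgM c1 c2)); last exact: nearW.
    by rewrite mulr0 cos0 mul1r /gauss_fun mulfK.
  have err : `|x| ^+ 3 * (C3 / A * (tau n * t n)^-1) @[n --> \oo] --> (`|x| ^+ 3 * (C3 / A * 0) : R).
    by apply: cvgM; [exact: cvg_cst|apply: cvgM => //; exact: cvg_cst].
  rewrite !mulr0 in err.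
  pose Gn n := cos (x * ((mu n - n%:R) / tau n)) * expR (- (x ^+ 2 * (V n / tau n ^+ 2) / 2)).
  pose En n := `|x| ^+ 3 * (C3 / A * (tau n * t n)^-1).
  have lo : Gn n - En n @[n --> \oo] --> (gauss_fun x : R).
    by rewrite -[X in _ --> X]subr0; exact: cvgB main err.
  have hi : Gn n + En n @[n --> \oo] --> (gauss_fun x : R).
    by rewrite -[X in _ --> X]addr0; exact: cvgD main err.
  apply: squeeze_cvgr lo hi; near=> n; rewrite /Gn /En.
  have tn := t0 n; have un := tau0 n.
  pose P := \prod_(k < M n) phi n k (k.+1%:R * y n) ^+ multn k.
  have phi1 k z : normc (phi n k z) <= 1.
    rewrite -(@ler_pXn2r _ 2) ?nnegrE ?normc_ge0 // expr1n; apply: le_trans (phiv n k z) _.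
    have h : 0 <= 2 * v n k * (1 - cos z) by rewrite mulr_ge0 ?cos_sub_ge0 // mulr_ge0.
    by rewrite invf_le1 ?lerDl // ltr_pwDl.
  have PG : normc (P - gfac (mu n) (V n) (y n)) <= `|x| ^+ 3 * (C3 / A * (tau n * t n)^-1).
    have g1 k : normc (gfac (m n k) (v n k) (k.+1%:R * y n)) <= 1 by exact: normc_gfac.
    rewrite /P /mu /V -gfac_prod.
    apply: le_trans (@normc_prod_sub (M n) _ _ multn (fun k => phi1 k (k.+1%:R * y n)) g1) _.
    apply: (@le_trans _ _ (\sum_(0 <= k < M n) `|y n| ^+ 3 * (mult k * (k.+1%:R ^+ 3 * kap n k)))).
      apply: ler_sum => k _; rewrite multn_mult.
      have -> : `|y n| ^+ 3 * (mult k * (k.+1%:R ^+ 3 * kap n k)) =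
          mult k * (kap n k * (k.+1%:R * `|y n|) ^+ 3) by ring.
      rewrite ler_wpM2l ?(ltW (mult_gt0 _)) //; apply: le_trans (phig n k _) _.
      by rewrite normrM ger0_norm.
    rewrite -mulr_sumr; apply: le_trans (ler_wpM2l _ (kapC n)) _; first by rewrite exprn_ge0.
    rewrite /y normrM normfV (gtr0_norm un) -(tA n) le_eqVlt; apply/orP; left; apply/eqP.
    by move: `|x| => z; field; rewrite !gt_eqF.
  have Gc : Re (gfac (mu n) (V n) (y n) * cis (- (n%:R * y n))) =
      cos (x * ((mu n - n%:R) / tau n)) * expR (- (x ^+ 2 * (V n / tau n ^+ 2) / 2)).
    rewrite /gfac mulrAC -cisD cReM cisE /= mulr0 subr0; congr (cos _ * expR _).
      by rewrite /y; ring.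
    by rewrite /y; field; rewrite gt_eqF.
  have : `|Re (P * cis (- (n%:R * y n))) - Re (gfac (mu n) (V n) (y n) * cis (- (n%:R * y n)))| <=
      `|x| ^+ 3 * (C3 / A * (tau n * t n)^-1).
    rewrite -cReN -cReD -mulrBl; apply: le_trans (Re_le_normc _) _.
    by rewrite normcM normc_cis mulr1.
  by rewrite Gc ler_distl.
near=> n => x xt.
have t32 : 0 < t n <= 32^-1.
  by rewrite t0 /=; near: n; apply: (cvgr_le _ tc); rewrite invr_gt0.
apply: le_trans (Re_le_normc _) _; rewrite normcM normc_cis mulr1.
exact: (HC (t n) (tau n) (M n) (phi n) (v n) t32 (tau0 n) (tA n) (Mt n) (phiv n) (v0 n) (vc n) x xt).
Unshelve. all: end_near. Qed.

End LocalLimit.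

(** * Partitions and generating polynomials *)

Section Counting.
Variable a : nat -> nat.
Hypothesis a0 : forall j, (0 < a j)%N.

(** The cap [B] unifies the two counts: [B = 1] gives distinct partitions, and [B = n] is no
    restriction when all parts are positive. *)
Definition bounded_partitions (B n : nat) : set {fsfun nat -> nat with 0%N} :=
  partitions a n `&` [set m | forall j, (m j <= B)%N].

Definition capped_poly (B N : nat) : {poly int} :=
  \prod_(j < N) \sum_(m < B.+1) 'X^(m * a j).

Lemma coef_capped_poly_rec B N n : (capped_poly B N.+1)`_n =
  \sum_(m < B.+1) if (n < m * a N)%N then 0 else (capped_poly B N)`_(n - m * a N).
Proof.
rewrite /capped_poly big_ord_recr /= mulr_sumr coef_sum; apply: eq_bigr => m _.
by rewrite coefMXn.
Qed.

Lemma pcount_coef B N n : (n <= B)%N -> (capped_poly B N)`_n = (pcount a N n)%:R.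
Proof.
elim: N n => [|N IH] n nB.
  by rewrite /capped_poly big_ord0 coef1.
rewrite coef_capped_poly_rec /= natr_sum -(big_mkord xpredT (fun m =>
  if (n < m * a N)%N then 0 else (capped_poly B N)`_(n - m * a N))).
rewrite (big_cat_nat (n := n.+1)) //= [X in _ + X]big_nat_cond [X in _ + X]big1 ?addr0.
  rewrite [RHS]big_mkcond /=; apply: eq_bigr => m _.
  by case: leqP => // h; rewrite IH // (leq_trans (leq_subr _ _)).
move=> m; rewrite andbT => /andP[h _]; rewrite ifT //.
by apply: leq_trans h _; rewrite leq_pmulr.
Qed.

Lemma qcount_coef N n : (capped_poly 1 N)`_n = (qcount a N n)%:R.
Proof.
elim: N n => [|N IH] n; first by rewrite /capped_poly big_ord0 coef1.
rewrite coef_capped_poly_rec big_ord_recr big_ord1 /= ?mul0n mul1n ?ltn0 subn0 IH natrD.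
by case: leqP => _ //; rewrite IH.
Qed.

Lemma coef_capped_poly_card B N n : (capped_poly B N)`_n =
  #|[pred h : {ffun 'I_N -> 'I_B.+1} | (\sum_(j < N) h j * a j == n)%N]|%:R.
Proof.
rewrite /capped_poly bigA_distr_bigA /= coef_sum.
under eq_bigr => h _ do rewrite prodrXr coefXn.
rewrite -sum1_card natr_sum [RHS]big_mkcond /=; apply: eq_bigr => h _.
by rewrite inE eq_sym; case: eqP.
Qed.

Lemma sum_finsupp (m : {fsfun nat -> nat with 0%N}) N : (forall j, (N <= j)%N -> m j = 0%N) ->
  (\sum_(j <- finsupp m) m j * a j = \sum_(j < N) m j * a j)%N.
Proof.
move=> mN; rewrite -(big_mkord xpredT (fun j => m j * a j)%N) /index_iota subn0.
rewrite (perm_big [seq j <- iota 0 N | m j != 0%N]) /=; last first.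
  apply: uniq_perm; [exact: fset_uniq|exact/filter_uniq/iota_uniq|].
  move=> j; rewrite mem_filter mem_iota add0n mem_finsupp /=.
  by case: eqP => //= mj; case: ltnP => // /mN.
rewrite big_filter big_mkcond /=; apply: eq_bigr => j _.
by case: eqP => //= ->; rewrite mul0n.
Qed.

Lemma card_bounded_partitions B n N : (forall j, (N <= j)%N -> (n < a j)%N) ->
  (#|` fset_set (bounded_partitions B n)|)%:R = (capped_poly B N)`_n.
Proof.
move=> aN; rewrite coef_capped_poly_card; congr (_%:R).
pose g (h : {ffun 'I_N -> 'I_B.+1}) : {fsfun nat -> nat with 0%N} :=
  [fsfun j in [fset k | k in iota 0 N]%fset =>
     if insub j is Some i then val (h i) else 0%N].
have gE h (i : 'I_N) : g h i = h i.
  by rewrite /g fsfunE !inE mem_iota add0n ltn_ord /= valK.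
have gN h j : (N <= j)%N -> g h j = 0%N.
  by move=> Nj; rewrite /g fsfunE !inE mem_iota add0n ltnNge Nj.
have gS h : (\sum_(j <- finsupp (g h)) g h j * a j = \sum_(j < N) h j * a j)%N.
  by rewrite (sum_finsupp (gN h)); apply: eq_bigr => i _; rewrite gE.
have ginj : injective g.
  by move=> h h' e; apply/ffunP => i; apply/val_inj; rewrite /= -!gE e.
have im : bounded_partitions B n =
    g @` [set h : {ffun 'I_N -> 'I_B.+1} | (\sum_(j < N) h j * a j == n)%N].
  apply/seteqP; split => [m [/= mn mB]|_ [h /= /eqP hn <-]]; last first.
    split; first by rewrite /partitions /= gS.
    move=> j /=; have [jN|/gN -> //] := ltnP j N.
    by rewrite (gE h (Ordinal jN)) -ltnS ltn_ord.
  have mN j : (N <= j)%N -> m j = 0%N.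
    move=> Nj; apply/eqP; rewrite -leqn0 leqNgt; apply/negP => mj.
    have jm : j \in finsupp m by rewrite mem_finsupp -lt0n.
    have : (m j * a j <= n)%N by rewrite -mn (big_fsetD1 j jm) /= leq_addr.
    by rewrite leqNgt (leq_trans (aN j Nj)) // leq_pmull.
  exists [ffun i : 'I_N => inord (m i)] => /=.
    apply/eqP; rewrite -mn (sum_finsupp mN); apply: eq_bigr => i _.
    by rewrite ffunE inordK // ltnS.
  apply/fsfunP => j; have [jN|Nj] := ltnP j N; last by rewrite gN // mN.
  by rewrite (gE _ (Ordinal jN)) ffunE inordK // ltnS.
rewrite im fset_set_image; last exact: finite_finset.
rewrite card_imfset //=.
have -> : fset_set [set h : {ffun 'I_N -> 'I_B.+1} | (\sum_(j < N) h j * a j == n)%N] =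
    [fset h in [pred h : {ffun 'I_N -> 'I_B.+1} | (\sum_(j < N) h j * a j == n)%N]]%fset.
  apply/fsetP => h; rewrite in_fset_set; last exact: finite_finset.
  apply/idP/idP => h0; first by rewrite !inE; exact: (set_mem h0).
  by apply/mem_set; move: h0; rewrite !inE.
by rewrite -[LHS]/(#|` _|) card_imfset //= -cardE.
Qed.

Lemma card_partitions n N : (forall j, (N <= j)%N -> (n < a j)%N) ->
  #|` fset_set (partitions a n)| = pcount a N n.
Proof.
move=> aN; apply/eqP; rewrite -(eqr_nat int) -(pcount_coef N (leqnn n)).
rewrite -(card_bounded_partitions _ aN) eqr_nat; apply/eqP; congr (#|` fset_set _|).
apply/seteqP; split => [m mn|m [] //]; split => // j /=.
have [jm|/fsfun_dflt -> //] := boolP (j \in finsupp m).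
apply: (@leq_trans (m j * a j)); first by rewrite leq_pmulr.
by rewrite -mn (big_fsetD1 j jm) /= leq_addr.
Qed.

Lemma card_distinct_partitions n N : (forall j, (N <= j)%N -> (n < a j)%N) ->
  #|` fset_set (distinct_partitions a n)| = qcount a N n.
Proof.
move=> aN; apply/eqP; rewrite -(eqr_nat int) -(qcount_coef N).
by rewrite -(card_bounded_partitions _ aN) eqr_nat.
Qed.

End Counting.

(** * Multiplicities of the sequence of cube root floors *)

Section FloorCbrt.
Variable R : realType.

Lemma floor_cbrt_le (n j : nat) : (j.+1 < n.+1 ^ 3)%N -> (floor_cbrt R j <= n)%N.
Proof.
move=> jn; rewrite -ltnS /floor_cbrt truncn_lt_nat ?powR_ge0 //.
have -> : (n.+1%:R : R) = ((n.+1 ^ 3)%:R : R) `^ (1 / 3).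
  by rewrite natrX -powR_mulrn // -powRrM mulrCA mulfV ?pnatr_eq0 // mulr1 powRr1.
by apply: gt0_ltr_powR; rewrite ?nnegrE ?divr_gt0 ?ltr_nat.
Qed.

Lemma floor_cbrtE (k j : nat) : (k.+1 ^ 3 <= j.+1 < k.+2 ^ 3)%N -> floor_cbrt R j = k.+1.
Proof.
move=> /andP[h1 h2]; apply/eqP; rewrite eqn_leq floor_cbrt_ge // andbT.
exact: floor_cbrt_le.
Qed.

Lemma floor_cbrt_gt0 j : (0 < floor_cbrt R j)%N.
Proof. exact: floor_cbrt_ge. Qed.

Lemma cube_step k : ((k.+1 ^ 3).-1 + multn k = (k.+2 ^ 3).-1)%N.
Proof.
have -> : (k.+2 ^ 3 = k.+1 ^ 3 + multn k)%N.
  by rewrite /multn -[k.+2]addn1 !expnS !expn0; move: (k.+1) => x; ring.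
by rewrite -(prednK (_ : 0 < k.+1 ^ 3)%N) ?expn_gt0.
Qed.

(** The first [(M.+1 ^ 3).-1] indices carry exactly the values 1, ..., M; the predecessor appears
    because index [j] stands for l = j + 1. *)
Lemma prod_floor_cbrt (S : comNzRingType) (f : nat -> S) M :
  \prod_(j < (M.+1 ^ 3).-1) f (floor_cbrt R j) = \prod_(k < M) f k.+1 ^+ multn k.
Proof.
rewrite -(big_mkord xpredT (fun j => f (floor_cbrt R j))).
rewrite -(big_mkord xpredT (fun k => f k.+1 ^+ multn k)).
elim: M => [|M IH]; first by rewrite exp1n !big_geq.
rewrite [RHS]big_nat_recr // -IH.
have le : ((M.+1 ^ 3).-1 <= (M.+2 ^ 3).-1)%N by rewrite -cube_step leq_addr.
rewrite (big_cat_nat (leq0n _) le) /=; congr (_ * _).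
transitivity (\prod_((M.+1 ^ 3).-1 <= j < (M.+2 ^ 3).-1) f M.+1); last first.
  by rewrite prodr_const_nat -cube_step addKn.
apply: eq_big_nat => j /andP[h1 h2].
rewrite (@floor_cbrtE M j) //.
have p (i : nat) : (0 < i.+1 ^ 3)%N by rewrite expn_gt0.
by rewrite -(prednK (p M)) -(prednK (p M.+1)) !ltnS h1.
Qed.

End FloorCbrt.

(** * The saddle point *)

Section SaddlePoint.
Context {R : realType}.
Implicit Types (x y t s : R).

Variables (A B C e D c : R).
Hypotheses (A0 : 0 < A) (B0 : 0 <= B) (c01 : 0 < c <= 4^-1).
(** Chosen so that 12 A be = 2 B, which cancels the s ^ -3 term of the mean at s + be s ^ 2. *)
Let be := B / (6 * A).

(* [saddle s] solves [3 A / t ^ 4 + 2 B / t ^ 3 = 3 A / s ^ 4] up to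
   [O(t ^ -2)]. *)
Definition saddle s : R := s + be * s ^+ 2.

Let be0 : 0 <= be. Proof. by rewrite divr_ge0 // mulr_ge0 // ltW. Qed.

Lemma saddleE s : saddle s = s * (1 + be * s).
Proof. by rewrite /saddle; ring. Qed.

Lemma saddle_gt0 s : 0 < s -> 0 < saddle s.
Proof. by move=> s0; rewrite saddleE mulr_gt0 // ltr_pwDl // mulr_ge0 // ltW. Qed.

Let u_gt0 s : 0 < s -> 0 < 1 + be * s.
Proof. by move=> s0; rewrite ltr_pwDl // mulr_ge0 // ltW. Qed.

Let BE : B = 6 * A * be. Proof. by rewrite /be; field; rewrite gt_eqF. Qed.

Lemma cvg_at_right0 (h : nat -> R) : h n @[n --> \oo] --> (0 : R) -> (forall n, 0 < h n) ->
  h n @[n --> \oo] --> 0^'+.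
Proof.
move=> hc h0 P HP; have H : \forall n \near \oo, (0 < h n -> P (h n)) := hc _ HP.
by change (\forall n \near \oo, P (h n)); apply: filterS H => n; apply.
Qed.

Lemma mean_at_saddle s : 0 < s ->
  3 * A / saddle s ^+ 4 + 2 * B / saddle s ^+ 3 - 3 * A / s ^+ 4 =
  - (3 * A * be ^+ 2) * (2 + 4 * (be * s) + (be * s) ^+ 2) / (1 + be * s) ^+ 4 / s ^+ 2.
Proof.
move=> s0; rewrite saddleE {1}BE; have := u_gt0 s0; move: (be) => b h.
by field; rewrite !gt_eqF.
Qed.

(** An exact identity, whose right-hand side tends to 8 A be ^ 3 - C be; this is the source of the
    constant in [log_main]. *)
Lemma exponent_at_saddle s : 0 < s ->
  A / saddle s ^+ 3 + B / saddle s ^+ 2 + C / saddle s + 3 * A / s ^+ 4 * saddle s -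
  (4 * A / s ^+ 3 + B / s ^+ 2 + (C - 6 * A * be ^+ 2) / s) =
  A * be ^+ 3 * (8 + 15 * (be * s) + 6 * (be * s) ^+ 2) / (1 + be * s) ^+ 3 - C * be / (1 + be * s).
Proof.
move=> s0; rewrite saddleE {1 2}BE; have := u_gt0 s0; move: (be) => b h.
by field; rewrite !gt_eqF.
Qed.

(** The solution of 3 A / s ^ 4 = n; [maxn n 1] keeps it positive at n = 0. *)
Definition sad_s (n : nat) : R := (3 * A / (maxn n 1)%:R) `^ (1 / 4).

Let s_gt0 n : 0 < sad_s n.
Proof. by rewrite powR_gt0 // divr_gt0 ?mulr_gt0 // ltr0n leq_max orbT. Qed.

Lemma sad_s4 n : (0 < n)%N -> n%:R = 3 * A / sad_s n ^+ 4.
Proof.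
move=> n0; have A3 : 0 < 3 * A / n%:R by rewrite divr_gt0 ?mulr_gt0 // ltr0n.
rewrite /sad_s (maxn_idPl n0) -powR_mulrn ?powR_ge0 // -powRrM.
rewrite (_ : 1 / 4 * 4%:R = 1); last by field.
rewrite powRr1 ?(ltW A3) //; field; rewrite gt_eqF //= ?ltr0n //.
by rewrite gt_eqF.
Qed.

Lemma cvg_sad_s : sad_s n @[n --> \oo] --> (0 : R).
Proof.
apply/cvgr0Pnorm_le => eps eps0; near=> n.
have n0 : (0 < n)%N by near: n; exact: nbhs_infty_gt.
have n0' : 0 < n%:R :> R by rewrite ltr0n.
have s4 : 0 < sad_s n ^+ 4 by rewrite exprn_gt0.
rewrite gtr0_norm // -(@ler_pXn2r _ 4) ?nnegrE ?(ltW eps0) ?(ltW (s_gt0 n)) //.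
have -> : sad_s n ^+ 4 = 3 * A / n%:R.
  by rewrite [in RHS](sad_s4 n0); field; rewrite !gt_eqF.
rewrite ler_pdivrMr // -ler_pdivrMl ?exprn_gt0 //; near: n.
exact: nbhs_infty_ger.
Unshelve. all: end_near. Qed.

(* The logarithm of [exp (F t + n t) / (2 sqrt pi tau)] at [t = saddle s], up
   to [o(1)]. *)
Definition log_main (n : nat) : R := let s := sad_s n in
  4 * A / s ^+ 3 + B / s ^+ 2 + (C - 6 * A * be ^+ 2) / s +
  (D + 8 * A * be ^+ 3 - C * be) + (e + 5 / 2) * ln s - ln (2 * Num.sqrt pi * Num.sqrt (6 * A)).

Variables (lf mf vf : R -> R) (fac : R -> R -> R[i]) (cnt : nat -> nat).

Hypothesis fac_norm : forall y x, 0 < y -> normc (fac y x) ^+ 2 <= (1 + 2 * vf y * (1 - cos x))^-1.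
Hypothesis vf_ge0 : forall y, 0 < y -> 0 <= vf y.
Hypothesis vf_ge : forall y, 0 < y <= 4^-1 -> c <= vf y.
Hypothesis fac_gfac : forall y x, 0 < y -> normc (fac y x - gfac (mf y) (vf y) x) <=
  13 * (bose y + bose y ^+ 2 + bose y ^+ 3 + bose y ^+ 4) * `|x| ^+ 3.
Hypothesis fac_ccont : forall y a tau, 0 < y -> ccont (fun x => fac y (a * (x / tau))).

Let F t := tsum (fun k => mult k * lf (k.+1%:R * t)).
Let f t := tsum (fun k => mult k * (k.+1%:R * mf (k.+1%:R * t))).
Let g t := tsum (fun k => mult k * (k.+1%:R ^+ 2 * vf (k.+1%:R * t))).

Hypothesis sF : forall t, 0 < t -> asum (fun k => mult k * lf (k.+1%:R * t)).
Hypothesis sf : forall t, 0 < t -> asum (fun k => mult k * (k.+1%:R * mf (k.+1%:R * t))).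
Hypothesis sg : forall t, 0 < t -> asum (fun k => mult k * (k.+1%:R ^+ 2 * vf (k.+1%:R * t))).
Hypothesis F_asymp : F t - phi A B C e t @[t --> 0^'+] --> D.
Hypothesis f_asymp : (f t - (3 * A / t ^+ 4 + 2 * B / t ^+ 3)) * w52 t @[t --> 0^'+] --> 0.
Hypothesis g_asymp : t ^+ 5 * g t @[t --> 0^'+] --> 12 * A.

Hypothesis cnt_fourier : forall n M t tau, 0 < t -> 0 < tau -> (n <= M)%N ->
  window tau (fun x => Re (\prod_(k < M) fac (k.+1%:R * t) (k.+1%:R * (x / tau)) ^+ multn k *
    cis (- (n%:R * (x / tau))))) =
  2 * pi * tau * (cnt n)%:R * expR (- (\sum_(0 <= k < M) mult k * lf (k.+1%:R * t) + n%:R * t)).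

Theorem saddle_count : (cnt n)%:R * expR (- log_main n) @[n --> \oo] --> (1 : R).
Proof.
pose t n := saddle (sad_s n).
have t0 n : 0 < t n by exact: saddle_gt0.
have pi0 := @pi_gt0 R.
have w0 n : 0 < w52 (t n) by exact: w52_gt0.
have A6 : 0 < Num.sqrt (6 * A) by rewrite sqrtr_gt0 mulr_gt0.
(* With variance asymptotic to 12 A / t ^ 5, this makes variance / tau ^ 2 tend to 2, as
   [local_limit] requires. *)
pose tau n := Num.sqrt (6 * A) / w52 (t n).
have tau0 n : 0 < tau n by rewrite divr_gt0.
have tauA n : tau n ^+ 2 * t n ^+ 5 = 6 * A.
  have h := w0 n; rewrite /tau -(w52_sqr (ltW (t0 n))) expr_div_n sqr_sqrtr ?mulr_ge0 ?(ltW A0) //.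
  by rewrite divfK // expf_neq0 // gt_eqF.
(* The truncation [M n] must reach [n] for the count to be exact, satisfy M t >= 1/4 for the
   majorant, and change the three sums by at most 1 / (n + 1). *)
have /choice[M HM] : forall n, exists M : nat, [/\ (n <= M)%N, 4^-1 <= M%:R * t n,
    `|F (t n) - \sum_(0 <= k < M) mult k * lf (k.+1%:R * t n)| <= n.+1%:R^-1,
    `|f (t n) - \sum_(0 <= k < M) mult k * (k.+1%:R * mf (k.+1%:R * t n))| <= n.+1%:R^-1 &
    `|g (t n) - \sum_(0 <= k < M) mult k * (k.+1%:R ^+ 2 * vf (k.+1%:R * t n))| <= n.+1%:R^-1].
  move=> n; have tn := t0 n.
  have n1 : 0 < n.+1%:R^-1 :> R by rewrite invr_gt0.
  near \oo => M; exists M; split.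
  - by near: M; exact: nbhs_infty_ge.
  - rewrite -ler_pdivrMr //; near: M.
    exact: nbhs_infty_ger.
  - by near: M; move/cvgrPdist_le : (asum_tsum (sF tn)); exact.
  - by near: M; move/cvgrPdist_le : (asum_tsum (sf tn)); exact.
  - by near: M; move/cvgrPdist_le : (asum_tsum (sg tn)); exact.
have cs := cvg_sad_s.
pose u n := be * sad_s n.
have u0 n : 0 < 1 + u n by exact: u_gt0.
have cu : u n @[n --> \oo] --> (0 : R).
  by rewrite -[X in _ --> X](mulr0 be); apply: cvgM => //; exact: cvg_cst.
have c1u : 1 + u n @[n --> \oo] --> (1 : R).
  by rewrite -[X in _ --> X]addr0; apply: cvgD => //; exact: cvg_cst.
have tE n : t n = sad_s n * (1 + u n) by exact: saddleE.
have ct0 : t n @[n --> \oo] --> (0 : R).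
  have h : sad_s n * (1 + u n) @[n --> \oo] --> (0 * 1 : R) by exact: cvgM.
  by apply: (cvgr_eq h); [rewrite mul0r|exact: nearW].
have ct : t n @[n --> \oo] --> 0^'+ by exact: cvg_at_right0.
have cinv : n.+1%:R^-1 @[n --> \oo] --> (0 : R) by exact: cvg_harmonic.
have small (h h' : nat -> R) : (forall n, `|h n - h' n| <= n.+1%:R^-1) -> h' n - h n @[n --> \oo] --> (0 : R).
  move=> hh; apply/cvgr0Pnorm_le => eps eps0.
  move/cvgr0Pnorm_le : cinv => /(_ _ eps0); apply: filterS => n.
  by rewrite distrC ger0_norm ?invr_ge0 //; apply: le_trans.
have dF : \sum_(0 <= k < M n) mult k * lf (k.+1%:R * t n) - F (t n) @[n --> \oo] --> (0 : R).
  by apply: (small (fun n => F (t n)) (fun n => \sum_(0 <= k < M n) mult k * lf (k.+1%:R * t n))) => n;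
    have [] := HM n.
have df : \sum_(0 <= k < M n) mult k * (k.+1%:R * mf (k.+1%:R * t n)) - f (t n) @[n --> \oo] --> (0 : R).
  by apply: (small (fun n => f (t n)) (fun n => \sum_(0 <= k < M n) mult k * (k.+1%:R * mf (k.+1%:R * t n)))) => n;
    have [] := HM n.
have dg : \sum_(0 <= k < M n) mult k * (k.+1%:R ^+ 2 * vf (k.+1%:R * t n)) - g (t n) @[n --> \oo] --> (0 : R).
  by apply: (small (fun n => g (t n)) (fun n => \sum_(0 <= k < M n) mult k * (k.+1%:R ^+ 2 * vf (k.+1%:R * t n)))) => n;
    have [] := HM n.
have csq : Num.sqrt (t n) @[n --> \oo] --> (0 : R).
  by rewrite -[X in _ --> X](sqrtr0 R); exact: (continuous_cvg _ (@sqrt_continuous R _) ct0).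
have cw : w52 (t n) @[n --> \oo] --> (0 : R).
  have h : t n * t n * Num.sqrt (t n) @[n --> \oo] --> (0 * 0 * 0 : R).
    by apply: cvgM => //; exact: cvgM.
  by apply: (cvgr_eq h); [rewrite !mul0r|apply: nearW => n; rewrite /w52 expr2].
have cpoly (a b d : R) : a + b * u n + d * u n ^+ 2 @[n --> \oo] --> (a : R).
  have h : a + b * u n + d * (u n * u n) @[n --> \oo] --> (a + b * 0 + d * (0 * 0) : R).
    apply: cvgD; [apply: cvgD; [exact: cvg_cst|by apply: cvgM => //; exact: cvg_cst]|].
    by apply: cvgM; [exact: cvg_cst|exact: cvgM].
  by apply: (cvgr_eq h); [rewrite !mulr0 !addr0|apply: nearW => n; rewrite expr2].
have cinvu k : ((1 + u n) ^+ k)^-1 @[n --> \oo] --> (1 : R).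
  have h : (1 + u n) ^+ k @[n --> \oo] --> (1 : R).
    by rewrite -[X in _ --> X](expr1n _ k); exact: (continuous_cvg _ (@exprn_continuous R k _) c1u).
  by rewrite -[X in _ --> X]invr1; apply: cvgV => //; exact: oner_neq0.
have [C3 C30 HC3] := @third_moment_bound R.
have L : window (tau n) (fun x => Re (\prod_(k < M n) fac (k.+1%:R * t n) (k.+1%:R * (x / tau n)) ^+ multn k *
    cis (- (n%:R * (x / tau n))))) @[n --> \oo] --> Num.sqrt (pi : R).
  have kt n k : 0 < k.+1%:R * t n by rewrite mulr_gt0.
  apply: (@local_limit R (6 * A) c (13 * C3) t tau M (fun n k x => fac (k.+1%:R * t n) x)
    (fun n k => mf (k.+1%:R * t n)) (fun n k => vf (k.+1%:R * t n))
    (fun n k => 13 * (bose (k.+1%:R * t n) + bose (k.+1%:R * t n) ^+ 2 +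
       bose (k.+1%:R * t n) ^+ 3 + bose (k.+1%:R * t n) ^+ 4))) => //.
  - by rewrite mulr_gt0.
  - by move=> n; have [] := HM n.
  - by move=> n k x; exact: fac_norm.
  - by move=> n k; exact: vf_ge0.
  - by move=> n k kt4; apply: vf_ge; rewrite kt.
  - by move=> n k x; exact: fac_gfac.
  - move=> n; have := HC3 (t n) (M n) (t0 n).
    rewrite -mulrA -(ler_pM2l (_ : 0 < 13)) // mulr_sumr; apply: le_trans.
    rewrite le_eqVlt; apply/orP; left; apply/eqP; apply: eq_bigr => k _.
    by move: (mult k) (k.+1%:R ^+ 3) (_ + _) => p q z; ring.
  (* The deviation of the mean from [n] splits into truncation, the error of the expansion, and the
     defect of the approximate saddle point, of order s ^ -2. Each tends to 0 after division by
     tau. *)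
  - have h1 := cvgM df cw.
    have h2 : (f (t n) - (3 * A / t n ^+ 4 + 2 * B / t n ^+ 3)) * w52 (t n) @[n --> \oo] --> (0 : R).
      exact: (cvg_comp _ _ ct f_asymp).
    have h3 : - (3 * A * be ^+ 2) * (2 + 4 * u n + 1 * u n ^+ 2) * ((1 + u n) ^+ 2)^-1 * Num.sqrt (t n)
        @[n --> \oo] --> (- (3 * A * be ^+ 2) * 2 * 1 * 0 : R).
      apply: cvgM => //; apply: cvgM; last exact: cinvu.
      by apply: cvgM; [exact: cvg_cst|exact: cpoly].
    have h : (\sum_(0 <= k < M n) mult k * (k.+1%:R * mf (k.+1%:R * t n)) - f (t n)) * w52 (t n) / Num.sqrt (6 * A) +
        (f (t n) - (3 * A / t n ^+ 4 + 2 * B / t n ^+ 3)) * w52 (t n) / Num.sqrt (6 * A) +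
        - (3 * A * be ^+ 2) * (2 + 4 * u n + 1 * u n ^+ 2) * ((1 + u n) ^+ 2)^-1 * Num.sqrt (t n) / Num.sqrt (6 * A)
        @[n --> \oo] --> (0 * 0 / Num.sqrt (6 * A) + 0 / Num.sqrt (6 * A) + - (3 * A * be ^+ 2) * 2 * 1 * 0 / Num.sqrt (6 * A) : R).
      apply: cvgD; last by apply: cvgM; [exact: h3|exact: cvg_cst].
      by apply: cvgD; apply: cvgM; [exact: h1|exact: cvg_cst|exact: h2|exact: cvg_cst].
    apply: (cvgr_eq h); first by rewrite !mulr0 !mul0r !addr0.
    near=> n; have n0 : (0 < n)%N by near: n; exact: nbhs_infty_gt.
    have m := mean_at_saddle (s_gt0 n).
    have m' : (3 * A / t n ^+ 4 + 2 * B / t n ^+ 3 - n%:R) * w52 (t n) =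
      - (3 * A * be ^+ 2) * (2 + 4 * u n + 1 * u n ^+ 2) * ((1 + u n) ^+ 2)^-1 * Num.sqrt (t n).
      rewrite (sad_s4 n0) m /w52 -/(t n) {1}tE -/(u n); have := u0 n; have := s_gt0 n.
      move: (sad_s n) (u n) (Num.sqrt _) => p q z p0 q0.
      by field; rewrite !gt_eqF.
    rewrite -m' /tau; have := w0 n; move: (w52 (t n)) => w wp.
    move: (\sum_(_ <= _ < _) _) (3 * A / _ + _) (f _) (n%:R) => P Q f0 N.
    by field; rewrite !gt_eqF.
  - have t5 : t n ^+ 5 @[n --> \oo] --> (0 : R).
      rewrite -[X in _ --> X](expr0n R 5); exact: (continuous_cvg _ (@exprn_continuous R 5 _) ct0).
    have h2 : t n ^+ 5 * g (t n) @[n --> \oo] --> (12 * A : R) by exact: (cvg_comp _ _ ct g_asymp).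
    have h : (\sum_(0 <= k < M n) mult k * (k.+1%:R ^+ 2 * vf (k.+1%:R * t n)) - g (t n)) * t n ^+ 5 / (6 * A) +
        t n ^+ 5 * g (t n) / (6 * A) @[n --> \oo] --> (0 * 0 / (6 * A) + 12 * A / (6 * A) : R).
      by apply: cvgD; apply: cvgM; [exact: cvgM|exact: cvg_cst|exact: h2|exact: cvg_cst].
    apply: (cvgr_eq h); first by field; rewrite gt_eqF.
    near=> n; have := tau0 n; have tn := t0 n; rewrite -(tauA n); move: (tau n) => ta ta0.
    move: (\sum_(_ <= _ < _) _) (g _) => P g0.
    by field; rewrite !gt_eqF.
  - by move=> n k; exact: fac_ccont.
have X : (cnt n)%:R * (2 * Num.sqrt pi * tau n *
    expR (- (\sum_(0 <= k < M n) mult k * lf (k.+1%:R * t n) + n%:R * t n))) @[n --> \oo] --> (1 : R).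
  have L2 : (Num.sqrt pi)^-1 * window (tau n) (fun x => Re (\prod_(k < M n) fac (k.+1%:R * t n) (k.+1%:R * (x / tau n)) ^+ multn k *
    cis (- (n%:R * (x / tau n))))) @[n --> \oo] --> ((Num.sqrt pi)^-1 * Num.sqrt pi : R).
    by apply: cvgM => //; exact: cvg_cst.
  have sp : Num.sqrt pi != 0 :> R by rewrite gt_eqF // sqrtr_gt0.
  apply: (cvgr_eq L2); first by rewrite mulVf.
  near=> n; have [nM _ _ _ _] := HM n.
  rewrite cnt_fourier //; move: (expR _) => E.
  have -> : (pi : R) = Num.sqrt pi * Num.sqrt pi by rewrite -expr2 sqr_sqrtr // ltW.
  rewrite [Num.sqrt (_ * _)](_ : _ = Num.sqrt pi); last first.
    by rewrite -expr2 sqr_sqrtr // ltW.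
  by move: (Num.sqrt pi) sp => p p0; field.
(* The exponent left over between the count in [X] and [log_main]: truncation, the expansion of [F],
   the exact identity at the saddle, and the logarithms of t and tau all combine to o(1). *)
have Y : expR ((\sum_(0 <= k < M n) mult k * lf (k.+1%:R * t n) + n%:R * t n) - log_main n -
    ln (2 * Num.sqrt pi * tau n)) @[n --> \oo] --> (expR 0 : R).
  apply: (continuous_cvg _ (@continuous_expR R _)).
  have h1 : F (t n) - phi A B C e (t n) @[n --> \oo] --> (D : R) by exact: (cvg_comp _ _ ct F_asymp).
  have h2 : A * be ^+ 3 * (8 + 15 * u n + 6 * u n ^+ 2) * ((1 + u n) ^+ 3)^-1 - C * be * ((1 + u n) ^+ 1)^-1
      @[n --> \oo] --> (A * be ^+ 3 * 8 * 1 - C * be * 1 : R).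
    apply: cvgB; last by apply: cvgM; [exact: cvg_cst|exact: cinvu].
    by apply: cvgM; [apply: cvgM; [exact: cvg_cst|exact: cpoly]|exact: cinvu].
  have h3 : (e + 5 / 2) * ln (1 + u n) @[n --> \oo] --> ((e + 5 / 2) * ln 1 : R).
    apply: cvgM; first exact: cvg_cst.
    by apply: (continuous_cvg _ _ c1u); apply: continuous_ln.
  have h : (\sum_(0 <= k < M n) mult k * lf (k.+1%:R * t n) - F (t n)) + (F (t n) - phi A B C e (t n)) +
      (A * be ^+ 3 * (8 + 15 * u n + 6 * u n ^+ 2) * ((1 + u n) ^+ 3)^-1 - C * be * ((1 + u n) ^+ 1)^-1) +
      (e + 5 / 2) * ln (1 + u n) - (D + 8 * A * be ^+ 3 - C * be) @[n --> \oo] -->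
      (0 + D + (A * be ^+ 3 * 8 * 1 - C * be * 1) + (e + 5 / 2) * ln 1 - (D + 8 * A * be ^+ 3 - C * be) : R).
    by apply: cvgB; [apply: cvgD; [apply: cvgD; [exact: cvgD|]|]|exact: cvg_cst].
  apply: (cvgr_eq h); first by rewrite ln1 mulr0; ring.
  near=> n; have n0 : (0 < n)%N by near: n; exact: nbhs_infty_gt.
  have m := exponent_at_saddle (s_gt0 n); rewrite -/(t n) -(sad_s4 n0) -/(u n) in m.
  have lt : ln (t n) = ln (sad_s n) + ln (1 + u n).
    by rewrite tE lnM ?posrE.
  have lw : ln (2 * Num.sqrt pi * tau n) = ln (2 * Num.sqrt pi * Num.sqrt (6 * A)) - 5 / 2 * ln (t n).
    have sp : 0 < Num.sqrt (pi : R) by rewrite sqrtr_gt0.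
    have w2 : 2 * ln (w52 (t n)) = 5 * ln (t n).
      have := congr1 (@ln R) (w52_sqr (ltW (t0 n))).
      by rewrite !lnXn // -[ln _ *+ 2]mulr_natl -[ln _ *+ 5]mulr_natl.
    rewrite /tau mulrA ln_div ?posrE ?w0 ?mulr_gt0 //; move: w2.
    by move: (ln (w52 _)) (ln (t n)) => p q hh; lra.
  rewrite lw /log_main -/(u n) /phi expr1 lt; move: m.
  move: (ln (sad_s n)) (ln (1 + u n)) (ln (2 * _ * _)) (F _) (\sum_(_ <= _ < _) _) => l1 l2 l3 F0 P m.
  move: m; move: (A / t n ^+ 3) (B / t n ^+ 2) (C / t n) (n%:R * t n) => q1 q2 q3 q4.
  move: (4 * A / _) (B / _ ^+ 2) ((C - _) / _) => q5 q6 q7.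
  move: (A * be ^+ 3 * (8 + _ + _) / _) (C * be / (1 + u n)) => q8 q9 m.
  have -> : q8 - q9 = q1 + q2 + q3 + q4 - (q5 + q6 + q7) by rewrite m.
  by ring.
rewrite expR0 in Y.
apply: (cvgr_eq (cvgM X Y)); first by rewrite mul1r.
near=> n; rewrite -[LHS]mulrA; congr (_ * _).
have q0 : 0 < 2 * Num.sqrt pi * tau n by rewrite mulr_gt0 // mulr_gt0 // sqrtr_gt0.
move: q0; set q := 2 * _ * tau n => q0.
have qe : expR (ln q) = q by rewrite lnK ?posrE.
rewrite -{1}qe -!expRD; congr expR.
by move: (ln _) (log_main _) (\sum_(_ <= _ < _) _) => p1 p2 p3; ring.
Unshelve. all: end_near. Qed.

End SaddlePoint.

(** * Generating functions of the two partition counts *)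

Section Instances.
Context {R : realType}.
Implicit Types (x y t s : R).

Lemma bose_ratio y : 0 < y -> bose y = expR (- y) / (1 - expR (- y)).
Proof.
move=> y0; have h : 0 < expR y - 1 by rewrite subr_gt0 -expR0 ltr_expR.
have e0 := expR_gt0 y.
rewrite /bose expRN; move: (expR y) h e0 => E h e0.
have E1 : 1 - E^-1 != 0 by rewrite subr_eq0 eq_sym invr_eq1; apply: contraTneq h => ->; rewrite subrr ltxx.
by field; rewrite ?E1 !gt_eqF.
Qed.

Lemma expRN_lt1 y : 0 < y -> 0 < expR (- y) < 1.
Proof. by move=> y0; rewrite expR_gt0 -expR0 ltr_expR oppr_lt0. Qed.

Lemma expRN_X t k : expR (- t) ^+ k = expR (- (k%:R * t)).
Proof. by rewrite -expRM_natl mulrN. Qed.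

Lemma prod_expR_ell (M : nat) t : 0 < t ->
  \prod_(k < M) (1 - expR (- t) ^+ k.+1) ^+ multn k =
  expR (- \sum_(0 <= k < M) mult k * ell (k.+1%:R * t)).
Proof.
move=> t0; elim: M => [|M IH]; first by rewrite big_ord0 big_nil oppr0 expR0.
rewrite big_ord_recr big_nat_recr //= IH opprD expRD; congr (_ * _).
have /expRN_lt1/andP[h0 h1] : 0 < M.+1%:R * t by rewrite mulr_gt0.
by rewrite expRN_X -multn_mult /ell mulrN opprK expRM_natl lnK // posrE subr_gt0.
Qed.

Lemma floor_cbrt_large (n M j : nat) : (n <= M)%N -> ((M.+1 ^ 3).-1 <= j)%N -> (n < floor_cbrt R j)%N.
Proof.
move=> nM h; apply: floor_cbrt_ge; apply: (@leq_trans (M.+1 ^ 3)); first by rewrite leq_exp2r.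
by rewrite -(prednK (_ : 0 < M.+1 ^ 3)%N) ?expn_gt0 // ltnS.
Qed.

(** All members of the sequence with value at most [M >= n] are present, so the truncated product
    already counts the partitions of [n] exactly. *)
Lemma p_fourier n M t tau : 0 < t -> 0 < tau -> (n <= M)%N ->
  window tau (fun x => Re (\prod_(k < M) geom_factor (bose (k.+1%:R * t)) (k.+1%:R * (x / tau)) ^+ multn k *
    cis (- (n%:R * (x / tau))))) =
  2 * pi * tau * (p_third R n)%:R * expR (- (\sum_(0 <= k < M) mult k * ell (k.+1%:R * t) + n%:R * t)).
Proof.
move=> t0 tau0 nM; pose r := expR (- t); have r01 : 0 < r < 1 by exact: expRN_lt1.
have h := (fourier_pfac_count tau0 r01 (@floor_cbrt_gt0 R) (M.+1 ^ 3).-1 n).1.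
rewrite -(card_partitions (@floor_cbrt_gt0 R) (fun j => @floor_cbrt_large n M j nM)) in h.
rewrite (prod_floor_cbrt R (fun m => 1 - r ^+ m)) prod_expR_ell // expRN_X in h.
rewrite opprD expRD /p_third.
transitivity (fourier tau (floor_cbrt R) (pfac r) (M.+1 ^ 3).-1 n); last by rewrite h; ring.
congr window; apply/funext => x.
rewrite (prod_floor_cbrt R (fun m => pfac r m (x / tau))).
congr (Re (_ * cis (- (_ * _)))).
apply: eq_bigr => k _; congr (_ ^+ _).
have kt : 0 < k.+1%:R * t by rewrite mulr_gt0.
by rewrite pfac_geom /r expRN_X ?expRN_lt1 // -bose_ratio.
Qed.

(** ln (1 + e ^ (- y)) written as a difference, so that the expansions for q follow from those for p
    at t and 2 t. [mfq] and [vfq] are the mean and variance of the corresponding Bernoulli variable,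
    as [mfqE] and [vfqE] show. *)
Definition lfq y : R := ell y - ell (2 * y).
Definition mfq y : R := bose y - 2 * bose (2 * y).
Definition vfq y : R := bose1 y - 4 * bose1 (2 * y).

Lemma expRN2 y : expR (- (2 * y)) = expR (- y) ^+ 2.
Proof. by rewrite expRN_X. Qed.

Lemma mfqE y : 0 < y -> mfq y = expR (- y) / (1 + expR (- y)).
Proof.
move=> y0; have y2 : 0 < 2 * y by rewrite mulr_gt0.
rewrite /mfq !bose_ratio // expRN2; have /andP[] := expRN_lt1 y0.
move: (expR _) => q q0 q1.
have h1 : 1 - q != 0 by rewrite gt_eqF // subr_gt0.
have h2 : 1 + q != 0 by rewrite gt_eqF // addr_gt0.
have h3 : 1 - q ^+ 2 != 0 by rewrite (_ : 1 - q ^+ 2 = (1 - q) * (1 + q)) ?mulf_neq0 //; ring.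
by field; rewrite h1 h2 h3.
Qed.

Lemma vfqE y : 0 < y -> vfq y = mfq y - mfq y ^+ 2.
Proof.
move=> y0; have y2 : 0 < 2 * y by rewrite mulr_gt0.
rewrite mfqE // /vfq /bose1 !bose_ratio // expRN2; have /andP[] := expRN_lt1 y0.
move: (expR _) => q q0 q1.
have h1 : 1 - q != 0 by rewrite gt_eqF // subr_gt0.
have h2 : 1 + q != 0 by rewrite gt_eqF // addr_gt0.
have h3 : 1 - q ^+ 2 != 0 by rewrite (_ : 1 - q ^+ 2 = (1 - q) * (1 + q)) ?mulf_neq0 //; ring.
by field; rewrite h1 h2 h3.
Qed.

Lemma lfqE y : 0 < y -> expR (lfq y) = 1 + expR (- y).
Proof.
move=> y0; have y2 : 0 < 2 * y by rewrite mulr_gt0.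
rewrite /lfq /ell opprK expRD expRN expRN2; have /andP[] := expRN_lt1 y0.
move: (expR _) => q q0 q1.
have h1 : 0 < 1 - q by rewrite subr_gt0.
have e : 1 - q ^+ 2 = (1 - q) * (1 + q) by ring.
have p : 0 < (1 - q) * (1 + q) by rewrite mulr_gt0 // addr_gt0.
by rewrite e (lnK (x := 1 - q)) ?posrE // lnK ?posrE // mulKf // gt_eqF.
Qed.

Lemma q_fourier n M t tau : 0 < t -> 0 < tau -> (n <= M)%N ->
  window tau (fun x => Re (\prod_(k < M) bern_factor (mfq (k.+1%:R * t)) (k.+1%:R * (x / tau)) ^+ multn k *
    cis (- (n%:R * (x / tau))))) =
  2 * pi * tau * (q_third R n)%:R * expR (- (\sum_(0 <= k < M) mult k * lfq (k.+1%:R * t) + n%:R * t)).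
Proof.
move=> t0 tau0 nM; pose r := expR (- t); have r01 : 0 < r < 1 by exact: expRN_lt1.
have h := (fourier_qfac_count tau0 r01 (@floor_cbrt_gt0 R) (M.+1 ^ 3).-1 n).1.
rewrite -(card_distinct_partitions (fun j => @floor_cbrt_large n M j nM)) in h.
rewrite (prod_floor_cbrt R (fun m => 1 + r ^+ m)) expRN_X in h.
have e : \prod_(k < M) (1 + r ^+ k.+1) ^+ multn k = expR (\sum_(0 <= k < M) mult k * lfq (k.+1%:R * t)).
  elim: M {nM h} => [|M IH]; first by rewrite big_ord0 big_nil expR0.
  rewrite big_ord_recr big_nat_recr //= IH expRD; congr (_ * _).
  by rewrite expRN_X -multn_mult expRM_natl lfqE // mulr_gt0.
rewrite e in h; rewrite opprD expRD /q_third.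
transitivity (fourier tau (floor_cbrt R) (qfac r) (M.+1 ^ 3).-1 n); last first.
  apply: (mulfI (lt0r_neq0 (expR_gt0 (\sum_(0 <= k < M) mult k * lfq (k.+1%:R * t))))).
  rewrite h mulrCA; move: (\sum_(_ <= _ < _) _) => S; rewrite [X in _ = _ * X]mulrA -expRD subrr expR0.
  by rewrite mul1r.
congr window; apply/funext => x.
rewrite (prod_floor_cbrt R (fun m => qfac r m (x / tau))).
congr (Re (_ * cis (- (_ * _)))).
apply: eq_bigr => k _; congr (_ ^+ _).
have kt : 0 < k.+1%:R * t by rewrite mulr_gt0.
by rewrite qfac_bern /r expRN_X ?expRN_lt1 // -mfqE.
Qed.

Lemma expRN_ge34 y : 0 < y <= 4^-1 -> 3 / 4 <= expR (- y).
Proof. by move=> /andP[y0 y4]; have := expR_ge1Dx (- y); lra. Qed.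

Lemma bose1_ge y : 0 < y <= 4^-1 -> 16^-1 <= bose1 y.
Proof.
move=> y4; have y0 : 0 < y by case/andP: y4.
have q34 := expRN_ge34 y4; have /andP[q0 q1] := expRN_lt1 y0.
have b1 : 1 <= bose y.
  by rewrite bose_ratio // ler_pdivlMr ?subr_gt0 // mul1r; lra.
by rewrite /bose1; have := sqr_ge0 (bose y); lra.
Qed.

Lemma mfq01 y : 0 < y -> 0 <= mfq y <= 1.
Proof.
move=> y0; rewrite mfqE //; have /andP[q0 q1] := expRN_lt1 y0.
have h : 0 < 1 + expR (- y) by lra.
by rewrite divr_ge0 ?(ltW h) ?(ltW q0) //= ler_pdivrMr // mul1r; lra.
Qed.

Lemma vfq_ge y : 0 < y <= 4^-1 -> 16^-1 <= vfq y.
Proof.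
move=> y4; have y0 : 0 < y by case/andP: y4.
have q34 := expRN_ge34 y4; have /andP[q0 q1] := expRN_lt1 y0.
rewrite vfqE // mfqE //; move: (expR _) q34 q0 q1 => q *.
have h : 0 < 1 + q by lra.
have -> : q / (1 + q) - (q / (1 + q)) ^+ 2 = q / (1 + q) ^+ 2 by field; rewrite gt_eqF.
rewrite ler_pdivlMr ?exprn_gt0 //; nra.
Qed.

Lemma vfq_ge0 y : 0 < y -> 0 <= vfq y.
Proof.
move=> y0; rewrite vfqE //; have /andP[h0 h1] := mfq01 y0.
have -> : mfq y - mfq y ^+ 2 = mfq y * (1 - mfq y) by ring.
by rewrite mulr_ge0 // subr_ge0.
Qed.

End Instances.

(** * The saddle point estimate for both counts *)

Section Counts.
Context {R : realType}.
Implicit Types (x y t s : R).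

Lemma cA_gt0 : 0 < cA :> R.
Proof. by rewrite /cA divr_gt0 // exprn_gt0 // pi_gt0. Qed.

Lemma cB_ge0 : 0 <= cB :> R.
Proof.
rewrite /cB mulr_ge0 //; apply: tsum_ge0; last by move=> k; rewrite invr_ge0 exprn_ge0.
exact: (@asum_invX R 1).
Qed.

Lemma ccont_cis_sub tau (a : R) : ccont (fun x => cis (a * (x / tau)) - 1).
Proof.
have h : ccont (fun x => cis (a * (x / tau)) + - 1).
  by apply: ccontD; [exact: ccont_cis_scale|exact: ccont_cst].
exact: h.
Qed.

Lemma p_count : (p_third R n)%:R * expR (- log_main cA cB cC (3 / 4) cD n) @[n --> \oo] --> (1 : R).
Proof.
have F := @Ltot_asymp R.
have f := first_moment_asymp (@Ltot_convex R) F.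
have g := second_moment_asymp (@mutot_convex R) f.
apply: (@saddle_count R cA cB cC (3 / 4) cD 16^-1 cA_gt0 cB_ge0 _ ell bose bose1
  (fun y x => geom_factor (bose y) x) (p_third R)).
- by rewrite invr_gt0 ltr0n lef_pV2 ?posrE // ler_nat.
- by move=> y x y0; apply: geom_factor_norm; exact/ltW/bose_gt0.
- by move=> y y0; exact/ltW/bose1_gt0.
- by move=> y; exact: bose1_ge.
- by move=> y x y0; apply: geom_factor_gfac; exact/ltW/bose_gt0.
- move=> y a tau y0; apply: ccontV.
    move=> x; rewrite -normc_eq0 -sqrf_eq0 normc_geom_den gt_eqF // ltr_pwDl //.
    by rewrite mulr_ge0 ?cos_sub_ge0 // mulr_ge0 // -/(bose1 y) ltW // bose1_gt0.
  have h : ccont (fun x => 1 + - (bose y)%:C * (cis (a * (x / tau)) - 1)).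
    apply: ccontD; first exact: ccont_cst.
    by apply: ccontM; [exact: ccont_cst|exact: ccont_cis_sub].
  by have -> : (fun x => 1 - (bose y)%:C * (cis (a * (x / tau)) - 1)) =
    (fun x => 1 + - (bose y)%:C * (cis (a * (x / tau)) - 1)) by apply/funext => x; rewrite mulNr.
- exact: asum_Ltot.
- exact: asum_mutot.
- exact: asum_Vtot.
- exact: F.
- exact: f.
- exact: g.
- by move=> n M t tau t0 tau0 nM; exact: p_fourier.
Qed.

Lemma asum_scale2 (w : nat -> R) (h : R -> R) (d : R) t :
  (forall s, 0 < s -> asum (fun k => w k * h (k.+1%:R * s))) -> 0 < t ->
  asum (fun k => w k * (h (k.+1%:R * t) - d * h (2 * (k.+1%:R * t)))) /\
  tsum (fun k => w k * (h (k.+1%:R * t) - d * h (2 * (k.+1%:R * t)))) =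
  tsum (fun k => w k * h (k.+1%:R * t)) - d * tsum (fun k => w k * h (k.+1%:R * (2 * t))).
Proof.
move=> sw t0; have t20 : 0 < 2 * t by rewrite mulr_gt0.
have s1 := sw _ t0; have s2 := asumZ (c := d) (sw _ t20).
have E k : w k * (h (k.+1%:R * t) - d * h (2 * (k.+1%:R * t))) =
    w k * h (k.+1%:R * t) - d * (w k * h (k.+1%:R * (2 * t))).
  by rewrite [k.+1%:R * (2 * t)]mulrCA mulrBr [w k * (d * _)]mulrCA.
split; first by apply: (eq_asum E); exact: asumB.
by rewrite (eq_tsum E) tsumB // tsumZ //; exact: sw.
Qed.

(** From L(t) - L(2t): the coefficients of t ^ -3, t ^ -2, t ^ -1 are multiplied by 7/8, 3/4, 1/2,
    the logarithms leave - 3/4 ln 2, and [cD] cancels, which is why zeta'(-1) is absent for q. *)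
Lemma q_count : (q_third R n)%:R * expR (- log_main (7 / 8 * cA) (3 / 4 * cB) (cC / 2) 0 (- (3 / 4 * ln 2)) n)
  @[n --> \oo] --> (1 : R).
Proof.
have F := @Ltot_asymp R.
have f := first_moment_asymp (@Ltot_convex R) F.
have g := second_moment_asymp (@mutot_convex R) f.
have gt0 := @nbhs_right_gt R 0.
have t2 (h : R -> R) (l : R) : h t @[t --> 0^'+] --> l -> h (2 * t) @[t --> 0^'+] --> l.
  by apply: cvg_scale_at0.
have S1 t := @asum_scale2 mult ell 1 t (@asum_Ltot R).
have sm s : 0 < s -> asum (fun k => mult k * k.+1%:R * bose (k.+1%:R * s)).
  by move=> s0; apply: eq_asum (asum_mutot s0) => k; rewrite mulrA.
have sv s : 0 < s -> asum (fun k => mult k * k.+1%:R ^+ 2 * bose1 (k.+1%:R * s)).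
  by move=> s0; apply: eq_asum (asum_Vtot s0) => k; rewrite mulrA.
have S2 t := @asum_scale2 (fun k => mult k * k.+1%:R) bose 2 t sm.
have S3 t := @asum_scale2 (fun k => mult k * k.+1%:R ^+ 2) bose1 4 t sv.
have E1 t k : mult k * lfq (k.+1%:R * t) = mult k * (ell (k.+1%:R * t) - 1 * ell (2 * (k.+1%:R * t))).
  by rewrite mul1r.
have E2 t k : mult k * (k.+1%:R * mfq (k.+1%:R * t)) =
    mult k * k.+1%:R * (bose (k.+1%:R * t) - 2 * bose (2 * (k.+1%:R * t))) by rewrite mulrA.
have E3 t k : mult k * (k.+1%:R ^+ 2 * vfq (k.+1%:R * t)) =
    mult k * k.+1%:R ^+ 2 * (bose1 (k.+1%:R * t) - 4 * bose1 (2 * (k.+1%:R * t))) by rewrite mulrA.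
have T1 t : 0 < t -> tsum (fun k => mult k * lfq (k.+1%:R * t)) = Ltot t - Ltot (2 * t).
  by move=> t0; rewrite (eq_tsum (E1 t)) (S1 _ t0).2 mul1r.
have T2 t : 0 < t -> tsum (fun k => mult k * (k.+1%:R * mfq (k.+1%:R * t))) = mutot t - 2 * mutot (2 * t).
  move=> t0; rewrite (eq_tsum (E2 t)) (S2 _ t0).2 /mutot.
  by congr (_ - _ * _); apply: eq_tsum => k; rewrite -mulrA.
have T3 t : 0 < t -> tsum (fun k => mult k * (k.+1%:R ^+ 2 * vfq (k.+1%:R * t))) = Vtot t - 4 * Vtot (2 * t).
  move=> t0; rewrite (eq_tsum (E3 t)) (S3 _ t0).2 /Vtot.
  by congr (_ - _ * _); apply: eq_tsum => k; rewrite -mulrA.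
have A0 : 0 < 7 / 8 * cA :> R by rewrite mulr_gt0 // cA_gt0.
have B0 : 0 <= 3 / 4 * cB :> R by rewrite mulr_ge0 // cB_ge0.
apply: (@saddle_count R (7 / 8 * cA) (3 / 4 * cB) (cC / 2) 0 (- (3 / 4 * ln 2)) 16^-1 A0 B0 _ lfq mfq vfq
  (fun y x => bern_factor (mfq y) x) (q_third R)).
- by rewrite invr_gt0 ltr0n lef_pV2 ?posrE // ler_nat.
- by move=> y x y0; rewrite vfqE //; apply: bern_factor_norm; exact: mfq01.
- by move=> y; exact: vfq_ge0.
- by move=> y; exact: vfq_ge.
- move=> y x y0; rewrite vfqE //; apply: le_trans (bern_factor_gfac x (mfq01 y0)) _.
  rewrite ler_wpM2r ?exprn_ge0 //.
  have b0 := bose_gt0 y0; have b2 : 0 < bose (2 * y) by rewrite bose_gt0 // mulr_gt0.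
  have : mfq y <= bose y by rewrite /mfq; lra.
  have := exprn_ge0 2 (ltW b0); have := exprn_ge0 3 (ltW b0); have := exprn_ge0 4 (ltW b0).
  lra.
- move=> y a tau y0; apply: ccontD; first exact: ccont_cst.
  by apply: ccontM; [exact: ccont_cst|exact: ccont_cis_sub].
- by move=> t t0; apply: (eq_asum (E1 t)); exact: (S1 _ t0).1.
- by move=> t t0; apply: (eq_asum (E2 t)); exact: (S2 _ t0).1.
- by move=> t t0; apply: (eq_asum (E3 t)); exact: (S3 _ t0).1.
- have H : Ltot t - phi cA cB cC (3 / 4) t - (Ltot (2 * t) - phi cA cB cC (3 / 4) (2 * t)) - 3 / 4 * ln 2
      @[t --> 0^'+] --> (cD - cD - 3 / 4 * ln 2 : R).
    by apply: cvgB; [apply: cvgB; [exact: F|exact: (t2 (fun t => Ltot t - phi cA cB cC (3 / 4) t))]|exact: cvg_cst].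
  apply: (cvgr_eq H); first by rewrite subrr sub0r.
  near=> t; have t0 : 0 < t by near: t; exact: gt0.
  rewrite T1 // /phi lnM ?posrE //; move: (Ltot _) (Ltot _) (ln 2) (ln t) => p1 p2 p3 p4.
  by move: (cA) (cB) (cC) => a b c'; field; rewrite gt_eqF.
(* The factor 2 / (4 sqrt 2) arises because the mean is mu(t) - 2 mu(2t) and [w52 (2 t)] is 4 sqrt 2
   times [w52 t]. *)
- have H : (mutot t - (3 * cA / t ^+ 4 + 2 * cB / t ^+ 3)) * w52 t -
      2 / (4 * Num.sqrt 2) * ((mutot (2 * t) - (3 * cA / (2 * t) ^+ 4 + 2 * cB / (2 * t) ^+ 3)) * w52 (2 * t))
      @[t --> 0^'+] --> (0 - 2 / (4 * Num.sqrt 2) * 0 : R).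
    apply: cvgB; first exact: f.
    apply: cvgM; first exact: cvg_cst.
    exact: (t2 (fun t => (mutot t - (3 * cA / t ^+ 4 + 2 * cB / t ^+ 3)) * w52 t)).
  apply: (cvgr_eq H); first by rewrite mulr0 subrr.
  near=> t; have t0 : 0 < t by near: t; exact: gt0.
  rewrite T2 // /w52 sqrtrM //; have : 0 < Num.sqrt (2 : R) by rewrite sqrtr_gt0.
  move: (mutot _) (mutot _) (Num.sqrt 2) (Num.sqrt t) => p1 p2 p3 p4 p30.
  by move: (cA) (cB) => a b; field; rewrite !gt_eqF.
- have H : t ^+ 5 * Vtot t - 8^-1 * ((2 * t) ^+ 5 * Vtot (2 * t)) @[t --> 0^'+] --> (12 * cA - 8^-1 * (12 * cA) : R).
    apply: cvgB; first exact: g.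
    apply: cvgM; first exact: cvg_cst.
    exact: (t2 (fun t => t ^+ 5 * Vtot t)).
  apply: (cvgr_eq H); first by field.
  near=> t; have t0 : 0 < t by near: t; exact: gt0.
  by rewrite T3 //; move: (Vtot _) (Vtot _) => p1 p2; field.
- by move=> n M t tau t0 tau0 nM; exact: q_fourier.
Unshelve. all: end_near. Qed.

End Counts.

(** * Closed forms *)

Section Final.
Context {R : realType}.
Implicit Types (x y a b : R).

Lemma equiv_of_ratio (f g E : nat -> R) : f n * expR (- E n) @[n --> \oo] --> (1 : R) ->
  (\forall n \near \oo, g n = expR (E n)) -> f ~_\oo g.
Proof.
move=> h gE; apply/eqaddoP => eps eps0.
move/cvgrPdist_le : h => /(_ _ eps0) h.
near=> n; have gn : g n = expR (E n) by near: n.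
have hn : `|1 - f n * expR (- E n)| <= eps by near: n; exact: h.
have -> : (f - g) n = - ((1 - f n * expR (- E n)) * expR (E n)).
  rewrite !fctE gn expRN; have := expR_gt0 (E n); move: (expR _) => q q0.
  by field; rewrite gt_eqF.
by rewrite normrN normrM gn ler_wpM2r.
Unshelve. all: end_near. Qed.

Lemma powR_root a y (n : nat) : 0 < y -> y ^+ n.+1 = a -> a `^ (1 / n.+1%:R) = y.
Proof.
move=> y0 <-; rewrite -powR_mulrn ?(ltW y0) // -powRrM mulrC mul1r mulVf ?pnatr_eq0 //.
by rewrite powRr1 // ltW.
Qed.

Lemma powR_expR a x : 0 < a -> a `^ x = expR (x * ln a).
Proof. by move=> a0; rewrite /powR gt_eqF. Qed.

Lemma ln_sqrt a : 0 < a -> ln (Num.sqrt a) = ln a / 2.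
Proof.
move=> a0; have s0 : 0 < Num.sqrt a by rewrite sqrtr_gt0.
by rewrite -{2}(sqr_sqrtr (ltW a0)) lnXn // -mulr_natl; field.
Qed.

Lemma fourth_root_pow a : 0 < a -> [/\ 0 < a `^ (1 / 4), a `^ (1 / 4) ^+ 4 = a,
  a `^ (3 / 4) = a `^ (1 / 4) ^+ 3, a `^ (1 / 2) = a `^ (1 / 4) ^+ 2 &
  ln a = 4 * ln (a `^ (1 / 4))].
Proof.
move=> a0; have p0 : 0 < a `^ (1 / 4) by rewrite powR_gt0.
have P n : a `^ (1 / 4) ^+ n = a `^ (n%:R / 4).
  by rewrite -powR_mulrn ?powR_ge0 // -powRrM mulrC mulrA mulr1.
split => //.
- by rewrite P divff // powRr1 // ltW.
- by rewrite P; congr (_ `^ _); field.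
- by rewrite (powR_expR _ a0) expRK; field.
Qed.

(** Since 3 [cA] = pi ^ 4 / 5, the point [sad_s] is pi / (5 n) ^ (1/4). The exponent 13/16 is (3/4 +
    5/2) / 4, from the logarithm in L and from the standard deviation. After taking logarithms the
    identity is rational in ln 2, ln 5, ln pi, ln X, X, pi, [zsum 3] and [rho1]. *)
Lemma p_log_main n : (0 < n)%N -> expR (log_main cA cB cC (3 / 4) cD n) =
  (25 * pi) `^ (1 / 4)
  * expR (225 * zsum 3 ^+ 3 / pi ^+ 8 - 2 * zsum 3 / pi ^+ 2 + 3 * (- (rho1 + ln 2 / 3) / 3))
  / (4 * (5 * n%:R) `^ (13 / 16))
  * expR (4 * pi * (5 * n%:R) `^ (3 / 4) / 15
          + 3 * zsum 3 * (5 * n%:R) `^ (1 / 2) / pi ^+ 2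
          + (pi ^+ 6 - 135 * zsum 3 ^+ 2) * (5 * n%:R) `^ (1 / 4) / (6 * pi ^+ 5)) :> R.
Proof.
move=> n0; have n0' : 0 < n%:R :> R by rewrite ltr0n.
have N0 : 0 < 5 * n%:R :> R by rewrite mulr_gt0.
have [X0 X4 X3 X2 lX] := fourth_root_pow N0.
have p0 := @pi_gt0 R.
have es : sad_s (cA : R) n = pi / (5 * n%:R) `^ (1 / 4).
  rewrite /sad_s (maxn_idPl n0); apply: powR_root; first by rewrite divr_gt0.
  by rewrite expr_div_n X4 /cA; move: (pi) => p; field; rewrite gt_eqF.
rewrite X3 X2 !powR_expR ?mulr_gt0 // -/(powR _ _).
rewrite [expR (1 / 4 * ln (5 * n%:R))](_ : _ = (5 * n%:R) `^ (1 / 4)); last by rewrite powR_expR.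
have e4 : 4 = expR (2 * ln 2) :> R by rewrite expRM_natl lnK ?posrE //; ring.
rewrite [X in _ / (X * _)]e4 -!expRD -expRN -!expRD; congr expR; rewrite /log_main es lX.
have l1 : ln (25 * pi) = 2 * ln 5 + ln pi :> R.
  rewrite (_ : 25 = 5 ^+ 2) ?lnM ?lnXn ?posrE ?exprn_gt0 -?[ln 5 *+ 2]mulr_natl //; ring.
have l2 : ln (pi / (5 * n%:R) `^ (1 / 4)) = ln pi - ln ((5 * n%:R) `^ (1 / 4)) :> R.
  by rewrite ln_div.
have l3 : ln (2 * Num.sqrt pi * Num.sqrt (6 * cA)) = ln 2 + ln pi / 2 + (ln 2 + 4 * ln pi - ln 5) / 2 :> R.
  have -> : 6 * cA = 2 * pi ^+ 4 / 5 :> R by rewrite /cA; field.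
  have q0 : 0 < 2 * pi ^+ 4 / 5 :> R by rewrite divr_gt0 // mulr_gt0 // exprn_gt0.
  rewrite !lnM ?posrE ?mulr_gt0 ?sqrtr_gt0 // !ln_sqrt // ln_div ?posrE ?mulr_gt0 ?exprn_gt0 //.
  by rewrite lnM ?posrE ?exprn_gt0 // lnXn // -[ln pi *+ 4]mulr_natl.
have l4 : ln (2 * pi) = ln 2 + ln pi :> R by rewrite lnM ?posrE.
rewrite l1 l2 l3 /cD l4 /cA /cB /cC.
move: ((5 * n%:R) `^ (1 / 4)) X0 => X X0; move: (ln X) (ln 2) (ln 5) (ln pi) => a b c d.
move: (zsum 3) (rho1) (pi) p0 => z r p p0.
by field; rewrite !gt_eqF.
Qed.

(** Here 3 (7/8) [cA] / n = (pi / 2) ^ 4 (14 / (5 n)), which explains the variable 5 n / 14; the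
    exponent 5/8 comes from the standard deviation alone. *)
Lemma q_log_main n : (0 < n)%N -> expR (log_main (7 / 8 * cA) (3 / 4 * cB) (cC / 2) 0 (- (3 / 4 * ln 2)) n) =
  (5 / 14) `^ (1 / 2)
  * expR (6075 * zsum 3 ^+ 3 / (49 * pi ^+ 8) - 15 * zsum 3 / (28 * pi ^+ 2))
  / (2 `^ (11 / 4) * (5 * n%:R / 14) `^ (5 / 8))
  * expR (28 * pi * (5 * n%:R / 14) `^ (3 / 4) / 15
          + 9 * zsum 3 * (5 * n%:R / 14) `^ (1 / 2) / pi ^+ 2
          + (7 * pi ^+ 6 - 1215 * zsum 3 ^+ 2) * (5 * n%:R / 14) `^ (1 / 4)
            / (42 * pi ^+ 5)) :> R.
Proof.
move=> n0; have n0' : 0 < n%:R :> R by rewrite ltr0n.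
have N0 : 0 < 5 * n%:R / 14 :> R by rewrite divr_gt0 // mulr_gt0.
have [X0 X4 X3 X2 lX] := fourth_root_pow N0.
have p0 := @pi_gt0 R.
have es : sad_s (7 / 8 * cA : R) n = pi / (2 * (5 * n%:R / 14) `^ (1 / 4)).
  rewrite /sad_s (maxn_idPl n0); apply: powR_root; first by rewrite divr_gt0 // mulr_gt0.
  by rewrite expr_div_n exprMn X4 /cA; move: (pi) => p; field; rewrite gt_eqF.
rewrite X3 X2 !powR_expR //.
rewrite [expR (1 / 4 * ln (5 * n%:R / 14))](_ : _ = (5 * n%:R / 14) `^ (1 / 4)); last by rewrite powR_expR.
rewrite -!expRD -expRN -!expRD; congr expR; rewrite /log_main es lX.
have l1 : ln (5 / 14) = ln 5 - ln 2 - ln 7 :> R.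
  have e14 : 14 = 2 * 7 :> R by ring.
  by rewrite ln_div ?posrE // e14 lnM ?posrE //; ring.
have l2 : ln (pi / (2 * (5 * n%:R / 14) `^ (1 / 4))) = ln pi - ln 2 - ln ((5 * n%:R / 14) `^ (1 / 4)) :> R.
  by rewrite ln_div ?lnM ?posrE ?mulr_gt0 //; ring.
have l3 : ln (2 * Num.sqrt pi * Num.sqrt (6 * (7 / 8 * cA))) =
    ln 2 + ln pi / 2 + (ln 7 + 4 * ln pi - 2 * ln 2 - ln 5) / 2 :> R.
  have -> : 6 * (7 / 8 * cA) = 7 * pi ^+ 4 / (2 ^+ 2 * 5) :> R by rewrite /cA; field.
  have q0 : 0 < 7 * pi ^+ 4 / (2 ^+ 2 * 5) :> R.
    by rewrite divr_gt0 // mulr_gt0 // exprn_gt0.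
  have e1 : ln (7 * pi ^+ 4) = ln 7 + 4 * ln pi :> R.
    by rewrite lnM ?posrE ?exprn_gt0 // lnXn // -[ln pi *+ 4]mulr_natl.
  have e2 : ln (2 ^+ 2 * 5) = 2 * ln 2 + ln 5 :> R.
    by rewrite lnM ?posrE ?exprn_gt0 // lnXn // -[ln 2 *+ 2]mulr_natl.
  rewrite lnM ?posrE ?mulr_gt0 ?sqrtr_gt0 // lnM ?posrE ?sqrtr_gt0 // !ln_sqrt //.
  rewrite ln_div ?posrE ?mulr_gt0 ?exprn_gt0 // e1 e2.
  by move: (ln _) (ln _) (ln _) (ln _) => a b c d; field.
rewrite l1 l2 l3 /cA /cB /cC.
move: ((5 * n%:R / 14) `^ (1 / 4)) X0 => X X0; move: (ln X) (ln 2) (ln 5) (ln pi) (ln 7) => a b c d e.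
move: (zsum 3) (pi) p0 => z p p0.
by field; rewrite !gt_eqF.
Qed.

End Final.

Theorem corollary1p4 (R : realType) (zeta : R[i] -> R[i]^o)
    (hzeta : is_riemann_zeta zeta) :
  let zeta3 : R := complex.Re (zeta 3) in
  let zeta'N1 : R := complex.Re (zeta^`() (- 1)) in
  ((fun n : nat => (p_third R n)%:R : R) ~_\oo
   (fun n : nat =>
      (25 * pi) `^ (1 / 4)
      * expR (225 * zeta3 ^+ 3 / pi ^+ 8 - 2 * zeta3 / pi ^+ 2 + 3 * zeta'N1)
      / (4 * (5 * n%:R) `^ (13 / 16))
      * expR (4 * pi * (5 * n%:R) `^ (3 / 4) / 15
              + 3 * zeta3 * (5 * n%:R) `^ (1 / 2) / pi ^+ 2
              + (pi ^+ 6 - 135 * zeta3 ^+ 2) * (5 * n%:R) `^ (1 / 4)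
                / (6 * pi ^+ 5)) : R))
  /\
  ((fun n : nat => (q_third R n)%:R : R) ~_\oo
   (fun n : nat =>
      (5 / 14) `^ (1 / 2)
      * expR (6075 * zeta3 ^+ 3 / (49 * pi ^+ 8) - 15 * zeta3 / (28 * pi ^+ 2))
      / (2 `^ (11 / 4) * (5 * n%:R / 14) `^ (5 / 8))
      * expR (28 * pi * (5 * n%:R / 14) `^ (3 / 4) / 15
              + 9 * zeta3 * (5 * n%:R / 14) `^ (1 / 2) / pi ^+ 2
              + (7 * pi ^+ 6 - 1215 * zeta3 ^+ 2) * (5 * n%:R / 14) `^ (1 / 4)
                / (42 * pi ^+ 5)) : R)).
Proof.
move=> z3 z'; have -> : z3 = zsum 3 by exact: Re_zeta3.
have -> : z' = - (rho1 + ln 2 / 3) / 3 by exact: zeta_derive_N1.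
split.
  apply: (equiv_of_ratio (@p_count R)); near=> n.
  by rewrite p_log_main //; near: n; exact: nbhs_infty_gt.
apply: (equiv_of_ratio (@q_count R)); near=> n.
by rewrite q_log_main //; near: n; exact: nbhs_infty_gt.
Unshelve. all: end_near. Qed.
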